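(* As $N\to\infty$, the sequence $\sqrt N(T_N-\theta)$ converges in law to $\mathcal{N}(0,\varsigma^2)$, where $$\varsigma^2:=\int\Big((I-\mathcal{A}^*\mathcal{A})^{-1}(\eta_{1,0}-\mathcal{A}^*\eta_{0,1})(x)\Big)^2dP(x)+\int\Big((I-\mathcal{A}\mathcal{A}^* )^{-1}(\eta_{0,1}-\mathcal{A}\eta_{1,0})(y)\Big)^2dQ(y).$$
   Context: Let $P,Q$ be Borel probability measures on $\mathbb{R}^d$, and let $\mu$ be a probability measure on $\mathbb{R}^d\times\mathbb{R}^d$ with marginals $P$ and $Q$, absolutely continuous with respect to $P\otimes Q$, with density $\xi=\frac{d\mu}{d(P\otimes Q)}$. Define $\mathcal{A}:L^2(P)\to L^2(Q)$ and its adjoint $\mathcal{A}^*:L^2(Q)\to L^2(P)$ by $(\mathcal{A}f)(y)=\int f(x)\xi(x,y)\,dP(x)$ and $(\mathcal{A}^*g)(x)=\int g(y)\xi(x,y)\,dQ(y)$. Standing assumptions: (i) $\xi\in L^2(P\otimes Q)$; consequently $\mathcal{A}$ is compact and there are eigenvalue decompositions $\mathcal{A}^*\mathcal{A}\alpha_k=s_k^2\alpha_k$, $\mathcal{A}\mathcal{A}^*\beta_k=s_k^2\beta_k$, $k\ge 0$, with $s_0=1$, $\alpha_0=\beta_0=\mathbf{1}$, $0\le s_k\le 1$, $\mathcal{A}\alpha_k=s_k\beta_k$, $\mathcal{A}^*\beta_k=s_k\alpha_k$. (ii) $s_k\le s_1<1$ for all $k\ge 1$. (iii) $\eta:\mathbb{R}^d\times\mathbb{R}^d\to\mathbb{R}$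 is a $\mu$-integrable function with $\eta^2\xi\in L^1(P\otimes Q)$ and $\eta\xi\in L^2(P\otimes Q)$. Let $X_1,X_2,\dots$ be i.i.d. from $P$ and $Y_1,Y_2,\dots$ i.i.d. from $Q$, the two sequences being independent. Let $\mathcal{S}_N$ be the set of permutations of $\{1,\dots,N\}$, $\xi^{\otimes}(X,Y_\sigma):=\prod_{i=1}^N\xi(X_i,Y_{\sigma_i})$, $$T_N:=\frac{\frac1{N!}\sum_{\sigma\in\mathcal{S}_N}\frac1N\sum_{i=1}^N\eta(X_i,Y_{\sigma_i})\,\xi^{\otimes}(X,Y_\sigma)}{\frac1{N!}\sum_{\sigma\in\mathcal{S}_N}\xi^{\otimes}(X,Y_\sigma)},\qquad\theta:=\int\eta\,d\mu$$ (on the event that the denominator vanishes, $T_N$ is assigned an arbitrary value). Put $$\eta_{1,0}(x):=\int[\eta(x,y)-\theta]\xi(x,y)\,dQ(y),\qquad\eta_{0,1}(y):=\int[\eta(x,y)-\theta]\xi(x,y)\,dP(x),$$ which have mean zero under $P$ and $Q$ respectively. $I$ is the identity operator; $(I-\mathcal{A}^*\mathcal{A})^{-1}$ and $(I-\mathcal{A}\mathcal{A}^* )^{-1}$ are the inverses on the subspaces $L^2_0(P)\subset L^2(P)$ and $L^2_0(Q)\subset L^2(Q)$ of mean-zero functions, where these operators are bijective. $\mathcal{N}(0,0)$ is the point mass at $0$. *)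

(* Defs.v *)
From HB Require Import structures.
From mathcomp Require Import all_boot all_order all_algebra all_fingroup.
From mathcomp Require Import all_classical all_reals all_analysis.

Set Implicit Arguments.
Unset Strict Implicit.
Unset Printing Implicit Defensive.

Import Order.TTheory GRing.Theory Num.Theory.
Import numFieldNormedType.Exports.

Local Open Scope classical_set_scope.
Local Open Scope ring_scope.

(* Elements of [L^2(m)] are represented by functions in [Lfun m 2%:E], and
   equality in [L^2(m)] by [ae_eq m setT]. *)

Section L2.
Context d (T : measurableType d) (R : realType).
Variable m : {measure set T -> \bar R}.
Implicit Types (f g u : T -> R) (K : (T -> R) -> (T -> R)).

Definition L2 f : Prop := f \in Lfun m 2%:E.

Definition L2_0 f : Prop := L2 f /\ \int[m]_x f x = 0.

Definition L2_eq f g : Prop := ae_eq m setT f g.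

(* A countable orthonormal basis of [L^2(m)], enumerated along [nat] with some
   indices possibly carrying the zero vector: the padding is what lets the same
   definition cover finite-dimensional [L^2(m)]. *)
Definition orthonormal_basis (e : nat -> T -> R) : Prop :=
  [/\ forall k, L2 (e k),
      forall j k, j != k -> \int[m]_x (e j x * e k x) = 0,
      forall k, \int[m]_x (e k x ^+ 2) = 1 \/ L2_eq (e k) (cst 0)
    & forall f, L2 f -> (forall k, \int[m]_x (f x * e k x) = 0) ->
        L2_eq f (cst 0)].

(* [(I - K)^{-1} g] on the mean-zero subspace: the [u] in [L^2_0(m)] with
   [u - K u = g], picked by choice among its a.e.-versions.  The default value
   is only reached when [g] has no preimage. *)
Definition resolvent_L2_0 K g : T -> R :=
  xget (cst 0) [set u | L2_0 u /\ L2_eq (u \- K u) g].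

End L2.

Section coupling.
Context d1 d2 (T1 : measurableType d1) (T2 : measurableType d2) (R : realType).
Variables (P : probability T1 R) (Q : probability T2 R).
Variable mu : probability (T1 * T2)%type R.
Implicit Types (xi eta : T1 * T2 -> R).

Definition has_marginals : Prop :=
  (forall A, measurable A -> mu (fst @^-1` A) = P A) /\
  (forall B, measurable B -> mu (snd @^-1` B) = Q B).

(* [xi] is any real-valued version of the Radon-Nikodym derivative. *)
Definition is_density xi : Prop :=
  measurable_fun setT xi /\
  forall C, measurable C ->
    mu C = (\int[(P \x Q)%E]_(z in C) (xi z)%:E)%E.

Definition opA xi (f : T1 -> R) : T2 -> R :=
  fun y => \int[P]_x (f x * xi (x, y)).

Definition opAadj xi (g : T2 -> R) : T1 -> R :=
  fun x => \int[Q]_y (g y * xi (x, y)).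

Definition eigen_decomposition xi (s : nat -> R)
    (alpha : nat -> T1 -> R) (beta : nat -> T2 -> R) : Prop :=
  [/\ orthonormal_basis P alpha /\ orthonormal_basis Q beta,
      [/\ s 0%N = 1, L2_eq P (alpha 0%N) (cst 1) & L2_eq Q (beta 0%N) (cst 1)],
      forall k, 0 <= s k <= 1,
      forall k, L2_eq P (opAadj xi (opA xi (alpha k))) (s k ^+ 2 \*o alpha k) /\
                L2_eq Q (opA xi (opAadj xi (beta k))) (s k ^+ 2 \*o beta k)
    & forall k, L2_eq Q (opA xi (alpha k)) (s k \*o beta k) /\
                L2_eq P (opAadj xi (beta k)) (s k \*o alpha k)].

Definition theta eta : R := \int[mu]_z eta z.

Definition eta10 xi eta : T1 -> R :=
  fun x => \int[Q]_y ((eta (x, y) - theta eta) * xi (x, y)).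

Definition eta01 xi eta : T2 -> R :=
  fun y => \int[P]_x ((eta (x, y) - theta eta) * xi (x, y)).

Definition asymptotic_variance xi eta : R :=
  let h := resolvent_L2_0 P (opAadj xi \o opA xi)
             (eta10 xi eta \- opAadj xi (eta01 xi eta)) in
  let g := resolvent_L2_0 Q (opA xi \o opAadj xi)
             (eta01 xi eta \- opA xi (eta10 xi eta)) in
  \int[P]_x (h x ^+ 2) + \int[Q]_y (g y ^+ 2).

End coupling.

(* The sequences start at index 0, so that [x i], [i : 'I_N], stands for the
   sample point number [i + 1]. *)
Section statistic.
Context (T1 T2 : Type) (R : realType).
Variables (xi eta : T1 * T2 -> R) (N : nat).
Variables (x : nat -> T1) (y : nat -> T2).

Definition xi_tensor (s : 'S_N) : R := \prod_(i < N) xi (x i, y (s i)).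

Definition T_num : R :=
  N`!%:R^-1 * \sum_(s : 'S_N)
    (N%:R^-1 * \sum_(i < N) eta (x i, y (s i))) * xi_tensor s.

Definition T_den : R := N`!%:R^-1 * \sum_(s : 'S_N) xi_tensor s.

End statistic.

Section probability_notions.
Context dO (Omega : measurableType dO) (R : realType).
Variable Pr : probability Omega R.

Definition mutually_independent (I : eqType) d (T : measurableType d)
    (Z : I -> Omega -> T) : Prop :=
  forall (J : seq I) (A : I -> set T), uniq J ->
    (forall i, measurable (A i)) ->
    Pr (\bigcap_(i in [set` J]) (Z i @^-1` A i)) =
    (\prod_(i <- J) Pr (Z i @^-1` A i))%E.

Definition has_law d (T : measurableType d) (Z : Omega -> T)
    (nu : probability T R) : Prop :=
  forall A, measurable A -> Pr (Z @^-1` A) = nu A.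

(* Both samples take values in the same space, and independence is joint over
   all the variables [X_i] and [Y_j]. *)
Definition independent_iid_samples d (T : measurableType d)
    (P Q : probability T R) (X Y : nat -> Omega -> T) : Prop :=
  [/\ forall i, has_law (X i) P,
      forall i, has_law (Y i) Q
    & mutually_independent
        (fun k : nat + nat => match k with inl i => X i | inr j => Y j end)].

Definition cvg_in_law (Z : nat -> Omega -> R)
    (nu : probability (measurableTypeR R) R) : Prop :=
  forall f : R -> R, continuous f -> (exists M, forall t, `|f t| <= M) ->
    (\int[Pr]_w f (Z n w)) @[n --> \oo] --> \int[nu]_t f t.

End probability_notions.

(* [normal_prob m s] is parametrised by the standard deviation, and for [s = 0]
   it is the uniform law on [0, 1]; hence the separate degenerate case. *)
Definition normal_law (R : realType) (m v : R) :
    probability (measurableTypeR R) R :=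
  if v == 0 then (\d_(m : measurableTypeR R) : probability _ R)
  else (normal_prob m (Num.sqrt v) : probability _ R).

(* The product sigma-algebra of [d.-tuple R] is the Borel one of [R^d]. *)
Notation Rvec R d := (d.-tuple (measurableTypeR R)).

(* Main.v *)
(* Let [a], [b] solve [a + A^* b = eta10] and [b + A a = eta01]; they are the two
   resolvents of the statement.  For bounded functions [a'], [b'] the kernel
   [(a' + b') xi] contributes exactly [D_N * N^(-1/2) sum_i (a'(X_i) + b'(Y_i))] to
   [sqrt N] times the centred numerator, where [D_N] is the denominator.  The
   remaining kernel [(eta - theta - a' - b') xi] has small row and column means as
   soon as [a'], [b'] are close to [a], [b], and expanding the permutation average
   in the products [alpha_p (x) beta_q] shows that its contribution has small second
   moment.  Thus [sqrt N (T_N - theta)] is a normalised i.i.d. sum plus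
   [o_P(1) / D_N].

   The denominator is bounded below in probability: up to a small error in L^2 it is
   a finite sum of products of elementary symmetric polynomials of the arrays
   [N^(-1/2) alpha_k(X_i)] and [N^(-1/2) beta_k(Y_i)].  These are approximated by
   Hermite polynomials of the column sums [U_k], [V_k], so that Mehler's formula
   gives the positive limit
   [prod_k (1 - s_k^2)^(-1/2) exp ((2 s_k U_k V_k - s_k^2 (U_k^2 + V_k^2)) / (2 (1 - s_k^2)))],
   whose exponent is tight.

   The central limit theorem for the i.i.d. sum compares the convolution operators of
   the summands with those of the Gaussian semigroup. *)

Require Import Defs.
From HB Require Import structures.
From mathcomp Require Import all_boot all_order all_algebra all_fingroup.
From mathcomp Require Import all_classical all_reals all_analysis.
From mathcomp Require Import measurable_realfun.
From mathcomp Require Import ring lra zify.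

Set Implicit Arguments.
Unset Strict Implicit.
Unset Printing Implicit Defensive.

Import Order.TTheory GRing.Theory Num.Theory.
Import numFieldNormedType.Exports.
Local Open Scope classical_set_scope.
Local Open Scope ring_scope.

(** * Expectations, square-integrable functions and rare events *)

Section expectation.
Context d (T : measurableType d) (R : realType) (m : probability T R).
Implicit Types f g : T -> R.

(** All bounds must be uniform in [N] and in the number of basis functions. The average over
    permutations only sees letter counts, and products of basis functions of the samples are
    orthogonal with norms 0 or 1, so second moments become sums of squared coefficients; these stay
    bounded because the [s_k ^+ 2] are summable and at most [s_1 ^+ 2 < 1]. In the second moment of
    a numerator the full L^2 norm of the kernel is damped by [1/N], its row and column means are
    not, and cancelling those means is what the coupled equations do. As [(u + v) * xi] need not be
    square integrable for [u], [v] in L^2, these are replaced by bounded approximations. The lower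
    bound of the denominator has to be fixed before the truncation levels; since the [s_k]
    themselves need not be summable, the mixed terms of Mehler's exponent are controlled in second
    moment and not in absolute value. Convergence in law is tested on sigmoids: they have uniform
    Taylor expansions, and their combinations also supply tightness. *)

Definition intg f := m.-integrable [set: T] (EFin \o f).

Lemma intg_meas f : intg f -> measurable_fun setT f.
Proof. by move=> /measurable_int/measurable_EFinP. Qed.

Lemma intg_le g f : measurable_fun setT f -> (forall x, `|f x| <= g x) ->
  intg g -> intg f.
Proof.
move=> mf fg; apply: le_integrable => //; first exact/measurable_EFinP.
by move=> x _ /=; rewrite lee_fin (le_trans (fg x))// ler_norm.
Qed.

Lemma intg_cst c : intg (cst c).
Proof. exact: finite_measure_integrable_cst. Qed.

Lemma intgD f g : intg f -> intg g -> intg (fun x => f x + g x).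
Proof. by move=> If Ig; apply: eq_integrable (integrableD measurableT If Ig). Qed.

Lemma intgZ c f : intg f -> intg (fun x => c * f x).
Proof. by move=> If; apply: eq_integrable (integrableZl measurableT c If). Qed.

Lemma intgN f : intg f -> intg (fun x => - f x).
Proof. by move=> /(intgZ (-1)); congr intg; apply/funext => x; rewrite mulN1r. Qed.

Lemma intgB f g : intg f -> intg g -> intg (fun x => f x - g x).
Proof. by move=> If Ig; exact: intgD If (intgN Ig). Qed.

Lemma intg_sum I (s : seq I) (P : pred I) (F : I -> T -> R) :
  (forall i, P i -> intg (F i)) -> intg (fun x => \sum_(i <- s | P i) F i x).
Proof.
move=> IF; elim: s => [|i s IHs].
  by apply: eq_integrable (intg_cst 0) => // x _ /=; rewrite big_nil.
apply: (@eq_integrable _ _ _ _ _ _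
  (EFin \o (fun x => (if P i then F i x else 0) + \sum_(i <- s | P i) F i x))) => //.
  by move=> x _ /=; rewrite big_cons; case: ifP; rewrite ?add0r.
apply: intgD => //; case: (P i) (IF i) => [H|_]; [exact: H|exact: intg_cst].
Qed.

Lemma intg_norm f : intg f -> intg (fun x => `|f x|).
Proof. exact: integrable_norm. Qed.

Lemma intg_bounded c f : measurable_fun setT f -> (forall x, `|f x| <= c) -> intg f.
Proof. by move=> mf fc; exact: intg_le mf fc (intg_cst c). Qed.

Lemma intg_ext f g : f =1 g -> intg f -> intg g.
Proof. by move=> /funext ->. Qed.

Definition Ex f : R := \int[m]_x f x.

Lemma ExE f : intg f -> (Ex f)%:E = (\int[m]_x (f x)%:E)%E.
Proof. by move=> If; rewrite fineK//; exact: integrable_fin_num. Qed.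

Lemma Ex_cst c : Ex (cst c) = c.
Proof. 
rewrite /Ex Rintegral_cst// -[RHS]mulr1; congr (_ * _).
by have /(congr1 fine) := probability_setT m.
 Qed.

Lemma ExD f g : intg f -> intg g -> Ex (fun x => f x + g x) = Ex f + Ex g.
Proof. by move=> If Ig; rewrite /Ex RintegralD. Qed.

Lemma ExB f g : intg f -> intg g -> Ex (fun x => f x - g x) = Ex f - Ex g.
Proof. by move=> If Ig; rewrite /Ex RintegralB. Qed.

Lemma ExZ c f : intg f -> Ex (fun x => c * f x) = c * Ex f.
Proof. by move=> If; rewrite /Ex RintegralZl. Qed.

Lemma Ex_sum I (s : seq I) (P : pred I) (F : I -> T -> R) :
  (forall i, P i -> intg (F i)) ->
  Ex (fun x => \sum_(i <- s | P i) F i x) = \sum_(i <- s | P i) Ex (F i).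
Proof.
move=> IF; elim: s => [|i s IHs].
  rewrite big_nil -[RHS]Ex_cst; congr Ex; apply/funext => x; by rewrite big_nil.
rewrite big_cons; case: ifPn => Pi; last first.
  by rewrite -IHs; congr Ex; apply/funext => x; rewrite big_cons (negbTE Pi).
rewrite -IHs -ExD; [|exact: IF|exact: intg_sum].
by congr Ex; apply/funext => x; rewrite big_cons Pi.
Qed.

Lemma Ex_le f g : intg f -> intg g -> (forall x, f x <= g x) -> Ex f <= Ex g.
Proof. by move=> If Ig fg; apply: le_Rintegral. Qed.

Lemma Ex_ge0 f : (forall x, 0 <= f x) -> 0 <= Ex f.
Proof. by move=> f0; apply: Rintegral_ge0. Qed.

Lemma Ex_norm f : intg f -> `|Ex f| <= Ex (fun x => `|f x|).
Proof. by move=> If; apply: le_normr_Rintegral. Qed.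

Lemma Ex_ae f g : measurable_fun setT f -> measurable_fun setT g ->
  ae_eq m setT f g -> Ex f = Ex g.
Proof.
move=> mf mg fg; rewrite /Ex /Rintegral; congr fine.
apply: ae_eq_integral => //; [exact/measurable_EFinP|exact/measurable_EFinP|].
by apply: filterS fg => x /= H xT; rewrite H.
Qed.

Lemma intg_ae f g : measurable_fun setT g -> ae_eq m setT f g -> intg f -> intg g.
Proof.
move=> mg fg If; have mf := intg_meas If.
apply/integrableP; split; first exact/measurable_EFinP.
move/integrableP : If => -[_]; congr (_ < _)%E.
apply: ae_eq_integral => //.
- by apply: measurableT_comp => //; exact/measurable_EFinP.
- by apply: measurableT_comp => //; exact/measurable_EFinP.
- by apply: filterS fg => x /= H xT; rewrite H.
Qed.

Lemma Ex_eq0 f : measurable_fun setT f -> intg f -> (forall x, 0 <= f x) ->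
  Ex f = 0 -> ae_eq m setT f (cst 0).
Proof.
move=> mf If f0 E0.
have : (\int[m]_x `|(EFin \o f) x|)%E = 0%E.
  under eq_integral do rewrite /= ger0_norm//.
  by rewrite -ExE// E0.
move/(ae_eq_integral_abs m measurableT); move=> H.
have /H : measurable_fun setT (EFin \o f) by exact/measurable_EFinP.
by apply: filterS => x /= + xT => /(_ xT) [].
Qed.

(** Representatives in L^2, kept as measurability plus an integrable square so that no norm has to
    be unfolded; [L2P] is the bridge to the [Lfun] form of the statement. *)
Definition sqi f := measurable_fun setT f /\ intg (fun x => f x ^+ 2).

Lemma sqi_meas f : sqi f -> measurable_fun setT f. Proof. by case. Qed.
Lemma sqi_sq f : sqi f -> intg (fun x => f x ^+ 2). Proof. by case. Qed.

Lemma L2P f : L2 m f <-> sqi f.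
Proof.
split=> [H|[mf If]].
  split; last exact: Lfun2_integrable_sqr.
  by move: H => /andP[+ _]; rewrite inE.
apply/andP; split; first exact/mem_set.
rewrite inE /finite_norm unlock /= ?gt_eqF//.
rewrite poweR_lty//.
have /integrableP[_] := If; congr (_ < _)%E; apply: eq_integral => x _ /=.
by rewrite normrX powR_mulrn.
Qed.

Lemma sqi_intgM f g : sqi f -> sqi g -> intg (fun x => f x * g x).
Proof.
move=> [mf If] [mg Ig].
apply: (@intg_le (fun x => f x ^+ 2 + g x ^+ 2)); last exact: intgD.
  exact: measurable_funM.
move=> x; rewrite normrM -[f x ^+ 2]real_normK ?num_real// -[g x ^+ 2]real_normK ?num_real//.
have := sqr_ge0 (`|f x| - `|g x|); have := sqr_ge0 (`|f x| + `|g x|); nra.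
Qed.

Lemma sqi_cst c : sqi (cst c).
Proof. by split; [exact: measurable_cst | apply: (@intg_ext (cst (c ^+ 2))) => //; exact: intg_cst]. Qed.

Lemma sqi_intg f : sqi f -> intg f.
Proof.
move=> sf; apply: intg_ext (sqi_intgM sf (sqi_cst 1)) => x.
by rewrite /= mulr1.
Qed.

Lemma sqiZ c f : sqi f -> sqi (fun x => c * f x).
Proof.
move=> [mf If]; split; first by apply: measurable_funM => //; exact: measurable_cst.
by apply: intg_ext (intgZ (c ^+ 2) If) => x; rewrite exprMn.
Qed.

Lemma sqiD f g : sqi f -> sqi g -> sqi (fun x => f x + g x).
Proof.
move=> sf sg; split; first by apply: measurable_funD; [case: sf | case: sg].
apply: intg_ext (intgD (intgD (sqi_sq sf) (intgZ 2 (sqi_intgM sf sg))) (sqi_sq sg)) => x.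
by rewrite sqrrD mulr_natl.
Qed.

Lemma sqiN f : sqi f -> sqi (fun x => - f x).
Proof. by move=> /(sqiZ (-1)); congr sqi; apply/funext => x; rewrite mulN1r. Qed.

Lemma sqiB f g : sqi f -> sqi g -> sqi (fun x => f x - g x).
Proof. by move=> sf sg; exact: sqiD sf (sqiN sg). Qed.

Lemma sqi_sum I (s : seq I) (P : pred I) (F : I -> T -> R) :
  (forall i, P i -> sqi (F i)) -> sqi (fun x => \sum_(i <- s | P i) F i x).
Proof.
move=> IF; elim: s => [|i s IHs].
  rewrite [X in sqi X](_ : _ = cst 0); first exact: sqi_cst.
  by apply/funext => x; rewrite big_nil.
rewrite [X in sqi X](_ : _ =
  (fun x => (if P i then F i x else 0) + \sum_(i <- s | P i) F i x)); last first.
  by apply/funext => x; rewrite big_cons; case: ifP; rewrite ?add0r.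
apply: sqiD => //; case: (P i) (IF i) => [H|_]; [exact: H|exact: sqi_cst].
Qed.

Lemma sqi_ae f g : measurable_fun setT g -> ae_eq m setT f g -> sqi f -> sqi g.
Proof.
move=> mg fg [mf If]; split => //; apply: intg_ae If.
  exact: measurable_funX.
by apply: filterS fg => x /= H xT; rewrite H.
Qed.

Lemma sqi_le g f : measurable_fun setT f -> (forall x, `|f x| <= `|g x|) ->
  sqi g -> sqi f.
Proof.
move=> mf fg [mg Ig]; split => //; apply: intg_le Ig.
  exact: measurable_funX.
by move=> x; rewrite normrX -[leRHS]real_normK ?num_real// ler_pXn2r ?nnegrE.
Qed.

Lemma sqi_bounded c f : measurable_fun setT f -> (forall x, `|f x| <= c) -> sqi f.
Proof.
move=> mf fc; apply: (@sqi_le (cst c)) => //; last exact: sqi_cst.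
by move=> x; rewrite (le_trans (fc x))// ler_norm.
Qed.

Lemma sqiM_bounded c f g : sqi f -> measurable_fun setT g -> (forall x, `|g x| <= c) ->
  sqi (fun x => g x * f x).
Proof.
move=> sf mg gc; apply: (@sqi_le (fun x => c * f x)).
- by apply: measurable_funM => //; exact: sqi_meas sf.
- by move=> x; rewrite !normrM ler_wpM2r// (le_trans (gc x))// ler_norm.
- exact: sqiZ.
Qed.

(** Nonnegativity of the quadratic polynomial [E (f - t g)^2] in [t], evaluated at its minimiser
    [b / c]. *)
Lemma cauchy_schwarz f g : sqi f -> sqi g ->
  Ex (fun x => f x * g x) ^+ 2 <= Ex (fun x => f x ^+ 2) * Ex (fun x => g x ^+ 2).
Proof.
move=> sf sg; set a := Ex (fun x => f x ^+ 2); set b := Ex _; set c := Ex (fun x => g x ^+ 2).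
have H t : 0 <= a - 2 * t * b + t ^+ 2 * c.
  have -> : a - 2 * t * b + t ^+ 2 * c = Ex (fun x => (f x - t * g x) ^+ 2).
    rewrite -!ExZ -?ExB -?ExD; last 6 first.
    - by apply: intgB; [exact: sqi_sq|apply: intgZ; exact: sqi_intgM].
    - by apply: intgZ; exact: sqi_sq.
    - exact: sqi_sq.
    - by apply: intgZ; exact: sqi_intgM.
    - exact: sqi_sq.
    - exact: sqi_intgM.
    by congr Ex; apply/funext => x; ring.
  by apply: Ex_ge0 => x; exact: sqr_ge0.
have c0 : 0 <= c by apply: Ex_ge0 => x; exact: sqr_ge0.
(* A null [g] admits no minimiser: [a - 2 * t * b] is then nonnegative for every [t], and
   [t = (a + 1) / (2 * b)] would make it [-1] if [b] were nonzero. *)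
have [c0'|cn0] := eqVneq c 0.
  rewrite c0' mulr0; have H1 t : 0 <= a - 2 * t * b by have := H t; rewrite c0' mulr0 addr0.
  suff -> : b = 0 by rewrite expr0n.
  apply/eqP; apply: contraT => b0.
  have := H1 ((a + 1) / (2 * b)).
  rewrite (_ : 2 * ((a + 1) / (2 * b)) * b = a + 1); last by field.
  lra.
have cp : 0 < c by rewrite lt_def cn0.
have := H (b / c); rewrite -(ler_pM2r cp) mul0r.
rewrite (_ : (a - 2 * (b / c) * b + (b / c) ^+ 2 * c) * c = a * c - b ^+ 2); last by field.
by rewrite subr_ge0.
Qed.

Lemma Ex_sqr_le f : sqi f -> Ex f ^+ 2 <= Ex (fun x => f x ^+ 2).
Proof.
move=> sf; have := cauchy_schwarz sf (sqi_cst 1).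
have -> : Ex (fun x => cst 1 x ^+ 2) = 1 :> R.
  by rewrite -[RHS]Ex_cst; congr Ex; apply/funext => x /=; rewrite expr1n.
by rewrite mulr1; under [X in Ex X]eq_fun do rewrite /= mulr1.
Qed.

Lemma Ex_sqrD_le f g : sqi f -> sqi g ->
  Ex (fun x => (f x + g x) ^+ 2) <= 2 * Ex (fun x => f x ^+ 2) + 2 * Ex (fun x => g x ^+ 2).
Proof.
move=> sf sg; rewrite -!ExZ; try exact: sqi_sq.
rewrite -ExD; try (apply: intgZ; exact: sqi_sq).
apply: Ex_le.
- exact: (sqi_sq (sqiD sf sg)).
- by apply: intgD; apply: intgZ; exact: sqi_sq.
- by move=> x; have := sqr_ge0 (f x - g x); nra.
Qed.

Lemma Ex_sqr_eq0 f : sqi f -> Ex (fun x => f x ^+ 2) = 0 -> ae_eq m setT f (cst 0).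
Proof.
move=> [mf If] /Ex_eq0 H.
have := H (measurable_funX 2 mf) If (fun=> sqr_ge0 _).
by apply: filterS => x /= + xT => /(_ xT) /eqP; rewrite sqrf_eq0 => /eqP.
Qed.

(* [pr A] is only meaningful for measurable [A]; [mostly e G] bounds the outer
   probability of the complement of [G], so that no measurability is needed. *)
Definition pr (A : set T) : R := fine (m A).

Definition mostly (e : R) (G : set T) :=
  exists A, [/\ measurable A, pr A <= e & forall x, ~ A x -> G x].

Lemma prE A : measurable A -> (pr A)%:E = m A.
Proof. by move=> mA; rewrite fineK// fin_num_measure. Qed.

Lemma pr_Ex A : measurable A -> pr A = Ex (\1_A : T -> R).
Proof. by move=> mA; rewrite /Ex /Rintegral integral_indic// setIT. Qed.

Lemma mostlyI e1 e2 G1 G2 : mostly e1 G1 -> mostly e2 G2 ->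
  mostly (e1 + e2) (G1 `&` G2).
Proof.
move=> [A [mA Ae AG]] [B [mB Be BG]]; exists (A `|` B); split.
- exact: measurableU.
- apply: le_trans (lerD Ae Be); rewrite -lee_fin EFinD !prE//; last exact: measurableU.
  exact: measureU2.
- by move=> x /not_orP[/AG ? /BG].
Qed.

Lemma mostly_sub e1 e2 (G1 G2 : set T) : e1 <= e2 -> (forall x, G1 x -> G2 x) ->
  mostly e1 G1 -> mostly e2 G2.
Proof.
move=> e12 G12 [A [mA Ae AG]]; exists A; split => //; first exact: le_trans e12.
by move=> x /AG /G12.
Qed.

Lemma mostly_all (e : R) (G : set T) : 0 <= e -> (forall x, G x) -> mostly e G.
Proof. by move=> e0 H; exists set0; split=> //; rewrite /pr measure0. Qed.

Lemma mostly_forall (I : finType) e (G : I -> set T) :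
  (forall i, mostly e (G i)) -> mostly (#|I|%:R * e) [set x | forall i, G i x].
Proof.
move=> H; rewrite cardE.
have : mostly ((size (enum I))%:R * e) [set x | forall i, i \in enum I -> G i x].
  elim: (enum I) => [|i s IHs].
    by apply: mostly_all => //=; rewrite mul0r.
  apply: mostly_sub (mostlyI (H i) IHs) => /=.
    by rewrite -natr1 mulrDl mul1r addrC.
  by move=> x [/= Gi Gs] j; rewrite in_cons => /predU1P[->//|/Gs].
by apply: mostly_sub => // x /= Gx i; apply: Gx; rewrite mem_enum.
Qed.

Lemma mostly_markov c f : intg f -> (forall x, 0 <= f x) -> 0 < c ->
  mostly (Ex f / c) [set x | f x < c].
Proof.
move=> If f0 c0; have mf := intg_meas If.
have mA : measurable [set x | c <= f x].
  rewrite -[X in measurable X]setTI; apply: (@measurable_fun_le _ _ _ setT (cst c) f) => //.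
exists [set x | c <= f x]; split => //; last first.
  by move=> x /= /negP; rewrite -ltNge.
rewrite pr_Ex// ler_pdivlMr// mulrC -ExZ; last first.
  exact: integrable_indic.
apply: Ex_le => //; first by apply: intgZ; exact: integrable_indic.
move=> x; rewrite indicE; case: (boolP (x \in _)) => [|_].
  by rewrite inE /= mulr1.
by rewrite mulr0.
Qed.

Lemma mostly_chebyshev c f : sqi f -> 0 < c ->
  mostly (Ex (fun x => f x ^+ 2) / c ^+ 2) [set x | `|f x| < c].
Proof.
move=> [mf If] c0; apply: mostly_sub (mostly_markov If _ _) => //.
- by move=> x /=; rewrite -real_normK ?num_real// ltr_pXn2r// ?nnegrE// ltW.
- by move=> x; exact: sqr_ge0.
- by rewrite exprn_gt0.
Qed.

End expectation.

(** * Products, laws and independence *)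

Section product_probability.
Context d1 d2 (T1 : measurableType d1) (T2 : measurableType d2) (R : realType).
Variables (P : probability T1 R) (Q : probability T2 R).

Let prodT : (P \x Q)%E setT = 1%E.
Proof.
rewrite -setXTT product_measure1E// -[RHS]mule1; congr (_ * _)%E;
exact: probability_setT.
Qed.

HB.instance Definition _ := Measure_isProbability.Build _ _ _ (P \x Q)%E prodT.

Implicit Types F : T1 * T2 -> R.

(** Fubini's theorem produces inner integrals with extended real values, finite only almost
    everywhere; this passes to the real-valued [Ex], [fine] changing the values on a null set
    only. *)
Lemma Ex_fine (d0 : measure_display) (T0 : measurableType d0) (m : probability T0 R)
    (G : T0 -> \bar R) : m.-integrable setT G ->
  intg m (fine \o G) /\ Ex m (fine \o G) = fine (\int[m]_x G x)%E.
Proof.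
move=> IG; have /measurable_int mG := IG.
have GE : ae_eq m setT G (EFin \o (fine \o G)).
  have := integrable_ae measurableT IG.
  by apply: filterS => x /= + xT => /(_ xT) ?; rewrite fineK.
have mf : measurable_fun setT (fine \o G).
  by apply: measurableT_comp => //; exact: fine_measurable.
split.
  apply/integrableP; split; first exact/measurable_EFinP.
  have /integrableP[_] := IG; congr (_ < _)%E; apply: ae_eq_integral => //.
  - exact: measurableT_comp.
  - by apply: measurableT_comp => //; exact/measurable_EFinP.
  - by apply: filterS GE => x /= H xT; rewrite {1}H.
rewrite /Ex /Rintegral; congr fine; symmetry; apply: ae_eq_integral => //.
exact/measurable_EFinP.
Qed.

Lemma fubini1 F : intg (P \x Q)%E F ->
  intg P (fun x => Ex Q (fun y => F (x, y))) /\
  Ex P (fun x => Ex Q (fun y => F (x, y))) = Ex (P \x Q)%E F.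
Proof.
move=> IF; have [I E] := Ex_fine (integrable_fubini_F IF).
split; first exact: I.
by rewrite [RHS]/Ex /Rintegral -(integral12_prod_meas1 IF) -E.
Qed.

Lemma integrable_fubini_G (F : T1 * T2 -> \bar R) :
  (P \x Q)%E.-integrable setT F -> Q.-integrable setT (fubini_G P F).
Proof.
move=> IF; have /measurable_int mF := IF; apply/integrableP; split.
  exact: measurable_fubini_G IF.
have /(integrable21ltyP _ _ mF) := IF; apply: le_lt_trans.
apply: ge0_le_integral => //.
- by apply: measurableT_comp => //; exact: measurable_fubini_G IF.
- apply: (@measurable_fun_fubini_tonelli_G _ _ T1 T2 R P (abse \o F)) => //.
  exact: measurableT_comp.
- by move=> z; exact: abse_ge0.
- move=> y _; apply: le_abse_integral => //.
  exact: measurableT_comp mF _.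
Qed.

Lemma fubini2 F : intg (P \x Q)%E F ->
  intg Q (fun y => Ex P (fun x => F (x, y))) /\
  Ex Q (fun y => Ex P (fun x => F (x, y))) = Ex (P \x Q)%E F.
Proof.
move=> IF; have [I E] := Ex_fine (integrable_fubini_G IF).
split; first exact: I.
by rewrite [RHS]/Ex /Rintegral -(integral21_prod_meas1 IF) -E.
Qed.

Lemma intg_section1 F : intg (P \x Q)%E F ->
  {ae P, forall x, intg Q (fun y => F (x, y))}.
Proof. by move=> /ae_integrable1. Qed.

Lemma intg_section2 F : intg (P \x Q)%E F ->
  {ae Q, forall y, intg P (fun x => F (x, y))}.
Proof. by move=> /ae_integrable2. Qed.

Lemma intg_tensor (f : T1 -> R) (g : T2 -> R) : intg P f -> intg Q g ->
  intg (P \x Q)%E (fun z => f z.1 * g z.2) /\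
  Ex (P \x Q)%E (fun z => f z.1 * g z.2) = Ex P f * Ex Q g.
Proof.
move=> If Ig.
have mF : measurable_fun setT (fun z : T1 * T2 => f z.1 * g z.2).
  apply: measurable_funM; (apply: measurableT_comp; last by []).
  exact: intg_meas If. exact: intg_meas Ig.
have I : intg (P \x Q)%E (fun z => f z.1 * g z.2).
  apply/integrable12ltyP => /=; first exact/measurable_EFinP.
  under eq_integral => x _.
    under eq_integral do rewrite normrM EFinM.
    rewrite ge0_integralZl_EFin//; last first.
      by apply/measurable_EFinP; apply: measurableT_comp => //; exact: intg_meas Ig.
    over.
  rewrite -ExE; last exact: intg_norm.
  rewrite ge0_integralZr//; last 2 first.
  - by apply/measurable_EFinP; apply: measurableT_comp => //; exact: intg_meas If.
  - by rewrite lee_fin Ex_ge0.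
  by rewrite -ExE ?ltry//; exact: intg_norm.
split => //; have [_ <-] := fubini1 I.
under [X in Ex _ X]eq_fun => x do rewrite /= ExZ//.
under [LHS]eq_Rintegral do rewrite mulrC.
by rewrite [LHS](ExZ _ If) mulrC.
Qed.

Lemma sqi_tensor (f : T1 -> R) (g : T2 -> R) : sqi P f -> sqi Q g ->
  sqi (P \x Q)%E (fun z => f z.1 * g z.2).
Proof.
move=> [mf If] [mg Ig]; split.
  by apply: measurable_funM; apply: measurableT_comp.
by apply: intg_ext (intg_tensor If Ig).1 => z /=; rewrite exprMn.
Qed.

(** The integrability of almost every section is a separate premise because [Ex] of a nonintegrable
    nonnegative function is [0]: the last premise alone could hold for a function of infinite
    integral. *)
Lemma tonelli_intg F : measurable_fun setT F -> (forall z, 0 <= F z) ->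
  {ae P, forall x, intg Q (fun y => F (x, y))} ->
  intg P (fun x => Ex Q (fun y => F (x, y))) -> intg (P \x Q)%E F.
Proof.
move=> mF F0 I1 I2; apply/integrable12ltyP => /=; first exact/measurable_EFinP.
rewrite [X in (X < _)%E](_ : _ = \int[P]_x (Ex Q (fun y => F (x, y)))%:E)%E.
  by rewrite -ExE// ltry.
apply: ae_eq_integral => //.
- apply: (@measurable_fun_fubini_tonelli_F _ _ T1 T2 R Q (fun z => (`|F z|)%:E)) => //.
  by apply/measurable_EFinP; apply: measurableT_comp.
- by apply/measurable_EFinP; exact: intg_meas I2.
- apply: filterS I1 => x Ix _; rewrite ExE//; apply: eq_integral => y _.
  by rewrite ger0_norm.
Qed.

End product_probability.

Section laws.
Context dO (Om : measurableType dO) (R : realType) (Pr : probability Om R).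
Context d (T : measurableType d) (nu : probability T R).

(** The equality of expectations comes without integrability: positive and negative parts always
    have equal integrals, so [fine] is applied to the same extended real on both sides. *)
Lemma law_eq (f : Om -> T) (h : T -> R) :
  measurable_fun setT f -> has_law Pr f nu -> measurable_fun setT h ->
  (intg nu h -> intg Pr (h \o f)) /\ Ex Pr (h \o f) = Ex nu h.
Proof.
move=> mf lf mh; pose X := mfun_Sub (mem_set mf) : {RV Pr >-> T}.
have E (g : T -> \bar R) : (\int[nu]_x g x = \int[distribution Pr X]_x g x)%E.
  by apply: eq_measure_integral => A mA _ /=; rewrite /distribution /pushforward lf.
have I : intg nu h -> intg Pr (h \o f).
  move=> /integrableP[_ Ih]; apply/integrableP; split.
    by apply/measurable_EFinP; exact: measurableT_comp.
  rewrite E ge0_integral_distribution// in Ih.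
  by apply: measurableT_comp => //; exact/measurable_EFinP.
split => //.
have [Ih|nIh] := pselect (intg Pr (h \o f)).
  rewrite /Ex /Rintegral E integral_distribution//.
  exact/measurable_EFinP.
have mh' : measurable_fun setT (EFin \o h) by exact/measurable_EFinP.
rewrite /Ex /Rintegral E integralE [in RHS]integralE; congr (fine (_ - _)%E); symmetry.
  rewrite (ge0_integral_distribution X (measurable_funepos mh'))//.
  by apply: eq_integral => x _ /=; rewrite !funeposE.
rewrite (ge0_integral_distribution X (measurable_funeneg mh'))//.
by apply: eq_integral => x _ /=; rewrite !funenegE.
Qed.

End laws.

Section independence.
Context dO (Om : measurableType dO) (R : realType) (Pr : probability Om R).
Context (I : choiceType) d (T : measurableType d) (Z : I -> Om -> T).
Hypothesis mZ : forall i, measurable_fun setT (Z i).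
Hypothesis indZ : mutually_independent Pr Z.

Definition cylinders (J : seq I) : set (set Om) :=
  [set A | exists B : I -> set T, (forall i, measurable (B i)) /\
     A = \bigcap_(i in [set` J]) (Z i @^-1` B i)].

(* [sigmaT J] is [Om] equipped with the sigma-algebra generated by the [Z i],
   [i \in J]. *)
Definition sigmaT (J : seq I) := g_sigma_algebraType (cylinders J).

Lemma cylinders_measurable J : cylinders J `<=` measurable.
Proof.
move=> A [B [mB ->]]; rewrite bigcap_seq; apply: bigsetI_measurable => i _.
by rewrite -[X in measurable X]setTI; exact: mZ.
Qed.

Lemma sigmaT_measurable J (A : set Om) : <<s cylinders J >> A -> measurable A.
Proof.
move: A; apply: smallest_sub; first exact: sigma_algebra_measurable.
exact: cylinders_measurable.
Qed.

Lemma cylindersI J : setI_closed (cylinders J).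
Proof.
move=> A A' [B [mB ->]] [B' [mB' ->]]; exists (fun i => B i `&` B' i).
split=> [i|]; first exact: measurableI.
by rewrite -bigcapI; apply: eq_bigcapr => i _; rewrite preimage_setI.
Qed.

Lemma cylindersT J : cylinders J setT.
Proof.
by exists (fun=> setT); split=> //; apply/seteqP; split.
Qed.

Lemma cylinders_mono J J' : {subset J <= J'} -> cylinders J `<=` cylinders J'.
Proof.
move=> JJ A [B [mB ->]]; exists (fun i => if i \in J then B i else setT); split.
  by move=> i; case: ifP.
apply/seteqP; split=> x /= H i /= iJ.
  by case: ifP => // iJ'; exact: (H i).
by have /= := H i (JJ _ iJ); rewrite iJ.
Qed.

Lemma measurable_Z_sigmaT J i : i \in J ->
  measurable_fun (setT : set (sigmaT J)) (Z i).
Proof.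
move=> iJ _ B mB; rewrite setTI; apply: sub_sigma_algebra.
exists (fun j => if j == i then B else setT); split.
  by move=> j; case: ifP.
apply/seteqP; split=> x /= H.
  by move=> j /= _; case: eqVneq => // ->.
by have /= := H i iJ; rewrite eqxx.
Qed.

Lemma sigmaT_mono J J' d' (T' : measurableType d') (f : Om -> T') :
  {subset J <= J'} -> measurable_fun (setT : set (sigmaT J)) f ->
  measurable_fun (setT : set (sigmaT J')) f.
Proof.
move=> JJ mf _ B mB; have := mf measurableT _ mB.
rewrite !setTI; apply: sub_smallest2r; first exact: smallest_sigma_algebra.
exact: cylinders_mono.
Qed.

Lemma sigmaT_measurable_fun J d' (T' : measurableType d') (f : Om -> T') :
  measurable_fun (setT : set (sigmaT J)) f -> measurable_fun setT f.
Proof.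
move=> mf _ B mB; have := mf measurableT _ mB.
by rewrite !setTI => /sigmaT_measurable.
Qed.

Lemma indep_cylinders J1 J2 A B : uniq (J1 ++ J2) ->
  cylinders J1 A -> cylinders J2 B -> Pr (A `&` B) = (Pr A * Pr B)%E.
Proof.
move=> uJ [A' [mA ->]] [B' [mB ->]].
have := uJ; rewrite cat_uniq => /and3P[u1 /hasPn dis u2].
pose C i := if i \in J1 then A' i else B' i.
have mC i : measurable (C i) by rewrite /C; case: ifP.
rewrite (_ : _ `&` _ = \bigcap_(i in [set` J1 ++ J2]) (Z i @^-1` C i)); last first.
  apply/seteqP; split=> x.
    move=> [H1 H2] i /=; rewrite mem_cat /C; case: ifPn => iJ1 /=.
      by move=> _; exact: H1.
    exact: H2.
  move=> H; split=> i /= iJ.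
    by have := H i; rewrite /= mem_cat iJ /C iJ; apply.
  have := H i; rewrite /= mem_cat iJ orbT /C.
  by rewrite (negbTE (dis _ iJ)); apply.
rewrite !indZ// big_cat/=; congr (_ * _)%E; apply: eq_big_seq => i iJ; rewrite /C.
  by rewrite iJ.
by rewrite (negbTE (dis _ iJ)).
Qed.

Lemma indepC (S C : set Om) : measurable S -> measurable C ->
  Pr (S `&` C) = (Pr S * Pr C)%E -> Pr (~` S `&` C) = (Pr (~` S) * Pr C)%E.
Proof.
move=> mS mC HS.
rewrite setIC -setDE measureD//; last by rewrite ltey_eq fin_num_measure.
transitivity (Pr C - Pr S * Pr C)%E.
  by congr (_ - _)%E; rewrite setIC; exact: HS.
rewrite probability_setC// muleBl ?mul1e ?fin_num_measure//.
Qed.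

Lemma indep_bigcup (F : (set Om)^nat) (C : set Om) :
  (forall n, measurable (F n)) -> measurable C -> trivIset setT F ->
  (forall n, Pr (F n `&` C) = (Pr (F n) * Pr C)%E) ->
  Pr (\bigcup_n F n `&` C) = (Pr (\bigcup_n F n) * Pr C)%E.
Proof.
move=> mF mC tF HF; rewrite setI_bigcupl measure_bigcup//; last 2 first.
- by move=> i _; exact: measurableI.
- exact: trivIset_setIr.
transitivity ((\sum_(n <oo) Pr (F n)) * Pr C)%E; last first.
  by congr (_ * _)%E; rewrite measure_bigcup//; apply: eq_eseriesl => n; rewrite in_setT.
rewrite -(fineK (fin_num_measure Pr _ mC)) muleC -nneseriesZl//.
rewrite [LHS](@eq_eseriesl _ _ predT) => [|n]; last by rewrite in_setT.
apply: eq_eseriesr => n _; rewrite fineK ?fin_num_measure// muleC; exact: HF.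
Qed.

(** Dynkin's pi-lambda argument, used once for each factor: cylinders are stable under intersection,
    and the events independent of a fixed [C] form a Dynkin system. The first use fixes [B], the
    second fixes a cylinder over [J1]. *)
Lemma indep_sigma J1 J2 A B : uniq (J1 ++ J2) ->
  <<s cylinders J1 >> A -> <<s cylinders J2 >> B -> Pr (A `&` B) = (Pr A * Pr B)%E.
Proof.
move=> uJ.
have key J (C : set Om) : measurable C ->
    (forall A, cylinders J A -> Pr (A `&` C) = (Pr A * Pr C)%E) ->
    forall A, <<s cylinders J >> A -> Pr (A `&` C) = (Pr A * Pr C)%E.
  move=> mC H; apply: (@dynkin_induction _ (sigmaT J)
    (cylinders J) [set A | Pr (A `&` C) = (Pr A * Pr C)%E]) => //=.
  - exact: cylindersI.
  - by apply: H; exact: cylindersT.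
  - move=> S mS HS; have mS' := sigmaT_measurable mS.
    exact: indepC mS' mC HS.
  - move=> F mF tF HF.
    by apply: indep_bigcup => // n; exact: sigmaT_measurable (mF n).
move=> sA sB.
apply: (key J1) sA; first exact: sigmaT_measurable sB.
move=> {}A cA; rewrite setIC muleC.
apply: (key J2) sB; first exact: cylinders_measurable cA.
by move=> {}B cB; rewrite setIC muleC (indep_cylinders uJ).
Qed.

Lemma indep_pair_law J1 J2 d1 d2 (T1 : measurableType d1) (T2 : measurableType d2)
    (mu1 : probability T1 R) (mu2 : probability T2 R) (f1 : Om -> T1) (f2 : Om -> T2) :
  uniq (J1 ++ J2) ->
  measurable_fun (setT : set (sigmaT J1)) f1 -> measurable_fun (setT : set (sigmaT J2)) f2 ->
  has_law Pr f1 mu1 -> has_law Pr f2 mu2 ->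
  has_law Pr (fun w => (f1 w, f2 w)) (mu1 \x mu2)%E.
Proof.
move=> uJ m1 m2 l1 l2 A mA.
have mf : measurable_fun setT (fun w => (f1 w, f2 w)).
  by apply: measurable_fun_pair; [exact: sigmaT_measurable_fun m1|exact: sigmaT_measurable_fun m2].
pose X := mfun_Sub (mem_set mf) : {RV Pr >-> (T1 * T2)%type}.
transitivity (distribution Pr X A); first by [].
symmetry; apply: product_measure_unique => // B C mB mC.
transitivity (Pr (f1 @^-1` B) * Pr (f2 @^-1` C))%E; last first.
  by congr (_ * _)%E; [exact: l1|exact: l2].
transitivity (Pr ((f1 @^-1` B) `&` (f2 @^-1` C))); first by [].
apply: (indep_sigma uJ).
  by have := m1 measurableT _ mB; rewrite setTI.
by have := m2 measurableT _ mC; rewrite setTI.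
Qed.

(** The joint law is the product of the two image laws, and there a tensor product of integrable
    functions is integrable; hence the integrability of the product needs no moment beyond the
    first. *)
Lemma indep_mul J1 J2 (f1 f2 : Om -> R) : uniq (J1 ++ J2) ->
  measurable_fun (setT : set (sigmaT J1)) f1 -> measurable_fun (setT : set (sigmaT J2)) f2 ->
  intg Pr f1 -> intg Pr f2 ->
  intg Pr (fun w => f1 w * f2 w) /\ Ex Pr (fun w => f1 w * f2 w) = Ex Pr f1 * Ex Pr f2.
Proof.
move=> uJ m1 m2 I1 I2.
have mf1 := intg_meas I1; have mf2 := intg_meas I2.
pose X1 := mfun_Sub (mem_set mf1) : {RV Pr >-> R}.
pose X2 := mfun_Sub (mem_set mf2) : {RV Pr >-> R}.
pose mu1 : probability R R := distribution Pr X1.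
pose mu2 : probability R R := distribution Pr X2.
have l1 : has_law Pr (f1) mu1 by [].
have l2 : has_law Pr (f2) mu2 by [].
have l12 := indep_pair_law uJ m1 m2 l1 l2.
have mid : measurable_fun setT (id : R -> R) by [].
have J1' : intg mu1 id.
  apply/integrableP; split; first exact/measurable_EFinP.
  rewrite ge0_integral_distribution//; last by apply: measurableT_comp => //; exact/measurable_EFinP.
  by have /integrableP[] := I1.
have J2' : intg mu2 id.
  apply/integrableP; split; first exact/measurable_EFinP.
  rewrite ge0_integral_distribution//; last by apply: measurableT_comp => //; exact/measurable_EFinP.
  by have /integrableP[] := I2.
have [It Et] := intg_tensor J1' J2'.
have mpair : measurable_fun setT (fun w => (f1 w, f2 w)) by exact: measurable_fun_pair.
have [A B] := law_eq mpair l12 (intg_meas It).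
split; first exact: A.
rewrite [LHS]B Et; congr (_ * _).
  by have [_ <-] := law_eq mf1 l1 mid.
by have [_ <-] := law_eq mf2 l2 mid.
Qed.

(** Carrying the measurability of the partial product with respect to the union of the blocks is
    what lets the induction apply [indep_mul] to the next factor. *)
Lemma indep_prod (K : Type) (s : seq K) (B : K -> seq I) (F : K -> Om -> R) :
  uniq (flatten [seq B k | k <- s]) ->
  (forall k, measurable_fun (setT : set (sigmaT (B k))) (F k)) ->
  (forall k, intg Pr (F k)) ->
  [/\ measurable_fun (setT : set (sigmaT (flatten [seq B k | k <- s])))
        (fun w => \prod_(k <- s) F k w),
      intg Pr (fun w => \prod_(k <- s) F k w)
    & Ex Pr (fun w => \prod_(k <- s) F k w) = \prod_(k <- s) Ex Pr (F k)].
Proof.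
move=> + mF IF; elim: s => [_|k s IHs /=].
  have -> : (fun w : Om => \prod_(k <- [::]) F k w) = cst 1.
    by apply/funext => w; rewrite big_nil.
  by rewrite big_nil Ex_cst; split=> //; exact: intg_cst.
move=> u; have := u; rewrite cat_uniq => /and3P[_ _ /IHs[m J E]].
have -> : (fun w : Om => \prod_(j <- k :: s) F j w) =
    (fun w => F k w * \prod_(j <- s) F j w).
  by apply/funext => w; rewrite big_cons.
have [I' E'] := indep_mul u (mF k) m (IF k) J.
split=> //; last by rewrite big_cons E' E.
apply: (@measurable_funM _ (sigmaT _)).
  by apply: sigmaT_mono (mF k) => i iB; rewrite mem_cat iB.
by apply: sigmaT_mono m => i iB; rewrite mem_cat iB orbT.
Qed.

End independence.

(** * Expansions of the permutation averages *)

Section coloring.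
Context (R : realType) (N K : nat).
Implicit Types (c d : {ffun 'I_N -> option 'I_K}) (A B : 'I_N -> option 'I_K -> R).

(* A coloring of the [N] positions by the letters [option 'I_K] is a monomial of
   the expansion of a product over the positions; [None] is the letter of the
   constant function. *)
Definition occ c (l : option 'I_K) : nat := \sum_(i < N) (c i == l).

Definition occv c : {ffun 'I_K -> 'I_N.+1} := [ffun k => inord (occ c (Some k))].

Definition cperm c (s : 'S_N) : {ffun 'I_N -> option 'I_K} := [ffun i => c (s i)].

Definition class_size c : nat := #|[pred d | occv d == occv c]|.

(** By [avg_cperm], the probability that a uniformly random permutation turns [d] into [c]: all
    colorings with the same letter counts are equally likely. *)
Definition wt c d : R := (occv c == occv d)%:R / (class_size c)%:R.

Definition mon A c : R := \prod_(i < N) A i (c i).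

Lemma occ_le c l : (occ c l <= N)%N.
Proof.
rewrite -[leqRHS](card_ord N) -sum1_card; apply: leq_sum => i _.
exact: leq_b1.
Qed.

Lemma occvE c k : occv c k = occ c (Some k) :> nat.
Proof. by rewrite ffunE inordK// ltnS occ_le. Qed.

Lemma occ_None c : (occ c None + \sum_(k < K) occ c (Some k) = N)%N.
Proof.
rewrite /occ exchange_big/= -big_split/= -[RHS](card_ord N) -sum1_card.
apply: eq_bigr => i _; case: (c i) => [k|]; rewrite ?eqxx.
  by rewrite (bigD1 k)//= eqxx big1// => j jk; case: eqP => // -[] /eqP; rewrite eq_sym (negbTE jk).
by rewrite big1.
Qed.

Lemma occ_perm c s l : occ (cperm c s) l = occ c l.
Proof.
rewrite /occ [RHS](reindex_inj (@perm_inj _ s))/=.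
by apply: eq_bigr => i _; rewrite ffunE.
Qed.

Lemma occv_perm c s : occv (cperm c s) = occv c.
Proof. by apply/ffunP => k; rewrite !ffunE occ_perm. Qed.

(** Counting the letters [Some k] suffices, since [None] fills the remaining positions; equal counts
    of all letters make the two words permutations of each other. *)
Lemma occv_eq c d : occv c = occv d -> exists s, c = cperm d s.
Proof.
move=> H.
have Hs k : occ c (Some k) = occ d (Some k) by rewrite -!occvE H.
have Hl l : occ c l = occ d l.
  case: l => [k//|]; apply/eqP; rewrite -(eqn_add2r (\sum_(k < K) occ c (Some k))).
  by rewrite occ_None (eq_bigr (fun k => occ d (Some k)))// occ_None.
have cE (e : {ffun 'I_N -> option 'I_K}) l :
    count_mem l [tuple e i | i < N] = occ e l.
  by rewrite /= count_map -sum1_count big_mkcond/= big_enum/=; apply: eq_bigr => i _ /=; case: eqP.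
have : perm_eq [tuple c i | i < N] [tuple d i | i < N].
  by apply/allP => l _ /=; rewrite !cE Hl.
case/tuple_permP => s Hp; exists s; apply/ffunP => i; rewrite ffunE.
have := congr1 (fun t => nth (c i) t i) Hp.
rewrite -[X in nth _ X](val_tcast (erefl N)) /=.
have nthE (e : 'I_N -> option 'I_K) : nth (c i) [seq e j | j <- enum 'I_N] i = e i.
  by rewrite (nth_map i) ?size_enum_ord// nth_ord_enum.
by rewrite nthE nthE tnth_mktuple.
Qed.

Lemma class_size_gt0 c : (0 < class_size c)%N.
Proof. by apply/card_gt0P; exists c; rewrite inE. Qed.

Lemma cpermM c s t : cperm (cperm c t) s = cperm c (s * t)%g.
Proof. by apply/ffunP => i; rewrite !ffunE permM. Qed.

Lemma cperm_eq c d s : (cperm d s == c) = (d == cperm c s^-1%g).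
Proof.
apply/eqP/eqP => [<-|->].
  by rewrite cpermM mulVg; apply/ffunP => i; rewrite ffunE perm1.
by rewrite cpermM mulgV; apply/ffunP => i; rewrite ffunE perm1.
Qed.

(** The number of permutations carrying [e] to [c] is the same for all [e] in the class of [c], and
    these numbers add up to [N!] because each permutation carries exactly one coloring to [c]. No
    stabiliser has to be counted. *)
Lemma avg_cperm c d : (N`!%:R)^-1 * \sum_(s : 'S_N) (cperm d s == c)%:R = wt c d.
Proof.
pose Phi e : R := \sum_(s : 'S_N) (cperm e s == c)%:R.
have Phi0 e : occv c != occv e -> Phi e = 0.
  move=> H; rewrite /Phi big1// => s _; case: eqP => // E.
  by move: H; rewrite -E occv_perm eqxx.
have PhiE e : occv c = occv e -> Phi e = Phi c.
  move=> /esym/occv_eq[t ->]; rewrite /Phi [RHS](reindex_inj (mulIg t))/=.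
  by apply: eq_bigr => s _; rewrite cpermM.
have : \sum_e Phi e = N`!%:R.
  rewrite /Phi exchange_big/= (eq_bigr (fun=> 1)).
    by rewrite sumr_const; congr (_ *+ _); rewrite -[RHS]card_Sn; apply: eq_card.
  move=> s _; rewrite (bigD1 (cperm c s^-1%g))//= cperm_eq eqxx big1 ?addr0// => e.
  by rewrite cperm_eq => /negbTE ->.
rewrite (bigID (fun e => occv e == occv c))/= [X in _ + X]big1 ?addr0; last first.
  by move=> e; rewrite eq_sym => /Phi0.
rewrite (eq_bigr (fun=> Phi c)); last by move=> e /eqP/esym/PhiE.
rewrite sumr_const -/(class_size c) => HP.
have nz : (class_size c)%:R != 0 :> R by rewrite pnatr_eq0 -lt0n class_size_gt0.
have nf : N`!%:R != 0 :> R by rewrite pnatr_eq0 -lt0n fact_gt0.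
rewrite -/(Phi d) /wt; case: eqVneq => [E|/Phi0->]; last by rewrite mulr0 mul0r.
rewrite PhiE// -HP -[Phi c *+ _]mulr_natr mul1r invfM mulrAC mulVf ?mul1r//.
by apply: contraNneq nf => P0; rewrite -HP P0 mul0rn.
Qed.

Lemma mon_cperm B c (s : 'S_N) : \prod_(i < N) B (s i) (c i) = mon B (cperm c s^-1%g).
Proof.
rewrite /mon [RHS](reindex_inj (@perm_inj _ s))/=; apply: eq_bigr => i _.
by rewrite ffunE permK.
Qed.

Lemma avg_mon B c : (N`!%:R)^-1 * \sum_(s : 'S_N) \prod_(i < N) B (s i) (c i) =
  \sum_d wt c d * mon B d.
Proof.
under eq_bigr do rewrite mon_cperm.
rewrite (eq_bigr (fun s : 'S_N => \sum_d (cperm d s == c)%:R * mon B d)); last first.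
  move=> s _; rewrite (bigD1 (cperm c s^-1%g))//= cperm_eq eqxx mul1r big1 ?addr0// => d.
  by rewrite cperm_eq => /negbTE ->; rewrite mul0r.
rewrite exchange_big mulr_sumr; apply: eq_bigr => d _.
by rewrite -mulr_suml mulrA avg_cperm.
Qed.

Definition upd c (i : 'I_N) (q : option 'I_K) : {ffun 'I_N -> option 'I_K} :=
  [ffun j => if j == i then q else c j].

Definition mon_del (s : option 'I_K -> R) c (i : 'I_N) : R :=
  \prod_(j < N | j != i) s (c j).

Lemma expand_D (s : option 'I_K -> R) A B :
  (N`!%:R)^-1 * \sum_(t : 'S_N) \prod_(i < N) \sum_l s l * A i l * B (t i) l =
  \sum_c \sum_d mon (fun=> s) c * wt c d * (mon A c * mon B d).
Proof.
under eq_bigr do rewrite bigA_distr_bigA/=.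
rewrite exchange_big mulr_sumr; apply: eq_bigr => c _.
under eq_bigr => t _.
  under eq_bigr do rewrite -mulrA.
  rewrite !big_split/= mulrA; over.
rewrite -mulr_sumr mulrCA avg_mon mulr_sumr; apply: eq_bigr => d _.
by rewrite /mon; ring.
Qed.

(** The factor at position [i] has its own pair of letters [(p, q)]: the [X] side of the resulting
    monomial is read off [c], the [Y] side off [upd c i q], and only the latter is averaged over
    permutations. *)
Lemma expand_E (s : option 'I_K -> R) (k : option 'I_K -> option 'I_K -> R) A B :
  \sum_(i < N) (N`!%:R)^-1 * \sum_(t : 'S_N) (\sum_p \sum_q k p q * A i p * B (t i) q) *
    \prod_(j < N | j != i) \sum_l s l * A j l * B (t j) l =
  \sum_c \sum_d (\sum_(i < N) mon_del s c i * \sum_q k (c i) q * wt (upd c i q) d) *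
    (mon A c * mon B d).
Proof.
have H i : (N`!%:R)^-1 * (\sum_(t : 'S_N) (\sum_p \sum_q k p q * A i p * B (t i) q) *
    \prod_(j < N | j != i) \sum_l s l * A j l * B (t j) l) =
  \sum_c \sum_d mon_del s c i * (\sum_q k (c i) q * wt (upd c i q) d) * (mon A c * mon B d).
  have E (t : 'S_N) : (\sum_p \sum_q k p q * A i p * B (t i) q) *
      \prod_(j < N | j != i) (\sum_l s l * A j l * B (t j) l) =
    \sum_c mon A c * mon_del s c i * \sum_q k (c i) q * \prod_j B (t j) (upd c i q j).
    (* With a special factor at [i] that depends on the letter [l], the whole expression is one
       product of sums and distributes over colorings. *)
    pose G j l := if j == i then A i l * \sum_q k l q * B (t i) q else s l * A j l * B (t j) l.
    transitivity (\prod_j \sum_l G j l).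
      rewrite [RHS](bigD1 i)//= /G eqxx; congr (_ * _).
        by apply: eq_bigr => p _; rewrite mulr_sumr; apply: eq_bigr => q _; ring.
      by apply: eq_bigr => j /negbTE ->.
    rewrite bigA_distr_bigA/=; apply: eq_bigr => c _.
    rewrite (bigD1 i)//= {1}/G eqxx.
    rewrite (eq_bigr (fun j => s (c j) * A j (c j) * B (t j) (c j))); last first.
      by move=> j /negbTE ji; rewrite /G ji.
    rewrite !big_split/= /mon [X in _ = X * _ * _](bigD1 i)//= -/(mon_del s c i).
    set a := A i (c i); set pa := \prod_(j | j != i) A j (c j).
    set pb := \prod_(j | j != i) B (t j) (c j).
    have -> : \sum_q k (c i) q * \prod_j B (t j) (upd c i q j) =
        (\sum_q k (c i) q * B (t i) q) * pb.
      rewrite mulr_suml; apply: eq_bigr => q _; rewrite (bigD1 i)//= ffunE eqxx mulrA.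
      by congr (_ * _); apply: eq_bigr => j /negbTE ji; rewrite ffunE ji.
    by ring.
  under eq_bigr do rewrite E.
  rewrite exchange_big mulr_sumr; apply: eq_bigr => c _.
  rewrite -mulr_sumr exchange_big/= mulrCA.
  under [X in _ * (_ * X)]eq_bigr => q _ do rewrite -mulr_sumr.
  rewrite [X in _ * X]mulr_sumr.
  under [X in _ * X]eq_bigr => q _ do rewrite mulrCA avg_mon mulr_sumr.
  rewrite exchange_big mulr_sumr; apply: eq_bigr => d _.
  rewrite mulr_sumr mulr_sumr mulr_suml; apply: eq_bigr => q _; ring.
rewrite (eq_bigr _ (fun i _ => H i)) exchange_big; apply: eq_bigr => c _.
by rewrite exchange_big; apply: eq_bigr => d _; rewrite mulr_suml.
Qed.

End coloring.

Arguments wt {R N K} c d.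

(** * Coefficient bounds uniform in the sample size and in the number of letters *)

Section finite_sums.
Variable R : realType.

(** Lagrange's identity: the two sides differ by half the double sum of [(x i - x j) ^+ 2]. The
    number of terms is kept as a real sum, so the predicate [P] need not be counted. *)
Lemma sum_sqr_le (I : finType) (P : pred I) (x : I -> R) :
  (\sum_(i | P i) x i) ^+ 2 <= (\sum_(i | P i) (1 : R)) * \sum_(i | P i) x i ^+ 2.
Proof.
set n := \sum_(i | P i) (1 : R); set S2 := \sum_(i | P i) x i ^+ 2.
have : 0 <= \sum_(i | P i) \sum_(j | P j) (x i - x j) ^+ 2.
  by apply: sumr_ge0 => i _; apply: sumr_ge0 => j _; exact: sqr_ge0.
have -> : \sum_(i | P i) \sum_(j | P j) (x i - x j) ^+ 2 =
    2 * (n * S2 - (\sum_(i | P i) x i) ^+ 2).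
  set S1 := \sum_(i | P i) x i.
  have E i : \sum_(j | P j) (x i - x j) ^+ 2 = x i ^+ 2 * n - 2 * S1 * x i + S2.
    rewrite (eq_bigr (fun j => x i ^+ 2 * 1 - 2 * x i * x j + x j ^+ 2)).
      by rewrite big_split sumrB/= -!mulr_sumr -/n -/S1 -/S2; ring.
    by move=> j _; ring.
  rewrite (eq_bigr (fun i => n * x i ^+ 2 - 2 * S1 * x i + S2 * 1)).
    by rewrite big_split sumrB/= -!mulr_sumr -/n -/S1 -/S2; ring.
  by move=> i _; rewrite E; ring.
by rewrite pmulr_rge0// subr_ge0.
Qed.

Lemma geo_sum_le (x : R) n : 0 <= x < 1 -> \sum_(j < n) x ^+ j <= (1 - x)^-1.
Proof.
move=> /andP[x0 x1]; rewrite -[leRHS]mul1r ler_pdivlMr ?subr_gt0// mulrC.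
have := subrX1 x n; have := exprn_ge0 n x0; lra.
Qed.

Lemma geo_deriv_sum_le (x : R) n : 0 <= x < 1 ->
  \sum_(j < n) j%:R * x ^+ j.-1 <= ((1 - x)^-1) ^+ 2.
Proof.
move=> /andP[x0 x1].
have x1' : 0 < 1 - x by rewrite subr_gt0.
rewrite exprVn -[leRHS]mul1r ler_pdivlMr ?exprn_gt0// mulrC.
case: n => [|n]; first by rewrite big_ord0 mulr0.
(* Closed form of the differentiated geometric sum; its two terms other than [1] add up to at most
   [0]. *)
have -> : (1 - x) ^+ 2 * (\sum_(j < n.+1) j%:R * x ^+ j.-1) =
    1 - n.+1%:R * x ^+ n + n%:R * x ^+ n.+1.
  elim: n => [|n IHn]; first by rewrite big_ord1 mul0r mulr0 expr0; ring.
  rewrite big_ord_recr mulrDr IHn/= -!natr1 !exprS; ring.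
have xn : 0 <= x ^+ n by exact: exprn_ge0.
have : n%:R * x ^+ n.+1 <= n.+1%:R * x ^+ n.
  rewrite exprS mulrA ler_pM ?mulr_ge0//.
  by rewrite -natr1 ler_wpDr// -[leRHS]mulr1 ler_wpM2l// ltW.
lra.
Qed.

Lemma sum_option (I : finType) (F : option I -> R) :
  \sum_l F l = F None + \sum_k F (Some k).
Proof.
rewrite (bigD1 None)//=; congr (_ + _).
rewrite (reindex_omap Some id) => [|[]//]; apply: eq_bigl => k.
by rewrite eqxx.
Qed.

End finite_sums.

Section coefficient_bounds.
Context (R : realType) (N K : nat).
Implicit Types (c d : {ffun 'I_N -> option 'I_K}).

(** Within a class the weights [1 / class_size c] add up to [1]. Equality fails only because some
    vectors [m] are not the letter count of any coloring, their entries adding up to more than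
    [N]. *)
Lemma class_sum_le (G : {ffun 'I_K -> 'I_N.+1} -> R) : (forall m, 0 <= G m) ->
  \sum_c G (occv c) / (class_size c)%:R <= \sum_m G m.
Proof.
move=> G0; rewrite (partition_big (@occv N K) predT)//=; apply: ler_sum => m _.
have [/existsP[c0 /eqP cm]|/existsPn H] := boolP [exists c, occv c == m]; last first.
  by rewrite big1// => c /eqP cm; have := H c; rewrite cm eqxx.
rewrite (eq_bigr (fun=> G m / (class_size c0)%:R)); last first.
  move=> c /eqP cc; rewrite cc; congr (_ / _%:R); apply: eq_card => e.
  by rewrite !inE cc cm.
have -> : class_size c0 = #|[pred c | occv c == m]|.
  by apply: eq_card => e; rewrite !inE cm.
rewrite sumr_const -[leLHS]mulr_natr mulfVK// pnatr_eq0 -lt0n; apply/card_gt0P.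
by exists c0; rewrite inE cm.
Qed.

Lemma prod_sum_occ (g : 'I_K -> nat -> R) :
  \sum_(m : {ffun 'I_K -> 'I_N.+1}) \prod_k g k (m k) = \prod_k \sum_(j < N.+1) g k j.
Proof. by rewrite bigA_distr_bigA. Qed.

Lemma wt_sqr c : \sum_d (wt c d : R) ^+ 2 = (class_size c)%:R^-1.
Proof.
rewrite /wt (bigID (fun d => occv c == occv d))/= [X in _ + X]big1 ?addr0; last first.
  by move=> d /negbTE ->; rewrite mul0r expr0n.
rewrite (eq_bigr (fun=> (class_size c)%:R ^-1 ^+ 2)) => [|d /eqP ->]; last first.
  by rewrite eqxx mul1r.
rewrite sumr_const (_ : #|_| = class_size c); last first.
  by apply: eq_card => d; rewrite !inE eq_sym.
rewrite -[LHS]mulr_natr expr2 -mulrA mulVf ?mulr1// pnatr_eq0 -lt0n.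
exact: class_size_gt0.
Qed.

Lemma occ_upd c i q l :
  occ (upd c i q) l = (\sum_(j < N | j != i) (c j == l) + (q == l))%N.
Proof.
rewrite /occ (bigD1 i)//= ffunE eqxx addnC; congr (_ + _)%N.
by apply: eq_bigr => j /negbTE ji; rewrite ffunE ji.
Qed.

Lemma occv_occ c d l : occv c = occv d -> occ c l = occ d l.
Proof. by move=> /occv_eq[s ->]; rewrite occ_perm. Qed.

(** This makes the cross terms vanish in [coeff_bound]: for a fixed target [d], at most one
    replacement letter at [i] leads into the class of [d]. *)
Lemma occv_upd_inj c i p q : occv (upd c i p) = occv (upd c i q) -> p = q.
Proof.
move=> /(occv_occ p); rewrite !occ_upd eqxx => /eqP.
by rewrite eqn_add2l; case: (eqVneq q p).
Qed.

Lemma upd_involutive i :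
  involutive (fun x : {ffun 'I_N -> option 'I_K} * option 'I_K => (upd x.1 i x.2, x.1 i)).
Proof.
move=> [c q] /=; congr (_, _); last by rewrite ffunE eqxx.
by apply/ffunP => j; rewrite !ffunE; case: eqP => [->|].
Qed.

Lemma mon_del_upd (s : option 'I_K -> R) c i q : mon_del s (upd c i q) i = mon_del s c i.
Proof. by apply: eq_bigr => j /negbTE ji; rewrite ffunE ji. Qed.

(* Cauchy-Schwarz over the positions [i] whose letter lies in [S], then the
   exchange of [(c, q)] with [(upd c i q, c i)]. *)
Lemma coeff_bound (S : pred (option 'I_K)) (s : option 'I_K -> R)
    (k : option 'I_K -> option 'I_K -> R) :
  (forall p q, ~~ S p -> k p q = 0) ->
  \sum_(c : {ffun 'I_N -> option 'I_K}) \sum_d (\sum_(i < N) mon_del s c i * \sum_q k (c i) q * wt (upd c i q) d) ^+ 2 <=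
  \sum_(c : {ffun 'I_N -> option 'I_K}) (\sum_(i < N) (S (c i) : nat)).+1%:R / (class_size c)%:R *
     \sum_(i < N) (\sum_p k p (c i) ^+ 2) * mon_del s c i ^+ 2.
Proof.
move=> kS; pose nS (c : {ffun 'I_N -> option 'I_K}) := (\sum_(i < N) (S (c i) : nat))%N.
have cross (c : {ffun 'I_N -> option 'I_K}) i d : (\sum_q k (c i) q * wt (upd c i q) d) ^+ 2 =
    \sum_q k (c i) q ^+ 2 * wt (upd c i q) d ^+ 2.
  rewrite expr2 mulr_suml; apply: eq_bigr => q _; rewrite mulr_sumr (bigD1 q)//=.
  rewrite -exprMn -expr2 big1 ?addr0// => q' qq'.
  rewrite /wt.
  case: (eqVneq (occv (upd c i q)) (occv d)) => [E|_]; last by rewrite !(mul0r, mulr0).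
  case: eqP => [E'|_]; last by rewrite !(mul0r, mulr0).
  by move: qq'; rewrite (occv_upd_inj (etrans E' (esym E))) eqxx.
have step1 (c d : {ffun 'I_N -> option 'I_K}) : (\sum_(i < N) mon_del s c i * \sum_q k (c i) q * wt (upd c i q) d) ^+ 2 <=
    (nS c)%:R * \sum_(i < N) mon_del s c i ^+ 2 * \sum_q k (c i) q ^+ 2 * wt (upd c i q) d ^+ 2.
  rewrite (bigID (fun i => S (c i)))/= [X in (_ + X) ^+ 2]big1 ?addr0; last first.
    move=> i nSi; rewrite big1 ?mulr0// => q _; by rewrite kS ?mul0r.
  apply: le_trans (sum_sqr_le _ _) _.
  have -> : \sum_(i < N | S (c i)) (1 : R) = (nS c)%:R.
    by rewrite /nS natr_sum big_mkcond; apply: eq_bigr => i _; case: ifP.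
  rewrite ler_wpM2l// [leRHS](bigID (fun i => S (c i)))/= -[leLHS]addr0 lerD//.
    by apply: ler_sum => i _; rewrite exprMn cross.
  apply: sumr_ge0 => i _; rewrite mulr_ge0 ?sqr_ge0//; apply: sumr_ge0 => q _.
  by rewrite mulr_ge0 ?sqr_ge0.
apply: (@le_trans _ _ (\sum_(i < N) \sum_(c : {ffun 'I_N -> option 'I_K}) \sum_q
    (nS c)%:R * (mon_del s c i ^+ 2 * (k (c i) q ^+ 2 / (class_size (upd c i q))%:R)))).
  rewrite [leRHS]exchange_big/=; apply: ler_sum => c _.
  apply: le_trans (ler_sum _ (fun d _ => step1 c d)) _.
  rewrite -mulr_sumr exchange_big/= mulr_sumr; apply: ler_sum => i _.
  rewrite -mulr_sumr exchange_big/= -!mulr_sumr ler_wpM2l// ler_wpM2l ?sqr_ge0//.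
  by apply: ler_sum => q _; rewrite -mulr_sumr wt_sqr.
rewrite [leRHS](eq_bigr (fun c => \sum_(i < N) \sum_p
   (nS c).+1%:R * (mon_del s c i ^+ 2 * (k p (c i) ^+ 2 / (class_size c)%:R)))); last first.
  move=> c _; rewrite mulr_sumr; apply: eq_bigr => i _; rewrite mulr_suml mulr_sumr.
  by apply: eq_bigr => p _; rewrite -/(nS c); ring.
rewrite [leRHS]exchange_big/=; apply: ler_sum => i _.
rewrite pair_big/= (reindex_inj (inv_inj (upd_involutive i)))/=.
rewrite pair_big/=; apply: ler_sum => -[c q] _ /=.
rewrite mon_del_upd ffunE eqxx.
have -> : upd (upd c i q) i (c i) = c by have := congr1 fst (upd_involutive i (c, q)).
rewrite ler_wpM2r//.
  by rewrite mulr_ge0 ?sqr_ge0// mulr_ge0 ?sqr_ge0// invr_ge0.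
(* The successor in the bound pays for the exchange, which may change by one the number of positions
   whose letter lies in [S]. *)
rewrite ler_nat /nS (bigD1 i)//= [in leqRHS](bigD1 i)//= ffunE eqxx.
rewrite (eq_bigr (fun j => (S (c j) : nat))); last by move=> j /negbTE ji; rewrite ffunE ji.
by case: (S q); case: (S (c i)); rewrite /= ?add1n ?add0n// ltnW.
Qed.

Lemma mon_occ (s : option 'I_K -> R) c : s None = 1 ->
  mon (fun=> s) c = \prod_k s (Some k) ^+ occ c (Some k).
Proof.
move=> s0; rewrite /mon (eq_bigr (fun i => \prod_k s (Some k) ^+ (c i == Some k))).
  rewrite exchange_big/=; apply: eq_bigr => k _; rewrite /occ.
  by rewrite (big_morph (fun n : nat => s (Some k) ^+ n) (exprD _) (expr0 _)).
move=> i _; case: (c i) => [l|].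
  rewrite (bigD1 l)//= eqxx expr1 big1 ?mulr1// => j jl.
  by case: eqP => // -[] /eqP; rewrite eq_sym (negbTE jl).
by rewrite s0 big1.
Qed.

Lemma mon_del_occ (s : option 'I_K -> R) c i l : s None = 1 -> c i = Some l ->
  mon_del s c i = \prod_k s (Some k) ^+ (occ c (Some k) - (k == l)).
Proof.
move=> s0 ci; have := @mon_occ s (upd c i None) s0.
rewrite /mon (bigD1 i)//= ffunE eqxx s0 mul1r -/(mon_del s (upd c i None) i) mon_del_upd => ->.
apply: eq_bigr => k _; congr (_ ^+ _).
rewrite occ_upd /= addn0 /occ [in RHS](bigD1 i)//= ci.
rewrite (_ : (Some l == Some k) = (k == l)) ?addKn//.
by apply/eqP/eqP => [[]|->].
Qed.

Lemma mon_del_None (s : option 'I_K -> R) c i : s None = 1 -> c i = None ->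
  mon_del s c i = \prod_k s (Some k) ^+ occ c (Some k).
Proof. by move=> s0 ci; rewrite -mon_occ// /mon (bigD1 i)//= ci s0 mul1r. Qed.

End coefficient_bounds.

Section occupation_bounds.
Context (R : realType) (tau T : R).
Hypothesis tau01 : 0 <= tau < 1.

(** Being above [1], [lam] lets [lam ^+ n] dominate the linear weight [n.+1%:R] ([lam_pow], which
    also uses [lam <= 2]); and [lam * tau < 1] keeps the geometric series in [lam * t k]
    convergent. *)
Let lam : R := 2 / (1 + tau).

Let lam_gt1 : 1 < lam.
Proof. by move/andP: tau01 => [? ?]; rewrite /lam ltr_pdivlMr; lra. Qed.

Let lam_tau : lam * tau < 1.
Proof. by move/andP: tau01 => [? ?]; rewrite /lam mulrAC ltr_pdivrMr; lra. Qed.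

(** Free of [N] and [K]. The first factor comes from [lam_pow], the middle one bounds the
    differentiated series of one distinguished letter, the exponential bounds the product of all
    geometric sums. *)
Definition occ_const : R := let lam := 2 / (1 + tau) in
  (lam - 1)^-1 * (1 + lam * ((1 - lam * tau)^-1) ^+ 2) * expR (lam * T / (1 - lam * tau)).

Context (N K : nat) (t : 'I_K -> R).
Hypothesis t_ge0 : forall k, 0 <= t k.
Hypothesis t_le : forall k, t k <= tau.
Hypothesis t_sum : \sum_k t k <= T.

Let lam_ge0 : 0 <= lam. Proof. by rewrite ltW// (lt_trans ltr01). Qed.

Let ltau : 0 < 1 - lam * tau. Proof. by rewrite subr_gt0. Qed.

Let lt01 k : 0 <= lam * t k < 1.
Proof.
rewrite mulr_ge0//=; apply: le_lt_trans lam_tau.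
by rewrite ler_wpM2l.
Qed.

Let lam_pow n : n.+1%:R <= (lam - 1)^-1 * lam ^+ n.
Proof.
rewrite mulrC ler_pdivlMr ?subr_gt0//.
have l2 : lam <= 2 by move/andP: tau01 => [? ?]; rewrite /lam ler_pdivrMr; lra.
elim: n => [|n IHn]; first by rewrite expr0; have := l2; lra.
rewrite exprS; have l1 := lam_gt1; have := exprn_ege1 n (ltW l1).
rewrite -[n.+2%:R]natr1 mulrDl mul1r => ln; nra.
Qed.

(** Each factor is at most [1 / (1 - x) = 1 + x / (1 - x) <= expR (x / (1 - x))] with
    [x = lam * t k], so the bound on the sum of [t] controls the product over any number of
    letters. *)
Lemma prod_geo_le : \prod_k \sum_(j < N.+1) (lam * t k) ^+ j <= expR (lam * T / (1 - lam * tau)).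
Proof.
apply: (@le_trans _ _ (\prod_k expR (lam * t k / (1 - lam * tau)))).
  apply: ler_prod => k _; apply/andP; split.
    by apply: sumr_ge0 => j _; apply: exprn_ge0; case/andP: (lt01 k).
  apply: le_trans (geo_sum_le _ (lt01 k)) _.
  have /andP[l0 l1] := lt01 k.
  apply: le_trans (expR_ge1Dx _).
  apply: (@le_trans _ _ (1 + lam * t k / (1 - lam * t k))).
    rewrite le_eqVlt; apply/orP; left; apply/eqP; field; apply/eqP; lra.
  rewrite lerD2l ler_wpM2l//.
  by rewrite lef_pV2 ?posrE ?subr_gt0// lerD2l lerN2 ler_wpM2l.
rewrite -expR_sum ler_expR -mulr_suml -mulr_sumr ler_wpM2r ?invr_ge0 ?(ltW ltau)//.
by rewrite ler_wpM2l.
Qed.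

Lemma occ_bound1 : \sum_(m : {ffun 'I_K -> 'I_N.+1})
  (\sum_k (m k : nat)).+1%:R * \prod_k t k ^+ m k <= occ_const.
Proof.
apply: (@le_trans _ _ ((lam - 1)^-1 *
  \sum_(m : {ffun 'I_K -> 'I_N.+1}) \prod_k (lam * t k) ^+ m k)).
  rewrite mulr_sumr; apply: ler_sum => m _.
  rewrite [leRHS](_ : _ = (lam - 1)^-1 * \prod_k (lam ^+ m k * t k ^+ m k)); last first.
    by congr (_ * _); apply: eq_bigr => k _; rewrite exprMn.
  rewrite big_split/= mulrA ler_wpM2r ?prodr_ge0// => [k _|]; first exact: exprn_ge0.
  apply: le_trans (lam_pow _) _.
  by rewrite (big_morph (fun n : nat => lam ^+ n) (exprD _) (expr0 _)).
rewrite (prod_sum_occ _ (fun k j => (lam * t k) ^+ j)) /occ_const -/lam -mulrA.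
rewrite ler_wpM2l ?invr_ge0 ?subr_ge0 ?(ltW lam_gt1)//.
apply: le_trans prod_geo_le _; rewrite -[leLHS]mul1r ler_wpM2r ?expR_ge0//.
by rewrite lerDl mulr_ge0// exprn_ge0// invr_ge0 ltW.
Qed.

(** Erasing one of the [m k0] letters [k0] lowers the power by one and gives the factor [m k0], a
    differentiated geometric series; the other letters contribute as in [occ_bound1]. *)
Lemma occ_bound2 k0 : \sum_(m : {ffun 'I_K -> 'I_N.+1})
  (\sum_k (m k : nat)).+1%:R * ((m k0)%:R * \prod_k t k ^+ (m k - (k == k0))) <= occ_const.
Proof.
pose g k (j : nat) := if k == k0 then lam * (j%:R * (lam * t k) ^+ j.-1) else (lam * t k) ^+ j.
apply: (@le_trans _ _ ((lam - 1)^-1 *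
  \sum_(m : {ffun 'I_K -> 'I_N.+1}) \prod_k g k (m k))).
  rewrite mulr_sumr; apply: ler_sum => m _.
  apply: (@le_trans _ _ ((lam - 1)^-1 * \prod_k lam ^+ m k *
      ((m k0)%:R * \prod_k t k ^+ (m k - (k == k0))))).
    rewrite ler_wpM2r ?mulr_ge0 ?prodr_ge0// => [k _|]; first exact: exprn_ge0.
    apply: le_trans (lam_pow _) _.
    by rewrite (big_morph (fun n : nat => lam ^+ n) (exprD _) (expr0 _)).
  rewrite -mulrA ler_wpM2l ?invr_ge0 ?subr_ge0 ?(ltW lam_gt1)//.
  rewrite mulrCA -big_split/= (bigD1 k0)//= [leRHS](bigD1 k0)//= /g eqxx subn1.
  rewrite mulrA [leRHS](_ : _ = (m k0)%:R * (lam ^+ m k0 * t k0 ^+ (m k0).-1) *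
    \prod_(i < K | i != k0) (lam * t i) ^+ m i).
    rewrite ler_wpM2l ?mulr_ge0 ?exprn_ge0// ler_prod// => k /negbTE kk0.
    have -> : lam ^+ m k * t k ^+ (m k - (k == k0)) = (lam * t k) ^+ m k.
      by rewrite kk0 subn0 [RHS]exprMn.
    by apply/andP; split => //; apply: exprn_ge0; exact: mulr_ge0.
  rewrite (eq_bigr (fun i => (lam * t i) ^+ m i)) => [|i /negbTE->//].
  congr (_ * _); case: (nat_of_ord (m k0)) => [|j]; first by rewrite !(mul0r, mulr0).
  by rewrite /= exprMn exprS; ring.
rewrite prod_sum_occ /occ_const -/lam -mulrA.
rewrite ler_wpM2l ?invr_ge0 ?subr_ge0 ?(ltW lam_gt1)//.
rewrite (bigD1 k0)//=; apply: ler_pM.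
- apply: sumr_ge0 => j _; rewrite /g eqxx; rewrite mulr_ge0// mulr_ge0// exprn_ge0//.
  by case/andP: (lt01 k0).
- apply: prodr_ge0 => k _; apply: sumr_ge0 => j _; rewrite /g; case: ifP => _.
    by rewrite mulr_ge0// mulr_ge0// exprn_ge0//; case/andP: (lt01 k).
  by rewrite exprn_ge0//; case/andP: (lt01 k).
- under eq_bigr do rewrite /g eqxx.
  rewrite -mulr_sumr -[leLHS]add0r lerD// ler_wpM2l//.
  apply: le_trans (geo_deriv_sum_le _ (lt01 k0)) _.
  rewrite ler_pXn2r ?nnegrE ?invr_ge0 ?(ltW ltau)//; last first.
    by rewrite subr_ge0; case/andP: (lt01 k0) => _ /ltW.
  rewrite lef_pV2 ?posrE ?subr_gt0//; last by case/andP: (lt01 k0).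
  by rewrite lerD2l lerN2 ler_wpM2l.
- apply: le_trans prod_geo_le; rewrite [leRHS](bigD1 k0)//= -[leLHS]mul1r.
  have nn k : 0 <= \sum_(j < N.+1) (lam * t k) ^+ j.
    by apply: sumr_ge0 => j _; apply: exprn_ge0; case/andP: (lt01 k).
  rewrite ler_pM//.
  + by apply: prodr_ge0 => k /negbTE kk0; rewrite /g kk0; exact: nn.
  + rewrite big_ord_recl expr0 lerDl; apply: sumr_ge0 => j _; apply: exprn_ge0.
    by case/andP: (lt01 k0).
  + apply: ler_prod => k /negbTE kk0; rewrite /g kk0 lexx andbT.
    exact: nn.
Qed.

End occupation_bounds.

Section coefficient_bounds_const.
Context (R : realType) (tau T : R).
Hypothesis tau01 : 0 <= tau < 1.
Context (N K : nat) (s : option 'I_K -> R).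
Hypothesis s_None : s None = 1.
Hypothesis s_le : forall k, s (Some k) ^+ 2 <= tau.
Hypothesis s_sum : \sum_k s (Some k) ^+ 2 <= T.
Local Notation col := {ffun 'I_N -> option 'I_K}.
Local Notation BC := (occ_const tau T).

Lemma sum_letters (w : option 'I_K -> R) (c : col) :
  \sum_(i < N) w (c i) * mon_del s c i ^+ 2 =
  w None * (occ c None)%:R * \prod_k (s (Some k) ^+ 2) ^+ occv c k +
  \sum_l w (Some l) * ((occv c l)%:R * \prod_k (s (Some k) ^+ 2) ^+ (occv c k - (k == l))).
Proof.
have cardE l : \sum_(i < N | c i == l) (1 : R) = (occ c l)%:R.
  by rewrite /occ natr_sum big_mkcond; apply: eq_bigr => i _; case: eqP.
rewrite (partition_big c predT)//= (bigD1 None)//=; congr (_ + _).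
  rewrite (eq_bigr (fun i => w None * \prod_k (s (Some k) ^+ 2) ^+ occv c k * 1)).
    by rewrite -mulr_sumr cardE; ring.
  move=> i /eqP ci; rewrite ci mulr1 mon_del_None// -prodrXl; congr (_ * _).
  by apply: eq_bigr => k _; rewrite occvE -!exprM mulnC.
rewrite (reindex_omap Some id) => [|[]//]; apply: eq_big => [l|l _]; first by rewrite eqxx.
rewrite (eq_bigr (fun i => w (Some l) * \prod_k (s (Some k) ^+ 2) ^+ (occv c k - (k == l)) * 1)).
  by rewrite -mulr_sumr cardE occvE; ring.
move=> i /eqP ci; rewrite ci mulr1 (mon_del_occ s_None ci) -prodrXl; congr (_ * _).
by apply: eq_bigr => k _; rewrite occvE -!exprM mulnC.
Qed.

(** [X] bounds the number of positions with a letter in [S], in units of one plus the degree: [1]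
    works if [S] excludes [None], and [N.+1] works in any case. The factor [N] falls only on
    coefficients whose second letter is [None], since the number of positions lettered [None] is not
    compensated by powers of [s]. *)
Lemma coeff_bound_const (S : pred (option 'I_K)) (k : option 'I_K -> option 'I_K -> R) (X : nat) :
  (forall p q, ~~ S p -> k p q = 0) ->
  (forall c : col, (\sum_(i < N) (S (c i) : nat) < X * (\sum_k occ c (Some k)).+1)%N) ->
  \sum_(c : col) \sum_d
    (\sum_(i < N) mon_del s c i * \sum_q k (c i) q * wt (upd c i q) d) ^+ 2 <=
  X%:R * BC * (N%:R * \sum_p k p None ^+ 2 + \sum_l \sum_p k p (Some l) ^+ 2).
Proof.
move=> kS HX; apply: le_trans (coeff_bound N s kS) _.
pose w q := \sum_p k p q ^+ 2.
have w0 q : 0 <= w q by apply: sumr_ge0 => p _; exact: sqr_ge0.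
pose t l := s (Some l) ^+ 2.
have t0 l : 0 <= t l by exact: sqr_ge0.
pose G (m : {ffun 'I_K -> 'I_N.+1}) := X%:R * (\sum_k (m k : nat)).+1%:R *
   (w None * N%:R * \prod_k t k ^+ m k +
    \sum_l w (Some l) * ((m l)%:R * \prod_k t k ^+ (m k - (k == l)))).
have pr0 (f : 'I_K -> nat) : 0 <= \prod_k t k ^+ f k by apply: prodr_ge0 => ? _; exact: exprn_ge0.
have sum0 (m : {ffun 'I_K -> 'I_N.+1}) :
    0 <= \sum_l w (Some l) * ((m l)%:R * \prod_k t k ^+ (m k - (k == l))).
  by apply: sumr_ge0 => l _; rewrite mulr_ge0// mulr_ge0.
apply: (@le_trans _ _ (\sum_(c : col) G (occv c) / (class_size c)%:R)).
  apply: ler_sum => c _; rewrite mulrAC ler_wpM2r ?invr_ge0//.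
  rewrite (sum_letters w c) /G; apply: ler_pM => //.
  - by rewrite addr_ge0// mulr_ge0// mulr_ge0.
  - rewrite -natrM ler_nat; have := HX c.
    by under [X in _ -> (_ <= _ * X.+1)%N]eq_bigr do rewrite occvE.
  - by rewrite lerD2r ler_wpM2r// ler_wpM2l// ler_nat occ_le.
apply: le_trans (class_sum_le _) _ => [m|].
  by rewrite /G mulr_ge0// addr_ge0// mulr_ge0// mulr_ge0.
rewrite /G; under eq_bigr => m _ do rewrite mulrDr.
rewrite big_split/= mulrDr lerD//.
  rewrite [leRHS](_ : _ = X%:R * (w None * N%:R) * BC); last by rewrite /w; ring.
  rewrite (eq_bigr (fun m : {ffun 'I_K -> 'I_N.+1} =>
    X%:R * (w None * N%:R) * ((\sum_k (m k : nat)).+1%:R * \prod_k t k ^+ m k))) => [|m _]; last by ring.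
  rewrite -mulr_sumr ler_wpM2l ?mulr_ge0//.
  exact: occ_bound1.
rewrite (eq_bigr (fun m : {ffun 'I_K -> 'I_N.+1} => \sum_l X%:R * w (Some l) *
    ((\sum_k (m k : nat)).+1%:R * ((m l)%:R * \prod_k t k ^+ (m k - (k == l)))))) => [|m _]; last first.
  by rewrite mulr_sumr; apply: eq_bigr => l _; ring.
rewrite exchange_big/= mulr_sumr; apply: ler_sum => l _.
rewrite -mulr_sumr [leRHS](_ : _ = X%:R * w (Some l) * BC); last by rewrite /w; ring.
rewrite ler_wpM2l ?mulr_ge0//; exact: occ_bound2.
Qed.

Lemma coeff_D_bound (Pm : pred {ffun 'I_K -> 'I_N.+1}) :
  \sum_(c : col) \sum_(d : col)
    ((Pm (occv c))%:R * (mon (fun=> s) c * wt c d)) ^+ 2 <=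
  \sum_(m | Pm m) \prod_k (s (Some k) ^+ 2) ^+ m k.
Proof.
rewrite [leRHS]big_mkcond/=.
apply: le_trans (class_sum_le _) => [|m]; last first.
  by case: ifP => // _; apply: prodr_ge0 => k _; apply: exprn_ge0; exact: sqr_ge0.
apply: ler_sum => c _; under eq_bigr do rewrite mulrA exprMn.
rewrite -mulr_sumr wt_sqr ler_wpM2r ?invr_ge0//.
case: (Pm _); last by rewrite mul0r expr0n.
rewrite mul1r mon_occ// -prodrXl le_eqVlt; apply/orP; left; apply/eqP.
by apply: eq_bigr => k _; rewrite occvE -!exprM mulnC.
Qed.

End coefficient_bounds_const.

(** * Elementary symmetric sums and Hermite polynomials *)

Section elementary_sums.
Context (R : realType) (K : nat).
Implicit Types (n : 'I_K -> nat).

Definition ev (r : 'I_K -> R) (l : option 'I_K) : R := if l is Some k then r k else 1.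

Definition in_class N n (c : {ffun 'I_N -> option 'I_K}) : bool :=
  [forall k, occ c (Some k) == n k].

(* The coefficient of [\prod_k x_k ^ n_k] in [\prod_i (1 + \sum_k a_ik x_k)]. *)
Definition esum N (a : 'I_N -> 'I_K -> R) n : R :=
  \sum_(c : {ffun 'I_N -> option 'I_K} | in_class n c) mon (fun i => ev (a i)) c.

Definition decr n (p : 'I_K) : 'I_K -> nat := fun k => (n k - (k == p))%N.

(** Zeroing a row instead of deleting it keeps the index type ['I_N]; a coloring with a letter
    [Some _] at [i] then contributes nothing. *)
Definition zrow N (a : 'I_N -> 'I_K -> R) (i : 'I_N) : 'I_N -> 'I_K -> R :=
  fun j => if j == i then (fun=> 0) else a j.

Lemma in_classP N n (c : {ffun 'I_N -> option 'I_K}) :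
  reflect (forall k, occ c (Some k) = n k) (in_class n c).
Proof. by apply: (iffP forallP) => H k; apply/eqP; rewrite H. Qed.

Lemma esum_None N (a : 'I_N -> 'I_K -> R) n i :
  \sum_(c | in_class n c && (c i == None)) mon (fun i => ev (a i)) c = esum (zrow a i) n.
Proof.
rewrite /esum [RHS](bigID (fun c : {ffun _ -> _} => c i == None))/=.
rewrite [X in _ = _ + X]big1 ?addr0; last first.
  move=> c /andP[_]; case E : (c i) => [k|]//= _.
  by rewrite /mon (bigD1 i)//= E /zrow eqxx mul0r.
apply: eq_bigr => c /andP[_ /eqP ci]; apply: eq_bigr => j _.
by rewrite /zrow; case: eqP => [->|//]; rewrite ci.
Qed.

Lemma esum_Some N (a : 'I_N -> 'I_K -> R) n i q :
  \sum_(c | in_class n c && (c i == Some q)) mon (fun i => ev (a i)) c =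
  if (0 < n q)%N then a i q * esum (zrow a i) (decr n q) else 0.
Proof.
case: ifPn => [nq|]; last first.
  rewrite -leqNgt leqn0 => /eqP nq; rewrite big1// => c /andP[/in_classP /(_ q) H /eqP ci].
  by move: H; rewrite nq /occ (bigD1 i)//= ci eqxx.
rewrite -esum_None mulr_sumr.
rewrite (reindex_onto (fun c => upd c i (Some q)) (fun c => upd c i None)) /=; last first.
  move=> c /andP[_ /eqP ci]; apply/ffunP => j; rewrite !ffunE.
  by case: eqP => [->|].
apply: eq_big => [c|c /andP[/andP[_ _] /eqP Hc]]; last first.
  rewrite /mon (bigD1 i)//= [in RHS](bigD1 i)//= ffunE eqxx /=.
  rewrite -{2}Hc ffunE eqxx /= mul1r; congr (_ * _); apply: eq_bigr => j /negbTE ji.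
  by rewrite ffunE ji.
rewrite ffunE eqxx eqxx andbT.
have -> : (upd (upd c i (Some q)) i None == c) = (c i == None).
  apply/eqP/eqP => [<-|ci]; first by rewrite !ffunE eqxx.
  by apply/ffunP => j; rewrite !ffunE; case: eqP => [->|].
case: (eqVneq (c i) None) => [ci|]; rewrite ?andbF// !andbT.
have E k : occ (upd c i (Some q)) (Some k) = (occ c (Some k) + (k == q))%N.
  rewrite occ_upd [in RHS]/occ [in RHS](bigD1 i)//= ci /= add0n; congr (_ + _)%N.
  by rewrite eq_sym; congr nat_of_bool; apply/eqP/eqP => [[]|->].
apply/in_classP/in_classP => H k.
  by have := H k; rewrite E /decr => <-; rewrite addnK.
by rewrite E H /decr subnK//; case: eqP => // ->.
Qed.

Lemma esum_split N (a : 'I_N -> 'I_K -> R) n i :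
  esum a n = esum (zrow a i) n +
    \sum_(q | (0 < n q)%N) a i q * esum (zrow a i) (decr n q).
Proof.
rewrite {1}/esum (partition_big (fun c : {ffun _ -> _} => c i) predT)//=.
rewrite sum_option esum_None; congr (_ + _).
by rewrite [RHS]big_mkcond/=; apply: eq_bigr => q _; rewrite esum_Some.
Qed.

(** Double counting of the pairs formed by a coloring and a position carrying the letter [p]: each
    coloring of the class has [n p] such positions. *)
Lemma esum_rec N (a : 'I_N -> 'I_K -> R) n p : (0 < n p)%N ->
  (n p)%:R * esum a n = \sum_i a i p * esum (zrow a i) (decr n p).
Proof.
move=> np; rewrite (eq_bigr (fun i =>
    \sum_(c | in_class n c && (c i == Some p)) mon (fun i => ev (a i)) c)); last first.
  by move=> i _; rewrite esum_Some np.
under eq_bigr => i _ do rewrite big_mkcondr/=.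
rewrite exchange_big mulr_sumr; apply: eq_bigr => c /in_classP Hc.
rewrite -Hc /occ natr_sum mulr_suml; apply: eq_bigr => i _.
by case: eqP => _; rewrite ?mul1r ?mul0r.
Qed.

Lemma esum_count_rec N n p : (0 < n p)%N ->
  (n p)%:R * esum (fun (_ : 'I_N) _ => 1) n =
  (N - \sum_k decr n p k)%:R * esum (fun (_ : 'I_N) _ => 1) (decr n p).
Proof.
move=> np; rewrite esum_rec//; 
rewrite (eq_bigr (fun i => \sum_(c | in_class (decr n p) c && (c i == None))
  mon (fun=> ev (fun=> 1)) c)) => [|i _]; last by rewrite mul1r esum_None.
under eq_bigr => i _ do rewrite big_mkcondr/=.
rewrite exchange_big mulr_sumr; apply: eq_bigr => c /in_classP Hc.
rewrite -big_mkcond/= sumr_const -[LHS]mulr_natl; congr (_%:R * _).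
have H : (occ c None + \sum_k decr n p k = N)%N.
  by rewrite -[RHS](occ_None c); congr (_ + _)%N; apply: eq_bigr => k _; rewrite Hc.
rewrite -[in RHS]H addnK /occ -sum1_card big_mkcond; apply: eq_bigr => i _.
by rewrite unfold_in; case: (c i).
Qed.

Lemma esum0 N (a : 'I_N -> 'I_K -> R) n : (forall k, n k = 0%N) -> esum a n = 1.
Proof.
move=> n0; rewrite /esum (bigD1 [ffun=> None])/=; last first.
  apply/in_classP => k; rewrite n0 /occ big1// => i _; by rewrite ffunE.
rewrite /mon big1 ?big1 ?addr0// => [c /andP[/in_classP H /eqP ne]|i _]; last by rewrite ffunE.
exfalso; apply: ne; apply/ffunP => i; rewrite ffunE; case E : (c i) => [k|//].
by have := H k; rewrite n0 /occ (bigD1 i)//= E eqxx.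
Qed.

Lemma decr_sum n p : (0 < n p)%N -> (\sum_k n k = (\sum_k decr n p k).+1)%N.
Proof.
move=> np; rewrite (bigD1 p)//= [in RHS](bigD1 p)//= /decr eqxx -addSn subn1 prednK//.
by congr (_ + _)%N; apply: eq_bigr => k /negbTE ->; rewrite subn0.
Qed.

Lemma decr_ind (P : ('I_K -> nat) -> Prop) :
  (forall n, (forall k, n k = 0%N) -> P n) ->
  (forall n p, (0 < n p)%N -> P (decr n p) -> P n) -> forall n, P n.
Proof.
move=> P0 PS n; move: {2}(\sum_k n k)%N (erefl (\sum_k n k)%N) => r.
elim: r n => [|r IHr] n Hn.
  apply: P0 => k; apply/eqP; have/eqP := Hn; rewrite sum_nat_eq0 => /forallP /(_ k).
  by [].
have [p np] : exists p, (0 < n p)%N.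
  apply/existsP; apply: contra_eqT Hn; rewrite negb_exists => /forallP H.
  by rewrite big1// => k _; have := H k; rewrite lt0n negbK => /eqP.
apply: (PS _ _ np); apply: IHr; by move: Hn; rewrite (decr_sum np) => -[].
Qed.

(** On the constant array the sum counts the colorings with prescribed letter counts, whence the
    multinomial value; [esum_count_rec] matches the descending factorial one factor at a time. *)
Lemma esum_count N n :
  esum (fun (_ : 'I_N) _ => 1) n * \prod_k (n k)`!%:R = (N ^_ (\sum_k n k))%:R.
Proof.
elim/decr_ind: n => [n n0|n p np IH].
  rewrite esum0// mul1r !big1 ?ffactn0// => k _; by rewrite n0.
rewrite (decr_sum np) ffactnSr natrM -IH.
have E : (n p)`! = (n p * (n p).-1`!)%N by rewrite -{1}(prednK np) factS prednK.
rewrite (bigD1 p)//= E natrM.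
have -> : \prod_k (decr n p k)`!%:R =
    (n p).-1`!%:R * \prod_(i < K | i != p) (n i)`!%:R :> R.
  rewrite (bigD1 p)//= /decr eqxx subn1; congr (_ * _); apply: eq_bigr => i /negbTE ->.
  by rewrite subn0.
set f1 := (n p).-1`!%:R.
transitivity ((n p)%:R * esum (fun (_ : 'I_N) _ => 1) n *
  (f1 * \prod_(i < K | i != p) (n i)`!%:R)); first by ring.
by rewrite esum_count_rec//; ring.
Qed.

Lemma esumZ N (a : 'I_N -> 'I_K -> R) n x :
  esum (fun i k => x * a i k) n = x ^+ (\sum_k n k) * esum a n.
Proof.
rewrite /esum mulr_sumr; apply: eq_bigr => c /in_classP Hc.
pose s (l : option 'I_K) := if l is Some _ then x else 1.
rewrite /mon (eq_bigr (fun i => s (c i) * ev (a i) (c i))); last first.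
  by move=> i _; case: (c i) => [k|] /=; rewrite ?mul1r.
rewrite big_split/= -/(mon (fun=> s) c) mon_occ//; congr (_ * _).
rewrite (big_morph (fun n : nat => x ^+ n) (exprD _) (expr0 _)).
by apply: eq_bigr => k _; rewrite Hc.
Qed.

End elementary_sums.

Section elementary_asymptotics.
Context (R : realType) (K : nat).
Implicit Types (n : 'I_K -> nat).

Definition rown N (a : 'I_N -> 'I_K -> R) (i : 'I_N) : R := \sum_p `|a i p|.

Definition colsum N (a : 'I_N -> 'I_K -> R) (p : 'I_K) : R := \sum_i a i p.

(** Both bounds hold with high probability for samples scaled by [1 / sqrt N]: the column sums by
    Chebyshev, the squared rows by Markov ([one_sample_regular]). *)
Definition tame N (B : R) (a : 'I_N -> 'I_K -> R) : Prop :=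
  (forall p, `|colsum a p| <= B) /\ \sum_i rown a i ^+ 2 <= B.

Lemma rown_ge0 N (a : 'I_N -> 'I_K -> R) i : 0 <= rown a i.
Proof. by apply: sumr_ge0. Qed.

Lemma le_rown N (a : 'I_N -> 'I_K -> R) i p : `|a i p| <= rown a i.
Proof. by rewrite /rown (bigD1 p)//= lerDl sumr_ge0. Qed.

Lemma rown_zrow N (a : 'I_N -> 'I_K -> R) i j :
  rown (zrow a i) j = if j == i then 0 else rown a j.
Proof.
by rewrite /rown /zrow; case: eqP => // _; rewrite big1// => p _; rewrite normr0.
Qed.

Lemma tame_ge0 N B (a : 'I_N -> 'I_K -> R) : tame B a -> 0 <= B.
Proof. by move=> [_]; apply: le_trans; apply: sumr_ge0 => i _; exact: sqr_ge0. Qed.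

(** The squared norm of a row is at most [B], so the row itself is at most [1 + B], and removing it
    moves a column sum by no more than that. *)
Lemma tame_zrow N B (a : 'I_N -> 'I_K -> R) i : tame B a -> tame (2 * B + 1) (zrow a i).
Proof.
move=> ta; have B0 := tame_ge0 ta; move: ta => [tU tS].
have rB : rown a i <= 1 + B.
  have : rown a i ^+ 2 <= B.
    by apply: le_trans tS; rewrite (bigD1 i)//= lerDl sumr_ge0// => j _; exact: sqr_ge0.
  by have := rown_ge0 a i; nra.
split=> [p|].
  have -> : colsum (zrow a i) p = colsum a p - a i p.
    rewrite /colsum (bigD1 i)//= [in RHS](bigD1 i)//= /zrow eqxx add0r [RHS]addrAC subrr add0r.
    by apply: eq_bigr => j /negbTE ->.
  apply: le_trans (ler_normB _ _) _.
  have := tU p; have := le_rown a i p; lra.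
apply: (@le_trans _ _ B); last lra.
apply: le_trans tS; apply: ler_sum => j _; rewrite rown_zrow; case: eqP => // _.
by rewrite expr0n sqr_ge0.
Qed.

Lemma esum_zrow N (a : 'I_N -> 'I_K -> R) n i : esum (zrow a i) n =
  esum a n - \sum_(q | (0 < n q)%N) a i q * esum (zrow a i) (decr n q).
Proof. by rewrite (esum_split a n i) addrK. Qed.

Lemma decr_le n p r : (0 < n p)%N -> (\sum_k n k <= r.+1)%N -> (\sum_k decr n p k <= r)%N.
Proof. by move=> np; rewrite (decr_sum np) ltnS. Qed.

(** Induction on the degree with [B] varying, as zeroing a row worsens it to [2 * B + 1]. One zeroed
    row is expanded back: the main term is a column sum times a lower [esum], and the correction
    carries two entries of the same row, which the second clause of [tame] sums. *)
Lemma esum_bounded r (B : R) : exists C : R, 0 <= C /\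
  forall N (a : 'I_N -> 'I_K -> R) n, (\sum_k n k <= r)%N -> tame B a -> `|esum a n| <= C.
Proof.
elim: r B => [|r IHr] B.
  exists 1; split=> // N a n n0 _; rewrite esum0 ?normr1// => k.
  by apply/eqP; move: n0; rewrite leqn0 sum_nat_eq0 => /forallP /(_ k).
have [C [C0 HC]] := IHr B; have [C' [C'0 HC']] := IHr (2 * B + 1).
exists (1 + `|B| * (C + C')); split; first by rewrite addr_ge0// mulr_ge0// addr_ge0.
move=> N a n; elim/decr_ind: n => [n n0 _ _|n p np _ Hn ta].
  by rewrite esum0// normr1 lerDl mulr_ge0// addr_ge0.
have B0 := tame_ge0 ta; have [tU tS] := ta; rewrite (ger0_norm B0).
have Hm := decr_le np Hn; set m := decr n p in Hm *.
apply: (@le_trans _ _ `|(n p)%:R * esum a n|).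
  by rewrite normrM normr_nat -[leLHS]mul1r ler_wpM2r// ler1n.
rewrite esum_rec//.
have -> : \sum_i a i p * esum (zrow a i) m = colsum a p * esum a m -
    \sum_i \sum_(q | (0 < m q)%N) a i p * (a i q * esum (zrow a i) (decr m q)).
  rewrite /colsum mulr_suml -sumrB; apply: eq_bigr => i _.
  by rewrite [in LHS]esum_zrow mulrBr; congr (_ - _); exact: mulr_sumr.
apply: le_trans (ler_normB _ _) _; rewrite mulrDr.
apply: (@le_trans _ _ (B * C + B * C')); last by rewrite lerDr.
apply: lerD.
  by rewrite normrM ler_pM// HC.
apply: le_trans (ler_norm_sum _ _ _) _.
apply: (@le_trans _ _ (\sum_i rown a i ^+ 2 * C')); last by rewrite -mulr_suml ler_wpM2r.
apply: ler_sum => i _; apply: le_trans (ler_norm_sum _ _ _) _.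
apply: (@le_trans _ _ (\sum_(q | (0 < m q)%N) rown a i * (`|a i q| * C'))).
  apply: ler_sum => q mq; rewrite !normrM; apply: ler_pM => //.
  - exact: le_rown.
  - rewrite ler_wpM2l//; apply: HC'; last exact: tame_zrow.
    by apply: leq_trans Hm; rewrite (decr_sum mq) leqnSn.
rewrite -mulr_sumr -mulr_suml expr2 -mulrA ler_wpM2l ?rown_ge0// ler_wpM2r//.
rewrite /rown [leRHS](bigID (fun q => (0 < m q)%N))/= lerDl; exact: sumr_ge0.
Qed.

(* The normalised Hermite polynomial [He_j(u) / j!] of variance [z]. *)
Fixpoint hz (z u : R) (j : nat) : R :=
  if j is j'.+1 then
    (u * hz z u j' - z * (if j' is j''.+1 then hz z u j'' else 0)) / j%:R
  else 1.

Lemma hz_rec z u j : j.+1%:R * hz z u j.+1 =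
  u * hz z u j - z * (if j is j'.+1 then hz z u j' else 0).
Proof. by rewrite mulrC [hz z u j.+1]/= mulfVK// pnatr_eq0. Qed.

Definition hprod (z U : 'I_K -> R) n : R := \prod_k hz (z k) (U k) (n k).

Lemma hprod_rec z U n p : (0 < n p)%N -> (n p)%:R * hprod z U n =
  U p * hprod z U (decr n p) -
  (if (0 < decr n p p)%N then z p * hprod z U (decr (decr n p) p) else 0).
Proof.
move=> np; rewrite /hprod (bigD1 p)//= [in X in _ = X - _](bigD1 p)//=.
set F := \prod_(i < K | i != p) _.
rewrite (_ : \prod_(i < K | i != p) _ = F); last first.
  by apply: eq_bigr => i /negbTE ip; rewrite /decr ip subn0.
rewrite /decr eqxx subn1 mulrA; case E : (n p) np => [//|j] _; rewrite hz_rec /=.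
case: j E => [|j] E /=; first by rewrite mulr0 !subr0 mulrA.
rewrite [in RHS](bigD1 p)//= eqxx E !subn1 /= mulrBl -!mulrA; congr (_ - _ * (_ * _)).
by apply: eq_bigr => i /negbTE ip; rewrite ip !subn0.
Qed.

(** Expanding the zeroed row twice in [esum_rec] reproduces the Hermite recursion [hprod_rec]:
    column sums play the role of the variable, Gram sums that of the variance [z], and what is left
    contains three entries of one row, whence the cubic hypothesis. *)
Lemma esum_approx (z : 'I_K -> R) r (B : R) : (forall k, `|z k| <= 1) ->
  exists C : R, 0 <= C /\
  forall N (a : 'I_N -> 'I_K -> R) n (e : R), (\sum_k n k <= r)%N -> tame B a ->
  (forall p q, `|\sum_i a i p * a i q - (p == q)%:R * z p| <= e) ->
  \sum_i rown a i ^+ 3 <= e ->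
  `|esum a n - hprod z (colsum a) n| <= C * e.
Proof.
move=> z1; elim: r => [|r [C [C0 HC]]].
  exists 0; split=> // N a n e n0 _ _ _.
  have n0' k : n k = 0%N.
    by apply/eqP; move: n0; rewrite leqn0 sum_nat_eq0 => /forallP /(_ k).
  by rewrite esum0// /hprod big1 ?subrr ?normr0 ?mul0r// => k _; rewrite n0'.
have [Cb [Cb0 HCb]] := esum_bounded r B.
have [Cd [Cd0 HCd]] := esum_bounded r (2 * B + 1).
exists (`|B| * C + K%:R * (Cb + C) + Cd); split.
  by rewrite !addr_ge0// !mulr_ge0// addr_ge0.
move=> N a n e; elim/decr_ind: n => [n n0 _ ta _ He|n p np _ Hn ta HS He].
  rewrite esum0// /hprod big1 => [|k _]; last by rewrite n0.
  have e0 : 0 <= e by apply: le_trans He; apply: sumr_ge0 => i _; rewrite exprn_ge0// rown_ge0.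
  by rewrite subrr normr0 mulr_ge0// !addr_ge0// !mulr_ge0// addr_ge0.
have e0 : 0 <= e by apply: le_trans He; apply: sumr_ge0 => i _; rewrite exprn_ge0// rown_ge0.
have B0 := tame_ge0 ta; have [tU tS] := ta; rewrite (ger0_norm B0).
have Hm := decr_le np Hn; set m := decr n p in Hm *.
set U := colsum a.
apply: (@le_trans _ _ `|(n p)%:R * (esum a n - hprod z U n)|).
  by rewrite normrM normr_nat -[leLHS]mul1r ler_wpM2r// ler1n.
have Hmq q : (0 < m q)%N -> (\sum_k decr m q k <= r)%N.
  by move=> mq; apply: leq_trans Hm; rewrite (decr_sum mq) leqnSn.
pose Z q := (p == q)%:R * z p.
rewrite mulrBr esum_rec// hprod_rec// -/m.
have -> : (if (0 < m p)%N then z p * hprod z U (decr m p) else 0) =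
    \sum_(q | (0 < m q)%N) Z q * hprod z U (decr m q).
  rewrite /Z big_mkcond (bigD1 p)//= eqxx mul1r big1 ?addr0// => q /negbTE qp.
  by rewrite eq_sym qp !mul0r; case: ifP.
have -> : \sum_i a i p * esum (zrow a i) m = U p * esum a m -
    \sum_(q | (0 < m q)%N) (\sum_i a i p * a i q) * esum a (decr m q) +
    \sum_i \sum_(q | (0 < m q)%N) a i p * (a i q *
       \sum_(q' | (0 < decr m q q')%N) a i q' * esum (zrow a i) (decr (decr m q) q')).
  under [X in _ - X + _]eq_bigr do rewrite mulr_suml.
  rewrite /U /colsum mulr_suml exchange_big/= -sumrB -big_split/=.
  apply: eq_bigr => i _; rewrite [in LHS]esum_zrow mulrBr mulr_sumr -addrA; congr (_ + _).
  rewrite -[LHS]mulN1r -[X in _ = X + _]mulN1r !mulr_sumr -big_split/=; apply: eq_bigr => q _.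
  by rewrite [in LHS]esum_zrow; ring.
rewrite (_ : _ - _ = U p * (esum a m - hprod z U m) -
   \sum_(q | (0 < m q)%N) ((\sum_i a i p * a i q - Z q) * esum a (decr m q) +
        Z q * (esum a (decr m q) - hprod z U (decr m q))) +
   \sum_i \sum_(q | (0 < m q)%N) a i p * (a i q *
       \sum_(q' | (0 < decr m q q')%N) a i q' * esum (zrow a i) (decr (decr m q) q'))); last first.
  rewrite [X in _ = _ - X + _](eq_bigr (fun q =>
    (\sum_i a i p * a i q) * esum a (decr m q) - Z q * hprod z U (decr m q))).
    by rewrite sumrB; ring.
  by move=> q _; ring.
rewrite !mulrDl; apply: le_trans (ler_normD _ _) _; apply: lerD.
  apply: le_trans (ler_normB _ _) _; apply: lerD.
    by rewrite normrM -mulrA ler_pM// HC.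
  apply: le_trans (ler_norm_sum _ _ _) _.
  rewrite [leRHS](_ : _ = \sum_(q < K) (e * Cb + C * e)); last first.
    by rewrite sumr_const card_ord -[RHS]mulr_natl; ring.
  rewrite [leRHS](bigID (fun q => (0 < m q)%N))/= -[leLHS]addr0; apply: lerD; last first.
    by apply: sumr_ge0 => q _; rewrite addr_ge0// mulr_ge0.
  apply: ler_sum => q mq; apply: le_trans (ler_normD _ _) _; apply: lerD; rewrite normrM.
    by rewrite ler_pM// HCb// Hmq.
  rewrite -[leRHS]mul1r ler_pM//; last by apply: HC => //; exact: Hmq.
  by rewrite /Z; case: eqP => _; rewrite ?mul1r ?mul0r ?normr0.
apply: le_trans (ler_norm_sum _ _ _) _.
apply: (@le_trans _ _ (\sum_i Cd * rown a i ^+ 3)); last first.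
  by rewrite -mulr_sumr ler_wpM2l.
apply: ler_sum => i _.
have sub (P : pred 'I_K) : \sum_(q | P q) `|a i q| <= rown a i.
  by rewrite /rown [leRHS](bigID P)/= lerDl; exact: sumr_ge0.
apply: le_trans (ler_norm_sum _ _ _) _.
apply: (@le_trans _ _ (\sum_(q | (0 < m q)%N) rown a i * (`|a i q| * (rown a i * Cd)))).
  apply: ler_sum => q mq; rewrite !normrM; apply: ler_pM => //; first exact: le_rown.
  rewrite ler_wpM2l//; apply: le_trans (ler_norm_sum _ _ _) _.
  apply: (@le_trans _ _ (\sum_(q' | (0 < decr m q q')%N) `|a i q'| * Cd)); last first.
    by rewrite -mulr_suml ler_wpM2r.
  apply: ler_sum => q' mq'; rewrite normrM ler_wpM2l//; apply: HCd; last exact: tame_zrow.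
  by apply: leq_trans (Hmq _ mq); rewrite [X in (_ <= X)%N](decr_sum mq') leqnSn.
rewrite -mulr_sumr -mulr_suml [leRHS](_ : _ = rown a i * (rown a i * (rown a i * Cd))); last by ring.
by rewrite ler_wpM2l ?rown_ge0// ler_wpM2r// mulr_ge0// rown_ge0.
Qed.

(** A division-free form of [N ^_ r / N^r >= 1 - r^2 / N]; the induction step leaves the slack
    [r^3 + N * (r + 1)]. *)
Lemma ffact_ratio (N r : nat) : (r <= N)%N ->
  N%:R ^+ r * (N%:R - (r ^ 2)%N%:R) <= (N ^_ r)%:R * N%:R :> R.
Proof.
elim: r => [|r IHr] rN; first by rewrite expr0 ffactn0 subr0.
have {}IHr := IHr (ltnW rN).
rewrite ffactnSr natrM natrB ?(ltnW rN)//.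
have Nr : 0 <= N%:R - r%:R :> R by rewrite subr_ge0 ler_nat ltnW.
apply: (@le_trans _ _ ((N%:R ^+ r * (N%:R - (r ^ 2)%N%:R)) * (N%:R - r%:R))); last first.
  by rewrite [leRHS]mulrAC; exact: ler_wpM2r.
rewrite exprS -subr_ge0.
have -> : N%:R ^+ r * (N%:R - (r ^ 2)%N%:R) * (N%:R - r%:R) -
   N%:R * N%:R ^+ r * (N%:R - (r.+1 ^ 2)%N%:R) = N%:R ^+ r * (r%:R ^+ 3 + N%:R * (r%:R + 1)) :> R.
  by rewrite !natrX -[r.+1%:R]natr1; ring.
by rewrite mulr_ge0 ?exprn_ge0// addr_ge0 ?exprn_ge0// mulr_ge0// addr_ge0.
Qed.

Lemma ffact_ratio_cvg (r : nat) (e : R) : 0 < e -> exists N0 : nat,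
  forall N, (N0 <= N)%N -> forall j, (j <= r)%N ->
  0 < (N ^_ j)%:R :> R /\ `|N%:R ^+ j / (N ^_ j)%:R - 1| <= e.
Proof.
(* The first term gives [r^2 <= e * (N - r^2)], which turns [ffact_ratio] into a relative error [e];
   the last one gives [r < N]. *)
move=> e0; pose x := (r ^ 2)%N%:R * (1 + e^-1) + 1 + r%:R.
exists (Num.truncn x).+1 => N NN j jr.
have xN : x < N%:R by apply: lt_le_trans (truncnS_gt _) _; rewrite ler_nat.
have einv : 0 < e^-1 by rewrite invr_gt0.
have r0 : 0 <= (r ^ 2)%N%:R :> R by [].
have rN : (r < N)%N.
  rewrite -(ltr_nat R); apply: lt_trans xN; rewrite /x.
  have : 0 <= (r ^ 2)%N%:R * (1 + e^-1) by rewrite mulr_ge0// ltW// addr_gt0.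
  lra.
have jN : (j <= N)%N by apply: leq_trans jr (ltnW rN).
have fp : 0 < (N ^_ j)%:R :> R by rewrite ltr0n ffact_gt0.
split => //.
have jr2 : (j ^ 2)%N%:R <= (r ^ 2)%N%:R :> R by rewrite ler_nat leq_exp2r.
have Hr := ffact_ratio jN.
have Hu : (N ^_ j)%:R <= N%:R ^+ j :> R.
  rewrite -natrX ler_nat; elim: (j) => [|i IHi]; first by rewrite ffactn0 expn0.
  by rewrite ffactnSr expnSr leq_mul// leq_subr.
have Np : 0 < N%:R :> R by rewrite ltr0n (leq_trans _ rN).
have rp : 0 <= r%:R :> R by [].
have Hx : (r ^ 2)%N%:R * (1 + e^-1) < N%:R by apply: le_lt_trans xN; rewrite /x; lra.
have key : (r ^ 2)%N%:R <= e * (N%:R - (r ^ 2)%N%:R).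
  have : e * ((r ^ 2)%N%:R * (1 + e^-1)) <= e * N%:R by rewrite ler_wpM2l// ltW.
  have -> : e * ((r ^ 2)%N%:R * (1 + e^-1)) = (r ^ 2)%N%:R * (e + 1) by field; rewrite gt_eqF.
  lra.
rewrite ger0_norm; last by rewrite subr_ge0 ler_pdivlMr// mul1r.
rewrite lerBlDr ler_pdivrMr//.
set F := (N ^_ j)%:R in fp Hr Hu *; set Z := N%:R ^+ j in Hr Hu *.
have Z0 : 0 <= Z by apply: le_trans Hu; exact: ltW.
set j2 := (j ^ 2)%N%:R in jr2 Hr; set r2 := (r ^ 2)%N%:R in jr2 key r0 Hx *; set n := N%:R in Np Hr Hx key *.
have nr : 0 <= n - r2.
  have : r2 <= r2 * (1 + e^-1) by rewrite ler_peMr// lerDl ltW.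
  lra.
have H1 : Z * (n - r2) <= F * n by apply: le_trans Hr; rewrite ler_wpM2l// lerB.
have H2 : n <= (e + 1) * (n - r2) by lra.
have nr1 : 0 < n - r2.
  have : 0 < (e + 1) * (n - r2) by apply: lt_le_trans H2.
  by rewrite pmulr_rgt0// addr_gt0.
have : Z * (n - r2) <= F * ((e + 1) * (n - r2)).
  by apply: le_trans H1 _; rewrite ler_wpM2l// ltW.
by rewrite mulrA ler_pM2r// mulrC.
Qed.

Definition occn M (n : {ffun 'I_K -> 'I_M.+1}) : 'I_K -> nat := fun k => n k.

(** For arrays scaled by [1 / sqrt N], the part of the expansion of the denominator in which every
    letter occurs at most [M] times ([box_term_sum]): the power of [N] undoes the scaling and the
    last [esum] is the size of the class. *)
Definition box_term N (s : 'I_K -> R) M (a b : 'I_N -> 'I_K -> R) : R :=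
  \sum_(n : {ffun 'I_K -> 'I_M.+1}) (\prod_k s k ^+ n k) *
     (N%:R ^+ (\sum_k (n k : nat)) * (esum a (occn n) * esum b (occn n)) / esum (fun (_ : 'I_N) _ => 1) (occn n)).

(** Partial sum of Mehler's series. Both [hz] factors are Hermite polynomials divided by a
    factorial, so one factorial is put back. *)
Definition mehler_sum (z s u v : R) (M : nat) : R :=
  \sum_(j < M.+1) s ^+ j * (j`!%:R * (hz z u j * hz z v j)).

Lemma box_approx (s z : 'I_K -> R) M (B e : R) : (forall k, `|z k| <= 1) -> 0 < e ->
  exists (d : R) (N0 : nat), 0 < d /\ forall N (a b : 'I_N -> 'I_K -> R), (N0 <= N)%N ->
  tame B a -> tame B b ->
  (forall p q, `|\sum_i a i p * a i q - (p == q)%:R * z p| <= d) ->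
  (forall p q, `|\sum_i b i p * b i q - (p == q)%:R * z p| <= d) ->
  \sum_i rown a i ^+ 3 <= d -> \sum_i rown b i ^+ 3 <= d ->
  `|box_term s M a b - \prod_k mehler_sum (z k) (s k) (colsum a k) (colsum b k) M| <= e.
Proof.
move=> z1 e0; set r := (K * M)%N.
have [C [C0 HC]] := @esum_approx z r B z1.
have [D [D0 HD]] := @esum_bounded r B.
pose S := \sum_(n : {ffun 'I_K -> 'I_M.+1}) `|\prod_k s k ^+ n k| * \prod_k (n k)`!%:R.
have S0 : 0 <= S by apply: sumr_ge0 => n _; rewrite mulr_ge0// prodr_ge0.
(* [S] collects the coefficients, [D ^+ 2] the error made on the descending factorial, the other
   term the errors of the two Hermite approximations; [d <= 1] makes the product of these two errors
   linear in [d]. *)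
pose Q := S * (D ^+ 2 + C * (2 * D + C)) + 1.
have Q0 : 0 < Q.
  by rewrite /Q ltr_wpDl// mulr_ge0// addr_ge0 ?exprn_ge0// mulr_ge0// addr_ge0// mulr_ge0.
pose d := Num.min 1 (e / Q).
have d0 : 0 < d by rewrite lt_min ltr01 divr_gt0.
have d1 : d <= 1 by rewrite ge_min lexx.
have [N0 HN] := @ffact_ratio_cvg r d d0.
exists d, N0; split => // N a b NN ta tb Sa Sb Ra Rb.
rewrite /mehler_sum -(prod_sum_occ M (fun k j => s k ^+ j *
  (j`!%:R * (hz (z k) (colsum a k) j * hz (z k) (colsum b k) j)))) /box_term.
rewrite -sumrB; apply: le_trans (ler_norm_sum _ _ _) _.
apply: (@le_trans _ _ (\sum_(n : {ffun 'I_K -> 'I_M.+1})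
   `|\prod_k s k ^+ n k| * \prod_k (n k)`!%:R * ((D ^+ 2 + C * (2 * D + C)) * d))).
  apply: ler_sum => n _; rewrite !big_split/= -mulrBr normrM -[leRHS]mulrA; apply: ler_wpM2l => //.
  rewrite -/(hprod z (colsum a) (occn n)) -/(hprod z (colsum b) (occn n)).
  set F := \prod_k (n k)`!%:R; pose c : R := esum (fun (_ : 'I_N) (_ : 'I_K) => 1) (occn n); rewrite -/c.
  have F0 : 0 < F by apply: prodr_gt0 => k _; rewrite ltr0n fact_gt0.
  have nr : (\sum_k (n k : nat) <= r)%N.
    apply: (@leq_trans (\sum_(k < K) M)); first by apply: leq_sum => k _; rewrite -ltnS.
    by rewrite sum_nat_const card_ord.
  have [fp Hf] := HN _ NN _ nr.
  have cE : c = (N ^_ (\sum_k (n k : nat)))%:R / F.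
    by rewrite -(@esum_count R K N (occn n)) mulfK//; exact: lt0r_neq0.
  have ea := HC N a (occn n) d nr ta Sa Ra; have eb := HC N b (occn n) d nr tb Sb Rb.
  have da := HD N a (occn n) nr ta; have db := HD N b (occn n) nr tb.
  set x := esum a (occn n) in ea da *; set y := esum b (occn n) in eb db *.
  set hx := hprod z (colsum a) (occn n) in ea *; set hy := hprod z (colsum b) (occn n) in eb *.
  set rho := _ / _ in Hf.
  rewrite (_ : _ - _ = F * ((rho - 1) * (x * y) + (x - hx) * y + x * (y - hy) -
     (x - hx) * (y - hy))); last first.
    by rewrite cE /rho; field; rewrite !lt0r_neq0.
  rewrite normrM (ger0_norm (ltW F0)); apply: ler_wpM2l; first exact: ltW.
  have dd : `|(rho - 1) * (x * y)| <= d * D ^+ 2.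
    by rewrite normrM ler_pM// normrM expr2 ler_pM.
  have d2 : `|(x - hx) * y| <= C * d * D by rewrite normrM ler_pM.
  have d3 : `|x * (y - hy)| <= D * (C * d) by rewrite normrM ler_pM.
  have d4 : `|(x - hx) * (y - hy)| <= C * d * C.
    rewrite normrM ler_pM//; apply: le_trans eb _.
    by rewrite -[leRHS]mulr1 ler_wpM2l.
  apply: le_trans (ler_normB _ _) _; apply: le_trans (lerD (ler_normD _ _) (lexx _)) _.
  apply: le_trans (lerD (lerD (ler_normD _ _) (lexx _)) (lexx _)) _.
  lra.
rewrite -mulr_suml -/S mulrA.
apply: (@le_trans _ _ (Q * d)); first by rewrite ler_wpM2r ?(ltW d0)// /Q lerDl.
by rewrite mulrC -ler_pdivlMr// ge_min lexx orbT.
Qed.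

End elementary_asymptotics.

(** * Mehler's formula *)

Section mehler.
Variable R : realType.
Implicit Types (s u v : R).

Definition mehler_exponent s u v : R :=
  2^-1 * ln (1 - s ^+ 2) + (s ^+ 2 * (u ^+ 2 + v ^+ 2) - 2 * s * (u * v)) / (2 * (1 - s ^+ 2)).

(* Mehler's kernel: the density of a pair of standard Gaussians of correlation
   [s] with respect to an independent pair. *)
Definition mehler s u v : R := expR (- mehler_exponent s u v).

Let c u v j : R := j`!%:R * (hz 1 u j * hz 1 v j).
(** This is [(1 - s ^+ 2) ^+ 2] times the derivative in [s] of the logarithm of Mehler's kernel, see
    [is_derive_mehler_exponent]. *)
Let q s u v : R := s * (1 - s ^+ 2) + u * v * (1 + s ^+ 2) - s * (u ^+ 2 + v ^+ 2).

Lemma sqr_lt1 s : `|s| < 1 -> 0 < 1 - s ^+ 2.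
Proof.
move=> s1; rewrite subr_gt0 -[s ^+ 2]real_normK ?num_real// -[ltRHS](expr1n _ 2%N).
by rewrite ltr_pXn2r ?nnegrE.
Qed.

Lemma hz1S u j : hz 1 u j.+2 = (u * hz 1 u j.+1 - hz 1 u j) / j.+2%:R.
Proof.
have := hz_rec 1 u j.+1; rewrite mul1r => <-.
by rewrite mulrC mulKf.
Qed.

(** Coefficientwise form of the differential equation [(1 - s^2)^2 K' = q K] of Mehler's kernel [K]
    in the variable [s]; it follows from the three-term recurrence of the Hermite polynomials. *)
Lemma mehler_coeff_rec u v m : (m%:R + 4) * c u v m.+4 =
  u * v * c u v m.+3 + (2 * m%:R + 5 - (u ^+ 2 + v ^+ 2)) * c u v m.+2 +
  u * v * c u v m.+1 - (m%:R + 1) * c u v m.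
Proof.
rewrite /c !hz1S !factS !natrM -!natr1.
have m0 : 0 <= m%:R :> R by [].
by field; rewrite !lt0r_neq0//; lra.
Qed.

Lemma mehler_coeff_small u v : [/\ c u v 0 = 1, c u v 1 = u * v,
  c u v 2 = (u ^+ 2 - 1) * (v ^+ 2 - 1) / 2 &
  3 * c u v 3 = u * v * c u v 2 + (3 - (u ^+ 2 + v ^+ 2)) * c u v 1 + u * v * c u v 0].
Proof.
rewrite /c !hz1S /= !factS fact0 !natrM !mulr1; split; by field.
Qed.

(** A partial sum solves the equation up to the terms that the recurrence has not yet cancelled, all
    of order [s ^+ M] or higher. *)
Lemma mehler_defect s u v M :
  (1 - s ^+ 2) ^+ 2 * (\sum_(j < M.+1) c u v j * (j%:R * s ^+ j.-1)) -
  q s u v * (\sum_(j < M.+1) c u v j * s ^+ j) =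
  s ^+ M * (- ((M%:R + 1) * c u v M.+1) - ((M%:R + 2) * c u v M.+2 - u * v * c u v M.+1) * s
  - ((M%:R + 3) * c u v M.+3 - u * v * c u v M.+2 -
      (2 * M%:R + 3 - (u ^+ 2 + v ^+ 2)) * c u v M.+1) * s ^+ 2
  + (M%:R + 1) * c u v M * s ^+ 3).
Proof.
elim: M => [|M IHM].
  have [c0 c1 c2 c3] := mehler_coeff_small u v.
  rewrite !big_ord1 /= expr0 !mul0r !mulr0 !add0r !mulr1 c3 c0 c1 c2 /q.
  by field.
rewrite big_ord_recr [in X in _ - _ * X]big_ord_recr !mulrDr opprD addrACA IHM /=.
have rec := mehler_coeff_rec u v M.
rewrite -[M.+1%:R]natr1 [s ^+ M.+1]exprS /q.
have -> : c u v M.+4 = (u * v * c u v M.+3 + (2 * M%:R + 5 - (u ^+ 2 + v ^+ 2)) * c u v M.+2 +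
  u * v * c u v M.+1 - (M%:R + 1) * c u v M) / (M%:R + 4).
  by rewrite -rec mulrC mulKf// lt0r_neq0// ltr_wpDl.
have m0 : 0 <= M%:R :> R by [].
by field; rewrite !lt0r_neq0//; lra.
Qed.

(** Weighted Young inequality [(x - y)^2 <= (1 + 1/e) x^2 + (1 + e) y^2] in the recurrence; [e]
    stays free so that the second coefficient can be brought close to [1]. *)
Lemma hz_sq_rec u j (e : R) : 0 < e ->
  j.+2`!%:R * hz 1 u j.+2 ^+ 2 <=
  (1 + e^-1) * u ^+ 2 / j.+2%:R * (j.+1`!%:R * hz 1 u j.+1 ^+ 2) +
  (1 + e) * (j`!%:R * hz 1 u j ^+ 2).
Proof.
move=> e0; rewrite hz1S; set x := hz 1 u j.+1; set y := hz 1 u j.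
have j2 : 0 < j.+2%:R :> R by [].
have H : (u * x - y) ^+ 2 <= (1 + e^-1) * (u * x) ^+ 2 + (1 + e) * y ^+ 2.
  have := sqr_ge0 (u * x + e * y); rewrite -subr_ge0 => H.
  rewrite -subr_ge0 (_ : _ - _ = e^-1 * (u * x + e * y) ^+ 2).
    by rewrite mulr_ge0 ?sqr_ge0// invr_ge0 ltW.
  by field; rewrite gt_eqF.
have -> : j.+2`!%:R * ((u * x - y) / j.+2%:R) ^+ 2 = j.+1`!%:R / j.+2%:R * (u * x - y) ^+ 2.
  by rewrite factS natrM; field; rewrite gt_eqF.
apply: (@le_trans _ _ (j.+1`!%:R / j.+2%:R * ((1 + e^-1) * (u * x) ^+ 2 + (1 + e) * y ^+ 2))).
  by rewrite ler_wpM2l// divr_ge0.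
rewrite mulrDr; apply: lerD.
  by rewrite le_eqVlt; apply/orP; left; apply/eqP; field; rewrite !gt_eqF.
rewrite mulrCA; apply: ler_wpM2l; first by rewrite ltW// addr_gt0.
apply: ler_wpM2r; first exact: sqr_ge0.
rewrite factS natrM mulrAC -[leRHS]mul1r; apply: ler_wpM2r => //.
by rewrite ler_pdivrMr// mul1r ler_nat.
Qed.

Lemma hz_sq_bounded (B : R) J : exists C : R, 0 <= C /\
  forall u j, `|u| <= B -> (j <= J)%N -> j`!%:R * hz 1 u j ^+ 2 <= C.
Proof.
elim: J => [|J [C [C0 HC]]].
  exists 1; split=> // u j _; rewrite leqn0 => /eqP ->.
  by rewrite /= expr1n mulr1.
exists (C + (1 + B ^+ 2) + (2 * B ^+ 2 + 2) * C); split.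
  have B20 := sqr_ge0 B; have : 0 <= (2 * B ^+ 2 + 2) * C by rewrite mulr_ge0//; lra.
  lra.
have B20 := sqr_ge0 B.
have T0 : 0 <= (2 * B ^+ 2 + 2) * C by rewrite mulr_ge0//; lra.
move=> u j uB; rewrite leq_eqVlt => /orP[/eqP ->|jJ]; last first.
  by apply: le_trans (HC u j uB jJ) _; lra.
have u2 : u ^+ 2 <= B ^+ 2.
  by rewrite -[u ^+ 2]real_normK ?num_real// ler_pXn2r ?nnegrE// (le_trans _ uB).
case: J HC => [|J] HC.
  by rewrite /= mulr0 subr0 mulr1 divr1 mul1r; lra.
apply: le_trans (hz_sq_rec u J ltr01) _; rewrite invr1.
have x1 := HC u J.+1 uB (leqnn _); have x0 := HC u J uB (leqnSn _).
have x10 : 0 <= J.+1`!%:R * hz 1 u J.+1 ^+ 2 by rewrite mulr_ge0// sqr_ge0.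
have : (1 + 1) * u ^+ 2 / J.+2%:R * (J.+1`!%:R * hz 1 u J.+1 ^+ 2) <= 2 * B ^+ 2 * C.
  apply: ler_pM => //; first by rewrite divr_ge0// mulr_ge0// sqr_ge0.
  rewrite ler_pdivrMr//; apply: (@le_trans _ _ (2 * B ^+ 2)); first lra.
  by rewrite ler_peMr// ?ler1n// mulr_ge0.
have := ler_wpM2l (ler0n R 2) x0 => h0 h1.
apply: le_trans (lerD h1 h0) _; rewrite -mulrDl; lra.
Qed.

Lemma hz_sq_growth (B e : R) : 0 < e -> exists C : R, 0 <= C /\
  forall u j, `|u| <= B -> j`!%:R * hz 1 u j ^+ 2 <= C * (1 + e) ^+ j.
Proof.
(* Beyond degree [J] the first coefficient in [hz_sq_rec] is at most [e], and
   [e * (1 + e) + (1 + e) = (1 + e) ^+ 2] closes the induction. *)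
move=> e0; pose J := (Num.truncn ((1 + e^-1) * B ^+ 2 / e)).+1.
have [C [C0 HC]] := hz_sq_bounded B J.+1.
exists C; split => // u j uB.
have e1 : 1 <= 1 + e by rewrite lerDl ltW.
have u2 : u ^+ 2 <= B ^+ 2.
  by rewrite -[u ^+ 2]real_normK ?num_real// ler_pXn2r ?nnegrE// (le_trans _ uB).
have small i : (i <= J.+1)%N -> i`!%:R * hz 1 u i ^+ 2 <= C * (1 + e) ^+ i.
  move=> iJ; apply: le_trans (HC u i uB iJ) _.
  by rewrite ler_peMr// exprn_ege1.
suff : j`!%:R * hz 1 u j ^+ 2 <= C * (1 + e) ^+ j /\
       j.+1`!%:R * hz 1 u j.+1 ^+ 2 <= C * (1 + e) ^+ j.+1 by case.
elim: j => [|j [IH1 IH2]]; first by split; apply: small.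
split => //; have [jJ|jJ] := leqP j.+2 J.+1; first exact: small.
apply: le_trans (hz_sq_rec u j e0) _.
have coef : (1 + e^-1) * u ^+ 2 / j.+2%:R <= e.
  have ei : 0 < e^-1 by rewrite invr_gt0.
  rewrite ler_pdivrMr//; apply: (@le_trans _ _ ((1 + e^-1) * B ^+ 2)).
    by rewrite ler_wpM2l// ltW// addr_gt0.
  rewrite -ler_pdivrMl// mulrC.
  have := truncnS_gt ((1 + e^-1) * B ^+ 2 / e); move=> /ltW /le_trans; apply.
  by rewrite ler_nat; exact: leq_trans (ltnW (ltnW jJ)).
have x1 : 0 <= j.+1`!%:R * hz 1 u j.+1 ^+ 2 by rewrite mulr_ge0// sqr_ge0.
apply: (@le_trans _ _ (e * (C * (1 + e) ^+ j.+1) + (1 + e) * (C * (1 + e) ^+ j))).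
  apply: lerD; last by rewrite ler_wpM2l// (le_trans ler01).
  by apply: ler_pM => //; rewrite divr_ge0// mulr_ge0 ?sqr_ge0// addr_ge0// invr_ge0 ltW.
rewrite !exprS le_eqVlt; apply/orP; left; apply/eqP; ring.
Qed.

Lemma mehler_coeff_growth (B e : R) : 0 < e -> exists C : R, 0 <= C /\
  forall u v j, `|u| <= B -> `|v| <= B -> `|c u v j| <= C * (1 + e) ^+ j.
Proof.
move=> e0; have [C [C0 HC]] := hz_sq_growth B e0.
exists C; split=> // u v j uB vB.
have hu := HC u j uB; have hv := HC v j vB.
rewrite /c normrM normr_nat normrM.
have fj : 0 <= j`!%:R :> R by [].
have : j`!%:R * (`|hz 1 u j| * `|hz 1 v j|) <=
    2^-1 * (j`!%:R * hz 1 u j ^+ 2 + j`!%:R * hz 1 v j ^+ 2).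
  rewrite -mulrDr [leRHS]mulrCA; apply: ler_wpM2l => //.
  rewrite -[hz 1 u j ^+ 2]real_normK ?num_real//.
  rewrite -[hz 1 v j ^+ 2]real_normK ?num_real//.
  have := sqr_ge0 (`|hz 1 u j| - `|hz 1 v j|); lra.
lra.
Qed.

Lemma mehler_sumE s u v M : mehler_sum 1 s u v M = \sum_(j < M.+1) c u v j * s ^+ j.
Proof. by apply: eq_bigr => j _; rewrite mulrC. Qed.

Lemma is_derive1_eq (f : R -> R) (x a b : R) : is_derive x 1 f a -> a = b -> is_derive x 1 f b.
Proof. by move=> fa <-. Qed.

Lemma is_derive1D (f g : R -> R) (x a b : R) : is_derive x 1 f a -> is_derive x 1 g b ->
  is_derive x 1 (fun y => f y + g y) (a + b).
Proof. exact: is_deriveD. Qed.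

Lemma is_derive1M (f g : R -> R) (x a b : R) : is_derive x 1 f a -> is_derive x 1 g b ->
  is_derive x 1 (fun y => f y * g y) (f x * b + g x * a).
Proof. exact: is_deriveM. Qed.

Lemma is_derive1Z (f : R -> R) (x k a : R) : is_derive x 1 f a ->
  is_derive x 1 (fun y => k * f y) (k * a).
Proof.
move=> fa; have := is_derive1M (is_derive_cst k x 1) fa.
by rewrite mulr0 addr0.
Qed.

Lemma is_derive1N (f : R -> R) (x a : R) : is_derive x 1 f a ->
  is_derive x 1 (fun y => - f y) (- a).
Proof. exact: is_deriveN. Qed.

Lemma is_derive1X n (x : R) : is_derive x 1 (fun y => y ^+ n) (n%:R * x ^+ n.-1).
Proof.
have := @is_deriveX _ _ (@idfun R) n x 1 1 (is_derive_id _ _).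
by rewrite exprfctE /GRing.scale /= mulr1.
Qed.

Lemma is_derive1_sum (n : nat) (f : 'I_n -> R -> R) (x : R) (a : 'I_n -> R) :
  (forall i, is_derive x 1 (f i) (a i)) ->
  is_derive x 1 (fun y => \sum_i f i y) (\sum_i a i).
Proof.
have := @is_derive_sum _ _ _ n f x 1 a => H fa.
by have := H fa; rewrite fct_sumE.
Qed.

Lemma is_derive_mehler_exponent s u v : `|s| < 1 ->
  is_derive s 1 (fun x => mehler_exponent x u v) (- q s u v / (1 - s ^+ 2) ^+ 2).
Proof.
move=> s1; have p := sqr_lt1 s1.
rewrite /mehler_exponent.
have d1 : is_derive s 1 (fun x : R => 1 - x ^+ 2) (- (2 * s)).
  have := is_derive1D (is_derive_cst (1 : R) s 1) (is_derive1N (is_derive1X 2 s)).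
  by rewrite add0r expr1.
have d2 : is_derive s 1 (fun x : R => ln (1 - x ^+ 2)) ((1 - s ^+ 2)^-1 * - (2 * s)).
  have H := @is_derive1_comp R (@ln R) (fun x => 1 - x ^+ 2) s _ _ (is_derive1_ln p) d1.
  by rewrite /comp in H; exact: H.
have d3 := is_derive1Z 2 d1.
have d4 : is_derive s 1 (fun x : R => (2 * (1 - x ^+ 2))^-1) 
   (- (2 * (1 - s ^+ 2)) ^- 2 * (2 * - (2 * s))).
  by apply: is_deriveV => //; rewrite gt_eqF// mulr_gt0.
have d5 : is_derive s 1 (fun x : R => x ^+ 2 * (u ^+ 2 + v ^+ 2) - 2 * x * (u * v))
   (2 * s * (u ^+ 2 + v ^+ 2) - 2 * (u * v)).
  have := is_derive1D (is_derive1Z (u ^+ 2 + v ^+ 2) (is_derive1X 2 s))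
    (is_derive1N (is_derive1Z (2 * (u * v)) (is_derive_id s 1))).
  have -> : (fun x : R => x ^+ 2 * (u ^+ 2 + v ^+ 2) - 2 * x * (u * v)) =
      (fun y => (u ^+ 2 + v ^+ 2) * y ^+ 2 - 2 * (u * v) * id y).
    by apply/funext => y /=; ring.
  by rewrite /= expr1 mulr1 [_ * (2 * s)]mulrC.
have H := is_derive1D (is_derive1Z 2^-1 d2) (is_derive1M d5 d4).
apply: (is_derive1_eq H).
by rewrite /q; field; rewrite gt_eqF.
Qed.

(** Multiplying the partial sum by the inverse of the kernel removes the homogeneous part of the
    equation, so that only the defect is left in the derivative. *)
Lemma mehler_sum_defect s u v M : `|s| < 1 ->
  let D x := (\sum_(j < M.+1) c u v j * x ^+ j) * expR (mehler_exponent x u v) in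
  is_derive s 1 D (expR (mehler_exponent s u v) / (1 - s ^+ 2) ^+ 2 *
   (s ^+ M * (- ((M%:R + 1) * c u v M.+1) - ((M%:R + 2) * c u v M.+2 - u * v * c u v M.+1) * s
  - ((M%:R + 3) * c u v M.+3 - u * v * c u v M.+2 -
      (2 * M%:R + 3 - (u ^+ 2 + v ^+ 2)) * c u v M.+1) * s ^+ 2
  + (M%:R + 1) * c u v M * s ^+ 3))).
Proof.
move=> s1 D; have p := sqr_lt1 s1.
have dE := @is_derive1_comp _ expR (fun x => mehler_exponent x u v) s _ _
  (is_derive_expR _) (is_derive_mehler_exponent u v s1).
have dS := @is_derive1_sum M.+1 (fun j x => c u v j * x ^+ j) s _
  (fun j => is_derive1Z (c u v j) (is_derive1X j s)).
have -> : expR (mehler_exponent s u v) / (1 - s ^+ 2) ^+ 2 * (s ^+ M *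
   (- ((M%:R + 1) * c u v M.+1) - ((M%:R + 2) * c u v M.+2 - u * v * c u v M.+1) * s
  - ((M%:R + 3) * c u v M.+3 - u * v * c u v M.+2 -
      (2 * M%:R + 3 - (u ^+ 2 + v ^+ 2)) * c u v M.+1) * s ^+ 2
  + (M%:R + 1) * c u v M * s ^+ 3)) =
  (\sum_(j < M.+1) c u v j * s ^+ j) *
    (expR (mehler_exponent s u v) * (- q s u v / (1 - s ^+ 2) ^+ 2)) +
  expR (mehler_exponent s u v) * (\sum_(j < M.+1) c u v j * (j%:R * s ^+ j.-1)).
  by rewrite -mehler_defect; field; rewrite gt_eqF.
exact: (is_derive1M dS dE).
Qed.

Lemma mehler_sum_s0 (z u v : R) M : mehler_sum z 0 u v M = 1.
Proof.
rewrite /mehler_sum big_ord_recl big1 => [|i _]; last by rewrite expr0n /= mul0r.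
by rewrite /= expr0 fact0 !mul1r addr0.
Qed.

Lemma mehler_s0 u v : mehler 0 u v = 1.
Proof. by rewrite /mehler /mehler_exponent expr0n /= subr0 ln1 !mulr0 !mul0r subr0 mul0r addr0 oppr0 expR0. Qed.

(** The logarithmic term of the exponent has a favourable sign and is dropped, which leaves a
    quadratic form in [u], [v]. *)
Lemma mehler_lower s u v : `|s| < 1 ->
  s * u * v / (1 - s ^+ 2) - s ^+ 2 * (u ^+ 2 + v ^+ 2) / (2 * (1 - s ^+ 2)) <= - mehler_exponent s u v.
Proof.
move=> s1; have p := sqr_lt1 s1; rewrite /mehler_exponent opprD.
have : ln (1 - s ^+ 2) <= 0 by apply: ln_le0; rewrite gerBl sqr_ge0.
have -> : s * u * v / (1 - s ^+ 2) - s ^+ 2 * (u ^+ 2 + v ^+ 2) / (2 * (1 - s ^+ 2)) =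
  - ((s ^+ 2 * (u ^+ 2 + v ^+ 2) - 2 * s * (u * v)) / (2 * (1 - s ^+ 2))).
  by field; rewrite gt_eqF.
lra.
Qed.

(** The quotient of the partial sum by the kernel is [1] at [0], and its derivative, given by
    [mehler_sum_defect], is uniformly small on [[0, s]]; the mean value theorem concludes. *)
Lemma mehler_cvg s (B e : R) : 0 <= s < 1 -> 0 < e -> exists M0, forall M, (M0 <= M)%N ->
  forall u v, `|u| <= B -> `|v| <= B -> `|mehler_sum 1 s u v M - mehler s u v| <= e.
Proof.
move=> /andP[s0 s1] e0.
have sn : `|s| < 1 by rewrite ger0_norm.
have p := sqr_lt1 sn.
wlog B0 : B / 0 <= B.
  move=> H; have [M0 HM] := H (Num.max B 0) ltac:(by rewrite le_max lexx orbT).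
  by exists M0 => M MM u v uB vB; apply: HM => //; rewrite le_max ?uB ?vB.
(* The rate [1 + d] allowed for the growth of the coefficients still satisfies [(1 + d) * s < 1]. *)
pose d := (1 - s) / 2; have d0 : 0 < d by rewrite divr_gt0// subr_gt0.
have d1 : d <= 1/2 by rewrite /d; lra.
have [C [C0 HC]] := mehler_coeff_growth B d0.
pose E := 2^-1 * - ln (1 - s ^+ 2) + (4 * B ^+ 2) / (1 - s ^+ 2).
have expE x u v : 0 <= x <= s -> `|u| <= B -> `|v| <= B -> `|mehler_exponent x u v| <= E.
  move=> /andP[x0 xs] uB vB.
  have x1 : `|x| < 1 by rewrite ger0_norm// (le_lt_trans xs).
  have px := sqr_lt1 x1.
  have xx : x ^+ 2 <= s ^+ 2 by rewrite ler_pXn2r ?nnegrE.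
  have u2 : u ^+ 2 <= B ^+ 2.
    by rewrite -[u ^+ 2]real_normK ?num_real// ler_pXn2r ?nnegrE.
  have v2 : v ^+ 2 <= B ^+ 2.
    by rewrite -[v ^+ 2]real_normK ?num_real// ler_pXn2r ?nnegrE.
  have uv : `|u * v| <= B ^+ 2 by rewrite normrM expr2 ler_pM.
  apply: le_trans (ler_normD _ _) _; apply: lerD.
    rewrite normrM ger0_norm ?invr_ge0// ler_wpM2l ?invr_ge0// ler0_norm.
      by rewrite lerN2 ler_ln ?posrE//; lra.
    by apply: ln_le0; rewrite gerBl sqr_ge0.
  rewrite normrM [X in _ * X]ger0_norm; last by rewrite invr_ge0 mulr_ge0// ltW.
  apply: ler_pM => //; first by rewrite invr_ge0 mulr_ge0// ltW.
    apply: le_trans (ler_normB _ _) _.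
    have : `|x ^+ 2 * (u ^+ 2 + v ^+ 2)| <= 1 * (B ^+ 2 + B ^+ 2).
      rewrite ger0_norm ?mulr_ge0 ?addr_ge0 ?sqr_ge0//.
      by clear -xx u2 v2 p; apply: ler_pM; rewrite ?addr_ge0 ?sqr_ge0//; lra.
    have : `|2 * x * (u * v)| <= 2 * B ^+ 2.
      rewrite normrM [`|2 * x|]ger0_norm ?mulr_ge0//; apply: ler_pM => //.
        by rewrite mulr_ge0.
      by have := ltW s1; lra.
    lra.
  by rewrite lef_pV2 ?posrE ?mulr_gt0//; lra.
pose A := expR E / (1 - s ^+ 2) ^+ 2 * ((4 + B ^+ 2 + B ^+ 2 + B ^+ 2 + B ^+ 2 + B ^+ 2 + 8) * C * 8).
have A0 : 0 <= A.
  rewrite /A mulr_ge0//; first by rewrite divr_ge0// ?expR_ge0// sqr_ge0.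
  by rewrite !mulr_ge0// !addr_ge0// sqr_ge0.
pose rho := (1 + d) * s.
have rho1 : 0 <= rho < 1.
  rewrite /rho mulr_ge0//=; last by lra.
  rewrite /d; nra.
have dbound M x u v : 0 <= x <= s -> `|u| <= B -> `|v| <= B ->
  `|expR (mehler_exponent x u v) / (1 - x ^+ 2) ^+ 2 *
   (x ^+ M * (- ((M%:R + 1) * c u v M.+1) - ((M%:R + 2) * c u v M.+2 - u * v * c u v M.+1) * x
  - ((M%:R + 3) * c u v M.+3 - u * v * c u v M.+2 -
      (2 * M%:R + 3 - (u ^+ 2 + v ^+ 2)) * c u v M.+1) * x ^+ 2
  + (M%:R + 1) * c u v M * x ^+ 3))| <= A * (M%:R * rho ^+ M + rho ^+ M).
  move=> xs uB vB; have Ex := expE x u v xs uB vB; have /andP[x0 xs'] := xs.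
  have xx : x ^+ 2 <= s ^+ 2 by rewrite ler_pXn2r ?nnegrE.
  have cb : forall k, (k <= 3)%N -> `|c u v (M + k)| <= C * (1 + d) ^+ M * 8.
    move=> k k3; apply: le_trans (HC u v _ uB vB) _.
    rewrite exprD mulrA ler_wpM2l ?mulr_ge0 ?exprn_ge0//; first (clear -d0; lra).
    apply: (@le_trans _ _ (2 ^+ k)); first by clear -d0 d1; apply: lerXn2r; rewrite ?nnegrE//; lra.
    by apply: (@le_trans _ _ (2 ^+ 3)); [by rewrite ler_weXn2l// ler1n|rewrite -natrX ler_nat].
  have := cb 0%N isT; have := cb 1%N isT; have := cb 2%N isT; have := cb 3%N isT.
  rewrite addn0 addn1 addn2 addn3.
  set W := C * _ * 8; have W0 : 0 <= W by clear -C0 d0; rewrite /W !mulr_ge0// exprn_ge0//; lra.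
  set c3 := c u v M.+3; set c2 := c u v M.+2; set c1 := c u v M.+1; set c0 := c u v M.
  move=> h3 h2 h1 h0.
  have u2 : `|u ^+ 2| <= B ^+ 2 by rewrite normrX ler_pXn2r ?nnegrE.
  have v2 : `|v ^+ 2| <= B ^+ 2 by rewrite normrX ler_pXn2r ?nnegrE.
  have uv : `|u * v| <= B ^+ 2 by rewrite normrM expr2 ler_pM.
  have x1 : x <= 1 := le_trans xs' (ltW s1).
  have nM : `|x| <= 1 by rewrite ger0_norm.
  have nb (y : R) n : `|y| <= 1 -> `|y ^+ n| <= 1 by move=> y1; rewrite normrX exprn_ile1.
  have m0 : 0 <= M%:R :> R by [].
  have B20 : 0 <= B ^+ 2 by exact: sqr_ge0.
  set bracket := (X in `|_ * (_ * X)|).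
  have bb : `|bracket| <= (4 + B ^+ 2 + B ^+ 2 + B ^+ 2 + B ^+ 2 + B ^+ 2 + 8) * (M%:R + 1) * W.
    have k1 : `|- ((M%:R + 1) * c1)| <= (M%:R + 1) * W.
      by rewrite normrN normrM ger0_norm ?ler_wpM2l//; lra.
    have k2 : `|((M%:R + 2) * c2 - u * v * c1) * x| <= (M%:R + 2) * W + B ^+ 2 * W.
      rewrite normrM -[leRHS]mulr1 ler_pM// (le_trans (ler_normB _ _))// lerD//.
        by rewrite normrM ger0_norm ?ler_wpM2l//; lra.
      by rewrite normrM ler_pM.
    have k3 : `|((M%:R + 3) * c3 - u * v * c2 - (2 * M%:R + 3 - (u ^+ 2 + v ^+ 2)) * c1) * x ^+ 2|
       <= (M%:R + 3) * W + B ^+ 2 * W + (2 * M%:R + 3 + (B ^+ 2 + B ^+ 2)) * W.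
      rewrite normrM -[leRHS]mulr1 ler_pM ?nb// (le_trans (ler_normB _ _))// lerD//.
        rewrite (le_trans (ler_normB _ _))// lerD//.
          by rewrite normrM ger0_norm ?ler_wpM2l//; lra.
        by rewrite normrM ler_pM.
      rewrite normrM ler_pM// (le_trans (ler_normB _ _))// lerD//.
        by rewrite ger0_norm//; lra.
      by rewrite (le_trans (ler_normD _ _))// lerD.
    have k4 : `|(M%:R + 1) * c0 * x ^+ 3| <= (M%:R + 1) * W.
      rewrite normrM -[leRHS]mulr1 ler_pM ?nb// normrM ger0_norm ?ler_wpM2l//; lra.
    rewrite /bracket (le_trans (ler_normD _ _))// (le_trans (lerD (le_trans (ler_normB _ _)
      (lerD (le_trans (ler_normB _ _) (lerD k1 k2)) k3)) k4))//.
    have -> : (M%:R + 1) * W + ((M%:R + 2) * W + B ^+ 2 * W) + ((M%:R + 3) * W + B ^+ 2 * W +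
      (2 * M%:R + 3 + (B ^+ 2 + B ^+ 2)) * W) + (M%:R + 1) * W =
      (6 * M%:R + 10 + 4 * B ^+ 2) * W by ring.
    by clear -W0 m0 B20; rewrite ler_wpM2r//; nra.
  clearbody bracket.
  have px : 0 < 1 - x ^+ 2 by rewrite (lt_le_trans p)// lerD2l lerN2.
  rewrite normrM /A.
  have -> : expR E / (1 - s ^+ 2) ^+ 2 * ((4 + B ^+ 2 + B ^+ 2 + B ^+ 2 + B ^+ 2 + B ^+ 2 + 8) * C * 8) *
    (M%:R * rho ^+ M + rho ^+ M) = (expR E / (1 - s ^+ 2) ^+ 2) *
    (s ^+ M * ((4 + B ^+ 2 + B ^+ 2 + B ^+ 2 + B ^+ 2 + B ^+ 2 + 8) * (M%:R + 1) * W)).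
    by rewrite /W /rho exprMn; ring.
  apply: ler_pM => //.
    rewrite ger0_norm; last by rewrite divr_ge0 ?expR_ge0// sqr_ge0.
    apply: ler_pM; rewrite ?expR_ge0 ?invr_ge0 ?sqr_ge0//.
      by rewrite ler_expR (le_trans (ler_norm _)).
    rewrite lef_pV2 ?posrE ?exprn_gt0//; apply: lerXn2r; rewrite ?nnegrE ?(ltW p) ?(ltW px)//.
    by rewrite lerD2l lerN2.
  rewrite normrM; apply: ler_pM => //.
  by rewrite normrX; apply: lerXn2r; rewrite ?nnegrE ?ger0_norm.
(* The first summand is dominated by the terms of a series whose partial sums [geo_deriv_sum_le]
   bounds, so it tends to [0]. *)
have cvg0 : (fun M => M%:R * rho ^+ M + rho ^+ M) @ \oo --> (0 : R).
  have /andP[r0 r1] := rho1.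
  rewrite -[0]addr0; apply: cvgD; last by apply: cvg_expr; rewrite ger0_norm.
  apply: cvg_series_cvg_0; apply: nondecreasing_is_cvgn.
    by apply: nondecreasing_series => n _ _; rewrite mulr_ge0// exprn_ge0.
  exists ((1 - rho)^-1 ^+ 2) => _ [n _ <-].
  rewrite /series/= big_mkord; apply: le_trans (geo_deriv_sum_le n rho1).
  apply: ler_sum => -[[|j] ?] _ /=; rewrite ?mul0r// ler_wpM2l//.
  by rewrite exprS ler_piMl ?exprn_ge0// ltW.
have e1 : 0 < e / (expR E * (A + 1)).
  by clear -e0 A0; rewrite divr_gt0// mulr_gt0 ?expR_gt0//; lra.
have [M0 _ HM] : \forall M \near \oo, `|M%:R * rho ^+ M + rho ^+ M| <= e / (expR E * (A + 1)).
  by have /cvgr0_norm_le := cvg0; exact.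
exists M0 => M /HM; rewrite /= => Msmall u v uB vB.
have m0 : 0 <= M%:R * rho ^+ M + rho ^+ M.
  by case/andP: rho1 => r0 _; rewrite addr_ge0 ?mulr_ge0 ?exprn_ge0.
rewrite ger0_norm// in Msmall.
rewrite mehler_sumE.
pose D x := (\sum_(j < M.+1) c u v j * x ^+ j) * expR (mehler_exponent x u v).
have D0 : D 0 = 1.
  have := mehler_s0 u v; have := mehler_sum_s0 1 u v M.
  rewrite mehler_sumE /mehler /D => -> /esym; rewrite mul1r expRN => H.
  by rewrite -[LHS]invrK -H invr1.
have Dd : `|D s - D 0| <= A * (M%:R * rho ^+ M + rho ^+ M).
  have [s00|sp] := eqVneq s 0; first by rewrite s00 subrr normr0 mulr_ge0.
  have sgt : 0 < s by rewrite lt_neqAle eq_sym sp.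
  have xs1 x : 0 <= x <= s -> `|x| < 1.
    by case/andP=> x0 xs; rewrite ger0_norm// (le_lt_trans xs).
  have dD x : x \in `]0, s[%R -> is_derive x 1 D ((fun x => expR (mehler_exponent x u v) / (1 - x ^+ 2) ^+ 2 *
   (x ^+ M * (- ((M%:R + 1) * c u v M.+1) - ((M%:R + 2) * c u v M.+2 - u * v * c u v M.+1) * x
  - ((M%:R + 3) * c u v M.+3 - u * v * c u v M.+2 -
      (2 * M%:R + 3 - (u ^+ 2 + v ^+ 2)) * c u v M.+1) * x ^+ 2
  + (M%:R + 1) * c u v M * x ^+ 3))) x).
    move=> /itvP xs; apply: (@mehler_sum_defect x u v M).
    by apply: xs1; rewrite !xs.
  have [|y ys ->] := MVT sgt dD.
    apply: derivable_within_continuous => x /itvP xs.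
    have /xs1 x1 : 0 <= x <= s by rewrite !xs.
    by have [] := mehler_sum_defect u v M x1.
  have {ys} ys : 0 <= y <= s by move/itvP: ys => ys; rewrite !ys.
  rewrite subr0 normrM -[leRHS]mulr1; apply: ler_pM => //; first exact: dbound.
  by rewrite ger0_norm// ltW.
have -> : \sum_(j < M.+1) c u v j * s ^+ j - mehler s u v = (D s - D 0) * mehler s u v.
  by rewrite D0 /D /mehler mulrBl mul1r -mulrA -expRD subrr expR0 mulr1.
have ME : `|mehler s u v| <= expR E.
  rewrite ger0_norm ?expR_ge0// ler_expR; apply: le_trans (ler_norm _) _.
  by rewrite normrN expE// s0 lexx.
rewrite normrM; apply: le_trans (ler_pM _ _ Dd ME) _ => //.
apply: (@le_trans _ _ (A * (e / (expR E * (A + 1))) * expR E)).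
  by rewrite ler_wpM2r ?expR_ge0// ler_wpM2l.
have -> : A * (e / (expR E * (A + 1))) * expR E = A / (A + 1) * e.
  by clear -A0; have eE := expR_gt0 E; field; rewrite !gt_eqF//; lra.
by clear -A0 e0; rewrite ger_pMl// ler_pdivrMr; lra.
Qed.
End mehler.

(** * Orthonormal expansions and resolvents *)

Section completeness.
Context d (T : measurableType d) (R : realType) (m : probability T R).
Implicit Types (f g : T -> R) (u v : nat -> T -> R).

Lemma Ex_sqr_norm f : sqi m f -> Ex m (fun x => `|f x|) ^+ 2 <= Ex m (fun x => f x ^+ 2).
Proof.
move=> sf; have sn : sqi m (fun x => `|f x|).
  apply: (sqi_le _ _ sf) => [|x]; last by rewrite normr_id.
  exact: measurableT_comp (sqi_meas sf).
apply: le_trans (Ex_sqr_le sn) _; rewrite le_eqVlt; apply/orP; left; apply/eqP.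
by congr (Ex m _); apply/funext => x; rewrite real_normK ?num_real.
Qed.

(** The increments have summable L^1 norms, so the sum of their absolute values is integrable, hence
    finite almost everywhere, and the telescoping series converges absolutely there. *)
Lemma ae_cvg_of_summable u : (forall n, intg m (u n)) ->
  (forall n, Ex m (fun x => `|u n.+1 x - u n x|) <= 2^-1 ^+ n) ->
  {ae m, forall x, cvgn (u ^~ x)}.
Proof.
move=> Iu uE; pose D n x : R := `|u n.+1 x - u n x|.
have ID n : intg m (D n) by apply: intg_norm; apply: intgB.
have mD n : measurable_fun setT (EFin \o D n) by exact/measurable_EFinP/(intg_meas (ID n)).
have D0 n x : (0 <= (D n x)%:E)%E by rewrite lee_fin; exact: normr_ge0.
pose G x : \bar R := (\sum_(0 <= n <oo) (D n x)%:E)%E.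
have mG : measurable_fun setT G.
  apply: (@ge0_emeasurable_sum _ _ _ _ (fun n => EFin \o D n) xpredT) => // n x _ _.
  exact: D0.
have IG : m.-integrable setT G.
  apply/integrableP; split => //.
  under eq_integral do rewrite gee0_abs ?nneseries_ge0//.
  have -> : (\int[m]_x G x = \sum_(n <oo) \int[m]_x (D n x)%:E)%E.
    apply: (@integral_nneseries _ _ _ m setT measurableT (fun n => EFin \o D n)) => // n x _.
    exact: D0.
  apply: (@le_lt_trans _ _ (2%:E)%E); last exact: ltry.
  apply: lime_le.
    by apply: is_cvg_nneseries => n _ _; apply: integral_ge0.
  apply: nearW => n; rewrite big_mkord.
  under eq_bigr do rewrite -(ExE (ID _)).
  rewrite sumEFin lee_fin; apply: (@le_trans _ _ (\sum_(i < n) 2^-1 ^+ i)).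
    by apply: ler_sum => i _; exact: uE.
  apply: le_trans (geo_sum_le _ _) _; first by lra.
  by rewrite le_eqVlt; apply/orP; left; apply/eqP; field.
have := integrable_ae measurableT IG; apply: filterS => x /(_ I) Gfin.
have : cvgn [normed series (fun n => u n.+1 x - u n x)].
  apply: nondecreasing_is_cvgn.
    by apply: nondecreasing_series => n _ _; exact: normr_ge0.
  exists (fine (G x)) => _ [n _ <-]; rewrite -lee_fin fineK//=.
  rewrite /series /= -sumEFin.
  by apply: (@nneseries_lim_ge _ (fun n => (D n x)%:E) xpredT 0%N n) => k _ _; exact: D0.
move=> /normed_cvg H.
rewrite (_ : u ^~ x = (fun n => u 0%N x + series (fun n => u n.+1 x - u n x) n)).
  by apply: is_cvgD => //; exact: is_cvg_cst.
apply/funext => n; rewrite /series /= telescope_sumr// addrC subrK //.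
Qed.

Lemma fatou_sqr u f (e : R) : (forall n, sqi m (u n)) -> measurable_fun setT f ->
  {ae m, forall x, u ^~ x @ \oo --> f x} ->
  (forall n, Ex m (fun x => u n x ^+ 2) <= e) -> sqi m f /\ Ex m (fun x => f x ^+ 2) <= e.
Proof.
move=> su mf uf ue.
have mu n : measurable_fun setT (EFin \o (fun x => u n x ^+ 2)).
  by apply/measurable_EFinP; exact: (intg_meas (sqi_sq (su n))).
have H : (\int[m]_x ((f x) ^+ 2)%:E <= e%:E)%E.
  rewrite (ae_eq_integral (fun x => limn_einf (fun n => ((u n x) ^+ 2)%:E)))//; last 3 first.
  - by apply/measurable_EFinP; exact: measurable_funX.
  - rewrite /limn_einf; apply: measurableT_comp => //.
    apply: measurable_fun_limn_esup => n; apply: measurableT_comp => //; exact: mu.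
  - apply: filterS uf => x ufx _.
    have c2 : ((u n x ^+ 2)%:E @[n --> \oo] --> (f x ^+ 2)%:E)%E.
      apply: cvg_EFin; first exact: nearW.
      rewrite /comp /= (_ : (fun n => u n x ^+ 2) = (fun n => u n x * u n x)).
        by rewrite expr2; exact: cvgM.
      by apply/funext => n; rewrite expr2.
    by have [-> _] := cvg_limn_einf_sup c2.
  apply: le_trans (fatou m measurableT mu _) _ => [n x _|]; first by rewrite lee_fin sqr_ge0.
  rewrite limn_einf_lim; apply: lime_le; first exact: is_cvg_einfs.
  apply: nearW => n; apply: le_trans (_ : _ <= \int[m]_x (u n x ^+ 2)%:E)%E _.
    by apply: ereal_inf_lbound; exists n => /=.
  by rewrite -(ExE (sqi_sq (su n))) lee_fin.
have If : intg m (fun x => f x ^+ 2).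
  apply/integrableP; split; first by apply/measurable_EFinP; exact: measurable_funX.
  under eq_integral do rewrite /= ger0_norm ?sqr_ge0//.
  exact: le_lt_trans H (ltry _).
split => //; by rewrite -lee_fin ExE.
Qed.

(** Riesz-Fischer: a subsequence with geometrically small increments converges almost everywhere,
    and Fatou's lemma transfers the Cauchy estimate to its limit. *)
Lemma L2_complete u : (forall n, sqi m (u n)) ->
  (forall e, 0 < e -> exists N, forall i j, (N <= i)%N -> (N <= j)%N ->
     Ex m (fun x => (u i x - u j x) ^+ 2) <= e) ->
  exists f, sqi m f /\ forall e, 0 < e -> exists N, forall n, (N <= n)%N ->
     Ex m (fun x => (f x - u n x) ^+ 2) <= e.
Proof.
move=> su cau.
have e0 n : 0 < (4^-1 ^+ n : R) by rewrite exprn_gt0.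
pose N n := projT1 (cid (cau _ (e0 n))).
have NP n i j : (N n <= i)%N -> (N n <= j)%N ->
    Ex m (fun x => (u i x - u j x) ^+ 2) <= 4^-1 ^+ n.
  by rewrite /N; case: cid => k /= H; exact: H.
(* The sum puts consecutive indices past the threshold for [4^-1 ^+ n], whose square root bounds the
   L^1 norm of the increment; the summand [n] makes [phi] cofinal, as Fatou's lemma is applied below
   to a shifted tail. *)
pose phi n := (n + \sum_(i < n.+1) N i)%N.
have phiN n : (N n <= phi n)%N by rewrite /phi big_ord_recr /= addnA leq_addl.
have phiS n : (N n <= phi n.+1)%N.
  by rewrite /phi big_ord_recr /= big_ord_recr /=; lia.
pose v n := u (phi n).
have aev : {ae m, forall x, cvgn (v ^~ x)}.
  apply: ae_cvg_of_summable => n; first exact: (sqi_intg (su _)).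
  rewrite -(@ler_pXn2r _ 2)// ?nnegrE ?exprn_ge0//; last by apply: Ex_ge0 => x.
  apply: le_trans (Ex_sqr_norm (sqiB (su _) (su _))) _.
  apply: le_trans (NP n _ _ (phiS n) (phiN n)) _.
  by rewrite -exprM mulnC exprM; apply: lerXn2r; rewrite ?nnegrE ?exprn_ge0//; lra.
(* The limit superior is measurable and defined everywhere, and it agrees with the limit wherever
   the latter exists. *)
pose f x := fine (limn_esup (fun n => (v n x)%:E)).
have mf : measurable_fun setT f.
  apply: measurableT_comp => //; apply: measurable_fun_limn_esup => n.
  by apply/measurable_EFinP; exact: (sqi_meas (su _)).
have fv : {ae m, forall x, v ^~ x @ \oo --> f x}.
  apply: filterS aev => x /cvg_ex[l vl]; rewrite /f.
  have c2 : ((v n x)%:E @[n --> \oo] --> l%:E)%E by apply: cvg_EFin => //; exact: nearW.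
  by have [_ ->] := cvg_limn_einf_sup c2.
have step e : 0 < e -> exists N0, forall n, (N0 <= n)%N ->
    sqi m (fun x => f x - u n x) /\ Ex m (fun x => (f x - u n x) ^+ 2) <= e.
  move=> ep; have [N0 HN] := cau e ep; exists N0 => n Nn.
  apply: (@fatou_sqr (fun i x => v (i + N0)%N x - u n x)).
  - by move=> i; exact: (sqiB (su _) (su _)).
  - by apply: measurable_funB => //; exact: sqi_meas.
  - apply: filterS fv => x fvx; apply: cvgB; last exact: cvg_cst.
    by move: fvx; rewrite -(cvg_shiftn N0).
  - by move=> i; apply: HN => //; rewrite /phi; lia.
exists f; split; last by move=> e /step[N0 H]; exists N0 => n /H[].
have [N0 /(_ _ (leqnn N0)) [H _]] := step 1 ltr01.
have := sqiD H (su N0); apply: sqi_ae => //.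
by apply: nearW => x _; rewrite subrK.
Qed.
End completeness.

Section orthonormal.
Context d (T : measurableType d) (R : realType) (m : probability T R).
Implicit Types (f g : T -> R) (e : nat -> T -> R).

Lemma orthonormal_sqi e k : orthonormal_basis m e -> sqi m (e k).
Proof. by case=> /(_ k)/L2P. Qed.

Lemma orthonormal_orth e j k : orthonormal_basis m e -> j != k ->
  Ex m (fun x => e j x * e k x) = 0.
Proof. by case=> _ + _ _ => /[apply]. Qed.

Lemma orthonormal_norm e k : orthonormal_basis m e ->
  Ex m (fun x => e k x ^+ 2) = 1 \/ ae_eq m setT (e k) (cst 0).
Proof. by case=> _ _ /(_ k). Qed.

Lemma orthonormal_complete e f : orthonormal_basis m e -> sqi m f ->
  (forall k, Ex m (fun x => f x * e k x) = 0) -> ae_eq m setT f (cst 0).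
Proof. by move=> [_ _ _ H] /L2P sf /(H _ sf). Qed.

Lemma orthonormal_norm_le1 e k : orthonormal_basis m e -> Ex m (fun x => e k x ^+ 2) <= 1.
Proof.
move=> oe; case: (orthonormal_norm k oe) => [->//|H].
rewrite (_ : Ex m _ = 0)// -(Ex_cst m 0); apply: Ex_ae => //.
  exact: (intg_meas (sqi_sq (orthonormal_sqi k oe))).
by apply: filterS H => x /= h xT; rewrite h// expr0n.
Qed.

Lemma orthonormal_ext e e' : (forall k, measurable_fun setT (e' k)) ->
  (forall k, ae_eq m setT (e k) (e' k)) ->
  orthonormal_basis m e -> orthonormal_basis m e'.
Proof.
move=> me ee [H1 H2 H3 H4].
have se k : sqi m (e k) by exact/L2P.
have se' k : sqi m (e' k) by apply: sqi_ae (se k).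
split.
- by move=> k; apply/L2P.
- move=> j k jk; rewrite -(H2 j k jk); apply: Ex_ae.
  + exact: (intg_meas (sqi_intgM (se' j) (se' k))).
  + exact: (intg_meas (sqi_intgM (se j) (se k))).
  + by apply: filterS2 (ee j) (ee k) => x /= h1 h2 xT; rewrite h1// h2.
- move=> k; case: (H3 k) => [H|H]; [left|right].
    rewrite -H; apply: Ex_ae; [exact: (intg_meas (sqi_sq (se' k)))|exact: (intg_meas (sqi_sq (se k)))|].
    by apply: filterS (ee k) => x /= h xT; rewrite h.
  by apply: filterS2 (ee k) H => x /= h1 h2 xT; rewrite -h1// h2.
- move=> f /L2P sf fe; apply: H4; first exact/L2P.
  move=> k; rewrite -(fe k); apply: Ex_ae.
  + exact: (intg_meas (sqi_intgM sf (se k))).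
  + exact: (intg_meas (sqi_intgM sf (se' k))).
  + by apply: filterS (ee k) => x /= h xT; rewrite h.
Qed.

Section finite_expansion.
Context (I : finType) (phi : I -> T -> R).
Hypothesis sphi : forall i, sqi m (phi i).
Hypothesis ophi : forall i j, i != j -> Ex m (fun x => phi i x * phi j x) = 0.
Hypothesis nphi : forall i, Ex m (fun x => phi i x ^+ 2) = 1 \/ ae_eq m setT (phi i) (cst 0).

Lemma Ex_sqr_sum_orth (c : I -> R) :
  Ex m (fun x => (\sum_i c i * phi i x) ^+ 2) = \sum_i c i ^+ 2 * Ex m (fun x => phi i x ^+ 2).
Proof.
have -> : (fun x => (\sum_i c i * phi i x) ^+ 2) =
    (fun x => \sum_i \sum_j (c i * c j) * (phi i x * phi j x)).
  apply/funext => x; rewrite expr2 mulr_suml; apply: eq_bigr => i _.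
  by rewrite mulr_sumr; apply: eq_bigr => j _; ring.
rewrite Ex_sum; last first.
  by move=> i _; apply: intg_sum => j _; apply: intgZ; exact: sqi_intgM.
apply: eq_bigr => i _; rewrite Ex_sum; last by move=> j _; apply: intgZ; exact: sqi_intgM.
rewrite (bigD1 i)//= big1 ?addr0.
  rewrite ExZ; last exact: sqi_intgM.
  by rewrite -expr2.
by move=> j ji; rewrite ExZ ?ophi ?mulr0// 1?eq_sym//; exact: sqi_intgM.
Qed.

(** Against a padding vector the coefficient is already [0], so multiplying it by the squared norm,
    [0] or [1], changes nothing. *)
Lemma Ex_proj f i : sqi m f ->
  Ex m (fun x => f x * phi i x) * Ex m (fun x => phi i x ^+ 2) = Ex m (fun x => f x * phi i x).
Proof.
move=> sf; case: (nphi i) => [->|H]; first by rewrite mulr1.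
rewrite (_ : Ex m (fun x => f x * phi i x) = 0) ?mul0r//.
rewrite -(Ex_cst m 0); apply: Ex_ae => //; first exact: (intg_meas (sqi_intgM sf (sphi i))).
by apply: filterS H => x /= h xT; rewrite h// mulr0.
Qed.

Lemma Ex_sqr_sub_proj f : sqi m f ->
  Ex m (fun x => (f x - \sum_i Ex m (fun x => f x * phi i x) * phi i x) ^+ 2) =
  Ex m (fun x => f x ^+ 2) - \sum_i Ex m (fun x => f x * phi i x) ^+ 2.
Proof.
move=> sf; set c := fun i => Ex m (fun x => f x * phi i x).
have sS : sqi m (fun x => \sum_i c i * phi i x) by apply: sqi_sum => i _; exact: sqiZ.
have -> : (fun x => (f x - \sum_i c i * phi i x) ^+ 2) =
   (fun x => f x ^+ 2 - (2 * (f x * \sum_i c i * phi i x)) + (\sum_i c i * phi i x) ^+ 2).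
  by apply/funext => x; ring.
have I1 := sqi_intgM sf sS.
rewrite ExD; [|apply: intgB; [exact: sqi_sq|exact: intgZ]|exact: sqi_sq].
rewrite ExB; [|exact: sqi_sq|exact: intgZ].
rewrite ExZ// Ex_sqr_sum_orth.
have -> : Ex m (fun x => f x * \sum_i c i * phi i x) = \sum_i c i ^+ 2.
  rewrite (_ : (fun x => f x * \sum_i c i * phi i x) = (fun x => \sum_i c i * (f x * phi i x))).
    rewrite Ex_sum => [|i _]; last by apply: intgZ; exact: sqi_intgM.
    by apply: eq_bigr => i _; rewrite ExZ//; exact: sqi_intgM.
  by apply/funext => x; rewrite mulr_sumr; apply: eq_bigr => i _; rewrite mulrCA.
have -> : \sum_i c i ^+ 2 * Ex m (fun x => phi i x ^+ 2) = \sum_i c i ^+ 2.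
  by apply: eq_bigr => i _; rewrite expr2 -mulrA Ex_proj.
ring.
Qed.

Lemma bessel f : sqi m f -> \sum_i Ex m (fun x => f x * phi i x) ^+ 2 <= Ex m (fun x => f x ^+ 2).
Proof.
move=> sf; rewrite -subr_ge0 -Ex_sqr_sub_proj//.
by apply: Ex_ge0 => x; exact: sqr_ge0.
Qed.
End finite_expansion.

(** The squared norm of [e k] appears in the coefficients because a padding vector loses its
    coefficient, whatever [c k] is. *)
Lemma orthonormal_sum e (c : nat -> R) (B : R) : orthonormal_basis m e ->
  (forall n, \sum_(k < n) c k ^+ 2 <= B) ->
  exists f, [/\ sqi m f, forall k, Ex m (fun x => f x * e k x) = c k * Ex m (fun x => e k x ^+ 2)
   & forall eps, 0 < eps -> exists N, forall n, (N <= n)%N ->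
     Ex m (fun x => (f x - \sum_(k < n) c k * e k x) ^+ 2) <= eps].
Proof.
move=> oe cB; have se k := orthonormal_sqi k oe.
have o1 j k := @orthonormal_orth e j k oe.
pose u n x := \sum_(k < n) c k * e k x.
have su n : sqi m (u n) by apply: sqi_sum => k _; exact: sqiZ.
have z1 k := orthonormal_norm_le1 k oe.
pose a n := \sum_(k < n) c k ^+ 2.
have acvg : cvgn a.
  apply: nondecreasing_is_cvgn; last by exists B => _ [n _ <-]; exact: cB.
  apply/nondecreasing_seqP => n; rewrite /a big_ord_recr lerDl sqr_ge0 //.
have tail i j : (i <= j)%N -> Ex m (fun x => (u j x - u i x) ^+ 2) <= a j - a i.
  move=> ij.
  have split_sum (F : nat -> R) : \sum_(k < j) F k - \sum_(k < i) F k = \sum_(k < j - i) F (k + i)%N.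
    rewrite -!(big_mkord xpredT) (@big_cat_nat _ _ _ i)//= addrAC subrr add0r.
    by rewrite -{1}[i]add0n big_addn big_mkord.
  have -> : (fun x => (u j x - u i x) ^+ 2) =
     (fun x => (\sum_(k < j - i) c (k + i)%N * e (k + i)%N x) ^+ 2).
    by apply/funext => x; rewrite /u (split_sum (fun k => c k * e k x)).
  rewrite (@Ex_sqr_sum_orth _ (fun k : 'I_(j - i) => e (k + i)%N))//; last first.
    by move=> p q pq; apply: o1; rewrite eqn_add2r.
  rewrite /a (split_sum (fun k => c k ^+ 2)); apply: ler_sum => k _.
  by rewrite ler_piMr ?sqr_ge0.
have cau eps : 0 < eps -> exists N, forall i j, (N <= i)%N -> (N <= j)%N ->
     Ex m (fun x => (u i x - u j x) ^+ 2) <= eps.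
  move=> ep; have e2 : 0 < eps / 2 by lra.
  have [N _ HN] : \forall n \near \oo, `|limn a - a n| < eps / 2.
    by move/cvgrPdist_lt: acvg => /(_ _ e2).
  exists N => i j Ni Nj.
  wlog ij : i j Ni Nj / (j <= i)%N.
    move=> H; have [/H|/ltnW ij] := leqP j i; first exact.
    rewrite (_ : (fun x => (u i x - u j x) ^+ 2) = (fun x => (u j x - u i x) ^+ 2)); first exact: H.
    by apply/funext => x; rewrite -sqrrN opprB.
  apply: le_trans (tail _ _ ij) _.
  have := HN _ Ni; have := HN _ Nj; rewrite /= => /ltr_normlW ? /ltrNnormlW ?; lra.
have [f [sf Hf]] := L2_complete su cau.
exists f; split => // k.
apply/eqP; rewrite -subr_eq0 -normr_le0; apply/ler_addgt0Pr => eps ep; rewrite add0r.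
have [N HN] := Hf (eps ^+ 2) ltac:(by rewrite exprn_gt0).
pose n := maxn N k.+1; have kn : (k < n)%N by rewrite leq_max leqnn orbT.
have Iue := sqi_intgM (su n) (se k).
have uk : Ex m (fun x => u n x * e k x) = c k * Ex m (fun x => e k x ^+ 2).
  rewrite /u (_ : (fun x => _) = (fun x => \sum_(j < n) c j * (e j x * e k x))); last first.
    by apply/funext => x; rewrite mulr_suml; apply: eq_bigr => j _; rewrite mulrA.
  rewrite Ex_sum => [|j _]; last by apply: intgZ; exact: sqi_intgM.
  rewrite (bigD1 (Ordinal kn))//= big1 => [|j jk].
    by rewrite addr0 ExZ//; exact: sqi_intgM.
  by rewrite ExZ ?o1 ?mulr0//; exact: sqi_intgM.
rewrite -uk -ExB//; last exact: sqi_intgM.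
rewrite (_ : (fun x => _) = (fun x => (f x - u n x) * e k x)); last first.
  by apply/funext => x; rewrite mulrBl.
rewrite -(@ler_pXn2r _ 2) ?nnegrE ?(ltW ep)//.
rewrite real_normK ?num_real//.
apply: le_trans (cauchy_schwarz (sqiB sf (su n)) (se k)) _.
rewrite -[leRHS]mulr1; apply: ler_pM => //.
- by apply: Ex_ge0 => x; exact: sqr_ge0.
- by apply: Ex_ge0 => x; exact: sqr_ge0.
- by apply: HN; rewrite leq_maxl.
Qed.

(** The sum [g] of the expansion of [f] has the same coefficients as [f], hence equals it by
    completeness; the claim is then the convergence of the partial sums to [g]. *)
Lemma parseval e f : orthonormal_basis m e -> sqi m f ->
  forall eps, 0 < eps -> exists N, forall n, (N <= n)%N ->
  Ex m (fun x => f x ^+ 2) - \sum_(k < n) Ex m (fun x => f x * e k x) ^+ 2 <= eps.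
Proof.
move=> oe sf; have se k := orthonormal_sqi k oe.
have o1 j k := @orthonormal_orth e j k oe; have o2 k := orthonormal_norm k oe.
have proj n := @Ex_sqr_sub_proj 'I_n (fun k => e k) (fun k => se k) (fun i j => @o1 i j) (fun k => o2 k) f sf.
have bes n := @bessel 'I_n (fun k => e k) (fun k => se k) (fun i j => @o1 i j) (fun k => o2 k) f sf.
have [g [sg gc Hg]] := @orthonormal_sum e (fun k => Ex m (fun x => f x * e k x)) _ oe bes.
have fg : ae_eq m setT f g.
  have : ae_eq m setT (fun x => f x - g x) (cst 0).
    apply: (orthonormal_complete oe); first exact: sqiB.
    move=> k; have := ExB (sqi_intgM sf (se k)) (sqi_intgM sg (se k)).
    have := @Ex_proj 'I_1 (fun=> e k) (fun=> se k) (fun=> o2 k) f ord0 sf.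
    rewrite gc => -> ; rewrite subrr => H; rewrite -[RHS]H; congr Rintegral.
    by apply/funext => x; rewrite mulrBl.
  by apply: filterS => x /= /[apply]/eqP; rewrite subr_eq0 => /eqP.
move=> eps /Hg[N HN]; exists N => n /HN; rewrite -(proj n).
congr (_ <= _); apply: (@Ex_ae _ _ _ m).
- apply: measurable_funX; apply: (@sqi_meas _ _ _ m); apply: sqiB => //.
  by apply: sqi_sum => i _; exact: sqiZ.
- apply: measurable_funX; apply: (@sqi_meas _ _ _ m); apply: sqiB => //.
  by apply: sqi_sum => i _; exact: sqiZ.
- by apply: filterS fg => x /= h xT; rewrite h.
Qed.
End orthonormal.

(** * Product bases, square-integrable kernels and their truncations *)

Section tensor_basis.
Context d1 d2 (T1 : measurableType d1) (T2 : measurableType d2) (R : realType).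
Variables (P : probability T1 R) (Q : probability T2 R).
Implicit Types (F : T1 * T2 -> R) (a : nat -> T1 -> R) (b : nat -> T2 -> R).

(** Pairs of indices are enumerated by [pickle]; an index that codes no pair carries the zero
    vector, which [orthonormal_basis] tolerates. *)
Definition tensor a b (k : nat) (z : T1 * T2) : R :=
  if pickle_inv k is Some pq then a pq.1 z.1 * b pq.2 z.2 else 0.

Lemma Ex_sqr_section_eq0 F : sqi (P \x Q)%E F ->
  {ae Q, forall y, ae_eq P setT (fun x => F (x, y)) (cst 0)} ->
  ae_eq (P \x Q)%E setT F (cst 0).
Proof.
move=> sF aeF; apply: Ex_sqr_eq0 => //.
have [I2 <-] := fubini2 (sqi_sq sF).
rewrite -[RHS](Ex_cst Q 0); apply: Ex_ae => //; first exact: intg_meas I2.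
have mF y : measurable_fun setT (fun x => F (x, y)).
  by apply: measurableT_comp (sqi_meas sF) _; exact: measurable_pair2.
apply: filterS aeF => y aey _ /=; rewrite -[RHS](Ex_cst P 0); apply: Ex_ae => //.
  exact: measurable_funX.
by apply: filterS aey => x h xT; rewrite h// expr0n.
Qed.

Lemma sqi_section F : sqi (P \x Q)%E F -> {ae Q, forall y, sqi P (fun x => F (x, y))}.
Proof.
move=> sF; have := intg_section2 (sqi_sq sF); apply: filterS => y Iy; split => //.
by apply: measurableT_comp (sqi_meas sF) _; exact: measurable_pair2.
Qed.

(** The bound holds only almost everywhere while [Ex_le] compares everywhere, hence the corrected
    versions [h'] and [g']. *)
Lemma sqi_of_le (h g : T2 -> R) : measurable_fun setT h -> intg Q g ->
  {ae Q, forall y, h y ^+ 2 <= g y} -> sqi Q h /\ Ex Q (fun y => h y ^+ 2) <= Ex Q g.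
Proof.
move=> mh Ig hg; have mg := intg_meas Ig.
pose h' y := Num.min (h y ^+ 2) `|g y|.
have mh' : measurable_fun setT h'.
  by apply: measurable_minr; [exact: measurable_funX|exact: measurableT_comp].
have Ih' : intg Q h'.
  apply: (intg_le mh' _ (intg_norm Ig)) => y.
  by rewrite ger0_norm ?ge_min ?lexx ?orbT// le_min sqr_ge0 normr_ge0.
have hh' : ae_eq Q setT h' (fun y => h y ^+ 2).
  apply: filterS hg => y hgy _; rewrite /h'; apply/min_idPl.
  by rewrite (le_trans hgy)// ler_norm.
have Ih : intg Q (fun y => h y ^+ 2) by apply: intg_ae Ih' => //; exact: measurable_funX.
split => //; rewrite -(Ex_ae mh' (intg_meas Ih) hh').
pose g' y := Num.max (h' y) (g y).
have mg' : measurable_fun setT g' by apply: measurable_maxr.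
have gg' : ae_eq Q setT g g'.
  apply: filterS hg => y hgy _; rewrite /g'; apply/esym/max_idPr.
  by rewrite (le_trans _ hgy)// ge_min lexx.
rewrite (Ex_ae mg mg' gg'); apply: Ex_le => //; first exact: intg_ae Ig.
by move=> y; rewrite /g' le_max lexx.
Qed.

Lemma kernel_sqi F (f : T1 -> R) : sqi (P \x Q)%E F -> sqi P f ->
  sqi Q (fun y => Ex P (fun x => f x * F (x, y))) /\
  Ex Q (fun y => Ex P (fun x => f x * F (x, y)) ^+ 2) <=
    Ex P (fun x => f x ^+ 2) * Ex (P \x Q)%E (fun z => F z ^+ 2).
Proof.
move=> sF sf.
have IfF : intg (P \x Q)%E (fun z => (f z.1 * cst 1 z.2) * F z).
  by apply: sqi_intgM => //; apply: sqi_tensor => //; exact: sqi_cst.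
have [I1 _] := fubini2 IfF.
have I1' : intg Q (fun y => Ex P (fun x => f x * F (x, y))).
  apply: intg_ext I1 => y; congr Rintegral; apply/funext => x /=.
  by rewrite mulr1.
have [I2 E2] := fubini2 (sqi_sq sF).
have -> : Ex P (fun x => f x ^+ 2) * Ex (P \x Q)%E (fun z => F z ^+ 2) =
   Ex Q (fun y => Ex P (fun x => f x ^+ 2) * Ex P (fun x => F (x, y) ^+ 2)).
  by rewrite ExZ// E2.
apply: sqi_of_le; [exact: intg_meas I1'|exact: intgZ|].
by apply: filterS (sqi_section sF) => y sy; exact: cauchy_schwarz.
Qed.

Lemma kernel_Ex F (f : T1 -> R) (g : T2 -> R) : sqi (P \x Q)%E F -> sqi P f -> sqi Q g ->
  Ex Q (fun y => Ex P (fun x => f x * F (x, y)) * g y) =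
  Ex (P \x Q)%E (fun z => F z * (f z.1 * g z.2)).
Proof.
move=> sF sf sg; have [sk _] := kernel_sqi sF sf.
have IF : intg (P \x Q)%E (fun z => F z * (f z.1 * g z.2)).
  by apply: sqi_intgM => //; exact: sqi_tensor.
have [I2 <-] := fubini2 IF; apply: Ex_ae.
- exact: (intg_meas (sqi_intgM sk sg)).
- exact: intg_meas I2.
apply: filterS (sqi_section sF) => y sy _ /=; rewrite mulrC -ExZ; last exact: sqi_intgM.
by congr Rintegral; apply/funext => x; ring.
Qed.

Lemma tensor_basis a b : orthonormal_basis P a -> orthonormal_basis Q b ->
  orthonormal_basis (P \x Q)%E (tensor a b).
Proof.
move=> oa ob; have sa k := orthonormal_sqi k oa; have sb k := orthonormal_sqi k ob.
have st k : sqi (P \x Q)%E (tensor a b k).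
  rewrite /tensor; case: pickle_inv => [[p q]|]; last exact: sqi_cst.
  exact: sqi_tensor.
have prodE k j k' j' : Ex (P \x Q)%E (fun z => (a k z.1 * b j z.2) * (a k' z.1 * b j' z.2)) =
   Ex P (fun x => a k x * a k' x) * Ex Q (fun y => b j y * b j' y).
  have [_ <-] := intg_tensor (sqi_intgM (sa k) (sa k')) (sqi_intgM (sb j) (sb j')).
  by congr Rintegral; apply/funext => z; rewrite mulrACA.
split.
- by move=> k; apply/L2P.
- move=> j k jk; transitivity (Ex (P \x Q)%E (fun z => tensor a b j z * tensor a b k z)) => //.
  rewrite /tensor; case Ej : (pickle_inv j) => [[p q]|]; last first.
    by rewrite -[RHS](Ex_cst (P \x Q)%E 0); congr Rintegral; apply/funext => z; rewrite mul0r.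
  case Ek : (pickle_inv k) => [[p' q']|]; last first.
    by rewrite -[RHS](Ex_cst (P \x Q)%E 0); congr Rintegral; apply/funext => z; rewrite mulr0.
  rewrite /= prodE; have [pp|pp] := eqVneq p p'; last by rewrite (orthonormal_orth oa)// mul0r.
  have [qq|qq] := eqVneq q q'; last by rewrite (orthonormal_orth ob)// mulr0.
  have k0 : pickle (p', q') = k by have := @pickle_invK (nat * nat)%type k; rewrite Ek.
  have j0 : pickle (p, q) = j by have := @pickle_invK (nat * nat)%type j; rewrite Ej.
  by move: jk; rewrite -j0 -k0 pp qq eqxx.
- move=> k.
  have [H|H] : Ex (P \x Q)%E (fun z => tensor a b k z ^+ 2) = 1 \/
     Ex (P \x Q)%E (fun z => tensor a b k z ^+ 2) = 0; last 2 first.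
  + by left.
  + by right; exact: Ex_sqr_eq0.
  rewrite /tensor; case Ek : (pickle_inv k) => [[p q]|]; last first.
    by right; rewrite -[RHS](Ex_cst (P \x Q)%E 0); congr Rintegral; apply/funext => z; rewrite expr0n.
  have -> : Ex (P \x Q)%E (fun z => (a p z.1 * b q z.2) ^+ 2) =
     Ex P (fun x => a p x ^+ 2) * Ex Q (fun y => b q y ^+ 2).
    have [_ <-] := intg_tensor (sqi_sq (sa p)) (sqi_sq (sb q)).
    by congr Rintegral; apply/funext => z; rewrite exprMn.
  have null d (T : measurableType d) (m : probability T R) (e : nat -> T -> R) i :
      sqi m (e i) -> ae_eq m setT (e i) (cst 0) -> Ex m (fun x => e i x ^+ 2) = 0.
    move=> se H; rewrite -[RHS](Ex_cst m 0); apply: Ex_ae => //.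
      exact: (intg_meas (sqi_sq se)).
    by apply: filterS H => x /= h xT; rewrite h// expr0n.
  case: (orthonormal_norm p oa) => [->|H]; last by right; rewrite null ?mul0r.
  case: (orthonormal_norm q ob) => [->|H]; first by left; rewrite mulr1.
  by right; rewrite [X in _ * X]null ?mulr0.
- move=> F /L2P sF HF; apply: Ex_sqr_section_eq0 => //.
  (* Completeness in two stages: integrating [F] against [a p] gives a function of [y] orthogonal to
     every [b q]; off a countable union of null sets the section of [F] is then orthogonal to every
     [a p]. *)
  have hp p : ae_eq Q setT (fun y => Ex P (fun x => a p x * F (x, y))) (cst 0).
    have [sh _] := kernel_sqi sF (sa p).
    apply: (orthonormal_complete ob) => // q; rewrite kernel_Ex//.
    rewrite -[RHS](HF (pickle (p, q))) /Ex; congr Rintegral; apply/funext => z.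
    by rewrite /tensor pickleK_inv.
  have hall : {ae Q, forall y, forall p, Ex P (fun x => a p x * F (x, y)) = 0}.
    by apply: ae_foralln => p; apply: filterS (hp p) => y; exact.
  apply: filterS2 (sqi_section sF) hall => y sy hy.
  apply: (orthonormal_complete oa) => // p; rewrite -[RHS](hy p).
  by congr Rintegral; apply/funext => x; rewrite mulrC.
Qed.

Lemma intg_swap F : intg (P \x Q)%E F ->
  intg (Q \x P)%E (fun z => F (z.2, z.1)) /\
  Ex (Q \x P)%E (fun z => F (z.2, z.1)) = Ex (P \x Q)%E F.
Proof.
move=> IF.
have mS : measurable_fun setT (fun z : T2 * T1 => F (z.2, z.1)).
  apply: (measurableT_comp (intg_meas IF)).
  by apply: measurable_fun_pair; [exact: measurable_snd|exact: measurable_fst].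
have In := intg_norm IF; have [J1 J2] := fubini2 In.
have IS : intg (Q \x P)%E (fun z => F (z.2, z.1)).
  apply: (intg_le mS (g := fun z => `|F (z.2, z.1)|)) => //.
  apply: tonelli_intg => //; first exact: measurableT_comp.
  exact: intg_section2 In.
split => //; have [_ <-] := fubini1 IS.
by have [_ <-] := fubini2 IF.
Qed.

Lemma sqi_swap F : sqi (P \x Q)%E F -> sqi (Q \x P)%E (fun z => F (z.2, z.1)).
Proof.
move=> sF; have [I _] := intg_swap (sqi_sq sF); split => //.
apply: (measurableT_comp (sqi_meas sF)).
by apply: measurable_fun_pair; [exact: measurable_snd|exact: measurable_fst].
Qed.
End tensor_basis.

Section letters.
Variable K : nat.

(* The letter [None] stands for the constant eigenfunction, of index [0]. *)
Definition letter (l : option 'I_K) : nat := if l is Some k then k.+1 else 0%N.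

Lemma letter_inj : injective letter.
Proof. by case=> [i|] [j|] //= [] /val_inj ->. Qed.

Lemma letter_surj p : (p <= K)%N -> exists l, letter l = p.
Proof.
case: p => [|p] pK; first by exists None.
by exists (Some (Ordinal pK)).
Qed.
End letters.

Section tensor_truncation.
Context d1 d2 (T1 : measurableType d1) (T2 : measurableType d2) (R : realType).
Variables (P : probability T1 R) (Q : probability T2 R).
Variables (a : nat -> T1 -> R) (b : nat -> T2 -> R).
Hypotheses (oa : orthonormal_basis P a) (ob : orthonormal_basis Q b).
Implicit Types (F : T1 * T2 -> R).

Definition tcoef F p q := Ex (P \x Q)%E (fun z => F z * (a p z.1 * b q z.2)).

Definition trunc F K z := \sum_(l : option 'I_K) \sum_(l' : option 'I_K)
  tcoef F (letter l) (letter l') * a (letter l) z.1 * b (letter l') z.2.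

Lemma tensor_pair p q : tensor a b (pickle (p, q)) = (fun z => a p z.1 * b q z.2).
Proof. by apply/funext => z; rewrite /tensor pickleK_inv. Qed.

Lemma trunc_cvg F : sqi (P \x Q)%E F -> forall e, 0 < e -> exists K0, forall K, (K0 <= K)%N ->
  [/\ sqi (P \x Q)%E (trunc F K),
    Ex (P \x Q)%E (fun z => (F z - trunc F K z) ^+ 2) <= e
  & \sum_(l : option 'I_K) \sum_(l' : option 'I_K) tcoef F (letter l) (letter l') ^+ 2 <=
    Ex (P \x Q)%E (fun z => F z ^+ 2)].
Proof.
move=> sF e e0; have ot := tensor_basis oa ob.
have [n Hn] := parseval ot sF e0.
(* The sum of all coordinates met among the first [n] indices dominates each of them, so the square
   truncation of side [K0] contains these pairs. *)
pose K0 := (\sum_(k < n) if pickle_inv k is Some pq then pq.1 + pq.2 else 0)%N.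
exists K0 => K K0K.
pose phi (u : option 'I_K * option 'I_K) := tensor a b (pickle (letter u.1, letter u.2)).
have phi_inj (u v : option 'I_K * option 'I_K) : u != v -> pickle (letter u.1, letter u.2) != pickle (letter v.1, letter v.2).
  apply: contra => /eqP /(pcan_inj (@pickleK _)) [/letter_inj h1 /letter_inj h2].
  by apply/eqP; case: u v h1 h2 => ? ? [? ?] /= -> ->.
have sphi u : sqi (P \x Q)%E (phi u) by exact: orthonormal_sqi.
have proj := @Ex_sqr_sub_proj _ _ _ (P \x Q)%E _ phi sphi
  (fun u v uv => orthonormal_orth ot (phi_inj u v uv)) (fun u => orthonormal_norm _ ot) F sF.
have bes := @bessel _ _ _ (P \x Q)%E _ phi sphi
  (fun u v uv => orthonormal_orth ot (phi_inj u v uv)) (fun u => orthonormal_norm _ ot) F sF.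
have cE u : Ex (P \x Q)%E (fun z => F z * phi u z) = tcoef F (letter u.1) (letter u.2).
  by rewrite /phi tensor_pair.
have tE : (fun z => \sum_i Ex (P \x Q)%E (fun z => F z * phi i z) * phi i z) = trunc F K.
  apply/funext => z; rewrite /trunc pair_big /=; apply: eq_bigr => u _.
  by rewrite cE /phi tensor_pair mulrA.
rewrite pair_big /=; split.
- by rewrite -tE; apply: sqi_sum => u _; apply: sqiZ; exact: orthonormal_sqi.
- rewrite -tE [leLHS]proj; apply: le_trans (Hn n (leqnn n)).
  rewrite lerD2l lerN2.
  have pE k : (k < n)%N -> Ex (P \x Q)%E (fun z => F z * tensor a b k z) ^+ 2 =
    \sum_u (pickle (letter u.1, letter u.2) == k)%:R * Ex (P \x Q)%E (fun z => F z * phi u z) ^+ 2.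
    move=> kn; case Ek : (@pickle_inv (nat * nat)%type k) => [[p q]|]; last first.
      rewrite (_ : Ex (P \x Q)%E _ = 0); last first.
        rewrite -[RHS](Ex_cst (P \x Q)%E 0); congr Rintegral; apply/funext => z.
        by rewrite /tensor Ek mulr0.
      rewrite expr0n big1// => u _; case: eqP => [uk|]; last by rewrite mul0r.
      by move: Ek; rewrite -uk pickleK_inv.
    have kE : pickle (p, q) = k by have := @pickle_invK (nat * nat)%type k; rewrite Ek.
    have pqK : (p + q <= K)%N.
      apply: leq_trans K0K; rewrite /K0 (bigD1 (Ordinal kn))//= Ek leq_addr //.
    have [l lp] := @letter_surj K p ltac:(lia); have [l' lq] := @letter_surj K q ltac:(lia).
    rewrite (bigD1 (l, l'))//= lp lq kE eqxx mul1r big1 ?addr0 => [|u ul].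
      by rewrite cE /= lp lq -kE tensor_pair.
    rewrite (_ : (_ == k) = false) ?mul0r// -kE -lp -lq.
    by apply/negbTE; exact: (phi_inj u (l, l')).
  rewrite (eq_bigr (fun k : 'I_n => \sum_u (pickle (letter u.1, letter u.2) == k)%:R *
     Ex (P \x Q)%E (fun z => F z * phi u z) ^+ 2)); last by move=> k _; exact: pE.
  rewrite exchange_big /=; apply: ler_sum => u _.
  rewrite -mulr_suml ler_piMl ?sqr_ge0//.
  have [un|un] := ltnP (pickle (letter u.1, letter u.2)) n.
    rewrite (bigD1 (Ordinal un))//= eqxx big1 ?addr0// => k ku.
    by case: eqP => // H; move/eqP: ku; case; apply/val_inj.
  rewrite big1// => k _; case: eqP => // H; move: un; rewrite H leqNgt ltn_ord //.
- by under eq_bigr do rewrite -cE.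
Qed.
End tensor_truncation.

(** * Resolvents through spectral coefficients, and the coupled equations *)

Section resolvent.
Context d (T : measurableType d) (R : realType) (m : probability T R).
Variables (e : nat -> T -> R) (s : nat -> R) (K : (T -> R) -> (T -> R)).
Hypothesis oe : orthonormal_basis m e.
Hypothesis e0 : ae_eq m setT (e 0%N) (cst 1).
Hypotheses (s_ge0 : forall k, 0 <= s k) (s1 : s 1%N < 1) (s_le : forall k, (1 <= k)%N -> s k <= s 1%N).
Hypothesis sK : forall f, sqi m f -> sqi m (K f).
Hypothesis eK : forall f k, sqi m f -> Ex m (fun x => K f x * e k x) = s k ^+ 2 * Ex m (fun x => f x * e k x).

Lemma one_minus_s k : (1 <= k)%N -> 0 < 1 - s 1%N ^+ 2 /\ 1 - s 1%N ^+ 2 <= 1 - s k ^+ 2.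
Proof.
move=> k1; split; first by apply: sqr_lt1; rewrite ger0_norm.
by rewrite lerD2l lerN2; apply: lerXn2r; rewrite ?nnegrE// s_le.
Qed.

Lemma Ex_e0 f : sqi m f -> Ex m (fun x => f x * e 0%N x) = Ex m f.
Proof.
move=> sf; apply: Ex_ae.
- exact: (intg_meas (sqi_intgM sf (orthonormal_sqi 0 oe))).
- exact: sqi_meas sf.
- by apply: filterS e0 => x h xT; rewrite h// mulr1.
Qed.

Lemma L2_eq_coef f g : sqi m f -> sqi m g ->
  (forall k, Ex m (fun x => f x * e k x) = Ex m (fun x => g x * e k x)) -> ae_eq m setT f g.
Proof.
move=> sf sg H; have : ae_eq m setT (fun x => f x - g x) (cst 0).
  apply: (orthonormal_complete oe); first exact: sqiB.
  move=> k; have se := orthonormal_sqi k oe.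
  have := ExB (sqi_intgM sf se) (sqi_intgM sg se); rewrite H subrr => H0.
  by rewrite -[RHS]H0; congr Rintegral; apply/funext => x; rewrite mulrBl.
by apply: filterS => x /= /[apply]/eqP; rewrite subr_eq0 => /eqP.
Qed.

Lemma resolvent_coef g u : sqi m g -> sqi m u -> ae_eq m setT (u \- K u) g ->
  forall k, (1 - s k ^+ 2) * Ex m (fun x => u x * e k x) = Ex m (fun x => g x * e k x).
Proof.
move=> sg su ug k; have se := orthonormal_sqi k oe.
rewrite mulrBl mul1r -eK// -ExB; [|exact: sqi_intgM|exact: sqi_intgM (sK su) se].
apply: Ex_ae.
- apply: (@intg_meas _ _ _ m); apply: intgB; [exact: sqi_intgM|exact: sqi_intgM (sK su) se].
- exact: (intg_meas (sqi_intgM sg se)).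
- by apply: filterS ug => x /= h xT; rewrite -mulrBl h.
Qed.

(** Coefficients are divided by [1 - s k ^+ 2], bounded below by the spectral gap; at index [0],
    where this factor may vanish, the mean-zero condition supplies the coefficient [0]. *)
Lemma resolvent_exists g : sqi m g -> Ex m g = 0 ->
  exists u, [/\ sqi m u, Ex m u = 0 & ae_eq m setT (u \- K u) g].
Proof.
move=> sg g0; pose c k := if k is 0%N then 0 else Ex m (fun x => g x * e k x) / (1 - s k ^+ 2).
pose s' := 1 - s 1%N ^+ 2; have [s'0 _] := @one_minus_s 1 isT.
have sck k := orthonormal_sqi k oe.
have cB n : \sum_(k < n) c k ^+ 2 <= (s' ^+ 2)^-1 * Ex m (fun x => g x ^+ 2).
  apply: (@le_trans _ _ (\sum_(k < n) (s' ^+ 2)^-1 * Ex m (fun x => g x * e k x) ^+ 2)).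
    apply: ler_sum => -[[|k] kn] _ /=.
      by rewrite expr0n/= mulr_ge0 ?sqr_ge0// invr_ge0 sqr_ge0.
    rewrite exprMn mulrC ler_wpM2r ?sqr_ge0// exprVn lef_pV2 ?posrE ?exprn_gt0//.
      have [_ H] := @one_minus_s k.+1 isT.
      by apply: lerXn2r => //; rewrite ?nnegrE ?ltW// (lt_le_trans s'0).
    by have [_ H] := @one_minus_s k.+1 isT; rewrite (lt_le_trans s'0).
  rewrite -mulr_sumr ler_wpM2l ?invr_ge0 ?sqr_ge0//.
  exact: (@bessel _ _ _ m _ (fun k : 'I_n => e k) (fun k => sck k)
    (fun j k jk => orthonormal_orth oe jk) (fun k => orthonormal_norm k oe)).
have [u [su uc _]] := orthonormal_sum oe cB; exists u; split => //.
  by rewrite -Ex_e0// uc /c mul0r.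
apply: L2_eq_coef => //; first exact: (sqiB su (sK su)).
move=> k; rewrite (_ : (fun x => (u \- K u) x * e k x) = (fun x => u x * e k x - K u x * e k x)); last first.
  by apply/funext => x; rewrite /= mulrBl.
rewrite ExB; [|exact: sqi_intgM|exact: sqi_intgM (sK su) (sck k)].
rewrite eK// uc; case: k => [|k]; first by rewrite /c !mul0r mulr0 subr0 Ex_e0.
have [sp sq] := @one_minus_s k.+1 isT.
have := @Ex_proj _ _ _ m _ (fun _ : unit => e k.+1) (fun=> sck _) (fun=> orthonormal_norm _ oe) g tt sg.
move=> Gz; apply: etrans Gz; rewrite /c; field.
by rewrite gt_eqF// (lt_le_trans sp).
Qed.

(** For [v] only the coefficient equations are asked, because the candidate met in
    [coupled_resolvent] is an explicit formula whose coefficients are known. *)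
Lemma resolvent_unique g u v : sqi m g -> sqi m u -> sqi m v -> Ex m u = 0 -> Ex m v = 0 ->
  ae_eq m setT (u \- K u) g ->
  (forall k, (1 - s k ^+ 2) * Ex m (fun x => v x * e k x) = Ex m (fun x => g x * e k x)) ->
  ae_eq m setT u v.
Proof.
move=> sg su sv u0 v0 ug vg; apply: L2_eq_coef => // -[|k]; first by rewrite !Ex_e0// u0 v0.
have [sp sq] := @one_minus_s k.+1 isT.
apply: (@mulfI _ (1 - s k.+1 ^+ 2)); first by rewrite gt_eqF// (lt_le_trans sp).
by rewrite vg (resolvent_coef sg su ug).
Qed.

Lemma resolventP g : sqi m g -> Ex m g = 0 -> let u := resolvent_L2_0 m K g in
  [/\ sqi m u, Ex m u = 0 & ae_eq m setT (u \- K u) g].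
Proof.
move=> sg g0 u; have [v [sv v0 vg]] := resolvent_exists sg g0.
have : [set u | L2_0 m u /\ L2_eq m (u \- K u) g] u.
  by apply: (@xgetPex _ (cst 0)); exists v; split => //; split => //; apply/L2P.
by case=> -[/L2P su u0] ug.
Qed.
End resolvent.

Section coupled_system.
Context d1 d2 (T1 : measurableType d1) (T2 : measurableType d2) (R : realType).
Variables (P : probability T1 R) (Q : probability T2 R).
Variables (xi : T1 * T2 -> R) (s : nat -> R) (a : nat -> T1 -> R) (b : nat -> T2 -> R).
Hypothesis sxi : sqi (P \x Q)%E xi.
Hypothesis dec : eigen_decomposition P Q xi s a b.
Hypotheses (s1 : s 1%N < 1) (s_le : forall k, (1 <= k)%N -> s k <= s 1%N).

Let oa : orthonormal_basis P a. Proof. by case: dec => -[]. Qed.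
Let ob : orthonormal_basis Q b. Proof. by case: dec => -[]. Qed.
Let a0 : ae_eq P setT (a 0%N) (cst 1). Proof. by case: dec => _ []. Qed.
Let b0 : ae_eq Q setT (b 0%N) (cst 1). Proof. by case: dec => _ []. Qed.
Let s0 : s 0%N = 1. Proof. by case: dec => _ []. Qed.
Let s_ge0 k : 0 <= s k. Proof. by case: dec => _ _ /(_ k)/andP[]. Qed.
Let sa k := orthonormal_sqi k oa.
Let sb k := orthonormal_sqi k ob.
Let Aa k : ae_eq Q setT (opA P xi (a k)) (s k \*o b k).
Proof. by case: dec => _ _ _ _ /(_ k)[]. Qed.
Let Ab k : ae_eq P setT (opAadj Q xi (b k)) (s k \*o a k).
Proof. by case: dec => _ _ _ _ /(_ k)[]. Qed.

Lemma opA_sqi f : sqi P f -> sqi Q (opA P xi f).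
Proof. by move=> sf; have [] := kernel_sqi sxi sf. Qed.

Lemma opAadj_sqi g : sqi Q g -> sqi P (opAadj Q xi g).
Proof. by move=> sg; have [] := kernel_sqi (sqi_swap sxi) sg. Qed.

Lemma opA_Ex f g : sqi P f -> sqi Q g ->
  Ex Q (fun y => opA P xi f y * g y) = Ex (P \x Q)%E (fun z => xi z * (f z.1 * g z.2)).
Proof. exact: kernel_Ex. Qed.

Lemma opAadj_Ex f g : sqi P f -> sqi Q g ->
  Ex P (fun x => opAadj Q xi g x * f x) = Ex (P \x Q)%E (fun z => xi z * (f z.1 * g z.2)).
Proof.
move=> sf sg; rewrite [LHS](kernel_Ex (sqi_swap sxi) sg sf).
have I : intg (P \x Q)%E (fun z => xi z * (f z.1 * g z.2)).
  by apply: sqi_intgM => //; exact: sqi_tensor.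
have [_ <-] := intg_swap I; congr Rintegral; apply/funext => z /=.
by rewrite [g _ * _]mulrC.
Qed.

Lemma opA_coef f k : sqi P f ->
  Ex Q (fun y => opA P xi f y * b k y) = s k * Ex P (fun x => f x * a k x).
Proof.
move=> sf; rewrite opA_Ex// -opAadj_Ex// -ExZ; last exact: sqi_intgM.
apply: Ex_ae.
- exact: (intg_meas (sqi_intgM (opAadj_sqi (sb k)) sf)).
- exact: (intg_meas (intgZ _ (sqi_intgM sf (sa k)))).
- by apply: filterS (Ab k) => x h xT; rewrite h//=; ring.
Qed.

Lemma opAadj_coef g k : sqi Q g ->
  Ex P (fun x => opAadj Q xi g x * a k x) = s k * Ex Q (fun y => g y * b k y).
Proof.
move=> sg; rewrite opAadj_Ex// -opA_Ex// -ExZ; last exact: sqi_intgM.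
apply: Ex_ae.
- exact: (intg_meas (sqi_intgM (opA_sqi (sa k)) sg)).
- exact: (intg_meas (intgZ _ (sqi_intgM sg (sb k)))).
- by apply: filterS (Aa k) => x h xT; rewrite h//=; ring.
Qed.

Lemma xi_tcoef p q : Ex (P \x Q)%E (fun z => xi z * (a p z.1 * b q z.2)) =
  s p * Ex Q (fun y => b p y * b q y).
Proof.
rewrite -opA_Ex// -ExZ; last exact: sqi_intgM.
apply: Ex_ae.
- exact: (intg_meas (sqi_intgM (opA_sqi (sa p)) (sb q))).
- exact: (intg_meas (intgZ _ (sqi_intgM (sb p) (sb q)))).
- by apply: filterS (Aa p) => x h xT; rewrite h//= mulrA.
Qed.

(** Eliminating [v] from [u + A^* v = g1], [v + A u = g2] presents [u] as a resolvent; then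
    [g2 - A u] has the coefficients of the other resolvent, hence equals it almost everywhere. *)
Lemma coupled_resolvent g1 g2 : sqi P g1 -> sqi Q g2 -> Ex P g1 = 0 -> Ex Q g2 = 0 ->
  let u := resolvent_L2_0 P (opAadj Q xi \o opA P xi) (g1 \- opAadj Q xi g2) in
  let v := resolvent_L2_0 Q (opA P xi \o opAadj Q xi) (g2 \- opA P xi g1) in
  [/\ sqi P u, sqi Q v, Ex P u = 0, Ex Q v = 0 &
   ae_eq P setT (fun x => u x + opAadj Q xi v x) g1 /\
   ae_eq Q setT (fun y => v y + opA P xi u y) g2].
Proof.
move=> sg1 sg2 g10 g20 u v.
have sK1 f : sqi P f -> sqi P ((opAadj Q xi \o opA P xi) f) by move=> /opA_sqi/opAadj_sqi.
have sK2 g : sqi Q g -> sqi Q ((opA P xi \o opAadj Q xi) g) by move=> /opAadj_sqi/opA_sqi.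
have eK1 f k : sqi P f -> Ex P (fun x => (opAadj Q xi \o opA P xi) f x * a k x) =
    s k ^+ 2 * Ex P (fun x => f x * a k x).
  by move=> sf; rewrite opAadj_coef ?opA_coef ?mulrA//; exact: opA_sqi.
have eK2 g k : sqi Q g -> Ex Q (fun y => (opA P xi \o opAadj Q xi) g y * b k y) =
    s k ^+ 2 * Ex Q (fun y => g y * b k y).
  by move=> sg; rewrite opA_coef ?opAadj_coef ?mulrA//; exact: opAadj_sqi.
have sh1 : sqi P (g1 \- opAadj Q xi g2) by exact: sqiB sg1 (opAadj_sqi sg2).
have sh2 : sqi Q (g2 \- opA P xi g1) by exact: sqiB sg2 (opA_sqi sg1).
have BP f g k : sqi P f -> sqi P g -> Ex P (fun x => (f \- g) x * a k x) =
    Ex P (fun x => f x * a k x) - Ex P (fun x => g x * a k x).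
  move=> sf sg; rewrite -ExB; [|exact: sqi_intgM|exact: sqi_intgM].
  by congr Rintegral; apply/funext => x; rewrite /= mulrBl.
have BQ f g k : sqi Q f -> sqi Q g -> Ex Q (fun x => (f \- g) x * b k x) =
    Ex Q (fun x => f x * b k x) - Ex Q (fun x => g x * b k x).
  move=> sf sg; rewrite -ExB; [|exact: sqi_intgM|exact: sqi_intgM].
  by congr Rintegral; apply/funext => x; rewrite /= mulrBl.
have h10 : Ex P (g1 \- opAadj Q xi g2) = 0.
  rewrite -(Ex_e0 oa a0)// BP//; last exact: opAadj_sqi.
  by rewrite (Ex_e0 oa a0)// g10 opAadj_coef// (Ex_e0 ob b0)// g20 mulr0 subr0.
have h20 : Ex Q (g2 \- opA P xi g1) = 0.
  rewrite -(Ex_e0 ob b0)// BQ//; last exact: opA_sqi.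
  by rewrite (Ex_e0 ob b0)// g20 opA_coef// (Ex_e0 oa a0)// g10 mulr0 subr0.
have [su u0 uh] := resolventP oa a0 s_ge0 s1 s_le sK1 eK1 sh1 h10.
have [sv v0 vh] := resolventP ob b0 s_ge0 s1 s_le sK2 eK2 sh2 h20.
rewrite -/u -/v in su u0 uh sv v0 vh.
have uc k := resolvent_coef oa sK1 eK1 sh1 su uh k.
have sv' : sqi Q (g2 \- opA P xi u) by exact: sqiB sg2 (opA_sqi su).
have vv' : ae_eq Q setT v (g2 \- opA P xi u).
  apply: (resolvent_unique ob b0 s_ge0 s1 s_le sK2 eK2 sh2 sv sv' v0 _ vh).
    rewrite -(Ex_e0 ob b0)// BQ//; last exact: opA_sqi.
    by rewrite (Ex_e0 ob b0)// g20 opA_coef// (Ex_e0 oa a0)// u0 mulr0 subr0.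
  move=> k; rewrite !BQ//; [|exact: opA_sqi|exact: opA_sqi].
  have := uc k; rewrite BP//; last exact: opAadj_sqi.
  rewrite !opA_coef// opAadj_coef//.
  set x1 := Ex P _; set x2 := Ex P _; set x3 := Ex Q _ => H.
  transitivity ((1 - s k ^+ 2) * x3 - s k * ((1 - s k ^+ 2) * x1)); first by ring.
  by rewrite H; ring.
split => //; split.
  apply: (L2_eq_coef oa) => //; first by apply: sqiD su (opAadj_sqi sv).
  move=> k; rewrite (_ : (fun x => _) = (fun x => u x * a k x + opAadj Q xi v x * a k x)); last first.
    by apply/funext => x; rewrite mulrDl.
  rewrite ExD; [|exact: sqi_intgM|exact: sqi_intgM (opAadj_sqi sv) (sa k)].
  rewrite opAadj_coef//.
  have -> : Ex Q (fun y => v y * b k y) = Ex Q (fun y => (g2 \- opA P xi u) y * b k y).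
    apply: Ex_ae.
    - exact: (intg_meas (sqi_intgM sv (sb k))).
    - exact: (intg_meas (sqi_intgM sv' (sb k))).
    - by apply: filterS vv' => y h yT; rewrite h.
  rewrite BQ ?opA_coef//; last exact: opA_sqi.
  have := uc k; rewrite BP//; last exact: opAadj_sqi.
  rewrite opAadj_coef// => H.
  by apply/eqP; rewrite -subr_eq0 -(subrr (Ex P (fun x => g1 x * a k x))); apply/eqP; lra.
by apply: filterS vv' => y h yT; rewrite h//= subrK.
Qed.
End coupled_system.

(** * Densities and Gaussian integrals *)

Section density.
Context d (T : measurableType d) (R : realType).
Variables (nu : probability T R) (mu : {sigma_finite_measure set T -> \bar R}) (g : T -> R).
Hypothesis mg : measurable_fun setT g.
Hypothesis numu : nu `<< mu.
Hypothesis nug : forall A, measurable A -> nu A = (\int[mu]_(x in A) (g x)%:E)%E.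

(** Identifies the prescribed density [g] with the abstract Radon-Nikodym derivative, for which the
    change of variables is available. *)
Let ae_density : ae_eq mu setT (Radon_Nikodym_SigmaFinite.f nu mu) (EFin \o g).
Proof.
apply: integral_ae_eq => //.
- exact: Radon_Nikodym_SigmaFinite.f_integrable.
- exact/measurable_EFinP.
- by move=> E _ mE; rewrite -(Radon_Nikodym_SigmaFinite.f_integral numu)//; exact: nug.
Qed.

Lemma density_ge0 (f : T -> \bar R) : (forall x, (0 <= f x)%E) -> measurable_fun setT f ->
  (\int[nu]_x f x = \int[mu]_x (f x * (g x)%:E))%E.
Proof.
move=> f0 mf; rewrite -(Radon_Nikodym_SigmaFinite.change_of_variables numu)//.
apply: ae_eq_integral => //.
- apply: emeasurable_funM => //.
  exact: (measurable_int _ (Radon_Nikodym_SigmaFinite.f_integrable numu)).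
- by apply: emeasurable_funM => //; exact/measurable_EFinP.
- by apply: filterS ae_density => x h xT; rewrite h.
Qed.

Lemma density_integral (f : T -> R) : intg nu f ->
  (\int[nu]_x (f x)%:E = \int[mu]_x (f x * g x)%:E)%E.
Proof.
move=> If; rewrite -(Radon_Nikodym_change_of_variables numu)//.
have mf : measurable_fun setT (EFin \o f) by exact/measurable_EFinP/(intg_meas If).
apply: ae_eq_integral => //.
- exact: emeasurable_funM.
- by apply/measurable_EFinP/measurable_funM => //; exact: intg_meas If.
- have := @ae_eq_Radon_Nikodym_SigmaFinite _ _ _ _ _ numu setT measurableT.
  by apply: filterS2 ae_density => x h1 h2 xT; rewrite -h2// h1.
Qed.
End density.

Section gaussian.
Variable R : realType.
Local Notation RT := (measurableTypeR R).
Implicit Types (s t : R) (x y : RT) (F : RT -> R).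
Local Notation mu := (@lebesgue_measure R).
Local Notation nu s := (@normal_prob R 0 s).

Lemma measurable_shift (c : R) :
  measurable_fun setT (fun x : measurableTypeR R => x + c : measurableTypeR R).
Proof. by apply: measurable_funD. Qed.

Lemma lebesgue_translation (c : R) (A : set R) : measurable A ->
  pushforward mu (fun x : measurableTypeR R => x + c : measurableTypeR R) A = mu A.
Proof.
move=> mA; apply/esym/lebesgue_measure_unique => //=; first exact: measurable_shift.
move=> mm _ [[a b]] _ <-.
rewrite /pushforward (_ : _ @^-1` _ = `]a - c, b - c]%classic); last first.
  by apply/seteqP; split => x /=; rewrite !in_itv /= ltrBlDr lerBrDr.
rewrite !lebesgue_measure_itv/= !lte_fin ltrD2r.
by case: ifP => // _; rewrite -!EFinD; congr (_%:E); ring.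
Qed.

Lemma integral_translation (f : RT -> \bar R) (c : R) : (forall x, (0 <= f x)%E) ->
  measurable_fun setT f -> (\int[mu]_x f (x + c)%R = \int[mu]_x f x)%E.
Proof.
move=> f0 mf; transitivity (\int[pushforward mu (fun x : measurableTypeR R => (x + c)%R : measurableTypeR R)]_x f x)%E.
  rewrite (ge0_integral_pushforward (measurable_shift c))//.
apply: eq_measure_integral; first exact: measurable_shift.
by move=> mm A mA _; exact: lebesgue_translation.
Qed.

Lemma normal_ge0 s (f : RT -> \bar R) : (forall x, (0 <= f x)%E) -> measurable_fun setT f ->
  (\int[nu s]_x f x = \int[mu]_x (f x * (normal_pdf 0 s x)%:E))%E.
Proof.
apply: (@density_ge0 _ (measurableTypeR R) R (nu s) mu).
- exact: measurable_normal_pdf.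
- exact: normal_prob_dominates.
- by [].
Qed.

Lemma complete_square (A B x y : R) : A + B != 0 -> A != 0 -> B != 0 ->
  - (x - y - 0) ^+ 2 / (B *+ 2) + - (y - 0) ^+ 2 / (A *+ 2) =
  - (x - 0) ^+ 2 / ((A + B) *+ 2) + - (y - x * A / (A + B)) ^+ 2 / (A * B / (A + B) *+ 2).
Proof. by move=> h hA hB; field; rewrite h hA hB. Qed.

Lemma normal_complete_square s1 s2 (x y : R) : 0 < s1 -> 0 < s2 ->
  let s := Num.sqrt (s1 ^+ 2 + s2 ^+ 2) in
  normal_pdf 0 s2 (x - y) * normal_pdf 0 s1 y =
  normal_pdf 0 s x * normal_pdf (x * s1 ^+ 2 / s ^+ 2) (s1 * s2 / s) y.
Proof.
move=> s10 s20 s.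
have ss : 0 < s1 ^+ 2 + s2 ^+ 2 by rewrite addr_gt0// exprn_gt0.
have s2E : s ^+ 2 = s1 ^+ 2 + s2 ^+ 2 by rewrite sqr_sqrtr// ltW.
have s0 : 0 < s by rewrite sqrtr_gt0.
rewrite !normal_pdfE ?gt_eqF ?divr_gt0 ?mulr_gt0//.
rewrite mulrACA [RHS]mulrACA; congr (_ * _).
  rewrite /normal_peak -!invfM; congr (_^-1).
  rewrite -!sqrtrM ?mulrn_wge0 ?mulr_ge0 ?sqr_ge0 ?pi_ge0 ?(ltW s0) ?(ltW s10) ?(ltW s20)//.
  have -> : (s1 * s2 / s) ^+ 2 = s2 ^+ 2 * s1 ^+ 2 / s ^+ 2 by rewrite expr_div_n exprMn [s1 ^+ 2 * _]mulrC.
  have : s ^+ 2 != 0 by rewrite gt_eqF// exprn_gt0.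
  move: (@pi R) (s ^+ 2) (s1 ^+ 2) (s2 ^+ 2) => p A B C A0; congr Num.sqrt.
  rewrite !mulrnAl !mulrnAr; congr (_ *+ _ *+ _).
  by rewrite mulrACA [RHS]mulrACA [A * _]mulrC divfK.
rewrite /normal_fun -!expRD; congr expR.
have hs : s ^+ 2 != 0 by rewrite gt_eqF// exprn_gt0.
have h1 : s1 ^+ 2 != 0 by rewrite gt_eqF// exprn_gt0.
have h2 : s2 ^+ 2 != 0 by rewrite gt_eqF// exprn_gt0.
have -> : (s1 * s2 / s) ^+ 2 = s1 ^+ 2 * s2 ^+ 2 / s ^+ 2 by rewrite expr_div_n exprMn.
by rewrite s2E in hs *; exact: complete_square.
Qed.

Lemma measurable_addl y F : measurable_fun setT F -> measurable_fun setT (fun z : RT => F (y + z)).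
Proof.
move=> mF; have my : measurable_fun setT (fun z : RT => y + z : RT).
  by apply: measurable_funD; [exact: measurable_cst|exact: measurable_id].
exact: measurableT_comp mF my.
Qed.

Lemma measurable_add2 F : measurable_fun setT F -> measurable_fun setT (fun z : RT * RT => F (z.1 + z.2)).
Proof.
move=> mF; have ma : measurable_fun setT (fun z : RT * RT => z.1 + z.2 : RT).
  by apply: measurable_funD; [exact: measurable_fst|exact: measurable_snd].
exact: measurableT_comp mF ma.
Qed.

(** After the translation [x = y + z] and Tonelli's theorem, [normal_complete_square] factors the
    two densities as the density of the sum times a Gaussian density in [y], which integrates to
    [1]. *)
Lemma normal_conv_ge0 s1 s2 F : 0 < s1 -> 0 < s2 -> measurable_fun setT F -> (forall x, 0 <= F x) ->
  (\int[nu s1]_y \int[nu s2]_z (F (y + z))%:E = \int[nu (Num.sqrt (s1 ^+ 2 + s2 ^+ 2))]_x (F x)%:E)%E.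
Proof.
move=> s10 s20 mF F0; set s := Num.sqrt _.
have s0 : 0 < s by rewrite sqrtr_gt0 addr_gt0// exprn_gt0.
pose H (x y : RT) := ((F x * normal_pdf 0 s2 (x - y)) * normal_pdf 0 s1 y)%:E : \bar R.
have mH : measurable_fun setT (fun z : measurableTypeR R * measurableTypeR R => H z.1 z.2).
  apply/measurable_EFinP; apply: measurable_funM; last first.
    by apply: measurableT_comp (measurable_normal_pdf _ _) _; exact: measurable_snd.
  apply: measurable_funM; first by apply: measurableT_comp mF _; exact: measurable_fst.
  apply: measurableT_comp (measurable_normal_pdf _ _) _.
  by apply: measurable_funB; [exact: measurable_fst|exact: measurable_snd].
have H0 x y : (0 <= H x y)%E by rewrite lee_fin !mulr_ge0// normal_pdf_ge0.
have inner y : (\int[nu s2]_z (F (y + z))%:E * (normal_pdf 0 s1 y)%:E = \int[mu]_x H x y)%E.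
  rewrite normal_ge0; [|by move=> x; rewrite lee_fin|]; last first.
    by apply/measurable_EFinP; exact: measurable_addl.
  have mFn : measurable_fun setT (fun x => ((F (y + x))%:E * (normal_pdf 0 s2 x)%:E)%E : \bar R).
    apply/measurable_EFinP/measurable_funM; last exact: measurable_normal_pdf.
    exact: measurable_addl.
  have Fn0 (x : RT) : setT x -> (0 <= (F (y + x))%:E * (normal_pdf 0 s2 x)%:E)%E.
    by move=> _; rewrite lee_fin mulr_ge0// normal_pdf_ge0.
  have k0 : (0 <= (normal_pdf 0 s1 y)%:E)%E by rewrite lee_fin normal_pdf_ge0.
  rewrite -(@ge0_integralZr _ RT R mu setT measurableT _ mFn _ Fn0 k0).
  have HT := @integral_translation (fun x => H x y) y (fun x => H0 x y)
    (measurableT_comp mH (@measurable_pair2 _ _ _ _ y)).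
  apply: etrans HT.
  apply: eq_integral => x _; rewrite /H -!EFinM; congr (_%:E).
  by rewrite [y + x]addrC addrK.
have outer x : (\int[mu]_y H x y = (F x * normal_pdf 0 s x)%:E)%E.
  transitivity (\int[mu]_y ((F x * normal_pdf 0 s x)%:E * (normal_pdf (x * s1 ^+ 2 / s ^+ 2) (s1 * s2 / s) y)%:E))%E.
    apply: eq_integral => y _; rewrite /H -EFinM; congr (_%:E).
    by rewrite -mulrA (normal_complete_square x y s10 s20) mulrA.
  have mn : measurable_fun setT (fun y : RT => (normal_pdf (x * s1 ^+ 2 / s ^+ 2) (s1 * s2 / s) y)%:E).
    by apply/measurable_EFinP; exact: measurable_normal_pdf.
  have n0 (y : RT) : setT y -> (0 <= (normal_pdf (x * s1 ^+ 2 / s ^+ 2) (s1 * s2 / s) y)%:E)%E.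
    by move=> _; rewrite lee_fin normal_pdf_ge0.
  have k0 : (0 <= (F x * normal_pdf 0 s x)%:E)%E by rewrite lee_fin mulr_ge0// normal_pdf_ge0.
  rewrite (@ge0_integralZl _ RT R mu setT measurableT _ mn _ n0 k0).
  by rewrite integral_normal_pdf mule1.
rewrite [RHS]normal_ge0; [|by move=> x; rewrite lee_fin|exact/measurable_EFinP].
rewrite normal_ge0; last 2 first.
- by move=> y; apply: integral_ge0 => z _; rewrite lee_fin.
- apply: (@measurable_fun_fubini_tonelli_F _ _ _ _ R (nu s2) (fun z : RT * RT => (F (z.1 + z.2))%:E)); last first.
    by move=> z; rewrite lee_fin.
  by apply/measurable_EFinP; exact: measurable_add2.
under eq_integral do rewrite inner.
rewrite -(@fubini_tonelli _ _ _ _ R mu mu (fun z => H z.1 z.2) mH (fun z => H0 z.1 z.2)).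
by apply: eq_integral => x _; exact: outer.
Qed.

(** A bounded function becomes nonnegative after adding [M], and the constant integrates to the same
    value on both sides. *)
Lemma conv_bounded (m1 m2 m3 : probability RT R) F (M : R) :
  (forall G : RT -> R, measurable_fun setT G -> (forall x, 0 <= G x) ->
    (\int[m1]_y \int[m2]_z (G (y + z))%:E = \int[m3]_x (G x)%:E)%E) ->
  measurable_fun setT F -> (forall x, `|F x| <= M) ->
  Ex m1 (fun y => Ex m2 (fun z => F (y + z))) = Ex m3 F.
Proof.
move=> H mF FM.
have mFy y := measurable_addl y mF.
have IF : intg m3 F by exact: (@intg_bounded _ RT R m3 M F mF FM).
have IFy y : intg m2 (fun z => F (y + z)) by exact: (@intg_bounded _ RT R m2 M _ (mFy y) (fun z => FM _)).
have M0 : 0 <= M := le_trans (normr_ge0 _) (FM 0).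
have G0 x : 0 <= F x + M by have := FM x; rewrite ler_norml => /andP[? _]; lra.
have := H _ (measurable_funD mF (measurable_cst M)) G0.
have E1 y : (\int[m2]_z (F (y + z) + M)%:E = (Ex m2 (fun z => F (y + z)) + M)%:E)%E.
  rewrite -(ExE (intgD (IFy y) (intg_cst _ M))); congr (_%:E).
  by rewrite ExD// ?Ex_cst//; exact: intg_cst.
under eq_integral do rewrite E1.
have I2 : intg (m1 \x m2)%E (fun z : RT * RT => F (z.1 + z.2)).
  exact: (@intg_bounded _ _ R (m1 \x m2)%E M _ (measurable_add2 mF) (fun z => FM _)).
have [IE _] := fubini1 I2.
rewrite -(ExE (intgD IE (intg_cst _ M))) -(ExE (intgD IF (intg_cst _ M))) => -[].
by rewrite (ExD IE (intg_cst _ M)) (ExD IF (intg_cst _ M)) !Ex_cst => /addIr.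
Qed.

Lemma normal_conv s1 s2 F (M : R) : 0 < s1 -> 0 < s2 -> measurable_fun setT F -> (forall x, `|F x| <= M) ->
  Ex (nu s1) (fun y => Ex (nu s2) (fun z => F (y + z))) = Ex (nu (Num.sqrt (s1 ^+ 2 + s2 ^+ 2))) F.
Proof.
move=> s10 s20 mF FM; apply: (@conv_bounded (nu s1) (nu s2) (nu (Num.sqrt (s1 ^+ 2 + s2 ^+ 2))) F M _ mF FM).
by move=> G mG G0; exact: normal_conv_ge0.
Qed.

Lemma normal_mgf_pdf s t (x : R) : 0 < s ->
  expR (t * x) * normal_pdf 0 s x = expR (t ^+ 2 * s ^+ 2 / 2) * normal_pdf (t * s ^+ 2) s x.
Proof.
move=> s0; rewrite !normal_pdfE ?gt_eqF// mulrCA [RHS]mulrCA; congr (_ * _).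
rewrite /normal_fun -!expRD; congr expR.
have : s ^+ 2 != 0 by rewrite gt_eqF// exprn_gt0.
by move: (s ^+ 2) => A A0; field.
Qed.

(** Exponential tilting shifts the mean of a Gaussian density ([normal_mgf_pdf]), which leaves a
    normalised density times the stated constant. *)
Lemma normal_mgf s t : 0 < s -> intg (nu s) (fun x : RT => expR (t * x)) /\
  Ex (nu s) (fun x : RT => expR (t * x)) = expR (t ^+ 2 * s ^+ 2 / 2).
Proof.
move=> s0.
have mE : measurable_fun setT (fun x : RT => expR (t * x)).
  by apply: measurableT_comp => //; apply: measurable_funM.
have E : (\int[nu s]_x (expR (t * x))%:E = (expR (t ^+ 2 * s ^+ 2 / 2))%:E)%E.
  rewrite normal_ge0; [|by move=> x; rewrite lee_fin expR_ge0|exact/measurable_EFinP].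
  transitivity (\int[mu]_x ((expR (t ^+ 2 * s ^+ 2 / 2))%:E * (normal_pdf (t * s ^+ 2) s x)%:E))%E.
    by apply: eq_integral => x _; rewrite -!EFinM normal_mgf_pdf.
  have mn : measurable_fun setT (fun y : RT => (normal_pdf (t * s ^+ 2) s y)%:E).
    by apply/measurable_EFinP; exact: measurable_normal_pdf.
  have n0 (y : RT) : setT y -> (0 <= (normal_pdf (t * s ^+ 2) s y)%:E)%E.
    by move=> _; rewrite lee_fin normal_pdf_ge0.
  have k0 : (0 <= (expR (t ^+ 2 * s ^+ 2 / 2))%:E)%E by rewrite lee_fin expR_ge0.
  rewrite (@ge0_integralZl _ RT R mu setT measurableT _ mn _ n0 k0).
  by rewrite integral_normal_pdf mule1.
have I : intg (nu s) (fun x : RT => expR (t * x)).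
  apply/integrableP; split; first exact/measurable_EFinP.
  under eq_integral do rewrite /= ger0_norm ?expR_ge0//.
  by rewrite E ltry.
by split => //; rewrite /Ex /Rintegral E.
Qed.

End gaussian.

(** * Taylor bounds, tails and Gaussian moments *)

Section taylor.
Variable R : realType.

Lemma is_derive1_eq_fun (f g : R -> R) (x a b : R) : f =1 g -> a = b ->
  is_derive x 1 f a -> is_derive x 1 g b.
Proof. by move=> /funext <- <-. Qed.

Lemma mean_value_bound (f f' : R -> R) (u w C : R) : 0 <= C -> (forall x : R, is_derive x 1 f (f' x)) ->
  (forall x, `|x - u| <= `|w| -> `|f' x| <= C) -> `|f (u + w) - f u| <= C * `|w|.
Proof.
move=> C0 df f1C.
have cf a b : {within `[a, b], continuous f}.
  by apply: derivable_within_continuous => x _; have [] := df x.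
have [->|w0] := eqVneq w 0; first by rewrite addr0 subrr normr0 mulr0.
have [wp|wn] := ltP 0 w.
  have [|c /andP[uc cw] ->] := @MVT R f f' u (u + w) _ (fun x _ => df x) (cf _ _).
    by rewrite ltrDl.
  rewrite !bnd_simp in uc cw.
  rewrite addrAC subrr add0r normrM ler_wpM2r// f1C// (gtr0_norm wp) ger0_norm.
    by rewrite lerBlDl ltW.
  by rewrite subr_ge0 ltW.
have wl : w < 0 by rewrite lt_neqAle w0.
have [|c /andP[uc cw] H] := @MVT R f f' (u + w) u _ (fun x _ => df x) (cf _ _).
  by rewrite gtrDl.
rewrite !bnd_simp in uc cw.
rewrite distrC H opprD addrA subrr add0r normrM normrN ler_wpM2r// f1C//.
by rewrite (ltr0_norm wl) ler0_norm; lra.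
Qed.

(** Three successive mean value bounds; they lose the factor [1/6] of the sharp remainder, which is
    immaterial here. *)
Lemma taylor3 (f f1 f2 f3 : R -> R) (u w C : R) : 0 <= C ->
  (forall x : R, is_derive x 1 f (f1 x)) -> (forall x : R, is_derive x 1 f1 (f2 x)) ->
  (forall x : R, is_derive x 1 f2 (f3 x)) ->
  (forall x, `|x - u| <= `|w| -> `|f3 x| <= C) ->
  `|f (u + w) - f u - w * f1 u - w ^+ 2 / 2 * f2 u| <= C * `|w| ^+ 3.
Proof.
move=> C0 d0 d1 d2 f3C.
have b2 x : `|x - u| <= `|w| -> `|f2 x - f2 u| <= C * `|w|.
  move=> xw; have := @mean_value_bound f2 f3 u (x - u) C C0 d2.
  rewrite (_ : u + (x - u) = x); last by ring.
  move=> H; apply: le_trans (H _) _.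
    by move=> y yx; apply: f3C; exact: le_trans yx xw.
  by rewrite ler_wpM2l.
have dlin (a : R) (y : R) : is_derive y 1 (fun y => a * (y - u)) a.
  have := is_derive1Z a (is_derive1D (is_derive_id y 1) (is_derive_cst (- u) y 1)).
  by rewrite addr0 mulr1.
have b1 x : `|x - u| <= `|w| -> `|f1 x - f1 u - f2 u * (x - u)| <= C * `|w| * `|w|.
  move=> xw; have dg y := is_derive1D (d1 y) (is_derive1N (dlin (f2 u) y)).
  have := @mean_value_bound _ _ u (x - u) (C * `|w|) (mulr_ge0 C0 (normr_ge0 _)) dg.
  rewrite (_ : u + (x - u) = x); last by ring.
  rewrite subrr mulr0 subr0 => H.
  rewrite (_ : f1 x - f1 u - f2 u * (x - u) = f1 x - f2 u * (x - u) - f1 u); last by ring.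
  apply: le_trans (H _) _; last by rewrite ler_wpM2l// mulr_ge0.
  by move=> y yx; apply: b2; exact: le_trans yx xw.
have dsq (y : R) : is_derive y 1 (fun y => (f2 u / 2) * (y - u) ^+ 2) (f2 u * (y - u)).
  have := is_derive1Z (f2 u / 2) (is_derive1M (dlin 1 y) (dlin 1 y)).
  apply: is_derive1_eq_fun; last by field.
  by move=> z; ring.
have dh y := is_derive1D (is_derive1D (d0 y) (is_derive1N (dlin (f1 u) y))) (is_derive1N (dsq y)).
have := @mean_value_bound _ _ u w (C * `|w| * `|w|) (mulr_ge0 (mulr_ge0 C0 (normr_ge0 _)) (normr_ge0 _)) dh.
move=> H; rewrite (_ : _ - _ - _ - _ = f (u + w) - f1 u * (u + w - u) - f2 u / 2 * (u + w - u) ^+ 2 -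
  (f u - f1 u * (u - u) - f2 u / 2 * (u - u) ^+ 2)); last by field.
apply: le_trans (H _) _; last by rewrite !exprS expr0 mulr1 !mulrA.
by move=> x xw; apply: b1.
Qed.

Lemma expR_taylor (w : R) : `|expR w - 1 - w - w ^+ 2 / 2| <= expR `|w| * `|w| ^+ 3.
Proof.
have := @taylor3 expR expR expR expR 0 w (expR `|w|) (expR_ge0 _) (@is_derive_expR _)
  (@is_derive_expR _) (@is_derive_expR _).
rewrite add0r expR0 !mulr1; apply => x; rewrite subr0 => xw.
by rewrite ger0_norm ?expR_ge0// ler_expR (le_trans (ler_norm _)).
Qed.

Definition logistic (x : R) : R := (1 + expR (- x))^-1.

Lemma logistic_gt0 x : 0 < logistic x.
Proof. by rewrite invr_gt0 addr_gt0// expR_gt0. Qed.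

Lemma logistic_lt1 x : logistic x < 1.
Proof. by rewrite invf_lt1 ?ltrDl ?addr_gt0// expR_gt0. Qed.

Lemma is_derive_logistic (x : R) : is_derive x 1 logistic (logistic x * (1 - logistic x)).
Proof.
have e0 : 0 < 1 + expR (- x) by rewrite addr_gt0// expR_gt0.
have d0 : is_derive x 1 (fun x : R => expR (- x)) (expR (- x) * - 1).
  exact: (@is_derive1_comp _ expR (fun x => - x) x _ _ (is_derive_expR _) (is_derive1N (is_derive_id x 1))).
have d1 := is_derive1D (is_derive_cst (1 : R) x 1) d0.
have := @is_deriveV R (fun x => 1 + expR (- x)) x _ 1 _ d1.
rewrite gt_eqF// => /(_ isT); apply: is_derive1_eq_fun => //.
rewrite /logistic /GRing.scale /= add0r; field.
by rewrite gt_eqF.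
Qed.

(** The derivatives of [logistic] are polynomials in [logistic] itself, whose values lie in []0,
    1[]; this makes the remainder uniform in [u]. *)
Lemma logistic_taylor (u w : R) :
  `|logistic (u + w) - logistic u - w * (logistic u * (1 - logistic u)) -
    w ^+ 2 / 2 * (logistic u * (1 - logistic u) * (1 - 2 * logistic u))| <= 6 * `|w| ^+ 3.
Proof.
pose f1 x := logistic x * (1 - logistic x).
pose f2 x := f1 x * (1 - 2 * logistic x).
pose f3 x := f2 x * (1 - 2 * logistic x) + f1 x * (- (2 * f1 x)).
have l0 := logistic_gt0; have l1 := logistic_lt1.
have d1 (x : R) : is_derive x 1 f1 (f2 x).
  have := is_derive1M (is_derive_logistic x) (is_derive1D (is_derive_cst (1 : R) x 1) (is_derive1N (is_derive_logistic x))).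
  apply: is_derive1_eq_fun => //; rewrite /f2 /f1 /=; ring.
have d2 (x : R) : is_derive x 1 f2 (f3 x).
  have := is_derive1M (d1 x) (is_derive1D (is_derive_cst (1 : R) x 1) (is_derive1N (is_derive1Z 2 (is_derive_logistic x)))).
  apply: is_derive1_eq_fun => //; rewrite /f3 /f2 /f1 /=; ring.
apply: (@taylor3 logistic f1 f2 f3 u w 6) => //; first exact: is_derive_logistic.
move=> x _; have := l0 x; have := l1 x; rewrite /f3 /f2 /f1; move: (logistic x) => p p1 p0.
have q0 : 0 <= p * (1 - p) by nra.
have q1 : p * (1 - p) <= 1 by nra.
rewrite ler_norml; apply/andP; split; nra.
Qed.
End taylor.

Section tails.
Context d (T : measurableType d) (R : realType) (m : probability T R).

Lemma tail_small (f g : T -> R) : measurable_fun setT f -> intg m g -> forall e : R, 0 < e ->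
  exists n : nat, Ex m (fun x => if n%:R < `|f x| then `|g x| else 0) <= e.
Proof.
move=> mf Ig e e0.
pose F n x := if n%:R < `|f x| then `|g x| else 0.
have mF n : measurable_fun setT (F n).
  apply: measurable_fun_ifT; [|exact: measurableT_comp (intg_meas Ig)|exact: measurable_cst].
  by apply: measurable_fun_ltr => //; exact: measurableT_comp.
have Fle n x : `|F n x| <= `|g x| by rewrite /F; case: ifP; rewrite ?normr_id ?normr0.
have IF n : intg m (F n) by apply: (intg_le (mF n) (Fle n)); exact: intg_norm.
have := @dominated_convergence _ T R m setT measurableT (fun n => EFin \o F n) (cst 0%E) (fun x => `|g x|%:E).
move=> H; have [] := H.
- by move=> n; exact/measurable_EFinP.
- exact: measurable_cst.
- apply: nearW => x _; apply: cvg_near_cst.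
  exists (Num.truncn `|f x|).+1 => // n /= nf; congr (_%:E); rewrite /F ltNge (_ : _ <= _)//.
  by apply: le_trans (ltW (truncnS_gt _)) _; rewrite ler_nat.
- exact: intg_norm.
- by apply: nearW => x n _; rewrite lee_fin; exact: Fle.
move=> _ _; rewrite (_ : (\int[m]_x cst 0 x = 0)%E); last exact: integral0.
move=> /fine_cvgP [_ /cvgr0_norm_le] /(_ _ e0)[n _ /(_ n (leqnn n))] h.
by exists n; apply: le_trans h; exact: ler_norm.
Qed.

(** Where [|w|] exceeds a level [n] the minimum is at most [1] and the tail of [w ^+ 2] is small;
    elsewhere the minimum is at most [n / sqrt N]. *)
Lemma lindeberg_small (w : T -> R) : sqi m w -> forall e : R, 0 < e ->
  exists N0 : nat, forall N : nat, (N0 <= N)%N -> (0 < N)%N ->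
   intg m (fun x => w x ^+ 2 * Num.min 1 (`|w x| / Num.sqrt N%:R)) /\
   Ex m (fun x => w x ^+ 2 * Num.min 1 (`|w x| / Num.sqrt N%:R)) <= e.
Proof.
move=> sw e e0; have [mw Iw] := sw; have e2 : 0 < e / 2 by lra.
have [n Hn] := tail_small mw Iw e2.
have E0 : 0 <= Ex m (fun x => w x ^+ 2) by apply: Ex_ge0 => x; exact: sqr_ge0.
pose D := n%:R * Ex m (fun x => w x ^+ 2) / (e / 2).
exists (Num.truncn (D ^+ 2)).+1 => N NN Npos.
have N0 : 0 < N%:R :> R by rewrite ltr0n.
have sN : 0 < Num.sqrt N%:R :> R by rewrite sqrtr_gt0.
have mm : measurable_fun setT (fun x => w x ^+ 2 * Num.min 1 (`|w x| / Num.sqrt N%:R)).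
  apply: measurable_funM; first exact: measurable_funX.
  apply: measurable_minr => //; apply: measurable_funM => //.
  exact: measurableT_comp.
have b0 x : 0 <= Num.min 1 (`|w x| / Num.sqrt N%:R) by rewrite le_min ler01 divr_ge0.
have I : intg m (fun x => w x ^+ 2 * Num.min 1 (`|w x| / Num.sqrt N%:R)).
  apply: (intg_le mm _ Iw) => x; rewrite ger0_norm; last by rewrite mulr_ge0 ?b0// sqr_ge0.
  by apply: ler_piMr; [exact: sqr_ge0|rewrite ge_min lexx].
split => //.
pose G x := (if n%:R < `|w x| then `|w x ^+ 2| else 0) + n%:R / Num.sqrt N%:R * w x ^+ 2.
have I1 : intg m (fun x => if n%:R < `|w x| then `|w x ^+ 2| else 0).
  apply: (intg_le _ _ Iw) => [|x]; last by case: ifP => _; rewrite ?normr_id ?normr0 ?sqr_ge0// ger0_norm ?sqr_ge0.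
  apply: measurable_fun_ifT; [|exact: measurableT_comp (intg_meas Iw)|exact: measurable_cst].
  by apply: measurable_fun_ltr => //; exact: measurableT_comp.
have I2 := intgZ (n%:R / Num.sqrt N%:R) Iw.
apply: (@le_trans _ _ (Ex m G)).
  apply: Ex_le => //; first exact: intgD.
  move=> x; rewrite /G; case: ltP => nw.
    apply: ler_wpDr; first by rewrite mulr_ge0 ?sqr_ge0// divr_ge0// sqrtr_ge0.
    by rewrite [leRHS]ger0_norm ?sqr_ge0//; apply: ler_piMr; [exact: sqr_ge0|rewrite ge_min lexx].
  rewrite add0r mulrC ler_wpM2r ?sqr_ge0// ge_min; apply/orP; right.
  by rewrite ler_wpM2r// invr_ge0 ltW.
rewrite ExD// ExZ//.
suff : n%:R / Num.sqrt N%:R * Ex m (fun x => w x ^+ 2) <= e / 2 by move: Hn; lra.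
rewrite mulrAC ler_pdivrMr// -ler_pdivrMl// mulrC.
have D0 : 0 <= D by rewrite /D divr_ge0 ?mulr_ge0// ltW.
rewrite -[leLHS]/D -[D]ger0_norm// -sqrtr_sqr ler_wsqrtr//.
by apply: le_trans (ltW (truncnS_gt _)) _; rewrite ler_nat.
Qed.
End tails.

Section gaussian_moments.
Variable R : realType.
Local Notation RT := (measurableTypeR R).
Local Notation nu s := (@normal_prob R 0 s).
Implicit Types s t : R.

Lemma expR_cube (x : R) : 0 <= x -> x ^+ 3 <= 6 * expR x.
Proof.
move=> x0; have := @expR_ge1Dxn R x 2 x0; rewrite (_ : 3`!%:R = 6 :> R)//.
lra.
Qed.

Lemma expR_norm_le (x : R) : expR `|x| <= expR x + expR (- x).
Proof.
have := expR_ge0 x; have := expR_ge0 (- x).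
by case: (ger0P x) => _; lra.
Qed.

(** Taking [1 / s] and [- 1 / s] in the moment generating function dominates the cube with the
    correct scaling [s ^+ 3]. *)
Lemma normal_cube s : 0 < s -> intg (nu s) (fun y : RT => `|y| ^+ 3) /\
  Ex (nu s) (fun y : RT => `|y| ^+ 3) <= 12 * expR 1 * s ^+ 3.
Proof.
move=> s0; have [I1 E1] := normal_mgf s^-1 s0; have [I2 E2] := normal_mgf (- s^-1) s0.
have I := intgZ (6 * s ^+ 3) (intgD I1 I2).
have mc : measurable_fun setT (fun y : RT => `|y| ^+ 3).
  apply: measurable_funX; apply: (measurableT_comp (f := Num.norm : R -> R)) => //.
have le1 (y : RT) : `|y| ^+ 3 <= 6 * s ^+ 3 * (expR (s^-1 * y) + expR (- s^-1 * y)).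
  have := @expR_cube (`|s^-1 * y|) (normr_ge0 _).
  rewrite normrM (gtr0_norm (_ : 0 < s^-1)) ?invr_gt0// exprMn => h.
  have -> : `|y| ^+ 3 = s ^+ 3 * (s^-1 ^+ 3 * `|y| ^+ 3).
    by rewrite mulrA -exprMn divff ?gt_eqF// expr1n mul1r.
  rewrite [6 * s ^+ 3]mulrC -[leRHS]mulrA; apply: ler_wpM2l; first by rewrite exprn_ge0// ltW.
  apply: le_trans h _; rewrite ler_wpM2l//.
  have := expR_norm_le (s^-1 * y); rewrite normrM (gtr0_norm (_ : 0 < s^-1)) ?invr_gt0//.
  by rewrite mulNr.
have Ic : intg (nu s) (fun y : RT => `|y| ^+ 3).
  apply: (@intg_le _ RT R (nu s) _ _ mc _ I) => y; rewrite ger0_norm ?exprn_ge0//; exact: le1.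
split => //; apply: le_trans (Ex_le Ic I le1) _.
rewrite (ExZ _ (intgD I1 I2)) (ExD I1 I2) E1 E2.
have -> : s^-1 ^+ 2 * s ^+ 2 = 1 by rewrite -exprMn mulVf ?gt_eqF// expr1n.
have -> : (- s^-1) ^+ 2 * s ^+ 2 = 1 by rewrite sqrrN -exprMn mulVf ?gt_eqF// expr1n.
have : expR (1 / 2) <= expR 1 :> R by clear; rewrite ler_expR; lra.
have := exprn_gt0 3 s0; clear; nra.
Qed.

(** Mean and variance are read off the moment generating function: comparing its expansions at [t]
    and [- t] for small [t] separates the first-order term from the second-order one. *)
Lemma normal_moments s : 0 < s ->
  [/\ sqi (nu s) (fun y : RT => y), Ex (nu s) (fun y : RT => y) = 0 &
   Ex (nu s) (fun y : RT => y ^+ 2) = s ^+ 2].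
Proof.
move=> s0; have [Ic Ec] := normal_cube s0.
have mid : measurable_fun setT (fun y : RT => y : R) by [].
have sid : sqi (nu s) (fun y : RT => y : R).
  split => //; apply: (@intg_le _ RT R (nu s) _ _ (measurable_funX 2 mid) _ (intgD (intg_cst _ 1) Ic)).
  move=> y; rewrite /cst normrX; have := normr_ge0 (y : R); move: `|_| => z z0.
  by case: (lerP z 1) => z1; have := exprn_ge0 3 z0; rewrite !exprS expr0; nra.
have I1 := sqi_intg sid; have I2 := sqi_sq sid.
have [J1 F1] := normal_mgf 2 s0; have [J2 F2] := normal_mgf (-2) s0.
pose C3 := Ex (nu s) (fun y : RT => 6 * (expR (2 * y) + expR (- 2 * y))).
have JJ := intgZ 6 (intgD J1 J2).
(* For [|t| <= 1], [C3] bounds the third-order remainder under the integral and the bracket bounds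
   the one of the explicit exponential. *)
pose D := C3 + ((s ^+ 2 / 2) ^+ 2 / 2 + expR (s ^+ 2 / 2) * (s ^+ 2 / 2) ^+ 3).
pose p := Ex (nu s) (fun y : RT => y : R).
pose q := Ex (nu s) (fun y : RT => y ^+ 2) - s ^+ 2.
have C30 : 0 <= C3 by apply: Ex_ge0 => y; rewrite mulr_ge0// addr_ge0// expR_ge0.
have D0 : 0 <= D.
  have e1 : 0 <= expR (s ^+ 2 / 2) * (s ^+ 2 / 2) ^+ 3.
    by rewrite mulr_ge0 ?expR_ge0 ?exprn_ge0 ?divr_ge0 ?sqr_ge0.
  have := sqr_ge0 (s ^+ 2 / 2); rewrite /D; clear -e1 C30; lra.
have key t : `|t| <= 1 -> `|t * p + t ^+ 2 / 2 * q| <= D * `|t| ^+ 3.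
  move=> t1; have [Jt Ft] := normal_mgf t s0.
  have t0 := normr_ge0 t.
  have h1 : `|Ex (nu s) (fun y : RT => expR (t * y)) - 1 - t * p - t ^+ 2 / 2 * Ex (nu s) (fun y : RT => y ^+ 2)| <= `|t| ^+ 3 * C3.
    have IA : intg (nu s) (fun y : RT => expR (t * y) - 1 - t * y - t ^+ 2 / 2 * y ^+ 2).
      by apply: intgB (intgZ _ I2); apply: intgB (intgZ _ I1); apply: intgB Jt (intg_cst _ 1).
    have -> : Ex (nu s) (fun y : RT => expR (t * y)) - 1 - t * p - t ^+ 2 / 2 * Ex (nu s) (fun y : RT => y ^+ 2) =
      Ex (nu s) (fun y : RT => expR (t * y) - 1 - t * y - t ^+ 2 / 2 * y ^+ 2).
      rewrite (ExB (intgB (intgB Jt (intg_cst _ 1)) (intgZ t I1)) (intgZ _ I2)).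
      rewrite (ExB (intgB Jt (intg_cst _ 1)) (intgZ t I1)) (ExB Jt (intg_cst _ 1)).
      by rewrite Ex_cst (ExZ _ I1) (ExZ _ I2).
    apply: le_trans (Ex_norm IA) _; rewrite -(ExZ _ JJ).
    apply: Ex_le; [exact: intg_norm|exact: intgZ|move=> y].
    have := expR_taylor (t * y); rewrite exprMn => h.
    rewrite (_ : t ^+ 2 / 2 * y ^+ 2 = t ^+ 2 * y ^+ 2 / 2); last by rewrite mulrAC.
    apply: le_trans h _; rewrite normrM exprMn [leLHS]mulrCA ler_wpM2l ?exprn_ge0//.
    have y0 : 0 <= `|y : R| by [].
    apply: (@le_trans _ _ (expR `|y : R| * (6 * expR `|y : R|))).
      apply: ler_pM; rewrite ?expR_ge0 ?exprn_ge0//; last exact: expR_cube.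
      by rewrite ler_expR ler_piMl.
    rewrite mulrCA -expRD ler_wpM2l//.
    have := expR_norm_le (2 * (y : R)); rewrite normrM ger0_norm//.
    have e1 : `|y : R| + `|y : R| = 2 * `|y : R| by ring.
    have e2 : -2 * (y : R) = - (2 * (y : R)) by ring.
    by rewrite e1 e2.
  have h2 : `|expR (t ^+ 2 * s ^+ 2 / 2) - 1 - t ^+ 2 / 2 * s ^+ 2| <= `|t| ^+ 3 * ((s ^+ 2 / 2) ^+ 2 / 2 + expR (s ^+ 2 / 2) * (s ^+ 2 / 2) ^+ 3).
    have A0 : 0 <= s ^+ 2 / 2 by rewrite divr_ge0 ?sqr_ge0.
    have tt : `|t| ^+ 2 = t ^+ 2 by rewrite real_normK ?num_real.
    rewrite (_ : t ^+ 2 * s ^+ 2 / 2 = `|t| ^+ 2 * (s ^+ 2 / 2)); last by rewrite tt; field.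
    rewrite (_ : t ^+ 2 / 2 * s ^+ 2 = `|t| ^+ 2 * (s ^+ 2 / 2)); last by rewrite tt; field.
    move: (s ^+ 2 / 2) A0 (`|t|) t0 t1 => A A0 r r0 r1.
    have z0 : 0 <= r ^+ 2 * A by rewrite mulr_ge0 ?sqr_ge0.
    have := expR_taylor (r ^+ 2 * A); rewrite (ger0_norm z0) => h.
    have r2 : r ^+ 2 <= 1 by rewrite exprn_ile1.
    have eA : expR (r ^+ 2 * A) <= expR A by rewrite ler_expR ler_piMl.
    have k1 : (r ^+ 2 * A) ^+ 2 / 2 <= r ^+ 3 * (A ^+ 2 / 2).
      rewrite exprMn -mulrA ler_wpM2r ?divr_ge0 ?sqr_ge0// -exprM.
      by rewrite (_ : (2 * 2 = 3 + 1)%N)// exprD ler_piMr ?exprn_ge0// expr1.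
    have k2 : expR (r ^+ 2 * A) * (r ^+ 2 * A) ^+ 3 <= r ^+ 3 * (expR A * A ^+ 3).
      rewrite exprMn [leRHS]mulrCA; apply: ler_pM; rewrite ?expR_ge0 ?mulr_ge0 ?exprn_ge0//.
      rewrite ler_wpM2r ?exprn_ge0// -exprM (_ : (2 * 3 = 3 + 3)%N)// exprD ler_piMr ?exprn_ge0//.
      by rewrite exprn_ile1.
    have -> : expR (r ^+ 2 * A) - 1 - r ^+ 2 * A = (expR (r ^+ 2 * A) - 1 - r ^+ 2 * A - (r ^+ 2 * A) ^+ 2 / 2) + (r ^+ 2 * A) ^+ 2 / 2 by ring.
    apply: le_trans (ler_normD _ _) _; rewrite mulrDr addrC lerD//.
      by rewrite ger0_norm// divr_ge0 ?sqr_ge0.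
    exact: le_trans h k2.
  have -> : t * p + t ^+ 2 / 2 * q = (expR (t ^+ 2 * s ^+ 2 / 2) - 1 - t ^+ 2 / 2 * s ^+ 2) -
     (Ex (nu s) (fun y : RT => expR (t * y)) - 1 - t * p - t ^+ 2 / 2 * Ex (nu s) (fun y : RT => y ^+ 2)).
    by rewrite Ft /q; ring.
  apply: le_trans (ler_normB _ _) _; rewrite /D [leRHS]mulrC [leRHS]mulrDr [leRHS]addrC; exact: lerD.
(* The difference of the estimates at [h] and [- h] isolates [p], their sum isolates [q]. *)
have small h : 0 < h -> h <= 1 -> `|p| <= D * h ^+ 2 /\ `|q| <= 2 * D * h.
  move=> h0 h1; have := key h; have := key (- h); rewrite normrN (gtr0_norm h0) sqrrN.
  move=> /(_ h1) + /(_ h1); rewrite !ler_norml => /andP[a1 a2] /andP[b1 b2].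
  have h3 : h ^+ 3 = h * h ^+ 2 by rewrite exprS.
  have h2 : h ^+ 2 = h * h by rewrite expr2.
  have hh : 0 < h ^+ 2 by rewrite exprn_gt0.
  split; apply/andP; split.
  - rewrite -(ler_pM2l h0); clear -a1 a2 b1 b2 h0 h2 h3; nra.
  - rewrite -(ler_pM2l h0); clear -a1 a2 b1 b2 h0 h2 h3; nra.
  - rewrite -(ler_pM2l hh); clear -a1 a2 b1 b2 h0 h2 h3; nra.
  - rewrite -(ler_pM2l hh); clear -a1 a2 b1 b2 h0 h2 h3; nra.
clearbody D.
have zero (x : R) : (forall h, 0 < h -> h <= 1 -> `|x| <= 2 * D * h) -> x = 0.
  move=> H; apply/eqP; rewrite -normr_le0; apply/ler_addgt0Pr => e e0; rewrite add0r.
  have k0 : 0 < Num.min 1 (e / (2 * D + 1)).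
    by clear -e0 D0; rewrite lt_min ltr01 divr_gt0//; lra.
  apply: le_trans (H _ k0 _) _; first by rewrite ge_min lexx.
  apply: (@le_trans _ _ (2 * D * (e / (2 * D + 1)))).
    by rewrite ler_wpM2l ?mulr_ge0// ge_min lexx orbT.
  by clear -e0 D0; rewrite mulrA ler_pdivrMr; lra || nra.
split => //.
  apply: zero => h h0 h1; have [H _] := small h h0 h1; apply: le_trans H _.
  by rewrite expr2 mulrA; have : D * h * h <= D * h * 1 by [rewrite ler_wpM2l// mulr_ge0// ltW]; have := mulr_ge0 D0 (ltW h0); clear; lra.
by apply/eqP; rewrite -subr_eq0; apply/eqP; apply: zero => h h0 h1; have [_ H] := small h h0 h1.
Qed.
End gaussian_moments.

(** * Central limit theorem by comparison of convolution operators *)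

Section convolution_operators.
Variable R : realType.
Local Notation RT := (measurableTypeR R).

Definition bmeas (M : R) (F : RT -> R) := measurable_fun setT F /\ forall x, `|F x| <= M.

(** Convolution with the law of [h]; sums of independent copies correspond to iterates
    ([sum_iter_cop]). *)
Definition cop d (T : measurableType d) (m : probability T R) (h : T -> R) (F : RT -> R) : RT -> R :=
  fun x => Ex m (fun z => F (x + h z)).

Section one.
Context d (T : measurableType d) (m : probability T R) (h : T -> R).
Hypothesis mh : measurable_fun setT h.

Lemma bmeas_shift F (M : R) x : bmeas M F -> bmeas M (fun y => F (x + y)).
Proof. by move=> [mF FM]; split; [exact: measurable_addl|move=> y; exact: FM]. Qed.

Lemma bmeas_intg F (M : R) x : bmeas M F -> intg m (fun z => F (x + h z)).
Proof.
move=> /(bmeas_shift x)[mF FM]; apply: (@intg_bounded _ _ _ m M) => //.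
exact: (measurableT_comp mF mh).
Qed.

Lemma cop_bmeas F (M : R) : bmeas M F -> bmeas M (cop m h F).
Proof.
move=> bF; have [mF FM] := bF; split; last first.
  move=> x; have I := bmeas_intg x bF; apply: le_trans (Ex_norm I) _.
  rewrite -[leRHS](Ex_cst m M); apply: Ex_le; [exact: intg_norm|exact: intg_cst|].
  by move=> z; exact: FM.
(* A Dirac mass as first factor makes Fubini's theorem deliver the measurability of the inner
   integral in [x]. *)
pose D := (\d_(0 : RT) : probability RT R).
have mG : measurable_fun setT (fun z : RT * T => F (z.1 + h z.2)).
  have ma : measurable_fun setT (fun z : RT * T => z.1 + h z.2 : RT).
    by apply: measurable_funD; [exact: measurable_fst|exact: measurableT_comp mh measurable_snd].
  exact: measurableT_comp mF ma.
have I : intg (D \x m)%E (fun z : RT * T => F (z.1 + h z.2)).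
  exact: (@intg_bounded _ _ R (D \x m)%E M _ mG (fun z => FM _)).
have [I1 _] := fubini1 I.
exact: (intg_meas I1).
Qed.

Lemma cop_dist F G (M e : R) : bmeas M F -> bmeas M G -> (forall x, `|F x - G x| <= e) ->
  forall x, `|cop m h F x - cop m h G x| <= e.
Proof.
move=> bF bG FG x; have IF := bmeas_intg x bF; have IG := bmeas_intg x bG.
rewrite /cop -ExB//; apply: le_trans (Ex_norm (intgB IF IG)) _.
rewrite -[leRHS](Ex_cst m e); apply: Ex_le; [exact/intg_norm/intgB|exact: intg_cst|].
by move=> z; exact: FG.
Qed.

Lemma iter_cop_bmeas n F (M : R) : bmeas M F -> bmeas M (iter n (cop m h) F).
Proof. by move=> bF; elim: n => //= n; exact: cop_bmeas. Qed.

End one.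

Section two.
Context d1 (T1 : measurableType d1) (m1 : probability T1 R) (h1 : T1 -> R).
Context d2 (T2 : measurableType d2) (m2 : probability T2 R) (h2 : T2 -> R).
Hypothesis mh1 : measurable_fun setT h1.
Hypothesis mh2 : measurable_fun setT h2.

Lemma cop_comm F (M : R) : bmeas M F -> cop m1 h1 (cop m2 h2 F) = cop m2 h2 (cop m1 h1 F).
Proof.
move=> bF; apply/funext => x; have [mF FM] := bmeas_shift x bF.
have mG : measurable_fun setT (fun z : T1 * T2 => F (x + (h1 z.1 + h2 z.2))).
  have ma : measurable_fun setT (fun z : T1 * T2 => h1 z.1 + h2 z.2 : RT).
    by apply: measurable_funD; [exact: measurableT_comp mh1 measurable_fst|exact: measurableT_comp mh2 measurable_snd].
  exact: measurableT_comp mF ma.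
have I : intg (m1 \x m2)%E (fun z : T1 * T2 => F (x + (h1 z.1 + h2 z.2))).
  exact: (@intg_bounded _ _ R (m1 \x m2)%E M _ mG (fun z => FM _)).
have [_ E1] := fubini1 I; have [_ E2] := fubini2 I.
transitivity (Ex (m1 \x m2)%E (fun z : T1 * T2 => F (x + (h1 z.1 + h2 z.2)))).
  rewrite -E1; congr Rintegral; apply/funext => y; congr Rintegral; apply/funext => z.
  by rewrite addrA.
rewrite -E2; congr Rintegral; apply/funext => y; congr Rintegral; apply/funext => z /=.
by rewrite -addrA [h1 z + _]addrC.
Qed.

End two.

(* Trotter's comparison of two commuting semigroups of contractions. *)
Lemma cop_trotter d1 (T1 : measurableType d1) (m1 : probability T1 R) (h1 : T1 -> R)
  d2 (T2 : measurableType d2) (m2 : probability T2 R) (h2 : T2 -> R) n (F : RT -> R) (M e : R) :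
  measurable_fun setT h1 -> measurable_fun setT h2 -> bmeas M F ->
  (forall x, `|cop m1 h1 F x - cop m2 h2 F x| <= e) ->
  forall x, `|iter n (cop m1 h1) F x - iter n (cop m2 h2) F x| <= n%:R * e.
Proof.
move=> mh1 mh2; elim: n F => [|n IH] F bF He x; first by rewrite subrr normr0 mul0r.
have b1 := cop_bmeas m1 mh1 bF; have b2 := cop_bmeas m2 mh2 bF.
have H2 : forall x, `|cop m1 h1 (cop m2 h2 F) x - cop m2 h2 (cop m2 h2 F) x| <= e.
  by rewrite (cop_comm m1 m2 mh1 mh2 bF); exact: (cop_dist m2 mh2 b1 b2 He).
have H1 : forall x, `|iter n (cop m1 h1) (cop m1 h1 F) x - iter n (cop m1 h1) (cop m2 h2 F) x| <= e.
  elim: n {IH} => [|n IH] //=.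
  by apply: (cop_dist m1 mh1 (iter_cop_bmeas m1 mh1 n b1) (iter_cop_bmeas m1 mh1 n b2)).
rewrite !iterSr -natr1 mulrDl mul1r [leRHS]addrC.
rewrite (_ : _ - _ = iter n (cop m1 h1) (cop m1 h1 F) x - iter n (cop m1 h1) (cop m2 h2 F) x +
   (iter n (cop m1 h1) (cop m2 h2 F) x - iter n (cop m2 h2) (cop m2 h2 F) x)); last by ring.
apply: le_trans (ler_normD _ _) _; rewrite lerD//.
exact: IH.
Qed.

Lemma iter_semigroup (nu : R -> probability RT R) n s F (M : R) :
  (forall s1 s2 (G : RT -> R), 0 < s1 -> 0 < s2 -> bmeas M G ->
    Ex (nu s1) (fun y => Ex (nu s2) (fun z => G (y + z))) = Ex (nu (Num.sqrt (s1 ^+ 2 + s2 ^+ 2))) G) ->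
  0 < s -> bmeas M F ->
  iter n.+1 (cop (nu s) id) F = cop (nu (Num.sqrt (n.+1%:R * s ^+ 2))) id F.
Proof.
move=> H s0; elim: n F => [|n IH] F bF.
  by rewrite /= mul1r sqrtr_sqr gtr0_norm.
have mid : measurable_fun setT (fun y : RT => y : R) by [].
rewrite iterSr IH; last exact: cop_bmeas.
apply/funext => x; have bx := bmeas_shift x bF.
have r0 : 0 < Num.sqrt (n.+1%:R * s ^+ 2) by rewrite sqrtr_gt0 mulr_gt0// exprn_gt0.
have := H _ _ _ r0 s0 bx.
rewrite sqr_sqrtr; last by rewrite mulr_ge0 ?sqr_ge0.
rewrite (_ : n.+1%:R * s ^+ 2 + s ^+ 2 = n.+2%:R * s ^+ 2); last by rewrite -[in RHS]natr1 mulrDl mul1r.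
rewrite /cop => <-; congr Rintegral; apply/funext => y; congr Rintegral; apply/funext => z.
by rewrite addrA.
Qed.

Lemma iter_normal n s F (M : R) : 0 < s -> bmeas M F ->
  iter n.+1 (cop (@normal_prob R 0 s) id) F = cop (@normal_prob R 0 (Num.sqrt (n.+1%:R * s ^+ 2))) id F.
Proof.
apply: (@iter_semigroup (fun s => @normal_prob R 0 s : probability RT R)).
by move=> s1 s2 G s10 s20 [mG GM]; exact: normal_conv s10 s20 mG GM.
Qed.
End convolution_operators.

Section one_step.
Variable R : realType.
Local Notation RT := (measurableTypeR R).

(** [F1] and [F2] stand for the first two derivatives. With this remainder, quadratic for large [w]
    and cubic for small [w], square-integrable summands suffice, as in Lindeberg's condition. *)
Definition smooth (M C : R) (F F1 F2 : RT -> R) :=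
  bmeas M F /\ forall u w : R, `|F (u + w) - F u - w * F1 u - w ^+ 2 / 2 * F2 u| <= C * (w ^+ 2 * Num.min 1 `|w|).

Lemma cop_expand d (T : measurableType d) (m : probability T R) (h : T -> R) F F1 F2 (M C x : R) :
  smooth M C F F1 F2 -> sqi m h -> Ex m h = 0 ->
  `|cop m h F x - F x - Ex m (fun z => h z ^+ 2) / 2 * F2 x| <=
    C * Ex m (fun z => h z ^+ 2 * Num.min 1 `|h z|).
Proof.
move=> [bF HF] sh h0; have I := bmeas_intg m (sqi_meas sh) x bF.
have Ih := sqi_intg sh; have Ih2 := sqi_sq sh.
have Im : intg m (fun z => h z ^+ 2 * Num.min 1 `|h z|).
  apply: (intg_le _ _ Ih2).
    apply: measurable_funM; first exact: (intg_meas Ih2).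
    by apply: measurable_minr => //; exact: measurableT_comp (sqi_meas sh).
  move=> z; rewrite ger0_norm; last by rewrite mulr_ge0 ?sqr_ge0// le_min ler01 /=.
  by apply: ler_piMr; [exact: sqr_ge0|rewrite ge_min lexx].
have J : intg m (fun z => F (x + h z) - F x - F1 x * h z - F2 x / 2 * h z ^+ 2).
  by apply: intgB (intgZ _ Ih2); apply: intgB (intgZ _ Ih); apply: intgB I (intg_cst _ _).
have -> : cop m h F x - F x - Ex m (fun z => h z ^+ 2) / 2 * F2 x =
   Ex m (fun z => F (x + h z) - F x - F1 x * h z - F2 x / 2 * h z ^+ 2).
  rewrite (ExB (intgB (intgB I (intg_cst _ _)) (intgZ _ Ih)) (intgZ _ Ih2)).
  rewrite (ExB (intgB I (intg_cst _ _)) (intgZ _ Ih)) (ExB I (intg_cst _ _)).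
  rewrite Ex_cst (ExZ _ Ih) (ExZ _ Ih2) h0 /cop; ring.
apply: le_trans (Ex_norm J) _; rewrite -ExZ//.
apply: Ex_le; [exact: intg_norm|exact: intgZ|move=> z].
rewrite [F1 x * _]mulrC (_ : F2 x / 2 * h z ^+ 2 = h z ^+ 2 / 2 * F2 x); last by ring.
exact: HF.
Qed.

(** A step of the walk and a Gaussian step of variance [sigma ^+ 2 / N] have the same expansion up
    to second order; [N] errors of size [o(1/N)] accumulate, and [N] Gaussian steps compose exactly
    to the limit law. *)
Lemma clt_smooth d (T : measurableType d) (m : probability T R) (w : T -> R) F F1 F2 (M C : R) :
  0 <= C -> smooth M C F F1 F2 -> sqi m w -> Ex m w = 0 ->
  let sigma := Num.sqrt (Ex m (fun z => w z ^+ 2)) in 0 < sigma ->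
  forall e : R, 0 < e -> exists N0, forall N, (N0 <= N)%N -> 
  `|iter N (cop m (fun z => w z / Num.sqrt N%:R)) F 0 - Ex (@normal_prob R 0 sigma) F| <= e.
Proof.
move=> C0 sF sw w0 sigma sigma0 e e0.
have E0 : 0 <= Ex m (fun z => w z ^+ 2) by apply: Ex_ge0 => z; exact: sqr_ge0.
have sE : sigma ^+ 2 = Ex m (fun z => w z ^+ 2) by rewrite sqr_sqrtr.
have e2 : 0 < e / (2 * (C + 1)) by rewrite divr_gt0//; lra.
have [N1 HN1] := lindeberg_small sw e2.
(* Past [A ^+ 2] the accumulated cubic remainder of the Gaussian steps, of order [1 / sqrt N], is
   below [e / 2]. *)
pose A := C * (12 * expR 1 * sigma ^+ 3) / (e / 2).
exists (maxn N1 (Num.truncn (A ^+ 2)).+1) => -[|N]; first by rewrite geq_max ltn0 andbF.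
rewrite geq_max => /andP[NN1 NN2].
have [bF _] := sF.
have n0 : 0 < N.+1%:R :> R by rewrite ltr0n.
set r := Num.sqrt N.+1%:R; have r0 : 0 < r by rewrite sqrtr_gt0.
have r2 : r ^+ 2 = N.+1%:R by rewrite sqr_sqrtr// ltW.
have sh : sqi m (fun z => w z / r).
  by apply: (sqi_le _ _ (sqiZ r^-1 sw)) => [|z]; [apply: measurable_funM => //; exact: (sqi_meas sw)|rewrite mulrC].
have h0 : Ex m (fun z => w z / r) = 0.
  rewrite -[RHS](mulr0 r^-1) -w0 -ExZ; last exact: sqi_intg.
  by congr Rintegral; apply/funext => z; rewrite mulrC.
have h2 : Ex m (fun z => (w z / r) ^+ 2) = sigma ^+ 2 / N.+1%:R.
  rewrite sE mulrC -ExZ; last exact: sqi_sq.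
  by congr Rintegral; apply/funext => z; rewrite expr_div_n r2 mulrC.
have [Im Em] := HN1 N.+1 NN1 isT.
have m1 : Ex m (fun z => (w z / r) ^+ 2 * Num.min 1 `|w z / r|) <= e / (2 * (C + 1)) / N.+1%:R.
  apply: (@le_trans _ _ (N.+1%:R^-1 * Ex m (fun x => w x ^+ 2 * Num.min 1 (`|w x| / r)))).
    rewrite -ExZ// le_eqVlt; apply/orP; left; apply/eqP.
    congr Rintegral; apply/funext => z; rewrite expr_div_n r2 normrM.
    by rewrite [`|r^-1|]ger0_norm ?invr_ge0 ?ltW//; ring.
  by rewrite mulrC ler_wpM2r// invr_ge0 ltW.
have t0 : 0 < sigma / r by rewrite divr_gt0.
have [sid id0 id2] := normal_moments t0; have [Ic Ec] := normal_cube t0.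
have m2 : Ex (@normal_prob R 0 (sigma / r)) (fun y : RT => y ^+ 2 * Num.min 1 `|y : R|) <= 12 * expR 1 * (sigma / r) ^+ 3.
  apply: le_trans _ Ec; apply: Ex_le => //.
    apply: (@intg_le _ RT R (@normal_prob R 0 (sigma / r)) _ _ _ _ Ic).
      apply: measurable_funM; first exact: (intg_meas (sqi_sq sid)).
      by apply: measurable_minr => //; exact: measurableT_comp (sqi_meas sid).
    move=> y; rewrite ger0_norm; last by rewrite mulr_ge0 ?sqr_ge0// le_min ler01 /=.
    by rewrite -[y ^+ 2]real_normK ?num_real// [leRHS]exprSr ler_wpM2l ?sqr_ge0// ge_min lexx orbT.
  by move=> y; rewrite -[y ^+ 2]real_normK ?num_real// [leRHS]exprSr ler_wpM2l ?sqr_ge0// ge_min lexx orbT.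
pose dlt := C * (e / (2 * (C + 1)) / N.+1%:R) + C * (12 * expR 1 * (sigma / r) ^+ 3).
have step x : `|cop m (fun z => w z / r) F x - cop (@normal_prob R 0 (sigma / r)) id F x| <= dlt.
  have k1 := cop_expand x sF sh h0; have k2 := cop_expand x sF sid id0.
  rewrite h2 in k1; rewrite id2 expr_div_n r2 in k2.
  set G := sigma ^+ 2 / N.+1%:R / 2 * F2 x in k1 k2.
  rewrite (_ : _ - _ = (cop m (fun z => w z / r) F x - F x - G) - (cop (@normal_prob R 0 (sigma / r)) id F x - F x - G)); last by ring.
  apply: le_trans (ler_normB _ _) _; apply: lerD.
    by apply: le_trans k1 _; rewrite ler_wpM2l.
  by apply: le_trans k2 _; rewrite ler_wpM2l.
have mid : measurable_fun setT (fun y : RT => y : R) by [].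
have sk : Num.sqrt (N.+1%:R * (sigma / r) ^+ 2) = sigma.
  by rewrite expr_div_n r2 mulrCA divff ?mulr1 ?gt_eqF// sqrtr_sqr gtr0_norm.
have H := cop_trotter N.+1 (sqi_meas sh) mid bF step 0.
rewrite (iter_normal N t0 bF) sk in H.
have -> : Ex (@normal_prob R 0 sigma) F = cop (@normal_prob R 0 sigma) id F 0.
  by congr Rintegral; apply/funext => y; rewrite add0r.
apply: le_trans H _; rewrite /dlt mulrDr.
apply: (@le_trans _ _ (e / 2 + e / 2)); last by clear; lra.
apply: lerD.
  have -> : N.+1%:R * (C * (e / (2 * (C + 1)) / N.+1%:R)) = C / (C + 1) * (e / 2).
    by clear -C0; field; rewrite !gt_eqF//; lra.
  by clear -C0 e0; rewrite ler_piMl//; [lra|rewrite ler_pdivrMr; lra].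
have -> : N.+1%:R * (C * (12 * expR 1 * (sigma / r) ^+ 3)) = C * (12 * expR 1 * sigma ^+ 3) / r.
  rewrite -r2; have : r != 0 by rewrite gt_eqF.
  by move: (expR 1) => ee rn; field.
rewrite ler_pdivrMr// -ler_pdivrMl; last by clear -e0; lra.
rewrite mulrC -[leLHS]/A.
have A0 : 0 <= A.
  by clear -C0 sigma0 e0; rewrite /A divr_ge0//; [rewrite !mulr_ge0 ?expR_ge0 ?exprn_ge0// ltW|lra].
rewrite -[A]ger0_norm// -sqrtr_sqr ler_wsqrtr//.
by apply: le_trans (ltW (truncnS_gt _)) _; rewrite ler_nat.
Qed.

End one_step.

(** * The two samples and their joint laws *)

Section samples.
Context dO (Om : measurableType dO) (R : realType) (Pr : probability Om R).
Context d (T : measurableType d) (P Q : probability T R) (X Y : nat -> Om -> T).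
Hypothesis mX : forall i, measurable_fun setT (X i).
Hypothesis mY : forall i, measurable_fun setT (Y i).
Hypothesis samples : independent_iid_samples Pr P Q X Y.

Definition draw (k : nat + nat) : Om -> T := match k with inl i => X i | inr j => Y j end.

Lemma measurable_draw k : measurable_fun setT (draw k).
Proof. by case: k. Qed.

Lemma draw_indep : mutually_independent Pr draw.
Proof. by case: samples. Qed.

Lemma X_law i : has_law Pr (X i) P. Proof. by case: samples. Qed.
Lemma Y_law i : has_law Pr (Y i) Q. Proof. by case: samples. Qed.

Local Notation sT J := (sigmaT draw J).

Lemma pair_measurable i j (J : seq (nat + nat)) : inl i \in J -> inr j \in J ->
  measurable_fun (setT : set (sT J)) (fun w => (X i w, Y j w)).
Proof.
move=> iJ jJ; apply: measurable_fun_pair.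
  exact: (@measurable_Z_sigmaT _ _ _ _ _ draw J (inl i)).
exact: (@measurable_Z_sigmaT _ _ _ _ _ draw J (inr j)).
Qed.

Lemma pair_law i j : has_law Pr (fun w => (X i w, Y j w)) (P \x Q)%E.
Proof.
apply: (indep_pair_law measurable_draw draw_indep (J1 := [:: inl i]) (J2 := [:: inr j])) => //.
- by apply: (@measurable_Z_sigmaT _ _ _ _ _ draw [:: inl i] (inl i)); rewrite inE.
- by apply: (@measurable_Z_sigmaT _ _ _ _ _ draw [:: inr j] (inr j)); rewrite inE.
- exact: X_law.
- exact: Y_law.
Qed.

Lemma measurable_pairXY i j : measurable_fun setT (fun w => (X i w, Y j w)).
Proof. exact: measurable_fun_pair. Qed.

Lemma X_Ex i (f : T -> R) : intg P f ->
  intg Pr (fun w => f (X i w)) /\ Ex Pr (fun w => f (X i w)) = Ex P f.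
Proof. by move=> If; have [A B] := law_eq (mX i) (X_law i) (intg_meas If); split; [exact: A|]. Qed.

Lemma Y_Ex i (f : T -> R) : intg Q f ->
  intg Pr (fun w => f (Y i w)) /\ Ex Pr (fun w => f (Y i w)) = Ex Q f.
Proof. by move=> If; have [A B] := law_eq (mY i) (Y_law i) (intg_meas If); split; [exact: A|]. Qed.

Lemma pair_Ex i j (f : T * T -> R) : intg (P \x Q)%E f ->
  intg Pr (fun w => f (X i w, Y j w)) /\ Ex Pr (fun w => f (X i w, Y j w)) = Ex (P \x Q)%E f.
Proof.
move=> If; have [A B] := law_eq (measurable_pairXY i j) (pair_law i j) (intg_meas If).
by split; [exact: A|].
Qed.

(** A permutation pairs each [X i] with its own [Y (s i)], so the pairs use disjoint blocks of draws
    and are independent, each of law [P \x Q]. *)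
Lemma prod_pairs_Ex N (s : 'S_N) (phi : 'I_N -> T * T -> R) : (forall i, intg (P \x Q)%E (phi i)) ->
  intg Pr (fun w => \prod_i phi i (X i w, Y (s i) w)) /\
  Ex Pr (fun w => \prod_i phi i (X i w, Y (s i) w)) = \prod_i Ex (P \x Q)%E (phi i).
Proof.
move=> Iphi.
pose B (i : 'I_N) : seq (nat + nat) := [:: inl (i : nat); inr (s i : nat)].
have uB (r : seq 'I_N) : uniq r -> uniq (flatten [seq B k | k <- r]).
  elim: r => //= i r IH /andP[ir ur]; rewrite IH// !inE /= andbT.
  have inB (k : nat + nat) : k \in flatten [seq B j | j <- r] -> exists2 j, j \in r & k \in B j.
    by move/flatten_mapP.
  apply/andP; split; apply/negP => /inB[j jr]; rewrite !inE.
    by case/orP => // /eqP[/val_inj ij]; rewrite ij jr in ir.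
  by case/orP => // /eqP[/val_inj/perm_inj ij]; rewrite ij jr in ir.
have [_ I E] := indep_prod measurable_draw draw_indep (uB _ (index_enum_uniq _))
  (F := fun i w => phi i (X i w, Y (s i) w))
  (fun i => measurableT_comp (intg_meas (Iphi i)) (@pair_measurable i (s i) (B i) ltac:(by rewrite !inE eqxx) ltac:(by rewrite !inE eqxx orbT)))
  (fun i => (pair_Ex i (s i) (Iphi i)).1).
by split => //; rewrite E; apply: eq_bigr => i _; have [_ ->] := pair_Ex i (s i) (Iphi i).
Qed.

Local Notation RT := (measurableTypeR R).

(** The last summand is independent of the preceding ones; integrating it out applies the operator
    once to [F], which the induction hypothesis then takes as its function. *)
Lemma sum_iter_cop (h : T * T -> R) k F (M : R) x : measurable_fun setT h -> bmeas M F ->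
  Ex Pr (fun w => F (x + \sum_(i < k) h (X i w, Y i w))) = iter k (cop (P \x Q)%E h) F x.
Proof.
move=> mh; elim: k F => [|k IH] F bF.
  rewrite /= -[RHS](Ex_cst Pr (F x)); congr Rintegral; apply/funext => w.
  by rewrite big_ord0 addr0.
rewrite iterSr -IH; last exact: cop_bmeas.
pose J1 := flatten [seq [:: inl i; inr i] | i <- iota 0 k] : seq (nat + nat).
pose J2 : seq (nat + nat) := [:: inl k; inr k].
have J1in i : (inl i \in J1) = (i < k)%N /\ (inr i \in J1) = (i < k)%N.
  split; apply/flatten_mapP/idP => [[j]|ik].
  - by rewrite mem_iota !inE => /andP[_ jk] /orP[/eqP[->]|].
  - by exists i; rewrite ?mem_iota// !inE eqxx.
  - by rewrite mem_iota !inE => /andP[_ jk] /orP[|/eqP[->]].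
  - by exists i; rewrite ?mem_iota// !inE eqxx orbT.
have uJ : uniq (J1 ++ J2).
  rewrite cat_uniq; apply/and3P; split; [|apply/hasPn|by []].
    rewrite /J1; elim: (iota 0 k) (iota_uniq 0 k) => //= i r IHr /andP[ir ur].
    rewrite IHr// !inE /= andbT.
    apply/andP; split; apply/negP => /flatten_mapP[j jr]; rewrite !inE.
      by case/orP => // /eqP[ij]; rewrite ij jr in ir.
    by case/orP => // /eqP[ij]; rewrite ij jr in ir.
  have [h1 h2] := J1in k.
  move=> z; rewrite !inE => /orP[] /eqP ->; apply/negP => hz.
    by have : inl k \in J1 := hz; rewrite h1 ltnn.
  by have : inr k \in J1 := hz; rewrite h2 ltnn.
pose S w := \sum_(i < k) h (X i w, Y i w).
have mS : measurable_fun (setT : set (sT J1)) S.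
  apply: measurable_sum => i; apply: measurableT_comp mh _.
  by apply: pair_measurable; [have [-> _] := J1in i|have [_ ->] := J1in i].
have mS' : measurable_fun setT S := sigmaT_measurable_fun measurable_draw mS.
have mk : measurable_fun (setT : set (sT J2)) (fun w => (X k w, Y k w)).
  by apply: pair_measurable; rewrite !inE ?eqxx ?orbT.
pose SX := mfun_Sub (mem_set mS') : {RV Pr >-> R}.
pose mu1 : probability R R := distribution Pr SX.
have l1 : has_law Pr S mu1 by [].
have l12 := indep_pair_law measurable_draw draw_indep uJ mS mk l1 (pair_law k k).
have [mF FM] := bmeas_shift x bF.
pose H (z : R * (T * T)) := F (x + (z.1 + h z.2)).
have mH : measurable_fun setT H.
  have ma : measurable_fun setT (fun z : R * (T * T) => z.1 + h z.2 : RT).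
    by apply: measurable_funD; [exact: measurable_fst|exact: measurableT_comp mh measurable_snd].
  exact: measurableT_comp mF ma.
have IH' : intg (mu1 \x (P \x Q))%E H.
  exact: (@intg_bounded _ _ R (mu1 \x (P \x Q))%E M _ mH (fun z => FM _)).
have mp : measurable_fun setT (fun w => (S w, (X k w, Y k w))).
  by apply: measurable_fun_pair => //; exact: measurable_pairXY.
have [_ E1] := law_eq mp l12 mH.
have [I2 E2] := fubini1 IH'.
have [_ E3] := law_eq mS' l1 (intg_meas I2).
transitivity (Ex Pr (H \o (fun w => (S w, (X k w, Y k w))))).
  by congr Rintegral; apply/funext => w; rewrite /H/= big_ord_recr.
rewrite [LHS]E1 -E2 -[LHS]E3; congr Rintegral; apply/funext => w /=.
by congr Rintegral; apply/funext => z; rewrite /H /= addrA.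
Qed.
End samples.

(** * Convergence in law through sigmoids *)

Section portmanteau.
Variable R : realType.
Local Notation RT := (measurableTypeR R).

Lemma cvg_sum (I : Type) (s : seq I) (f : I -> nat -> R) (l : I -> R) :
  (forall i, f i n @[n --> \oo] --> l i) ->
  (\sum_(i <- s) f i n) @[n --> \oo] --> \sum_(i <- s) l i.
Proof.
move=> fl; elim: s => [|i s IH].
  by under eq_fun do rewrite big_nil; rewrite big_nil; exact: cvg_cst.
by under eq_fun do rewrite big_cons; rewrite big_cons; exact: cvgD.
Qed.

(* Smoothed step functions at [c] of width [e]: they have a Taylor expansion
   uniform on the line, and their linear combinations approximate every bounded
   continuous function on compact sets. *)
Definition sigmoid (c e x : R) : R := logistic ((x - c) / e).

Lemma logistic_neg (x : R) : logistic (- x) = 1 - logistic x.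
Proof.
rewrite /logistic opprK expRN; have := expR_gt0 x; move: (expR x) => y y0.
by field; rewrite !gt_eqF// ?addr_gt0// ?addr_gt0.
Qed.

Lemma logistic_neg_le (x : R) : 0 < x -> logistic (- x) <= x^-1.
Proof.
move=> x0; rewrite /logistic opprK lef_pV2 ?posrE ?addr_gt0 ?expR_gt0//.
by have := expR_ge1Dx x; lra.
Qed.

Lemma logistic_ge_half (x : R) : 0 <= x -> 2^-1 <= logistic x.
Proof.
move=> x0; rewrite /logistic lef_pV2 ?posrE ?addr_gt0 ?expR_gt0//.
have : expR (- x) <= 1 by rewrite expR_le1 oppr_le0.
lra.
Qed.

Lemma sigmoid_bounds c e x : 0 < sigmoid c e x < 1.
Proof. by rewrite logistic_gt0 logistic_lt1. Qed.

Lemma sigmoid_lipschitz c e x y : 0 < e -> `|sigmoid c e x - sigmoid c e y| <= `|x - y| / e.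
Proof.
move=> e0; have d := @is_derive_logistic R.
have := @mean_value_bound R (@logistic R) _ ((y - c) / e) ((x - y) / e) 1 ler01 d.
rewrite (_ : (y - c) / e + (x - y) / e = (x - c) / e); last by field; rewrite gt_eqF.
move=> H; have -> : `|x - y| / e = 1 * `|(x - y) / e|.
  by rewrite mul1r normrM [`|e^-1|]ger0_norm// invr_ge0 ltW.
apply: H => z _; have := logistic_gt0 z; have := logistic_lt1 z; move: (logistic z) => p p1 p0.
by rewrite ger0_norm; nra.
Qed.

Lemma sigmoid_smooth c e : 0 < e -> exists C F1 F2, 0 <= C /\ smooth 1 C (sigmoid c e : RT -> R) F1 F2.
Proof.
move=> e0.
pose p (x : RT) := sigmoid c e x.
exists (6 / e ^+ 3 + 2 + e^-1 + e^-1 ^+ 2), (fun x => e^-1 * (p x * (1 - p x))),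
  (fun x => e^-1 ^+ 2 * (p x * (1 - p x) * (1 - 2 * p x))).
have ei : 0 < e^-1 by rewrite invr_gt0.
have e3 : 0 <= 6 / e ^+ 3 by rewrite divr_ge0// exprn_ge0// ltW.
have e2 := exprn_gt0 2 ei.
split; first by lra.
have p01 x : 0 < p x < 1 by exact: sigmoid_bounds.
split.
  split; last by move=> x; have /andP[? ?] := p01 x; rewrite ger0_norm ltW.
  have cl : continuous (@logistic R).
    move=> x; apply: differentiable_continuous; apply/derivable1_diffP.
    by have [] := is_derive_logistic x.
  have ml : measurable_fun setT (@logistic R) := continuous_measurable_fun cl.
  have mlin : measurable_fun setT (fun x : RT => (x - c) / e : R).
    by apply: measurable_funM => //; apply: measurable_funB.
  exact: measurableT_comp ml mlin.
move=> u w.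
have T3 := logistic_taylor ((u - c) / e) (w / e).
have euw : (u - c) / e + w / e = (u + w - c) / e by field; rewrite gt_eqF.
rewrite euw in T3; rewrite -![logistic (_ / _)]/(p _) in T3.
set q := p u in T3 *; set r := p (u + w) in T3 *.
have q01 : 0 < q < 1 by exact: p01.
have r01 : 0 < r < 1 by exact: p01.
rewrite -/(p u) -/(p (u + w)) -/q -/r.
move: q r q01 r01 T3 => q r /andP[q0 q1] /andP[r0 r1] T3.
have [w1|w1] := lerP 1 `|w|; last first.
  rewrite (_ : _ - _ - _ - _ = r - q - w / e * (q * (1 - q)) - (w / e) ^+ 2 / 2 * (q * (1 - q) * (1 - 2 * q))); last first.
    by field; rewrite gt_eqF.
  apply: le_trans T3 _; rewrite normrM exprMn.
  rewrite [`|e^-1|]ger0_norm ?(ltW ei)// -exprVn.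
  rewrite -[w ^+ 2]real_normK ?num_real// -[`|w| ^+ 2 * `|w|]exprSr.
  have w3 := exprn_ge0 3 (normr_ge0 w).
  rewrite mulrA [leRHS]mulrC [leLHS](_ : _ = `|w| ^+ 3 * (6 * e^-1 ^+ 3)); last by ring.
  by apply: ler_wpM2l => //; lra.
rewrite mulr1.
have b1 : `|q * (1 - q)| <= 1 by rewrite ger0_norm; nra.
have b2 : `|q * (1 - q) * (1 - 2 * q)| <= 1 by rewrite ler_norml; apply/andP; split; nra.
have b0 : `|r - q| <= 1 by rewrite ler_norml; apply/andP; split; lra.
have w2 : `|w| <= w ^+ 2.
  by rewrite -[w ^+ 2]real_normK ?num_real// expr2 ler_peMl.
have w21 : 1 <= w ^+ 2 := le_trans w1 w2.
apply: le_trans (ler_normB _ _) _.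
apply: (@le_trans _ _ ((2 + e^-1) * w ^+ 2 + e^-1 ^+ 2 * w ^+ 2)); last first.
  by rewrite -mulrDl ler_wpM2r ?sqr_ge0//; lra.
apply: lerD.
  apply: le_trans (ler_normB _ _) _; rewrite mulrDl; apply: lerD; first lra.
  rewrite mulrCA normrM (ger0_norm (ltW ei)); apply: ler_wpM2l; first exact: ltW.
  by rewrite normrM -[leRHS]mulr1 ler_pM.
rewrite mulrCA normrM (ger0_norm (ltW e2)); apply: ler_wpM2l; first exact: ltW.
rewrite normrM -[leRHS]mulr1; apply: ler_pM => //.
by rewrite ger0_norm; lra.
Qed.

(** Compactness of [[-A, A]] along the filter of right neighbourhoods of [0]; the second point [y]
    is not confined to the interval. *)
Lemma uniform_continuity (f : R -> R) (A e : R) : continuous f -> 0 < e ->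
  exists2 dlt : R, 0 < dlt & forall x y, `|x| <= A -> `|x - y| < dlt -> `|f x - f y| <= e.
Proof.
move=> cf e0.
have /compact_near_coveringP cpt := @segment_compact R (- A) A.
have := cpt R (0^'+) (fun dlt x => forall y, `|x - y| < dlt -> `|f x - f y| <= e) _.
move=> [] // .
  move=> x xA; have e2 : 0 < e / 2 by lra.
  have /cvgrPdist_lt /(_ _ e2) := cf x; rewrite near_simpl => -[r /= r0 Hr].
  have r2 : 0 < r / 2 by lra.
  exists (ball x (r / 2), [set dlt | dlt < r / 2]).
    split; first exact: nbhsx_ballx.
    exact: nbhs_right_lt.
  move=> [x' dlt] /= [xx' dr] y x'y.
  have h1 : `|f x - f x'| < e / 2.
    apply: Hr; rewrite /ball /= in xx' *; apply: lt_trans xx' _; lra.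
  have h2 : `|f x - f y| < e / 2.
    apply: Hr; rewrite /ball /= in xx' *.
    rewrite (_ : x - y = (x - x') + (x' - y)); last by ring.
    apply: le_lt_trans (ler_normD _ _) _; lra.
  rewrite (_ : f x' - f y = (f x - f y) - (f x - f x')); last by ring.
  apply: le_trans (ler_normB _ _) _; lra.
move=> r /= r0 Hr; exists (r / 2); first by lra.
move=> x y xA xy; apply: (Hr (r / 2)) xy.
- rewrite /ball /= sub0r normrN gtr0_norm; lra.
- lra.
- by rewrite /= in_itv /= -ler_norml.
Qed.

Lemma monotone_count (b : nat -> bool) n : (forall j, b j.+1 -> b j) ->
  exists2 k, (k <= n)%N & forall j, (j < n)%N -> b j = (j < k)%N.
Proof.
move=> mb; elim: n => [|n [k kn Hk]]; first by exists 0%N.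
have mono j i : b (j + i)%N -> b j.
  elim: i => [|i IH]; first by rewrite addn0.
  by rewrite addnS => /mb.
case bn : (b n).
  exists n.+1 => // j jn; rewrite jn.
  by apply: (mono j (n - j)%N); rewrite subnKC.
have [kn'|kn'] := ltnP k n.+1; last by rewrite ltnNge kn in kn'.
exists k; first exact: leq_trans kn _.
move=> j; rewrite ltnS leq_eqVlt => /orP[/eqP ->|jn]; last exact: Hk.
by rewrite bn ltnNge kn.
Qed.

Lemma sigmoid_step (c e t x : R) : 0 < e -> 0 < t -> t <= `|x - c| ->
  `|sigmoid c e x - (c <= x)%R%:R| <= e / t.
Proof.
move=> e0 t0 tx; rewrite /sigmoid.
have [cx|xc] := lerP c x.
  rewrite ger0_norm ?subr_ge0// in tx.
  have z0 : 0 < (x - c) / e by rewrite divr_gt0//; lra.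
  rewrite distrC -logistic_neg ger0_norm ?(ltW (logistic_gt0 _))//.
  apply: le_trans (logistic_neg_le z0) _; rewrite invf_div ler_pM2l// lef_pV2 ?posrE//.
  lra.
rewrite ltr0_norm ?subr_lt0// opprB in tx.
have z0 : 0 < (c - x) / e by rewrite divr_gt0//; lra.
rewrite subr0 ger0_norm ?(ltW (logistic_gt0 _))//.
rewrite (_ : (x - c) / e = - ((c - x) / e)); last by ring.
apply: le_trans (logistic_neg_le z0) _; rewrite invf_div ler_pM2l// lef_pV2 ?posrE//.
lra.
Qed.

(** A staircase through the values of [f] on a fine grid, with smoothed jumps. Every [x], inside
    [[-A, A]] or not, sees the sum telescope to one grid value of [f] up to [eps / 2], which also
    gives the global bound on [g]. *)
Lemma sigmoid_approx (f : R -> R) (M A eps : R) : continuous f -> (forall x, `|f x| <= M) ->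
  0 < A -> 0 < eps -> exists n (c dd : 'I_n -> R) (b e : R), 0 < e /\
  let g x := b + \sum_j dd j * sigmoid (c j) e x in
  (forall x, `|x| <= A -> `|f x - g x| <= eps) /\ (forall x, `|g x| <= M + eps).
Proof.
move=> cf fM A0 eps0; have e4 : 0 < eps / 4 by lra.
have M0 : 0 <= M := le_trans (normr_ge0 _) (fM 0).
have [dlt dlt0 Hd] := uniform_continuity A cf e4.
pose n := (Num.truncn (2 * A / dlt)).+1.
have n0 : 0 < n%:R :> R by rewrite ltr0n.
pose h : R := 2 * A / n%:R.
have h0 : 0 < h by rewrite divr_gt0// mulr_gt0.
have hd : h < dlt.
  rewrite /h ltr_pdivrMr// -ltr_pdivrMl// mulrC.
  exact: truncnS_gt.
pose xx (j : nat) : R := - A + j%:R * h.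
have xxS j : xx j.+1 = xx j + h by rewrite /xx -natr1; ring.
have xxn : xx n = A by rewrite /xx /h; field; rewrite gt_eqF.
have xx0 : xx 0%N = - A by rewrite /xx mul0r addr0.
have xx_in j : (j <= n)%N -> `|xx j| <= A.
  move=> jn; have jn' : j%:R <= n%:R :> R by rewrite ler_nat.
  have j0 : 0 <= j%:R :> R by [].
  have : j%:R * h <= n%:R * h by rewrite ler_wpM2r// ltW.
  have : 0 <= j%:R * h by rewrite mulr_ge0// ltW.
  have : n%:R * h = 2 * A by rewrite /h; field; rewrite gt_eqF.
  by rewrite ler_norml /xx => -> ? ?; apply/andP; split; lra.
pose dd (j : 'I_n) : R := f (xx j.+1) - f (xx j).
have ddM j : `|dd j| <= 2 * M.
  apply: le_trans (ler_normB _ _) _; have := fM (xx j.+1); have := fM (xx j); lra.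
have dds (j : 'I_n) : `|dd j| <= eps / 4.
  apply: Hd; first exact: xx_in.
  by rewrite xxS addrAC subrr add0r gtr0_norm.
(* At distance [h / 2] from its centre a sigmoid of this width misses its step by at most
   [eps / (8 n (M + 1))], so [n] jumps of size at most [2 M] add up to at most [eps / 4]. *)
pose e : R := h * eps / (16 * n%:R * (M + 1)).
have e0 : 0 < e.
  by apply: divr_gt0; [exact: mulr_gt0|apply: mulr_gt0; [exact: mulr_gt0|lra]].
exists n, (fun j => xx j), dd, (f (xx 0%N)), e; split => // g.
have main x : exists2 k, (k <= n)%N & `|g x - f (xx k)| <= eps / 2 /\
    (forall j, (j < n)%N -> (xx j <= x) = (j < k)%N).
  have [|k kn Hk] := @monotone_count (fun j => xx j <= x) n.
    by move=> j; apply: le_trans; rewrite xxS lerDl ltW.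
  exists k => //; split => //.
  have -> : g x - f (xx k) = \sum_j dd j * (sigmoid (xx j) e x - (xx j <= x)%R%:R).
    under [RHS]eq_bigr do rewrite mulrBr.
    rewrite sumrB /g; suff -> : \sum_j dd j * (xx j <= x)%R%:R = f (xx k) - f (xx 0%N) by ring.
    rewrite -(telescope_sumr (fun j => f (xx j)) (leq0n k)) big_mkord.
    rewrite (big_ord_widen n (fun j => f (xx j.+1) - f (xx j)) kn) [RHS]big_mkcond /=.
    apply: eq_bigr => j _; rewrite (Hk j (ltn_ord j)); case: ifP => _; first by rewrite mulr1.
    by rewrite mulr0.
  apply: le_trans (ler_norm_sum _ _ _) _.
  pose near (j : 'I_n) := `|x - xx j| < h / 2.
  apply: (@le_trans _ _ (\sum_(j < n) ((near j)%:R * (eps / 4) + 2 * M * (e / (h / 2))))).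
    apply: ler_sum => j _; rewrite normrM.
    have big0 : 0 <= 2 * M * (e / (h / 2)) 
      by apply: mulr_ge0; [exact: mulr_ge0|apply/ltW/divr_gt0 => //; exact: divr_gt0].
    rewrite /near; case: ltP => xj; last first.
      rewrite mul0r add0r; apply: ler_pM => //.
      by apply: sigmoid_step => //; lra.
    rewrite mul1r; apply: (@le_trans _ _ (eps / 4)); last by rewrite lerDl.
    rewrite -[leRHS]mulr1; apply: ler_pM => //.
    have /andP[s0 s1] := sigmoid_bounds (xx j) e x.
    by clear -s0 s1; case: (xx j <= x)%R => /=; rewrite ler_norml; apply/andP; split; lra.
  rewrite big_split /= -mulr_suml sumr_const card_ord.
  have -> : eps / 2 = eps / 4 + eps / 4 by lra.
  apply: lerD.
    rewrite ler_piMl ?(ltW e4)//.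
    (* At most one grid point lies within [h / 2] of [x], and its jump is at most [eps / 4] by
       uniform continuity. *)
    have [j0 nj0|no] := pickP near; last by rewrite big1// => j _; rewrite no.
    rewrite (bigD1 j0)//= nj0 big1 ?addr0// => j jj0.
    rewrite /near in nj0 *; case: ltP => // nj; exfalso.
    have far : h <= `|xx j - xx j0|.
      have -> : xx j - xx j0 = (j%:R - j0%:R) * h by rewrite /xx; ring.
      rewrite normrM (gtr0_norm h0) ler_peMl ?(ltW h0)//.
      have jn0 : (j : nat) != j0 by [].
      have [lt|lt] : (j < j0)%N \/ (j0 < j)%N by apply/orP; rewrite -neq_ltn.
        have : j.+1%:R <= j0%:R :> R by rewrite ler_nat.
        by clear; rewrite -natr1 => ?; rewrite ler0_norm; lra.
      have : j0.+1%:R <= j%:R :> R by rewrite ler_nat.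
      by clear; rewrite -natr1 => ?; rewrite ger0_norm; lra.
    have : `|xx j - xx j0| < h; last by rewrite ltNge far.
    rewrite (_ : xx j - xx j0 = (x - xx j0) - (x - xx j)); last by ring.
    apply: le_lt_trans (ler_normB _ _) _; lra.
  rewrite -[leLHS]mulr_natr /e.
  have -> : 2 * M * (h * eps / (16 * n%:R * (M + 1)) / (h / 2)) * n%:R = M / (M + 1) * (eps / 4).
    by field; rewrite !gt_eqF//; lra.
  by rewrite ler_piMl ?(ltW e4)// ler_pdivrMr; lra.
split=> x; last first.
  have [k kn [gk _]] := main x.
  rewrite (_ : g x = (g x - f (xx k)) + f (xx k)); last by ring.
  apply: le_trans (ler_normD _ _) _; have := fM (xx k); lra.
move=> xA; have [k kn [gk Hk]] := main x.
have xk : `|x - xx k| <= h.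
  move: xA; rewrite ler_norml => /andP[xA1 xA2].
  have n1 : (0 < n)%N by [].
  have k0 : (0 < k)%N by rewrite -Hk// xx0.
  have x1 : xx k.-1 <= x by rewrite Hk ?prednK// (leq_trans _ kn)// prednK.
  have xkE : xx k = xx k.-1 + h by rewrite -xxS prednK.
  have x2 : x <= xx k.
    move: kn; rewrite leq_eqVlt => /orP[/eqP ->|kn]; first by rewrite xxn.
    by have := Hk k kn; rewrite ltnn => /negbT; rewrite -ltNge => /ltW.
  by clear -x1 xkE x2 h0; rewrite ler_norml; apply/andP; split; lra.
have fk : `|f x - f (xx k)| <= eps / 4.
  by apply: Hd => //; apply: le_lt_trans xk hd.
rewrite (_ : f x - g x = (f x - f (xx k)) - (g x - f (xx k))); last by ring.
apply: le_trans (ler_normB _ _) _; lra.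
Qed.

(** A smooth substitute for the indicator of [|x| > n], built from sigmoids so that tightness of the
    sequence follows from the assumed convergence. *)
Definition sigmoid_tail (n : nat) (x : R) : R := sigmoid n%:R 1 x + (1 - sigmoid (- n%:R) 1 x).

Lemma sigmoid_tail_ge n x : n%:R < `|x| -> 2^-1 <= sigmoid_tail n x.
Proof.
have /andP[a0 a1] := sigmoid_bounds n%:R 1 x; have /andP[b0 b1] := sigmoid_bounds (- n%:R) 1 x.
rewrite /sigmoid_tail; case: (ger0P x) => x0 nx.
  have : 2^-1 <= sigmoid n%:R 1 x by apply: logistic_ge_half; rewrite divr1; lra.
  lra.
have : 2^-1 <= 1 - sigmoid (- n%:R) 1 x.
  by rewrite /sigmoid -logistic_neg; apply: logistic_ge_half; rewrite divr1; lra.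
lra.
Qed.

Lemma sigmoid_tail_bounds n x : 0 <= sigmoid_tail n x <= 2.
Proof.
have /andP[a0 a1] := sigmoid_bounds n%:R 1 x; have /andP[b0 b1] := sigmoid_bounds (- n%:R) 1 x.
by rewrite /sigmoid_tail; apply/andP; split; lra.
Qed.

Lemma sigmoid_tail_le (k : nat) (x : R) : `|x| <= k.+1%:R -> sigmoid_tail (k.+1 + k.+1) x <= 2 / k.+1%:R.
Proof.
move=> xk; have k0 : 0 < k.+1%:R :> R by [].
have := @sigmoid_step (k.+1 + k.+1)%:R 1 k.+1%:R x ltr01 k0.
have := @sigmoid_step (- (k.+1 + k.+1)%:R) 1 k.+1%:R x ltr01 k0.
rewrite natrD; move: xk; rewrite ler_norml => /andP[x1 x2].
rewrite (_ : (- _ <= x) = true); last by lra.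
rewrite (_ : (_ + _ <= x) = false); last by apply/negbTE; rewrite -ltNge; lra.
move=> H1 H2; have h1 : k.+1%:R <= `|x - - (k.+1%:R + k.+1%:R)| by rewrite ger0_norm; lra.
have h2 : k.+1%:R <= `|x - (k.+1%:R + k.+1%:R)| by rewrite ler0_norm; lra.
move: (H1 h1) (H2 h2); rewrite /sigmoid_tail natrD !ler_norml mulr1n mulr0n.
move: (sigmoid _ _ _) (sigmoid _ _ _) (k.+1%:R^-1) => a b c /andP[? ?] /andP[? ?]; lra.
Qed.

Lemma sigmoid_bmeas c e : 0 < e -> bmeas 1 (sigmoid c e : RT -> R).
Proof. by move=> /sigmoid_smooth => /(_ c)[C [F1 [F2 [_ []]]]]. Qed.

Lemma tail_bookkeeping (eps tau K eps0 f1 f2 g1 g2 t1 t2 : R) : 0 < K -> K * tau * 3 = eps ->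
  eps <= eps0 / 4 -> `|g1 - g2| <= eps -> `|t1 - t2| <= tau ->
  `|f2 - g2| <= eps + K * t2 -> `|f1 - g1| <= eps + K * t1 -> t1 <= tau -> `|f1 - f2| <= eps0.
Proof.
move=> K0 tauE e2; rewrite !ler_norml => /andP[? ?] /andP[? ?] /andP[? ?] /andP[? ?] t1t.
have : K * t1 <= K * tau by rewrite ler_pM2l.
have : K * t2 <= K * (tau + tau) by rewrite ler_pM2l//; lra.
by rewrite [K * (_ + _)]mulrDr => ? ?; apply/andP; split; lra.
Qed.

Lemma sigmoid_cvg_in_law d (Om : measurableType d) (Pr : probability Om R)
    (Z : nat -> Om -> R) (nu : probability RT R) :
  (forall n, measurable_fun setT (Z n : Om -> RT)) ->
  (forall c e : R, 0 < e -> Ex Pr (fun w => sigmoid c e (Z n w)) @[n --> \oo] --> Ex nu (sigmoid c e)) ->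
  cvg_in_law Pr Z nu.
Proof.
move=> mZ cvgZ f cf [M0 fM0].
have [M M1 fM] : exists2 M : R, 0 <= M & forall t, `|f t| <= M.
  by exists M0 => //; apply: le_trans (fM0 0).
have mf : measurable_fun setT (f : RT -> R) := continuous_measurable_fun cf.
apply/cvgrPdist_le => eps0 eps00.
pose eps : R := Num.min 1 (eps0 / 4).
have e1 : eps <= 1 by rewrite ge_min lexx.
have e2 : eps <= eps0 / 4 by rewrite ge_min lexx orbT.
have eps_gt0 : 0 < eps by rewrite lt_min ltr01 divr_gt0.
(* Off [[- k.+1, k.+1]] the difference of [f] and its approximation [g] is at most
   [2 M + eps <= 2 M + 1], while the tail function is at least [1/2]. *)
pose K := 4 * M + 2; have K0 : 0 < K by rewrite /K; lra.
pose tau := eps / (3 * K); have tau0 : 0 < tau by rewrite divr_gt0// mulr_gt0.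
have tauE : K * tau * 3 = eps by rewrite /tau; field; rewrite gt_eqF.
have mtail k : measurable_fun setT (sigmoid_tail k : RT -> R).
  apply: measurable_funD; first by have [] := sigmoid_bmeas k%:R ltr01.
  by apply: measurable_funB => //; have [] := sigmoid_bmeas (- k%:R) ltr01.
have Itail d' (Om' : measurableType d') (m : probability Om' R) k (W : Om' -> R) :
    measurable_fun setT (W : Om' -> RT) -> intg m (fun w => sigmoid_tail k (W w)).
  move=> mW; apply: (@intg_bounded _ _ _ m 2); first exact: measurableT_comp (mtail k) mW.
  by move=> x; have /andP[? ?] := sigmoid_tail_bounds k (W x); rewrite ger0_norm.
have Isig d' (Om' : measurableType d') (m : probability Om' R) c e (W : Om' -> R) : 0 < e ->
    measurable_fun setT (W : Om' -> RT) -> intg m (fun w => sigmoid c e (W w)).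
  move=> e0 mW; have [ms Ms] := sigmoid_bmeas c e0.
  apply: (@intg_bounded _ _ _ m 1); first exact: measurableT_comp ms mW.
  by move=> x; exact: Ms.
have mid : measurable_fun setT (idfun : RT -> RT) by exact: measurable_id.
have [k ktail] : exists k : nat, Ex nu (sigmoid_tail k) <= tau.
  have tau4 : 0 < tau / 4 by lra.
  have [n Hn] := tail_small (mid : measurable_fun setT (idfun : RT -> R)) (intg_cst nu 1) tau4.
  have [j j1 j2] : exists2 j : nat, (n <= j.+1)%N & 2 / j.+1%:R <= tau / 2.
    exists (maxn n (Num.truncn (4 / tau))); first by rewrite ltnW// ltnS leq_maxl.
    have : 4 / tau < (maxn n (Num.truncn (4 / tau))).+1%:R.
      apply: lt_le_trans (truncnS_gt _) _; rewrite ler_nat ltnS; exact: leq_maxr.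
    move: (_.+1%:R) (ltr0n R (maxn n (Num.truncn (4 / tau))).+1) => z /= z0.
    by rewrite ltr_pdivrMr// => h; rewrite ler_pdivrMr//; lra.
  exists (j.+1 + j.+1)%N.
  have mI : measurable_fun setT (fun x : RT => if n%:R < `|x| then `|1 : R| else 0 : R).
    apply: measurable_fun_ifT => //.
    by apply: measurable_fun_ltr => //; exact: measurableT_comp.
  have II : intg nu (fun x : RT => if n%:R < `|x| then `|1 : R| else 0 : R).
    apply: (@intg_bounded _ _ _ nu 1); first exact: mI.
    by move=> x; case: ifP => _; rewrite !(normr1, normr0, normr_id).
  apply: (@le_trans _ _ (Ex nu (fun x => 2 / j.+1%:R + 2 * (if n%:R < `|x| then `|1 : R| else 0)))).
    apply: Ex_le; [exact: Itail|apply: intgD; [exact: intg_cst|exact: intgZ]|].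
    move=> x; have z0 : 0 <= 2 / j.+1%:R :> R by [].
    case: ltrP => nx; rewrite ?normr1 ?mulr1 ?mulr0 ?addr0.
      have /andP[_ t2] := sigmoid_tail_bounds (j.+1 + j.+1) x; apply: le_trans t2 _.
      by rewrite lerDr.
    by apply: sigmoid_tail_le; apply: le_trans nx _; rewrite ler_nat.
  rewrite ExD; [|exact: intg_cst|exact: intgZ].
  rewrite Ex_cst ExZ//.
  have Hn' : Ex nu (fun x : RT => if n%:R < `|x| then `|1 : R| else 0 : R) <= tau / 4 := Hn.
  have l1 (z1 z2 : R) : z1 <= tau / 2 -> z2 <= tau / 4 -> z1 + 2 * z2 <= tau by lra.
  exact: l1 j2 Hn'.
have [n [c [dd [b [e [e0]]]]]] := @sigmoid_approx f M (k.+1)%:R eps cf fM (ltr0Sn _ _) eps_gt0.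
set g := (X in let g := X in _) => -[fg gM].
have Ig d' (Om' : measurableType d') (m : probability Om' R) (W : Om' -> R) :
    measurable_fun setT (W : Om' -> RT) -> intg m (fun w => g (W w)).
  move=> mW; apply: intgD; first exact: intg_cst.
  by apply: intg_sum => i _; apply: intgZ; exact: Isig.
have EgE d' (Om' : measurableType d') (m : probability Om' R) (W : Om' -> R) :
    measurable_fun setT (W : Om' -> RT) ->
    Ex m (fun w => g (W w)) = b + \sum_j dd j * Ex m (fun w => sigmoid (c j) e (W w)).
  move=> mW; rewrite ExD; [|exact: intg_cst|].
    rewrite Ex_cst Ex_sum; last by move=> i _; apply: intgZ; exact: Isig.
    by congr (_ + _); apply: eq_bigr => i _; rewrite ExZ//; exact: Isig.
  by apply: intg_sum => i _; apply: intgZ; exact: Isig.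
have If d' (Om' : measurableType d') (m : probability Om' R) (W : Om' -> R) :
    measurable_fun setT (W : Om' -> RT) -> intg m (fun w => f (W w)).
  move=> mW; apply: (@intg_bounded _ _ _ m M); first exact: measurableT_comp mf mW.
  by move=> x.
have close d' (Om' : measurableType d') (m : probability Om' R) (W : Om' -> R) :
    measurable_fun setT (W : Om' -> RT) ->
    `|Ex m (fun w => f (W w)) - Ex m (fun w => g (W w))| <= eps + K * Ex m (fun w => sigmoid_tail k (W w)).
  move=> mW; rewrite -ExB; [|exact: If|exact: Ig].
  apply: le_trans (Ex_norm _) _; first by apply: intgB; [exact: If|exact: Ig].
  have IT := Itail _ _ m k _ mW.
  rewrite -[X in _ <= X + _](Ex_cst m) -(ExZ K IT) -ExD; [|exact: intg_cst|exact: intgZ].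
  apply: Ex_le; [apply: intg_norm; apply: intgB; [exact: If|exact: Ig]| |].
    by apply: intgD; [exact: intg_cst|exact: intgZ].
  move=> x /=; have /andP[t0 t2] := sigmoid_tail_bounds k (W x).
  have [Wk|Wk] := lerP `|W x| k.+1%:R.
    apply: le_trans (fg _ Wk) _; rewrite lerDl; exact: mulr_ge0 (ltW K0) t0.
  have : 2^-1 <= sigmoid_tail k (W x).
    by apply: sigmoid_tail_ge; apply: le_lt_trans Wk; rewrite ler_nat.
  have := fM (W x); have := gM (W x); have := ler_normB (f (W x)) (g (W x)).
  by rewrite /K; nra.
have cg : Ex Pr (fun w => g (Z n w)) @[n --> \oo] --> Ex nu (fun x => g x).
  rewrite (EgE _ _ nu idfun mid).
  rewrite (_ : (fun i => _) = (fun i => b + \sum_j dd j * Ex Pr (fun w => sigmoid (c j) e (Z i w)))); last first.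
    by apply/funext => i; rewrite EgE.
  apply: cvgD; first exact: cvg_cst.
  apply: (@cvg_sum _ _ (fun j i => dd j * Ex Pr (fun w => sigmoid (c j) e (Z i w)))) => j.
  by apply: cvgM; [exact: cvg_cst|exact: cvgZ].
have ct : Ex Pr (fun w => sigmoid_tail k (Z n w)) @[n --> \oo] --> Ex nu (fun x => sigmoid_tail k x).
  have tE d' (Om' : measurableType d') (m : probability Om' R) (W : Om' -> R) :
      measurable_fun setT (W : Om' -> RT) ->
      Ex m (fun w => sigmoid_tail k (W w)) =
      Ex m (fun w => sigmoid k%:R 1 (W w)) + (1 - Ex m (fun w => sigmoid (- k%:R) 1 (W w))).
    move=> mW; rewrite ExD; [|exact: Isig|apply: intgB; [exact: intg_cst|exact: Isig]].
    by rewrite ExB; [rewrite Ex_cst|exact: intg_cst|exact: Isig].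
  rewrite (tE _ _ nu idfun mid).
  rewrite (_ : (fun i => _) = (fun i => Ex Pr (fun w => sigmoid k%:R 1 (Z i w)) +
     (1 - Ex Pr (fun w => sigmoid (- k%:R) 1 (Z i w))))); last by apply/funext => i; rewrite tE.
  by apply: cvgD; [exact: cvgZ|apply: cvgB; [exact: cvg_cst|exact: cvgZ]].
have eps3 := eps_gt0.
near=> i.
have Hg : `|Ex nu (fun x => g x) - Ex Pr (fun w => g (Z i w))| <= eps.
  by near: i; move/cvgrPdist_le : cg => /(_ _ eps3).
have Ht : `|Ex nu (fun x => sigmoid_tail k x) - Ex Pr (fun w => sigmoid_tail k (Z i w))| <= tau.
  by near: i; move/cvgrPdist_le : ct => /(_ _ tau0).
have C1 := close _ _ Pr _ (mZ i); have C2 := close _ _ nu idfun mid.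
exact: (@tail_bookkeeping eps tau K eps0 _ _ _ _ _ _ K0 tauE e2 Hg Ht C1 C2 ktail).
Unshelve. all: by end_near.
Qed.
End portmanteau.

(** * Second moments over the samples *)

Section gram.
Context dO (Om : measurableType dO) (R : realType) (Pr : probability Om R).
Context d (T : measurableType d) (P Q : probability T R) (X Y : nat -> Om -> T).
Hypothesis mX : forall i, measurable_fun setT (X i).
Hypothesis mY : forall i, measurable_fun setT (Y i).
Hypothesis samples : independent_iid_samples Pr P Q X Y.

Lemma prod_Ex N (f g : 'I_N -> T -> R) :
  (forall i, intg P (f i)) -> (forall i, intg Q (g i)) ->
  intg Pr (fun w => \prod_i f i (X i w) * \prod_i g i (Y i w)) /\
  Ex Pr (fun w => \prod_i f i (X i w) * \prod_i g i (Y i w)) =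
  \prod_i Ex P (f i) * \prod_i Ex Q (g i).
Proof.
move=> If Ig.
have I i := intg_tensor (If i) (Ig i).
have [I1 E1] := prod_pairs_Ex mX mY samples 1%g (fun i => (I i).1).
have fE : (fun w => \prod_i f i (X i w) * \prod_i g i (Y i w)) =
    (fun w => \prod_i (f i (X i w) * g i (Y ((1%g : 'S_N) i) w))).
  apply/funext => w; rewrite -big_split /=; apply: eq_bigr => i _; by rewrite perm1.
rewrite fE -big_split /=; split => //; rewrite E1; apply: eq_bigr => i _.
by rewrite (I i).2.
Qed.

Context (N K : nat) (a b : option 'I_K -> T -> R).
Hypotheses (sa : forall l, sqi P (a l)) (sb : forall l, sqi Q (b l)).
Hypothesis oa : forall l l', l != l' -> Ex P (fun x => a l x * a l' x) = 0.
Hypothesis ob : forall l l', l != l' -> Ex Q (fun x => b l x * b l' x) = 0.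
Hypothesis na : forall l, Ex P (fun x => a l x ^+ 2) = 1 \/ Ex P (fun x => a l x ^+ 2) = 0.
Hypothesis nb : forall l, Ex Q (fun x => b l x ^+ 2) = 1 \/ Ex Q (fun x => b l x ^+ 2) = 0.
Local Notation col := {ffun 'I_N -> option 'I_K}.

Definition sample_mon (cd : col * col) (w : Om) : R :=
  mon (fun i l => a l (X i w)) cd.1 * mon (fun i l => b l (Y i w)) cd.2.

Lemma sample_mon_prod cd cd' :
  intg Pr (fun w => sample_mon cd w * sample_mon cd' w) /\
  Ex Pr (fun w => sample_mon cd w * sample_mon cd' w) =
  \prod_i Ex P (fun x => a (cd.1 i) x * a (cd'.1 i) x) *
  \prod_i Ex Q (fun x => b (cd.2 i) x * b (cd'.2 i) x).
Proof.
have -> : (fun w => sample_mon cd w * sample_mon cd' w) =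
   (fun w => \prod_i (a (cd.1 i) (X i w) * a (cd'.1 i) (X i w)) *
             \prod_i (b (cd.2 i) (Y i w) * b (cd'.2 i) (Y i w))).
  by apply/funext => w; rewrite /sample_mon /mon !big_split /= mulrACA.
apply: (@prod_Ex N (fun i x => a (cd.1 i) x * a (cd'.1 i) x)
  (fun i x => b (cd.2 i) x * b (cd'.2 i) x)) => i; exact: sqi_intgM.
Qed.

Lemma sample_mon_sqi cd : sqi Pr (sample_mon cd).
Proof.
split; last by under eq_fun do rewrite expr2; exact: (sample_mon_prod cd cd).1.
by apply: measurable_funM; apply: measurable_prod => i _;
  apply: measurableT_comp; (exact: sqi_meas || exact: mX || exact: mY).
Qed.

Lemma sample_mon_orth cd cd' : cd != cd' ->
  Ex Pr (fun w => sample_mon cd w * sample_mon cd' w) = 0.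
Proof.
move=> ne; rewrite (sample_mon_prod cd cd').2.
have [/eqP e1|/eqP] := boolP (cd.1 == cd'.1); last first.
  move=> ne1; have [i ni] : exists i, cd.1 i != cd'.1 i.
    apply/existsP; rewrite -negb_forall; apply/negP => /forallP H; apply: ne1.
    by apply/ffunP => i; apply/eqP; exact: H.
  by rewrite (bigD1 i)//= oa// !mul0r.
have [/eqP e2|/eqP ne2] := boolP (cd.2 == cd'.2).
  by case: cd cd' e1 e2 ne => c1 c2 [c1' c2'] /= -> -> /eqP.
have [i ni] : exists i, cd.2 i != cd'.2 i.
  apply/existsP; rewrite -negb_forall; apply/negP => /forallP H; apply: ne2.
  by apply/ffunP => i; apply/eqP; exact: H.
by rewrite [X in _ * X](bigD1 i)//= ob// mul0r mulr0.
Qed.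

Lemma sample_mon_norm cd : Ex Pr (fun w => sample_mon cd w ^+ 2) = 1 \/
  Ex Pr (fun w => sample_mon cd w ^+ 2) = 0.
Proof.
have -> : Ex Pr (fun w => sample_mon cd w ^+ 2) =
  \prod_i Ex P (fun x => a (cd.1 i) x ^+ 2) * \prod_i Ex Q (fun x => b (cd.2 i) x ^+ 2).
  by rewrite -(sample_mon_prod cd cd).2.
have p01 (F : 'I_N -> R) : (forall i, F i = 1 \/ F i = 0) -> \prod_i F i = 1 \/ \prod_i F i = 0.
  move=> HF; have [i /eqP Fi|no] := pickP (fun i => F i == 0).
    by right; rewrite (bigD1 i)//= Fi mul0r.
  by left; rewrite big1// => i _; have [//|F0] := HF i; have := no i; rewrite F0 eqxx.
have [->|->] := p01 (fun i => Ex P (fun x => a (cd.1 i) x ^+ 2)) (fun i => na (cd.1 i)).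
  rewrite mul1r; exact: (p01 (fun i => Ex Q (fun x => b (cd.2 i) x ^+ 2)) (fun i => nb (cd.2 i))).
by rewrite mul0r; right.
Qed.

(** Independence factorises the expectation of a product of two monomials, so one differing letter
    makes them orthogonal; their norms are at most [1]. *)
Lemma sample_mon_sum (f : col -> col -> R) :
  sqi Pr (fun w => \sum_c \sum_d f c d * sample_mon (c, d) w) /\
  Ex Pr (fun w => (\sum_c \sum_d f c d * sample_mon (c, d) w) ^+ 2) <= \sum_c \sum_d f c d ^+ 2.
Proof.
have E : (fun w => \sum_c \sum_d f c d * sample_mon (c, d) w) =
    (fun w => \sum_cd f cd.1 cd.2 * sample_mon cd w).
  by apply/funext => w; rewrite pair_big /=; apply: eq_bigr => -[].
rewrite (_ : (fun w => (\sum_c _) ^+ 2) = (fun w => (\sum_cd f cd.1 cd.2 * sample_mon cd w) ^+ 2)); last first.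
  by apply/funext => w; congr (_ ^+ 2); exact: (congr1 (fun F => F w) E).
rewrite E; split; first by apply: sqi_sum => cd _; apply: sqiZ; exact: sample_mon_sqi.
rewrite (Ex_sqr_sum_orth sample_mon_sqi sample_mon_orth (fun cd => f cd.1 cd.2)).
rewrite [leRHS]pair_big /=; apply: ler_sum => cd _.
by rewrite ler_piMr ?sqr_ge0//; case: (sample_mon_norm cd) => ->.
Qed.

End gram.

Section lln.
Context dO (Om : measurableType dO) (R : realType) (Pr : probability Om R).
Context d (T : measurableType d) (P : probability T R) (Z : nat -> Om -> T).
Hypothesis mZ : forall i, measurable_fun setT (Z i).
Hypothesis ZP : forall i, has_law Pr (Z i) P.
Hypothesis ZZ : forall i j (f : T -> R), i != j -> sqi P f ->
  Ex Pr (fun w => f (Z i w) * f (Z j w)) = Ex P f ^+ 2.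

Lemma law_Ex i (f : T -> R) : intg P f ->
  intg Pr (fun w => f (Z i w)) /\ Ex Pr (fun w => f (Z i w)) = Ex P f.
Proof.
move=> If; have [I E] := law_eq (mZ i) (@ZP i) (intg_meas If).
by split => //; exact: I.
Qed.

Lemma law_sqi i (f : T -> R) : sqi P f -> sqi Pr (fun w => f (Z i w)).
Proof.
move=> sf; split; first exact: measurableT_comp (sqi_meas sf) (mZ i).
exact: (law_Ex i (sqi_sq sf)).1.
Qed.

Lemma mean_Ex N (f : T -> R) : (0 < N)%N -> intg P f ->
  intg Pr (fun w => N%:R^-1 * \sum_(i < N) f (Z i w)) /\
  Ex Pr (fun w => N%:R^-1 * \sum_(i < N) f (Z i w)) = Ex P f.
Proof.
move=> N0 If; have I : intg Pr (fun w => \sum_(i < N) f (Z i w)).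
  by apply: intg_sum => i _; exact: (law_Ex i If).1.
split; first exact: intgZ.
rewrite ExZ// Ex_sum; last by move=> i _; exact: (law_Ex i If).1.
under eq_bigr do rewrite (law_Ex _ If).2.
rewrite sumr_const card_ord -[Ex P f *+ N]mulr_natl mulKf//.
by rewrite pnatr_eq0 -lt0n.
Qed.

Lemma sum_sqi N (f : T -> R) : sqi P f -> sqi Pr (fun w => \sum_(i < N) f (Z i w)).
Proof. by move=> sf; apply: sqi_sum => i _; exact: law_sqi. Qed.

Lemma sum_sqr_Ex N (f : T -> R) : sqi P f -> Ex P f = 0 ->
  Ex Pr (fun w => (\sum_(i < N) f (Z i w)) ^+ 2) = N%:R * Ex P (fun x => f x ^+ 2).
Proof.
move=> sf f0.
under [X in Ex _ X]eq_fun do rewrite expr2 mulr_suml; rewrite Ex_sum; last first.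
  move=> i _; apply: sqi_intgM; [exact: law_sqi|exact: sum_sqi].
rewrite (eq_bigr (fun=> Ex P (fun x => f x ^+ 2))); first by rewrite sumr_const card_ord mulr_natl.
move=> i _; under [X in Ex _ X]eq_fun do rewrite mulr_sumr; rewrite Ex_sum; last first.
  by move=> j _; apply: sqi_intgM; exact: law_sqi.
rewrite (bigD1 i)//= big1 ?addr0; last first.
  by move=> j ji; rewrite ZZ// ?f0 ?expr0n// eq_sym.
by have := (law_Ex i (sqi_sq sf)).2; under eq_fun do rewrite expr2.
Qed.

(** Truncation at a level [n]: the bounded part obeys Chebyshev, the tail obeys Markov. Mere
    integrability is what a product of two basis functions offers. *)
Lemma lln (f : T -> R) : intg P f -> forall c e : R, 0 < c -> 0 < e ->
  exists N0 : nat, forall N, (N0 <= N)%N ->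
  mostly Pr e [set w | `|N%:R^-1 * \sum_(i < N) f (Z i w) - Ex P f| < c].
Proof.
move=> If c e c0 e0; have mf := intg_meas If.
(* The cap at [1] lets one tail estimate serve both as a probability below [e / 2] and as a bound
   [c / 16] on the mean of the tail. *)
pose e' := Num.min 1 e.
have e'1 : e' <= 1 by rewrite ge_min lexx.
have e'e : e' <= e by rewrite ge_min lexx orbT.
have e'0 : 0 < e' by rewrite lt_min ltr01.
have ec : 0 < e' * c / 16 by rewrite divr_gt0// mulr_gt0.
have [n Hn] := tail_small mf If ec.
pose f2 x := if n%:R < `|f x| then f x else 0.
pose f1 x := if n%:R < `|f x| then 0 else f x.
have mc : measurable_fun setT (fun x => n%:R < `|f x|).
  by apply: measurable_fun_ltr => //; exact: measurableT_comp.
have mf1 : measurable_fun setT f1 by apply: measurable_fun_ifT.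
have mf2 : measurable_fun setT f2 by apply: measurable_fun_ifT.
have f12 x : f x = f1 x + f2 x by rewrite /f1 /f2; case: ifP; rewrite ?add0r ?addr0.
have f1n x : `|f1 x| <= n%:R by rewrite /f1; case: ifPn; rewrite ?normr0// -leNgt.
have I2 : intg P f2.
  by apply: (intg_le mf2 _ (intg_norm If)) => x; rewrite /f2; case: ifP; rewrite ?normr0.
have s1 : sqi P f1 := sqi_bounded P mf1 f1n.
have I1 := sqi_intg s1.
have E2 : Ex P (fun x => `|f2 x|) <= e' * c / 16.
  apply: le_trans Hn; rewrite /f2 le_eqVlt; apply/orP; left; apply/eqP.
  by congr Rintegral; apply/funext => x; case: ifP; rewrite ?normr0.
pose g x := f1 x - Ex P f1.
have sg : sqi P g by apply: sqiB => //; exact: sqi_cst.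
have g0 : Ex P g = 0 by rewrite ExB ?Ex_cst ?subrr//; exact: intg_cst.
have V0 := Ex_ge0 P (fun x => sqr_ge0 (g x)).
have c2 : 0 < c / 2 by lra.
pose D := Ex P (fun x => g x ^+ 2) / (c / 2) ^+ 2 / (e / 2).
have D0 : 0 <= D by rewrite !divr_ge0// ?sqr_ge0//; lra.
exists (Num.truncn D).+1 => N NN.
have N0 : (0 < N)%N := leq_trans (ltn0Sn _) NN.
have NR : 0 < N%:R :> R by rewrite ltr0n.
have DN : D <= N%:R.
  apply/ltW/(lt_le_trans (truncnS_gt D)); by rewrite ler_nat.
have M1 := mostly_chebyshev (sqiZ N%:R^-1 (sum_sqi N sg)) c2.
have c4 : 0 < c / 4 by lra.
have [Ia Ea] := mean_Ex N0 (intg_norm I2).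
have Ia0 w : 0 <= N%:R^-1 * \sum_(i < N) `|f2 (Z i w)|.
  by rewrite mulr_ge0 ?invr_ge0 ?(ltW NR)// sumr_ge0.
have M2 := mostly_markov Ia Ia0 c4.
apply: mostly_sub (mostlyI M1 M2); last first.
  move=> w [/= h1 h2].
  have E12 : Ex P f = Ex P f1 + Ex P f2.
    by rewrite -ExD//; congr Rintegral; apply/funext => x.
  have -> : N%:R^-1 * \sum_(i < N) f (Z i w) - Ex P f =
     N%:R^-1 * \sum_(i < N) g (Z i w) + N%:R^-1 * \sum_(i < N) f2 (Z i w) - Ex P f2.
    rewrite (eq_bigr (fun i : 'I_N => f1 (Z i w) + f2 (Z i w))); last by [].
    rewrite /g big_split sumrB /= sumr_const card_ord -[_ *+ _]mulr_natl E12.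
    by field; rewrite gt_eqF.
  have h3 : `|N%:R^-1 * \sum_(i < N) f2 (Z i w)| < c / 4.
    apply: le_lt_trans h2; rewrite normrM ger0_norm ?invr_ge0 ?(ltW NR)// ler_pM2l ?invr_gt0//.
    exact: ler_norm_sum.
  have h4 : `|Ex P f2| <= c / 16.
    apply: le_trans (Ex_norm I2) _; apply: le_trans E2 _.
    by rewrite -mulrA ger_pMl// divr_gt0.
  move: h1 h3 h4.
  move: (N%:R^-1 * _) (N%:R^-1 * _) (Ex P f2) => a b z ha hb hz.
  apply: le_lt_trans (ler_normB _ _) _; have := ler_normD a b; lra.
rewrite Ea; under [X in Ex _ X]eq_fun do rewrite exprMn.
rewrite ExZ; last exact: sqi_sq (sum_sqi N sg).
rewrite sum_sqr_Ex//.
have -> : N%:R^-1 ^+ 2 * (N%:R * Ex P (fun x => g x ^+ 2)) / (c / 2) ^+ 2 =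
    Ex P (fun x => g x ^+ 2) / (c / 2) ^+ 2 / N%:R.
  by field; rewrite !gt_eqF.
rewrite [leRHS]splitr; apply: lerD.
  have e2 : 0 < e / 2 by rewrite divr_gt0.
  by rewrite ler_pdivrMr// [e / 2 * _]mulrC -ler_pdivrMr//.
rewrite ler_pdivrMr//; apply: le_trans E2 _; nra.
Qed.

(** If the sum of [x ^+ 2 * min 1 x] is below [1], no [x] exceeds [1], and the sum is then that of
    the cubes; so the Lindeberg bound replaces a third moment. *)
Lemma cubic_small (r : T -> R) : sqi P r -> (forall x, 0 <= r x) -> forall c e : R, 0 < c -> 0 < e ->
  exists N0 : nat, forall N, (N0 <= N)%N ->
  mostly Pr e [set w | \sum_(i < N) (r (Z i w) / Num.sqrt N%:R) ^+ 3 < c].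
Proof.
move=> sr r0 c e c0 e0.
pose c' := Num.min 1 c.
have c'1 : c' <= 1 by rewrite ge_min lexx.
have c'c : c' <= c by rewrite ge_min lexx orbT.
have c'0 : 0 < c' by rewrite lt_min ltr01.
have [N0 HN] := lindeberg_small sr (mulr_gt0 e0 c'0).
exists N0.+1 => N NN.
have Np : (0 < N)%N := leq_trans (ltn0Sn _) NN.
have NR : 0 < N%:R :> R by rewrite ltr0n.
have sN : 0 < Num.sqrt (N%:R : R) by rewrite sqrtr_gt0.
have sN2 : Num.sqrt (N%:R : R) ^+ 2 = N%:R by rewrite sqr_sqrtr// ltW.
have [Ig Eg] := HN N (ltnW NN) Np.
have [Im Em] := mean_Ex Np Ig.
pose g x := r x ^+ 2 * Num.min 1 (`|r x| / Num.sqrt N%:R).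
have g0 x : 0 <= g x by rewrite mulr_ge0 ?sqr_ge0// le_min ler01 divr_ge0// ltW.
have m0 w : 0 <= N%:R^-1 * \sum_(i < N) g (Z i w).
  by rewrite mulr_ge0 ?invr_ge0 ?(ltW NR)// sumr_ge0.
pose x w (i : 'I_N) := r (Z i w) / Num.sqrt N%:R.
have x0 w i : 0 <= x w i by rewrite divr_ge0// ltW.
have gx w (i : 'I_N) : N%:R^-1 * g (Z i w) = x w i ^+ 2 * Num.min 1 (x w i).
  by rewrite /g /x (ger0_norm (r0 _)) mulrA expr_div_n sN2 [N%:R^-1 * _]mulrC.
apply: mostly_sub (mostly_markov Im m0 c'0); first by rewrite Em ler_pdivrMr.
move=> w /=; rewrite mulr_sumr; rewrite (eq_bigr _ (fun i _ => gx w i)).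
move=> H; apply: lt_le_trans c'c; apply: le_lt_trans (H); apply: ler_sum => i _.
rewrite -[r (Z i w) / _]/(x w i).
case: (boolP (x w i <= 1)) => [small|]; first by rewrite min_r// exprSr.
rewrite -ltNge => big.
exfalso; move: H; apply/negP; rewrite -leNgt; apply: le_trans c'1 _.
rewrite (bigD1 i)//= min_l ?(ltW big)// mulr1; apply: le_trans (_ : 1 <= x w i ^+ 2) _.
  by rewrite exprn_ege1// ltW.
by rewrite lerDl sumr_ge0// => j _; rewrite mulr_ge0 ?sqr_ge0// le_min ler01 x0.
Qed.

End lln.

(** * Truncation of the kernels at a fixed sample size *)

Section truncation.
Context dO (Om : measurableType dO) (R : realType) (Pr : probability Om R).
Context d (T : measurableType d) (P Q : probability T R) (X Y : nat -> Om -> T).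
Hypothesis mX : forall i, measurable_fun setT (X i).
Hypothesis mY : forall i, measurable_fun setT (Y i).
Hypothesis samples : independent_iid_samples Pr P Q X Y.
Implicit Types (f g k : T * T -> R).

(** Hybrid argument, replacing one factor at a time. The bound may grow exponentially in [N], which
    is harmless since the truncation level is chosen after [N]. *)
Lemma prod_pairs_close N (s : 'S_N) (phi psi : 'I_N -> T * T -> R) (A dl : R) :
  1 <= A -> 0 <= dl ->
  (forall i, intg (P \x Q)%E (phi i)) -> (forall i, intg (P \x Q)%E (psi i)) ->
  (forall i, Ex (P \x Q)%E (fun z => `|phi i z|) <= A) ->
  (forall i, Ex (P \x Q)%E (fun z => `|psi i z|) <= A) ->
  (forall i, Ex (P \x Q)%E (fun z => `|phi i z - psi i z|) <= dl) ->
  Ex Pr (fun w => `|\prod_i phi i (X i w, Y (s i) w) - \prod_i psi i (X i w, Y (s i) w)|) <=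
  N%:R * (A ^+ N * dl).
Proof.
move=> A1 dl0 Iphi Ipsi Aphi Apsi close.
pose h (k : nat) (i : 'I_N) : T * T -> R := if (i < k)%N then psi i else phi i.
have Ih (k : nat) i : intg (P \x Q)%E (h k i) by rewrite /h; case: ifP.
have Ah (k : nat) i : Ex (P \x Q)%E (fun z => `|h k i z|) <= A by rewrite /h; case: ifP.
pose H (k : nat) w := \prod_i h k i (X i w, Y (s i) w).
have IH (k : nat) : intg Pr (H k) := (prod_pairs_Ex mX mY samples s (Ih k)).1.
have I0 : intg Pr (fun w => \prod_i phi i (X i w, Y (s i) w)) := (prod_pairs_Ex mX mY samples s Iphi).1.
suff main (k : nat) : (k <= N)%N ->
    Ex Pr (fun w => `|\prod_i phi i (X i w, Y (s i) w) - H k w|) <= k%:R * (A ^+ N * dl).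
  have := main N (leqnn N); congr (_ <= _); congr Rintegral; apply/funext => w.
  by congr (`| _ - _ |); apply: eq_bigr => i _; rewrite /h ltn_ord.
elim: k => [_|k IHk kN].
  rewrite mul0r (_ : (fun w => _) = cst 0) ?Ex_cst//; apply/funext => w /=.
  by apply/eqP; rewrite normr_eq0 subr_eq0; apply/eqP; apply: eq_bigr => i _; rewrite /h ltn0.
pose ik := Ordinal kN.
pose g i : T * T -> R := if i == ik then (fun z => phi ik z - psi ik z) else h k i.
have Ig i : intg (P \x Q)%E (g i) by rewrite /g; case: eqP => // _; exact: intgB.
have gE w : H k w - H k.+1 w = \prod_i g i (X i w, Y (s i) w).
  rewrite /H (bigD1 ik)//= [X in _ - X](bigD1 ik)//= [RHS](bigD1 ik)//=.
  rewrite /g eqxx /h /= ltnn ltnSn mulrBl; congr (_ * _ - _ * _).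
    by apply: eq_bigr => i ni; rewrite (negbTE ni).
  apply: eq_bigr => i ni; rewrite (negbTE ni) ltnS leq_eqVlt.
  by rewrite (_ : (i == k :> nat) = false)//; apply/negbTE.
have [_ Eg] := prod_pairs_Ex mX mY samples s (fun i => intg_norm (Ig i)).
have step : Ex Pr (fun w => `|H k w - H k.+1 w|) <= A ^+ N * dl.
  rewrite (_ : (fun w => _) = (fun w => \prod_i `|g i (X i w, Y (s i) w)|)); last first.
    by apply/funext => w; rewrite gE normr_prod.
  rewrite Eg; apply: (@le_trans _ _ (\prod_(i < N) (if i == ik then dl else A))).
    apply: ler_prod => i _; rewrite Ex_ge0/=; last by move=> z.
    by rewrite /g; case: ifP => _; [exact: close|exact: Ah].
  rewrite (bigD1 ik)//= eqxx (eq_bigr (fun=> A)); last by move=> i /negbTE ->.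
  rewrite mulrC; apply: ler_wpM2r => //.
  rewrite prodr_const; apply: ler_weXn2l => //; apply: leq_trans (max_card _) _.
  by rewrite card_ord.
have IB j : intg Pr (fun w => `|\prod_i phi i (X i w, Y (s i) w) - H j w|).
  by apply: intg_norm; exact: intgB.
have IC : intg Pr (fun w => `|H k w - H k.+1 w|) by apply: intg_norm; exact: intgB.
apply: (@le_trans _ _ (Ex Pr (fun w => `|\prod_i phi i (X i w, Y (s i) w) - H k w| + `|H k w - H k.+1 w|))).
  apply: Ex_le => //; first exact: intgD.
  by move=> w; rewrite -[X in `|X| <= _](subrKA (H k w)); exact: ler_normD.
by rewrite ExD// -natr1 mulrDl mul1r; apply: lerD => //; apply: IHk; exact: ltnW.
Qed.

Lemma avg_close N (F : 'S_N -> Om -> R) (B : R) : (forall t, intg Pr (F t)) ->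
  (forall t, Ex Pr (fun w => `|F t w|) <= B) ->
  Ex Pr (fun w => `|(N`!%:R)^-1 * \sum_t F t w|) <= B.
Proof.
move=> IF FB; have f0 : 0 < N`!%:R :> R by rewrite ltr0n fact_gt0.
have I1 : intg Pr (fun w => \sum_t `|F t w|) by apply: intg_sum => t _; exact: intg_norm.
apply: (@le_trans _ _ (Ex Pr (fun w => (N`!%:R)^-1 * \sum_t `|F t w|))).
  apply: Ex_le; [|exact: intgZ|].
    by apply: intg_norm; apply: intgZ; apply: intg_sum.
  move=> w; rewrite normrM ger0_norm ?invr_ge0 ?(ltW f0)//.
  by apply: ler_wpM2l; [rewrite invr_ge0 ltW|exact: ler_norm_sum].
rewrite ExZ// Ex_sum; last by move=> t _; exact: intg_norm.
rewrite ler_pdivrMl//; apply: le_trans (ler_sum _ (fun t _ => FB t)) _.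
by rewrite sumr_const card_Sn mulr_natl.
Qed.

Definition Dn f N (w : Om) : R := (N`!%:R)^-1 * \sum_(t : 'S_N) \prod_(i < N) f (X i w, Y (t i) w).

(* [Dn xi] is the denominator of the statistic, and for [k = h * xi] the
   quantity [En k xi] is [sqrt N] times its numerator for the summand [h]. *)
Definition En k f N (w : Om) : R := (Num.sqrt N%:R)^-1 * \sum_(i < N)
  (N`!%:R)^-1 * \sum_(t : 'S_N) k (X i w, Y (t i) w) * \prod_(j < N | j != i) f (X j w, Y (t j) w).

Lemma En_prod k f N w : En k f N w = (Num.sqrt N%:R)^-1 * \sum_(i < N)
  (N`!%:R)^-1 * \sum_(t : 'S_N) \prod_(j < N) (if j == i then k else f) (X j w, Y (t j) w).
Proof.
congr (_ * _); apply: eq_bigr => i _; congr (_ * _); apply: eq_bigr => t _.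
rewrite [RHS](bigD1 i)//= eqxx; congr (_ * _).
by apply: eq_bigr => j /negbTE ->.
Qed.

Lemma Dn_intg f N : intg (P \x Q)%E f -> intg Pr (Dn f N).
Proof.
move=> If; apply: intgZ; apply: intg_sum => t _.
exact: (prod_pairs_Ex mX mY samples t (fun=> If)).1.
Qed.

Lemma En_intg k f N : intg (P \x Q)%E k -> intg (P \x Q)%E f -> intg Pr (En k f N).
Proof.
move=> Ik If; apply: intg_ext (fun w => esym (En_prod k f N w)) _.
apply: intgZ; apply: intg_sum => i _; apply: intgZ; apply: intg_sum => t _.
by apply: (prod_pairs_Ex mX mY samples t (phi := fun j => if j == i then k else f) _).1 => j; case: eqP.
Qed.

Lemma Dn_close f g N (A dl : R) : 1 <= A -> 0 <= dl ->
  intg (P \x Q)%E f -> intg (P \x Q)%E g ->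
  Ex (P \x Q)%E (fun z => `|f z|) <= A -> Ex (P \x Q)%E (fun z => `|g z|) <= A ->
  Ex (P \x Q)%E (fun z => `|f z - g z|) <= dl ->
  Ex Pr (fun w => `|Dn f N w - Dn g N w|) <= N%:R * (A ^+ N * dl).
Proof.
move=> A1 dl0 If Ig fA gA fg.
have -> : (fun w => `|Dn f N w - Dn g N w|) = (fun w => `|(N`!%:R)^-1 * \sum_(t : 'S_N)
   (\prod_(i < N) f (X i w, Y (t i) w) - \prod_(i < N) g (X i w, Y (t i) w))|).
  by apply/funext => w; rewrite sumrB mulrBr.
apply: avg_close => t; last exact: (prod_pairs_close t (phi := fun=> f) (psi := fun=> g)).
by apply: intgB; [have := (prod_pairs_Ex mX mY samples t (fun=> If)).1
  | have := (prod_pairs_Ex mX mY samples t (fun=> Ig)).1].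
Qed.

Lemma En_close k k' f g N (A dl : R) : (0 < N)%N -> 1 <= A -> 0 <= dl ->
  intg (P \x Q)%E k -> intg (P \x Q)%E k' -> intg (P \x Q)%E f -> intg (P \x Q)%E g ->
  Ex (P \x Q)%E (fun z => `|k z|) <= A -> Ex (P \x Q)%E (fun z => `|k' z|) <= A ->
  Ex (P \x Q)%E (fun z => `|f z|) <= A -> Ex (P \x Q)%E (fun z => `|g z|) <= A ->
  Ex (P \x Q)%E (fun z => `|k z - k' z|) <= dl ->
  Ex (P \x Q)%E (fun z => `|f z - g z|) <= dl ->
  Ex Pr (fun w => `|En k f N w - En k' g N w|) <= N%:R * (N%:R * (A ^+ N * dl)).
Proof.
move=> N0 A1 dl0 Ik Ik' If Ig kA kA' fA gA kk fg.
pose phi (i j : 'I_N) : T * T -> R := if j == i then k else f.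
pose psi (i j : 'I_N) : T * T -> R := if j == i then k' else g.
have Iphi i j : intg (P \x Q)%E (phi i j) by rewrite /phi; case: eqP.
have Ipsi i j : intg (P \x Q)%E (psi i j) by rewrite /psi; case: eqP.
have I1 t i := (prod_pairs_Ex mX mY samples t (Iphi i)).1.
have I2 t i := (prod_pairs_Ex mX mY samples t (Ipsi i)).1.
pose F i w := (N`!%:R)^-1 * \sum_(t : 'S_N)
   (\prod_(j < N) phi i j (X j w, Y (t j) w) - \prod_(j < N) psi i j (X j w, Y (t j) w)).
have IF i : intg Pr (F i) by apply: intgZ; apply: intg_sum => t _; exact: intgB.
have EF i : Ex Pr (fun w => `|F i w|) <= N%:R * (A ^+ N * dl).
  apply: avg_close => t; first exact: intgB.
  by apply: prod_pairs_close => // j; rewrite /phi /psi; case: eqP.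
have dE w : En k f N w - En k' g N w = (Num.sqrt N%:R)^-1 * \sum_i F i w.
  rewrite !En_prod -mulrBr -sumrB; congr (_ * _); apply: eq_bigr => i _.
  by rewrite -mulrBr -sumrB.
have sN : (Num.sqrt N%:R)^-1 <= 1 :> R.
  by rewrite invf_le1 ?sqrtr_gt0 ?ltr0n// -[leLHS]sqrtr1 ler_wsqrtr// ler1n.
have I3 : intg Pr (fun w => \sum_i `|F i w|) by apply: intg_sum => i _; exact: intg_norm.
apply: (@le_trans _ _ (Ex Pr (fun w => \sum_i `|F i w|))).
  apply: Ex_le => //.
    apply: intg_norm; apply: intg_ext (_ : _ =1 _) (intgZ _ (intg_sum _ _)); last first.
    - by move=> i _; exact: (IF i).
    - by move=> w; rewrite dE.
  move=> w; rewrite dE normrM ger0_norm ?invr_ge0 ?sqrtr_ge0//.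
  apply: le_trans (ler_wpM2r _ sN) _ => //; rewrite mul1r; exact: ler_norm_sum.
rewrite Ex_sum; last by move=> i _; exact: intg_norm.
apply: le_trans (ler_sum _ (fun i _ => EF i)) _.
by rewrite sumr_const card_ord [leRHS]mulr_natl.
Qed.

Definition L2lim f (fK : nat -> T * T -> R) : Prop :=
  [/\ sqi (P \x Q)%E f, forall K, sqi (P \x Q)%E (fK K) &
   forall e : R, 0 < e -> exists K0, forall K, (K0 <= K)%N ->
     Ex (P \x Q)%E (fun z => (f z - fK K z) ^+ 2) <= e].

Lemma L2lim_L1 f fK (dl : R) : L2lim f fK -> 0 < dl -> exists K0, forall K, (K0 <= K)%N ->
  Ex (P \x Q)%E (fun z => `|f z - fK K z|) <= dl /\
  Ex (P \x Q)%E (fun z => `|fK K z|) <= Ex (P \x Q)%E (fun z => `|f z|) + dl.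
Proof.
move=> [sf sK cK] dl0; have [K0 HK] := cK _ (exprn_gt0 2 dl0).
exists K0 => K KK; have sB : sqi (P \x Q)%E (fun z => f z - fK K z) by exact: sqiB.
have L1 : Ex (P \x Q)%E (fun z => `|f z - fK K z|) <= dl.
  rewrite -(ler_pXn2r (n := 2))// ?nnegrE ?(ltW dl0)//; last by apply: Ex_ge0 => z.
  exact: le_trans (Ex_sqr_norm sB) (HK K KK).
split => //; apply: (@le_trans _ _ (Ex (P \x Q)%E (fun z => `|f z| + `|f z - fK K z|))).
  apply: Ex_le.
  - exact: intg_norm (sqi_intg (sK K)).
  - by apply: intgD; apply: intg_norm; exact: sqi_intg.
  - move=> z; have := ler_normB (f z) (f z - fK K z).
    by rewrite (_ : f z - (f z - fK K z) = fK K z); last by ring.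
by rewrite ExD ?lerD2l//; apply: intg_norm; exact: sqi_intg.
Qed.

Lemma Dn_trunc f fK N (e : R) : L2lim f fK -> 0 < e -> exists K0, forall K, (K0 <= K)%N ->
  Ex Pr (fun w => `|Dn f N w - Dn (fK K) N w|) <= e.
Proof.
move=> L e0; have [sf sK _] := L.
pose A := Ex (P \x Q)%E (fun z => `|f z|) + 1.
have E0 : 0 <= Ex (P \x Q)%E (fun z => `|f z|) by apply: Ex_ge0.
have A1 : 1 <= A by rewrite lerDr.
have A0 : 0 < A by exact: lt_le_trans A1.
pose C := (N.+1)%:R * A ^+ N; have C0 : 0 < C by rewrite mulr_gt0// exprn_gt0.
pose dl := Num.min 1 (e / C); have dl0 : 0 < dl by rewrite lt_min ltr01 divr_gt0.
have dl1 : dl <= 1 by rewrite ge_min lexx.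
have dle : dl <= e / C by rewrite ge_min lexx orbT.
have [K0 HK] := L2lim_L1 L dl0; exists K0 => K KK; have [h1 h2] := HK K KK.
apply: le_trans (@Dn_close f (fK K) N A dl A1 (ltW dl0) (sqi_intg sf) (sqi_intg (sK K)) _ _ h1) _.
- by rewrite lerDl.
- by apply: le_trans h2 _; rewrite lerD2l.
- rewrite mulrA; apply: le_trans (_ : C * dl <= e); last by rewrite -ler_pdivlMl// mulrC.
  by rewrite ler_wpM2r ?(ltW dl0)// ler_wpM2r ?exprn_ge0 ?(ltW A0)// ler_nat.
Qed.

Lemma En_trunc k kK f fK N (e : R) : (0 < N)%N -> L2lim k kK -> L2lim f fK -> 0 < e ->
  exists K0, forall K, (K0 <= K)%N ->
  Ex Pr (fun w => `|En k f N w - En (kK K) (fK K) N w|) <= e.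
Proof.
move=> N0 Lk L e0; have [sf sK _] := L; have [sk skK _] := Lk.
pose A := Ex (P \x Q)%E (fun z => `|f z|) + Ex (P \x Q)%E (fun z => `|k z|) + 1.
have E0 : 0 <= Ex (P \x Q)%E (fun z => `|f z|) by apply: Ex_ge0.
have E1 : 0 <= Ex (P \x Q)%E (fun z => `|k z|) by apply: Ex_ge0.
have A1 : 1 <= A by rewrite lerDr addr_ge0.
have A0 : 0 < A by exact: lt_le_trans A1.
pose C := N%:R * (N%:R * A ^+ N); have C0 : 0 < C by rewrite !mulr_gt0 ?exprn_gt0 ?ltr0n.
pose dl := Num.min 1 (e / C); have dl0 : 0 < dl by rewrite lt_min ltr01 divr_gt0.
have dl1 : dl <= 1 by rewrite ge_min lexx.
have dle : dl <= e / C by rewrite ge_min lexx orbT.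
have [K0 HK] := L2lim_L1 L dl0; have [K1 HK1] := L2lim_L1 Lk dl0.
exists (maxn K0 K1) => K KK.
have [h1 h2] := HK K (leq_trans (leq_maxl _ _) KK); have [h3 h4] := HK1 K (leq_trans (leq_maxr _ _) KK).
apply: le_trans (@En_close k (kK K) f (fK K) N A dl N0 A1 (ltW dl0) (sqi_intg sk) (sqi_intg (skK K))
  (sqi_intg sf) (sqi_intg (sK K)) _ _ _ _ h3 h1) _.
- by rewrite /A addrAC lerDr addr_ge0.
- by apply: le_trans h4 _; rewrite /A -addrA; apply: ler_wpDl => //; rewrite lerD2l.
- by rewrite /A -addrA lerDl addr_ge0.
- by apply: le_trans h2 _; rewrite /A addrAC -addrA lerD2l; apply: le_trans dl1 _; rewrite lerDl.
- rewrite (_ : _ * _ = C * dl); last by rewrite /C; ring.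
  by rewrite -ler_pdivlMl// mulrC.
Qed.

End truncation.

Section numerator_bound.
Context dO (Om : measurableType dO) (R : realType) (Pr : probability Om R).
Context d (T : measurableType d) (P Q : probability T R) (X Y : nat -> Om -> T).
Hypothesis mX : forall i, measurable_fun setT (X i).
Hypothesis mY : forall i, measurable_fun setT (Y i).
Hypothesis samples : independent_iid_samples Pr P Q X Y.
Context (K : nat) (a b : option 'I_K -> T -> R).
Hypotheses (sa : forall l, sqi P (a l)) (sb : forall l, sqi Q (b l)).
Hypothesis oa : forall l l', l != l' -> Ex P (fun x => a l x * a l' x) = 0.
Hypothesis ob : forall l l', l != l' -> Ex Q (fun x => b l x * b l' x) = 0.
Hypothesis na : forall l, Ex P (fun x => a l x ^+ 2) = 1 \/ Ex P (fun x => a l x ^+ 2) = 0.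
Hypothesis nb : forall l, Ex Q (fun x => b l x ^+ 2) = 1 \/ Ex Q (fun x => b l x ^+ 2) = 0.
Context (tau TT : R) (s : option 'I_K -> R).
Hypothesis tau01 : 0 <= tau < 1.
Hypothesis s_None : s None = 1.
Hypothesis s_le : forall k, s (Some k) ^+ 2 <= tau.
Hypothesis s_sum : \sum_k s (Some k) ^+ 2 <= TT.

Let f (z : T * T) := \sum_l s l * a l z.1 * b l z.2.

(** The coefficients are split according to which of the two letters is constant. Against the
    prefactor [1/N], [coeff_bound_const] charges the doubly nonconstant part a constant and each of
    the two margins a multiple of [N]; the doubly constant coefficient is the mean of the kernel,
    assumed zero. *)
Lemma En_second_moment (k : option 'I_K -> option 'I_K -> R) N : (0 < N)%N -> k None None = 0 ->
  let kk (z : T * T) := \sum_p \sum_q k p q * a p z.1 * b q z.2 in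
  sqi Pr (En X Y kk f N) /\
  Ex Pr (fun w => En X Y kk f N w ^+ 2) <= 6 * occ_const tau TT *
  (N%:R^-1 * (\sum_p \sum_q k p q ^+ 2) + \sum_p k p None ^+ 2 + \sum_q k None q ^+ 2).
Proof.
move=> N0 k00 kk; have NR : 0 < N%:R :> R by rewrite ltr0n.
have sN2 : (Num.sqrt N%:R)^-1 ^+ 2 = N%:R^-1 :> R by rewrite exprVn sqr_sqrtr// ltW.
pose coef (k : option 'I_K -> option 'I_K -> R) (c d : {ffun 'I_N -> option 'I_K}) : R :=
  \sum_(i < N) mon_del s c i * \sum_q k (c i) q * wt (upd c i q) d.
have EnE : En X Y kk f N = (fun w => (Num.sqrt N%:R)^-1 * \sum_c \sum_d coef k c d * sample_mon X Y a b (c, d) w).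
  apply/funext => w; congr (_ * _).
  exact: (expand_E s k (fun i l => a l (X i w)) (fun i l => b l (Y i w))).
have [S1 S2] := sample_mon_sum mX mY samples sa sb oa ob na nb (coef k).
split; first by rewrite EnE; exact: sqiZ.
have -> : Ex Pr (fun w => En X Y kk f N w ^+ 2) =
    N%:R^-1 * Ex Pr (fun w => (\sum_c \sum_d coef k c d * sample_mon X Y a b (c, d) w) ^+ 2).
  rewrite -sN2 -ExZ; last exact: sqi_sq S1.
  by congr Rintegral; apply/funext => w; rewrite EnE exprMn.
pose k1 p q : R := if p is Some _ then (if q is Some _ then k p q else 0) else 0.
pose k2 p q : R := if p is Some _ then (if q is Some _ then 0 else k p q) else 0.
pose k3 p q : R := if p is Some _ then 0 else (if q is Some _ then k p q else 0).
have kE p q : k p q = k1 p q + k2 p q + k3 p q.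
  by case: p q => [p|] [q|]; rewrite /k1 /k2 /k3 ?k00 ?addr0 ?add0r.
have coefE c e : coef k c e = coef k1 c e + coef k2 c e + coef k3 c e.
  rewrite /coef -!big_split /=; apply: eq_bigr => i _; rewrite -!mulrDr; congr (_ * _).
  by rewrite -!big_split /=; apply: eq_bigr => q _; rewrite -!mulrDl -kE.
have B0 : 0 <= occ_const tau TT.
  case/andP: tau01 => t0 t1; have t2 : 0 < 1 + tau by lra.
  have l1 : 1 <= 2 / (1 + tau) by rewrite ler_pdivlMr//; lra.
  rewrite /occ_const mulr_ge0 ?expR_ge0// mulr_ge0 ?invr_ge0 ?subr_ge0//.
  by rewrite addr_ge0// mulr_ge0 ?sqr_ge0// (le_trans ler01 l1).
have some_occ (c : {ffun 'I_N -> option 'I_K}) : (\sum_(i < N) (isSome (c i) : nat) < 1 * (\sum_k occ c (Some k)).+1)%N.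
  rewrite mul1n ltnS /occ exchange_big /=; apply: leq_sum => i _.
  by case: (c i) => // x /=; rewrite (bigD1 x)//= eqxx.
have none_occ (c : {ffun 'I_N -> option 'I_K}) : (\sum_(i < N) (pred1 None (c i) : nat) < N.+1 * (\sum_k occ c (Some k)).+1)%N.
  apply: leq_trans (_ : (N.+1 <= _)%N); last by rewrite leq_pmulr.
  rewrite ltnS; apply: leq_trans (leq_sum _ (fun i _ => leq_b1 _)) _.
  by rewrite sum1_card card_ord.
have H1 := @coeff_bound_const R tau TT tau01 N K s s_None s_le s_sum isSome k1 1 ltac:(by move=> [p|] [q|]) some_occ.
have H2 := @coeff_bound_const R tau TT tau01 N K s s_None s_le s_sum isSome k2 1 ltac:(by move=> [p|] [q|]) some_occ.
have H3 := @coeff_bound_const R tau TT tau01 N K s s_None s_le s_sum (pred1 None) k3 N.+1 ltac:(by move=> [p|] [q|]) none_occ.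
apply: le_trans (ler_wpM2l _ S2) _; first by rewrite invr_ge0 ltW.
(* Splitting a square into three costs the factor [3], and [(N + 1) / N <= 2] doubles it: this is
   the [6] of the conclusion. *)
have S3 : \sum_c \sum_d coef k c d ^+ 2 <=
   3 * (\sum_c \sum_d coef k1 c d ^+ 2) + 3 * (\sum_c \sum_d coef k2 c d ^+ 2) + 3 * (\sum_c \sum_d coef k3 c d ^+ 2).
  rewrite !mulr_sumr -!big_split /=; apply: ler_sum => c _.
  rewrite !mulr_sumr -!big_split /=; apply: ler_sum => e _; rewrite coefE.
  move: (coef k1 c e) (coef k2 c e) (coef k3 c e) => x y z.
  by have := sqr_ge0 (x - y); have := sqr_ge0 (y - z); have := sqr_ge0 (x - z); nra.
have Z1 : \sum_p k1 p None ^+ 2 = 0 by apply: big1 => -[p|] _; rewrite expr0n.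
have Z2 : \sum_l \sum_p k2 p (Some l) ^+ 2 = 0 by apply: big1 => l _; apply: big1 => -[p|] _; rewrite expr0n.
have Z3 : \sum_p k3 p None ^+ 2 = 0 by apply: big1 => -[p|] _; rewrite expr0n.
have L1 : \sum_l \sum_p k1 p (Some l) ^+ 2 <= \sum_p \sum_q k p q ^+ 2.
  rewrite [leRHS]exchange_big /= [leRHS]sum_option; apply: ler_wpDl; first by apply: sumr_ge0 => p _; exact: sqr_ge0.
  apply: ler_sum => l _; apply: ler_sum => -[p|] _ //; by rewrite expr0n sqr_ge0.
have L2 : \sum_p k2 p None ^+ 2 <= \sum_p k p None ^+ 2.
  by apply: ler_sum => -[p|] _ //; rewrite expr0n sqr_ge0.
have L3 : \sum_l \sum_p k3 p (Some l) ^+ 2 <= \sum_q k None q ^+ 2.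
  rewrite [leRHS]sum_option; apply: ler_wpDl; first exact: sqr_ge0.
  by apply: ler_sum => l _; rewrite sum_option /= big1 ?addr0// => p _; rewrite expr0n.
rewrite Z1 mulr0 add0r mul1r in H1; rewrite Z2 addr0 mul1r in H2; rewrite Z3 mulr0 add0r in H3.
have M1 := le_trans H1 (ler_wpM2l B0 L1).
have M2 := le_trans H2 (ler_wpM2l B0 (ler_wpM2l (ltW NR) L2)).
have M3 := le_trans H3 (ler_wpM2l (mulr_ge0 (ler0n R N.+1) B0) L3).
apply: le_trans (_ : N%:R^-1 * (3 * (occ_const tau TT * (\sum_p \sum_q k p q ^+ 2)) +
   3 * (occ_const tau TT * (N%:R * (\sum_p k p None ^+ 2))) +
   3 * (N.+1%:R * occ_const tau TT * (\sum_q k None q ^+ 2))) <= _).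
  apply: ler_wpM2l; first by rewrite invr_ge0 ltW.
  by apply: le_trans S3 _; apply: lerD; [apply: lerD|]; rewrite ler_pM2l.
have e1 : 0 <= \sum_p \sum_q k p q ^+ 2 by apply: sumr_ge0 => p _; apply: sumr_ge0 => q _; exact: sqr_ge0.
have e2 : 0 <= \sum_p k p None ^+ 2 by apply: sumr_ge0 => p _; exact: sqr_ge0.
have e3 : 0 <= \sum_q k None q ^+ 2 by apply: sumr_ge0 => p _; exact: sqr_ge0.
rewrite -[N.+1%:R]natr1; have N1 : 1 <= N%:R :> R by rewrite ler1n.
have Ni : N%:R^-1 <= 1 :> R by rewrite invf_le1.
have Ni0 : 0 < N%:R^-1 :> R by rewrite invr_gt0.
move: B0 e1 e2 e3; move: (occ_const _ _) (\sum_p \sum_q k p q ^+ 2) (\sum_p k p None ^+ 2) (\sum_q k None q ^+ 2).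
move=> B x y z B0 x0 y0 z0.
have -> : N%:R^-1 * (3 * (B * x) + 3 * (B * (N%:R * y)) + 3 * ((N%:R + 1) * B * z)) =
   3 * B * (N%:R^-1 * x) + 3 * (B * y) + 3 * (B * z) + 3 * (N%:R^-1 * (B * z)).
  by field; rewrite gt_eqF.
have Bz := mulr_ge0 B0 z0; have By := mulr_ge0 B0 y0.
have Bx : 0 <= B * (N%:R^-1 * x) by rewrite mulr_ge0// mulr_ge0// ltW.
have : N%:R^-1 * (B * z) <= 1 * (B * z) by rewrite ler_wpM2r.
rewrite mul1r (_ : 6 * B * (N%:R^-1 * x + y + z) = 6 * (B * (N%:R^-1 * x)) + 6 * (B * y) + 6 * (B * z)); last by ring.
rewrite -mulrA; move: Bx By Bz; move: (B * (N%:R^-1 * x)) (B * y) (B * z) (N%:R^-1 * _) => p1 p2 p3 p4; lra.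
Qed.

End numerator_bound.

(** * Truncation of the expansions *)

Section boxes.
Variable R : realType.

Lemma box_complement_sum K N (box : 'I_K -> nat -> bool) (t : 'I_K -> R) :
  \sum_(m : {ffun 'I_K -> 'I_N.+1} | ~~ [forall k, box k (m k)]) \prod_k t k ^+ m k =
  \prod_k \sum_(j < N.+1) t k ^+ j - \prod_k \sum_(j < N.+1) (box k j)%:R * t k ^+ j.
Proof.
apply/esym/eqP; rewrite subr_eq addrC; apply/eqP.
rewrite -(prod_sum_occ N (fun k j => t k ^+ j)) -(prod_sum_occ N (fun k j => (box k j)%:R * t k ^+ j)).
rewrite (bigID (fun m : {ffun 'I_K -> 'I_N.+1} => [forall k, box k (m k)])) /=; congr (_ + _).
rewrite big_mkcond /=; apply: eq_bigr => m _; rewrite big_split /=.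
case: ifP => [/forallP H|/negbT]; first by rewrite [X in _ = X * _]big1 ?mul1r// => k _; rewrite H.
by rewrite negb_forall => /existsP[k /negbTE nk]; rewrite (bigD1 k)//= nk !mul0r.
Qed.

(** Grouping the colorings by letter counts, each class yields a product of two elementary sums, and
    [wt] is there the inverse class size. *)
Lemma box_term_sum N K (s : 'I_K -> R) M (a b : 'I_N -> 'I_K -> R) : (0 < N)%N ->
  box_term s M (fun i k => (Num.sqrt N%:R)^-1 * a i k) (fun i k => (Num.sqrt N%:R)^-1 * b i k) =
  \sum_(c : {ffun 'I_N -> option 'I_K}) \sum_(e : {ffun 'I_N -> option 'I_K})
    ([forall k, (occ c (Some k) <= M)%N])%:R * (mon (fun=> ev s) c * wt c e) *
    (mon (fun i => ev (a i)) c * mon (fun i => ev (b i)) e).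
Proof.
move=> N0; have NR : 0 < N%:R :> R by rewrite ltr0n.
have x2 : N%:R * ((Num.sqrt N%:R)^-1 * (Num.sqrt N%:R)^-1) = 1 :> R.
  by rewrite -expr2 exprVn sqr_sqrtr ?(ltW NR)// mulfV// gt_eqF.
set x := (Num.sqrt N%:R)^-1 in x2 *.
have classE (n : 'I_K -> nat) : esum (fun (_ : 'I_N) _ => 1) n = #|[pred c | @in_class K N n c]|%:R :> R.
  rewrite /esum (eq_bigr (fun=> 1)) ?sumr_const//.
  by move=> c _; rewrite /mon big1// => i _; case: (c i).
have uniq_n (c : {ffun 'I_N -> option 'I_K}) : [forall k, (occ c (Some k) <= M)%N]%:R =
    \sum_(n : {ffun 'I_K -> 'I_M.+1}) (in_class (occn n) c)%:R :> R.
  case: forallP => [H|H].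
    pose n0 : {ffun 'I_K -> 'I_M.+1} := [ffun k => inord (occ c (Some k))].
    have n0E k : n0 k = occ c (Some k) :> nat by rewrite ffunE inordK// ltnS.
    rewrite (bigD1 n0)//= big1 ?addr0.
      by rewrite (_ : in_class _ _ = true)//; apply/in_classP => k; rewrite /occn n0E.
    move=> n nn; case: in_classP => // Hn; case/eqP: nn; apply/ffunP => k.
    by apply/val_inj; rewrite /= n0E Hn.
  rewrite big1// => n _; case: in_classP => // Hn; case: H => k.
  by rewrite Hn /occn -ltnS ltn_ord.
under [RHS]eq_bigr do under eq_bigr do rewrite uniq_n -mulrA mulr_suml.
under [RHS]eq_bigr do rewrite exchange_big /=.
rewrite exchange_big /=; apply: eq_bigr => n _.
have cl (c e : {ffun 'I_N -> option 'I_K}) : in_class (occn n) c ->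
    (wt c e : R) = (in_class (occn n) e)%:R / esum (fun (_ : 'I_N) _ => 1) (occn n).
  move=> /in_classP Hc; have same g : (occv g == occv c) = in_class (occn n) g.
    apply/eqP/in_classP => [E k|Hg]; first by rewrite (occv_occ (Some k) E).
    by apply/ffunP => k; apply/val_inj; rewrite /= !occvE Hg Hc.
  rewrite /wt classE eq_sym same; congr (_ / _%:R); apply: eq_card => g; rewrite !inE; exact: same.
have sE (c : {ffun 'I_N -> option 'I_K}) : in_class (occn n) c ->
    mon (fun=> ev s) c = \prod_k s k ^+ n k.
  move=> /in_classP Hc; rewrite mon_occ//; apply: eq_bigr => k _; by rewrite Hc.
rewrite !esumZ [N%:R ^+ _ * _](_ : _ = esum a (occn n) * esum b (occn n)); last first.
  rewrite (_ : _ * _ = (N%:R * (x * x)) ^+ (\sum_k (n k : nat)) * (esum a (occn n) * esum b (occn n))).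
    by rewrite x2 expr1n mul1r.
  by rewrite !exprMn /occn; ring.
rewrite (eq_bigr (fun c => if in_class (occn n) c then \sum_(e | in_class (occn n) e)
    \prod_k s k ^+ n k / esum (fun (_ : 'I_N) _ => 1) (occn n) *
    (mon (fun i => ev (a i)) c * mon (fun i => ev (b i)) e) else 0)); last first.
  move=> c _; case: ifP => Hc; last by apply: big1 => e _; rewrite mul0r.
  rewrite [RHS]big_mkcond /=; apply: eq_bigr => e _.
  rewrite mul1r sE// cl//; case: (in_class _ e); last by rewrite !(mul0r, mulr0).
  by rewrite mul1r.
rewrite -big_mkcond /=; move: (esum (fun _ _ => 1) _) => z.
transitivity (\prod_k s k ^+ n k / z * (esum a (occn n) * esum b (occn n))); first by ring.
rewrite {1}/esum mulr_suml mulr_sumr; apply: eq_bigr => c _.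
by rewrite /esum !mulr_sumr.
Qed.

(** The gain from extra factors is monotone in the factors as long as all are at least [1]. This
    replaces geometric sums cut at [N] by their limits, giving a bound free of [N]. *)
Lemma prod_diff_le (x y : nat -> R) K K' : (K <= K')%N -> (forall k, 1 <= x k <= y k) ->
  \prod_(k < K') x k - \prod_(k < K) x k <= \prod_(k < K') y k - \prod_(k < K) y k.
Proof.
move=> KK' xy; have xy1 k : 1 <= x k by case/andP: (xy k).
have xy2 k : x k <= y k by case/andP: (xy k).
have x0 k : 0 <= x k := le_trans ler01 (xy1 k).
elim: K' KK' => [|K' IH]; first by rewrite leqn0 => /eqP ->; rewrite !big_ord0.
rewrite leq_eqVlt => /orP[/eqP ->|]; first by rewrite !subrr.
rewrite ltnS => /IH H; rewrite !big_ord_recr /=.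
have p0 : 0 <= \prod_(k < K') x k by apply: prodr_ge0.
have pp : \prod_(k < K') x k <= \prod_(k < K') y k by apply: ler_prod => i _; rewrite x0 xy2.
have : \prod_(k < K') x k * (x K' - 1) <= \prod_(k < K') y k * (y K' - 1).
  by apply: ler_pM => //; [rewrite subr_ge0|rewrite lerD2r].
by rewrite !mulrBr !mulr1; lra.
Qed.

Lemma geo_prod_cvg (t : nat -> R) (tau TT : R) : 0 <= tau < 1 -> (forall k, 0 <= t k <= tau) ->
  (forall K, \sum_(k < K) t k <= TT) -> forall e : R, 0 < e -> exists K, forall K', (K <= K')%N ->
  \prod_(k < K') (1 - t k)^-1 - \prod_(k < K) (1 - t k)^-1 <= e.
Proof.
move=> /andP[tau0 tau1] tt sumt e e0.
have t0 k : 0 <= t k by case/andP: (tt k).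
have t1 k : t k <= tau by case/andP: (tt k).
have d0 k : 0 < 1 - t k by have := t1 k; lra.
have g1 k : 1 <= (1 - t k)^-1 by rewrite invf_ge1//; have := t0 k; lra.
pose p K := \prod_(k < K) (1 - t k)^-1.
have pnd : {homo p : n m / (n <= m)%N >-> n <= m}.
  apply: homo_leq => //; first exact: le_trans.
  move=> K; rewrite /p big_ord_recr /= ler_peMr//; apply: prodr_ge0 => k _; exact: le_trans (g1 k).
have pub K : p K <= expR (TT / (1 - tau)).
  apply: (@le_trans _ _ (\prod_(k < K) expR (t k / (1 - tau)))).
    apply: ler_prod => k _; rewrite (le_trans ler01 (g1 k))/=.
    have tk0 := t0 k; have tk1 := t1 k; have dk := d0 k.
    have -> : (1 - t k)^-1 = 1 + t k / (1 - t k) by field; rewrite gt_eqF.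
    apply: le_trans (expR_ge1Dx _) _; rewrite ler_expR ler_wpM2l//.
    by rewrite lef_pV2 ?posrE; lra.
  rewrite -expR_sum -mulr_suml ler_expR ler_wpM2r// invr_ge0; lra.
have ub : has_ubound (range p) by exists (expR (TT / (1 - tau))) => _ [K _ <-].
have /cvgrPdist_le /(_ _ e0)[K0 _ HK0] := nondecreasing_cvgn pnd ub.
exists K0 => K' KK'; have := HK0 K0 (leqnn _).
rewrite ger0_norm; last by rewrite subr_ge0; apply: ub_le_sup => //; exists K0.
apply: le_trans; rewrite lerD2r; apply: ub_le_sup => //; by exists K'.
Qed.

Lemma cvg_prod (I : Type) (r : seq I) (f : I -> nat -> R) (l : I -> R) :
  (forall i, f i n @[n --> \oo] --> l i) ->
  (\prod_(i <- r) f i n) @[n --> \oo] --> \prod_(i <- r) l i.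
Proof.
move=> fl; elim: r => [|i r IH].
  by under eq_fun do rewrite big_nil; rewrite big_nil; exact: cvg_cst.
by under eq_fun do rewrite big_cons; rewrite big_cons; exact: cvgM.
Qed.

Lemma geo_box_cvg (t : nat -> R) K : (forall k, 0 <= t k < 1) -> forall e : R, 0 < e ->
  exists M0, forall M, (M0 <= M)%N ->
  \prod_(k < K) (1 - t k)^-1 - \prod_(k < K) \sum_(j < M.+1) t k ^+ j <= e.
Proof.
move=> t01 e e0.
have C : (\prod_(k < K) \sum_(j < n.+1) t k ^+ j) @[n --> \oo] --> \prod_(k < K) (1 - t k)^-1.
  apply: (@cvg_prod _ _ (fun (k : 'I_K) n => \sum_(j < n.+1) t k ^+ j)) => k.
  have /andP[tk0 tk1] := t01 k.
  have tk : `|t k| < 1 by rewrite ger0_norm.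
  have := @cvg_geometric_series R 1 (t k) tk; rewrite -(cvg_shiftS _) mul1r.
  apply: cvg_trans; apply: near_eq_cvg; near=> n.
  by rewrite /series /= big_mkord; apply: eq_bigr => j _; rewrite /geometric /= mul1r.
move/cvgrPdist_le : C => /(_ _ e0)[M0 _ HM]; exists M0 => M MM.
exact: le_trans (ler_norm _) (HM M MM).
Unshelve. all: by end_near.
Qed.

End boxes.

(** * Smallness of the numerator of a centred kernel *)

Section numerator_small.
Context dO (Om : measurableType dO) (R : realType) (Pr : probability Om R).
Context d (T : measurableType d) (P Q : probability T R) (X Y : nat -> Om -> T).
Hypothesis mX : forall i, measurable_fun setT (X i).
Hypothesis mY : forall i, measurable_fun setT (Y i).
Hypothesis samples : independent_iid_samples Pr P Q X Y.
Variables (xi : T * T -> R) (s : nat -> R) (a b : nat -> T -> R).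
Hypothesis sxi : sqi (P \x Q)%E xi.
Hypotheses (oa : orthonormal_basis P a) (ob : orthonormal_basis Q b).
Hypotheses (a0 : a 0%N = cst 1) (b0 : b 0%N = cst 1).
Hypothesis xi_coef : forall p q, tcoef P Q a b xi p q = s p * Ex Q (fun y => b p y * b q y).
Hypotheses (s0 : s 0%N = 1) (s_ge0 : forall k, 0 <= s k) (s1 : s 1%N < 1).
Hypothesis s_le : forall k, (1 <= k)%N -> s k <= s 1%N.

Let sa k := orthonormal_sqi k oa.
Let sb k := orthonormal_sqi k ob.

(* Equals [s k] unless [b k] is one of the zero vectors that pad the basis. *)
Definition sval_of k : R := tcoef P Q a b xi k k.

Lemma sval_of0 : sval_of 0 = 1.
Proof.
rewrite /sval_of xi_coef s0 mul1r b0.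
by rewrite -[RHS](Ex_cst Q 1); congr Rintegral; apply/funext => y; exact: mulr1.
Qed.

Lemma sval_of_bounds k : 0 <= sval_of k.+1 <= s 1%N.
Proof.
rewrite /sval_of xi_coef; have -> : Ex Q (fun y => b k.+1 y * b k.+1 y) = Ex Q (fun y => b k.+1 y ^+ 2) by [].
have E0 : 0 <= Ex Q (fun y => b k.+1 y ^+ 2) by apply: Ex_ge0 => y; exact: sqr_ge0.
have E1 := orthonormal_norm_le1 k.+1 ob.
rewrite mulr_ge0//=; apply: le_trans (s_le (ltn0Sn k)); exact: ler_piMr.
Qed.

Lemma sval_of_off p q : p != q -> tcoef P Q a b xi p q = 0.
Proof. by move=> pq; rewrite xi_coef (orthonormal_orth ob pq) mulr0. Qed.

Lemma sval_of_sum K : \sum_(k < K) sval_of k.+1 ^+ 2 <= Ex (P \x Q)%E (fun z => xi z ^+ 2).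
Proof.
have [K0 HK] := trunc_cvg oa ob sxi ltr01.
have [_ _ H] := HK (maxn K0 K) (leq_maxl _ _); apply: le_trans H.
rewrite sum_option; apply: ler_wpDl; first by apply: sumr_ge0 => l _; exact: sqr_ge0.
rewrite (big_ord_widen _ (fun k => sval_of k.+1 ^+ 2) (leq_maxr K0 K)) big_mkcond /=.
apply: ler_sum => k _; rewrite (bigD1 (Some k))//=.
have S0 : 0 <= \sum_(i | i != Some k) tcoef P Q a b xi k.+1 (letter i) ^+ 2.
  by apply: sumr_ge0 => l _; exact: sqr_ge0.
by case: ifP => _; [rewrite lerDl|rewrite addr_ge0// sqr_ge0].
Qed.

Lemma trunc_xi K z : trunc P Q a b xi K z =
  \sum_(l : option 'I_K) sval_of (letter l) * a (letter l) z.1 * b (letter l) z.2.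
Proof.
apply: eq_bigr => l _; rewrite (bigD1 l)//= big1 ?addr0// => l' ll'.
by rewrite sval_of_off ?mul0r// eq_sym; apply: contra_neq ll' => /letter_inj.
Qed.

Lemma trunc_sqi F K : sqi (P \x Q)%E (trunc P Q a b F K).
Proof.
apply: sqi_sum => l _; apply: sqi_sum => l' _.
have := sqiZ (tcoef P Q a b F (letter l) (letter l')) (sqi_tensor (sa (letter l)) (sb (letter l'))).
by congr sqi; apply/funext => z; rewrite mulrA.
Qed.

Lemma L2lim_trunc F : sqi (P \x Q)%E F -> L2lim P Q F (trunc P Q a b F).
Proof.
move=> sF; split => //; first exact: trunc_sqi.
move=> e e0; have [K0 HK] := trunc_cvg oa ob sF e0.
by exists K0 => K /HK[].
Qed.

(** As [a 0] is the constant [1], these are the coefficients of the mean of [F] over its first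
    variable, and Bessel's inequality applies to that mean alone. *)
Lemma tcoef_row F : sqi (P \x Q)%E F -> forall K,
  \sum_(l : option 'I_K) tcoef P Q a b F 0 (letter l) ^+ 2 <=
  Ex Q (fun y => Ex P (fun x => F (x, y)) ^+ 2).
Proof.
move=> sF K; have s1' := sqi_cst P 1.
have [sk _] := kernel_sqi sF s1'.
have fE : (fun y => Ex P (fun x => cst 1 x * F (x, y))) = (fun y => Ex P (fun x => F (x, y))).
  by apply/funext => y; congr Rintegral; apply/funext => x; rewrite mul1r.
rewrite fE in sk; apply: le_trans (@bessel _ _ _ Q (option 'I_K) (fun l => b (letter l)) _ _ _ _ sk).
- apply: ler_sum => l _; have := kernel_Ex sF s1' (sb (letter l)); rewrite /tcoef a0 => <-.
  by rewrite le_eqVlt; apply/orP; left; apply/eqP; congr (_ ^+ 2); congr Rintegral;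
    apply/funext => y; congr (_ * _); exact: (congr1 (fun g => g y) fE).
- by move=> l; exact: sb.
- by move=> l l' ll'; apply: (orthonormal_orth ob); apply: contra_neq ll' => /letter_inj.
- by move=> l; exact: orthonormal_norm.
Qed.

Lemma tcoef_col F : sqi (P \x Q)%E F -> forall K,
  \sum_(l : option 'I_K) tcoef P Q a b F (letter l) 0 ^+ 2 <=
  Ex P (fun x => Ex Q (fun y => F (x, y)) ^+ 2).
Proof.
move=> sF K; have s1' := sqi_cst Q 1; have sF' := sqi_swap sF.
have [sk _] := kernel_sqi sF' s1'.
have fE : (fun x => Ex Q (fun y => cst 1 y * F (x, y))) = (fun x => Ex Q (fun y => F (x, y))).
  by apply/funext => x; congr Rintegral; apply/funext => y; rewrite mul1r.
rewrite /= fE in sk; apply: le_trans (@bessel _ _ _ P (option 'I_K) (fun l => a (letter l)) _ _ _ _ sk).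
- apply: ler_sum => l _; have := kernel_Ex sF' s1' (sa (letter l)).
  have I := sqi_intgM sF (sqi_tensor (sa (letter l)) s1').
  have -> : Ex (Q \x P)%E (fun z => F (z.2, z.1) * (cst 1 z.1 * a (letter l) z.2)) = tcoef P Q a b F (letter l) 0.
    rewrite /tcoef b0 -(intg_swap I).2; congr Rintegral; apply/funext => z; congr (_ * _).
    exact: mulrC.
  move=> <-; rewrite le_eqVlt; apply/orP; left; apply/eqP; congr (_ ^+ 2); congr Rintegral.
  by apply/funext => x; congr (_ * _); exact: (congr1 (fun g => g x) fE).
- by move=> l; exact: sa.
- by move=> l l' ll'; apply: (orthonormal_orth oa); apply: contra_neq ll' => /letter_inj.
- by move=> l; exact: orthonormal_norm.
Qed.

Lemma basis_norm01 (m : probability T R) e k : orthonormal_basis m e ->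
  Ex m (fun x => e k x ^+ 2) = 1 \/ Ex m (fun x => e k x ^+ 2) = 0.
Proof.
move=> oe; have [->|e0] := orthonormal_norm k oe; [by left|right].
rewrite (@Ex_ae _ _ _ m _ (cst 0)) ?Ex_cst//.
  by apply: measurable_funX; exact: sqi_meas (orthonormal_sqi k oe).
by move: e0; apply: filterS => x /= h _; rewrite h// expr0n.
Qed.

(** The truncation level may depend on [N], at the price of the extra [e]; Chebyshev at [c / 2]
    turns the [6] of [En_second_moment] into [24]. The constant [C] is chosen before the kernel and
    [N]. *)
Lemma En_small : exists2 C : R, 0 <= C & forall F N (c e : R), sqi (P \x Q)%E F -> (0 < N)%N ->
  Ex (P \x Q)%E F = 0 -> 0 < c -> 0 < e ->
  mostly Pr (C / c ^+ 2 * (N%:R^-1 * Ex (P \x Q)%E (fun z => F z ^+ 2) +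
     Ex P (fun x => Ex Q (fun y => F (x, y)) ^+ 2) + Ex Q (fun y => Ex P (fun x => F (x, y)) ^+ 2)) + e)
   [set w | `|En X Y F xi N w| < c].
Proof.
pose TT := Ex (P \x Q)%E (fun z => xi z ^+ 2); pose tau := s 1%N ^+ 2.
have tau01 : 0 <= tau < 1 by rewrite sqr_ge0 expr_lt1.
have BC0 : 0 <= occ_const tau TT.
  case/andP: tau01 => t0 t1; have t2 : 0 < 1 + tau by lra.
  have l1 : 1 <= 2 / (1 + tau) by rewrite ler_pdivlMr//; lra.
  rewrite /occ_const mulr_ge0 ?expR_ge0// mulr_ge0 ?invr_ge0 ?subr_ge0//.
  by rewrite addr_ge0// mulr_ge0 ?sqr_ge0// (le_trans ler01 l1).
exists (24 * occ_const tau TT); first by rewrite mulr_ge0.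
move=> F N c e sF N0 F0 c0 e0.
have c2 : 0 < c / 2 by lra.
have [K0 HK0] := En_trunc mX mY samples N0 (L2lim_trunc sF) (L2lim_trunc sxi) (mulr_gt0 e0 c2).
have [K1 HK1] := trunc_cvg oa ob sF ltr01.
pose K := maxn K0 K1.
have close := HK0 K (leq_maxl _ _); have [_ _ sum2] := HK1 K (leq_maxr _ _).
pose tF := trunc P Q a b F K; pose tx := trunc P Q a b xi K.
have txE : tx = (fun z => \sum_(l : option 'I_K) sval_of (letter l) * a (letter l) z.1 * b (letter l) z.2).
  by apply/funext => z; exact: trunc_xi.
have ll (l l' : option 'I_K) : l != l' -> letter l != letter l' by apply: contra_neq => /letter_inj.
have k00 : tcoef P Q a b F (letter (None : option 'I_K)) (letter (None : option 'I_K)) = 0.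
  rewrite /tcoef /= a0 b0 -[RHS]F0; congr Rintegral; apply/funext => z; by rewrite /= !mulr1.
have [S1 S2] := @En_second_moment _ Om R Pr _ T P Q X Y mX mY samples K (fun l => a (letter l)) (fun l => b (letter l))
  (fun l => sa _) (fun l => sb _) (fun l l' h => orthonormal_orth oa (ll l l' h))
  (fun l l' h => orthonormal_orth ob (ll l l' h)) (fun l => basis_norm01 _ oa) (fun l => basis_norm01 _ ob)
  tau TT (fun l => sval_of (letter l)) tau01 sval_of0
  (fun k => ltac:(by have /andP[? ?] := sval_of_bounds k; rewrite ler_pXn2r// nnegrE))
  (sval_of_sum K) (fun p q => tcoef P Q a b F (letter p) (letter q)) N N0 k00.
rewrite -txE in S1 S2.
have ID : intg Pr (fun w => `|En X Y F xi N w - En X Y tF tx N w|).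
  by apply: intg_norm; apply: intgB; apply: (En_intg mX mY samples); apply: sqi_intg => //; exact: trunc_sqi.
have M1 := mostly_markov ID (fun=> normr_ge0 _) c2.
have M2 := mostly_chebyshev S1 c2.
apply: mostly_sub (mostlyI M2 M1); last first.
  move=> w [/= h1 h2]; rewrite (_ : En X Y F xi N w = (En X Y F xi N w - En X Y tF tx N w) + En X Y tF tx N w); last by ring.
  apply: le_lt_trans (ler_normD _ _) _; have -> : c = c / 2 + c / 2 by lra.
  exact: ltrD.
apply: lerD; last by rewrite ler_pdivrMr.
rewrite ler_pdivrMr ?exprn_gt0//; apply: le_trans S2 _.
have scale (o x : R) : 24 * o / c ^+ 2 * x * (c / 2) ^+ 2 = 6 * o * x by field; rewrite gt_eqF.
rewrite scale.
apply: ler_wpM2l; first by rewrite mulr_ge0.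
apply: lerD; last exact: (tcoef_row sF).
apply: lerD; last exact: (tcoef_col sF).
by apply: ler_wpM2l; rewrite ?invr_ge0.
Qed.

End numerator_small.

Section mehler_products.
Variable R : realType.

Lemma prod_close K (x y : nat -> R) (C dl : R) : 1 <= C -> 0 <= dl <= 1 ->
  (forall k, (k < K)%N -> `|y k| <= C) -> (forall k, (k < K)%N -> `|x k - y k| <= dl) ->
  `|\prod_(k < K) x k - \prod_(k < K) y k| <= K%:R * (C + 1) ^+ K * dl.
Proof.
move=> C1 /andP[dl0 dl1]; have C0 : 0 <= C := le_trans ler01 C1.
have C2 : 0 <= C + 1 by rewrite addr_ge0.
elim: K => [|K IH] yC xy; first by rewrite !big_ord0 subrr normr0 !mul0r.
have {}IH := IH (fun k kK => yC k (ltnW kK)) (fun k kK => xy k (ltnW kK)).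
have yp : `|\prod_(k < K) y k| <= (C + 1) ^+ K.
  rewrite normr_prod; apply: (@le_trans _ _ (\prod_(k < K) (C + 1))); last by rewrite prodr_const card_ord.
  apply: ler_prod => k _; rewrite normr_ge0 /=; apply: le_trans (yC k (leqW (ltn_ord k))) _.
  by rewrite lerDl.
have xK : `|x K| <= C + 1.
  rewrite (_ : x K = y K + (x K - y K)); last by ring.
  by apply: le_trans (ler_normD _ _) _; apply: lerD; [exact: yC|exact: le_trans (xy K _) dl1].
rewrite !big_ord_recr /=.
set p := \prod_(k < K) x k in IH *; set q := \prod_(k < K) y k in IH yp *.
rewrite (_ : p * x K - q * y K = (p - q) * x K + q * (x K - y K)); last by ring.
apply: le_trans (ler_normD _ _) _; rewrite !normrM.
have h1 : `|p - q| * `|x K| <= K%:R * (C + 1) ^+ K * dl * (C + 1) by exact: ler_pM.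
have h2 : `|q| * `|x K - y K| <= (C + 1) ^+ K * dl by apply: ler_pM => //; exact: xy.
apply: le_trans (lerD h1 h2) _; rewrite exprSr -natr1.
have e0 : 0 <= (C + 1) ^+ K * dl by rewrite mulr_ge0// exprn_ge0.
have : (C + 1) ^+ K * dl <= (C + 1) ^+ K * dl * (C + 1) by rewrite ler_peMr// lerDr.
rewrite (_ : (K%:R + 1) * ((C + 1) ^+ K * (C + 1)) * dl =
  K%:R * (C + 1) ^+ K * dl * (C + 1) + (C + 1) ^+ K * dl * (C + 1)); last by ring.
by rewrite lerD2l.
Qed.

Lemma mehler_bounded (tau B s u v : R) : tau < 1 -> 0 <= s -> s ^+ 2 <= tau -> 
  `|u| <= B -> `|v| <= B ->
  0 <= mehler s u v <= expR (- (2^-1 * ln (1 - tau)) + B ^+ 2 / (1 - tau)).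
Proof.
move=> tau1 s0 st uB vB; rewrite /mehler expR_ge0 /= ler_expR /mehler_exponent opprD.
have d0 : 0 < 1 - tau by lra.
have d1 : 0 < 1 - s ^+ 2 by lra.
have dd : 1 - tau <= 1 - s ^+ 2 by lra.
apply: lerD; first by rewrite lerN2 ler_pM2l// ler_ln.
rewrite -mulNr; apply: (@le_trans _ _ (B ^+ 2 * 2 / (2 * (1 - s ^+ 2)))).
  rewrite ler_pM2r ?invr_gt0 ?mulr_gt0//.
  have uv : `|u * v| <= B ^+ 2 by rewrite normrM expr2 ler_pM.
  have suv : s * (u * v) <= B ^+ 2.
    apply: le_trans (ler_norm _) _; rewrite normrM (ger0_norm s0).
    have s1 : s <= 1 by rewrite -(ler_pXn2r (n := 2))// ?nnegrE// expr1n; lra.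
    by apply: le_trans uv; rewrite ler_piMl.
  have : 0 <= s ^+ 2 * (u ^+ 2 + v ^+ 2) by rewrite mulr_ge0 ?addr_ge0 ?sqr_ge0.
  rewrite -mulrA; lra.
rewrite -mulrA; apply: ler_wpM2l; first exact: sqr_ge0.
by rewrite invfM mulrA divff ?mul1r ?lef_pV2.
Qed.

(** A padding index has [z k = 0], hence [s k = 0], where partial sum and kernel both equal [1];
    elsewhere [mehler_cvg] applies with variance [1]. *)
Lemma mehler_prod_cvg (s z : nat -> R) (tau B e : R) K : 0 <= tau < 1 ->
  (forall k, 0 <= s k) -> (forall k, s k ^+ 2 <= tau) ->
  (forall k, z k = 0 \/ z k = 1) -> (forall k, z k = 0 -> s k = 0) -> 0 < e ->
  exists M0, forall M, (M0 <= M)%N -> forall u v : 'I_K -> R,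
  (forall k, `|u k| <= B) -> (forall k, `|v k| <= B) ->
  `|\prod_(k < K) mehler_sum (z k) (s k) (u k) (v k) M - \prod_(k < K) mehler (s k) (u k) (v k)| <= e.
Proof.
move=> /andP[tau0 tau1] s0 st z01 zs e0.
pose C := expR (- (2^-1 * ln (1 - tau)) + B ^+ 2 / (1 - tau)) + 1.
have C1 : 1 <= C by rewrite lerDr expR_ge0.
have C0 : 0 < C + 1 by lra.
pose W := K%:R * (C + 1) ^+ K + 1.
have W0 : 0 < W by rewrite /W ltr_wpDl// mulr_ge0// exprn_ge0// ltW.
pose dl := Num.min 1 (e / W).
have dl0 : 0 < dl by rewrite lt_min ltr01 divr_gt0.
have dl1 : dl <= 1 by rewrite ge_min lexx.
have dle : dl <= e / W by rewrite ge_min lexx orbT.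
have s1 k : s k < 1.
  by rewrite -(ltr_pXn2r (n := 2))// ?nnegrE// expr1n (le_lt_trans (st k)).
have MM k : exists M0, forall M, (M0 <= M)%N -> forall u v, `|u| <= B -> `|v| <= B ->
    `|mehler_sum (z k) (s k) u v M - mehler (s k) u v| <= dl.
  have [zk|->] := z01 k; last by apply: mehler_cvg => //; rewrite s0 s1.
  exists 0%N => M _ u v _ _; rewrite zs// mehler_sum_s0 mehler_s0 subrr normr0; exact: ltW.
have [M0 HM] := choice MM.
exists (\max_(k < K) M0 k) => M MK u v uB vB.
pose x (k : nat) := if insub k is Some k' then mehler_sum (z k) (s k) (u k') (v k') M else 0.
pose y (k : nat) := if insub k is Some k' then mehler (s k) (u k') (v k') else 0.
have -> : \prod_(k < K) mehler_sum (z k) (s k) (u k) (v k) M = \prod_(k < K) x k.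
  by apply: eq_bigr => k _; rewrite /x valK.
have -> : \prod_(k < K) mehler (s k) (u k) (v k) = \prod_(k < K) y k.
  by apply: eq_bigr => k _; rewrite /y valK.
apply: le_trans (@prod_close K x y C dl C1 _ _ _) _.
- by rewrite (ltW dl0).
- move=> k kK; rewrite /y insubT/=.
  have /andP[m0 m1] := mehler_bounded tau1 (s0 k) (st k) (uB (Ordinal kK)) (vB (Ordinal kK)).
  by rewrite ger0_norm//; apply: le_trans m1 _; rewrite lerDl.
- move=> k kK; rewrite /x /y insubT/=; apply: HM => //.
  apply: leq_trans MK; exact: (leq_bigmax (Ordinal kK)).
apply: le_trans (_ : W * dl <= e); first by rewrite ler_wpM2r ?(ltW dl0)// lerDl.
by rewrite -ler_pdivlMl// mulrC.
Qed.

End mehler_products.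

(** * Lower tail of the denominator *)

Section one_sample.
Context dO (Om : measurableType dO) (R : realType) (Pr : probability Om R).
Context d (T : measurableType d) (m : probability T R) (Z : nat -> Om -> T).
Hypothesis mZ : forall i, measurable_fun setT (Z i).
Hypothesis Zm : forall i, has_law Pr (Z i) m.
Hypothesis ZZ : forall i j (f : T -> R), i != j -> sqi m f ->
  Ex Pr (fun w => f (Z i w) * f (Z j w)) = Ex m f ^+ 2.
Variables (f : nat -> T -> R) (z : nat -> R).
Hypothesis sf : forall k, sqi m (f k).
Hypothesis of_ : forall p q, Ex m (fun x => f p x * f q x) = (p == q)%:R * z p.
Hypothesis mf : forall k, Ex m (f k) = 0.
Hypothesis z01 : forall k, z k = 0 \/ z k = 1.

Definition scaled N K (w : Om) (i : 'I_N) (k : 'I_K) : R := (Num.sqrt N%:R)^-1 * f k (Z i w).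

Lemma colsum_sqi N K (k : 'I_K) : sqi Pr (fun w => colsum (@scaled N K w) k).
Proof. by apply: sqi_sum => i _; apply: sqiZ; exact: (law_sqi mZ Zm i (sf k)). Qed.

Lemma colsum_norm N K (k : 'I_K) : (0 < N)%N -> Ex Pr (fun w => colsum (@scaled N K w) k ^+ 2) <= 1.
Proof.
move=> N0; have NR : 0 < N%:R :> R by rewrite ltr0n.
have -> : Ex Pr (fun w => colsum (@scaled N K w) k ^+ 2) = z k.
  have E : (fun w => colsum (@scaled N K w) k ^+ 2) = (fun w => N%:R^-1 * (\sum_(i < N) f k (Z i w)) ^+ 2).
    by apply/funext => w; rewrite /colsum /scaled -mulr_sumr exprMn exprVn sqr_sqrtr ?(ltW NR).
  rewrite E ExZ; last exact: sqi_sq (sum_sqi mZ Zm N (sf k)).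
  rewrite (sum_sqr_Ex mZ Zm ZZ N (sf k) (mf k)) mulKf ?gt_eqF//.
  by have := of_ k k; rewrite eqxx mul1r.
by case: (z01 k) => ->.
Qed.

(** [B0] precedes [dd]: the size bounds hold for every positive [N] at the given probability,
    whereas the Gram and cubic deviations are small only for large [N]. Each of the four events
    costs [u]. *)
Lemma one_sample_regular K (u : R) : 0 < u -> exists B0 : R, forall B, B0 <= B -> forall dd : R, 0 < dd ->
  exists N0, forall N, (N0 <= N)%N ->
  mostly Pr (4 * u) [set w | [/\ tame B (@scaled N K w),
    forall p q : 'I_K, `|\sum_i @scaled N K w i p * @scaled N K w i q - (p == q)%:R * z p| <= dd
   & \sum_i rown (@scaled N K w) i ^+ 3 <= dd]].
Proof.
move=> u0; pose r x := \sum_(p < K) `|f p x|.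
have sr : sqi m r.
  apply: sqi_sum => p _; apply: (sqi_le _ _ (sf p)) => [|x]; last by rewrite normr_id.
  exact: measurableT_comp (sqi_meas (sf p)).
have r0 x : 0 <= r x by apply: sumr_ge0.
have E0 : 0 <= Ex m (fun x => r x ^+ 2) by apply: Ex_ge0 => x; exact: sqr_ge0.
exists (1 + K%:R / u + Ex m (fun x => r x ^+ 2) / u) => B BB dd dd0.
have K0 : 0 <= K%:R / u by rewrite divr_ge0// ltW.
have E1 : 0 <= Ex m (fun x => r x ^+ 2) / u by rewrite divr_ge0// ltW.
have B1 : 1 <= B by apply: le_trans BB; rewrite -addrA lerDl addr_ge0.
have B0 : 0 < B := lt_le_trans ltr01 B1.
have BK : K%:R / u <= B by apply: le_trans BB; rewrite addrAC lerDr addr_ge0.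
have BE : Ex m (fun x => r x ^+ 2) / u <= B by apply: le_trans BB; rewrite lerDr addr_ge0.
pose u' := u / (K * K).+1%:R; have u'0 : 0 < u' by rewrite divr_gt0.
have Hpq (pq : 'I_K * 'I_K) := lln mZ Zm ZZ (sqi_intgM (sf pq.1) (sf pq.2)) dd0 u'0.
have [N1 HN1] := choice Hpq.
have [N2 HN2] := cubic_small mZ Zm sr r0 dd0 u0.
exists (maxn 1 (maxn (\max_pq N1 pq) N2)) => N; rewrite !geq_max => /andP[N0 /andP[NN1 NN2]].
have NR : 0 < N%:R :> R by rewrite ltr0n.
have x2 : (Num.sqrt N%:R)^-1 ^+ 2 = N%:R^-1 :> R by rewrite exprVn sqr_sqrtr// ltW.
have x0 : 0 <= (Num.sqrt N%:R)^-1 :> R by rewrite invr_ge0 sqrtr_ge0.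
have rowE w i : rown (@scaled N K w) i = r (Z i w) / Num.sqrt N%:R.
  rewrite /rown /r mulrC mulr_sumr; apply: eq_bigr => p _.
  by rewrite normrM (ger0_norm x0).
have row2 w : \sum_i rown (@scaled N K w) i ^+ 2 = N%:R^-1 * \sum_(i < N) r (Z i w) ^+ 2.
  by rewrite mulr_sumr; apply: eq_bigr => i _; rewrite rowE expr_div_n sqr_sqrtr ?(ltW NR)// mulrC.
have M1 : mostly Pr u [set w | forall k : 'I_K, `|colsum (@scaled N K w) k| < B].
  apply: mostly_sub (mostly_forall (e := 1 / B ^+ 2) (G := fun k : 'I_K => [set w | `|colsum (@scaled N K w) k| < B]) _); [|by []|].
    rewrite card_ord; apply: (@le_trans _ _ (K%:R / B)).
      by rewrite ler_wpM2l// ler_pdivrMr ?exprn_gt0// expr2 mulrA mulVf ?gt_eqF// mul1r.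
    by rewrite ler_pdivrMr// mulrC -ler_pdivrMr.
  move=> k; apply: mostly_sub (mostly_chebyshev (@colsum_sqi N K k) B0); last by [].
  by rewrite ler_pM2r ?invr_gt0 ?exprn_gt0//; exact: colsum_norm.
have [I2 E2] := mean_Ex mZ Zm N0 (sqi_sq sr).
have M2 : mostly Pr u [set w | \sum_i rown (@scaled N K w) i ^+ 2 < B].
  have p0 w : 0 <= N%:R^-1 * \sum_(i < N) r (Z i w) ^+ 2.
    by rewrite mulr_ge0 ?invr_ge0 ?(ltW NR)// sumr_ge0// => i _; exact: sqr_ge0.
  apply: mostly_sub (mostly_markov I2 p0 B0); last by move=> w /=; rewrite row2.
  by rewrite E2 ler_pdivrMr// mulrC -ler_pdivrMr.
have M3 : mostly Pr u [set w | forall pq : 'I_K * 'I_K,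
    `|N%:R^-1 * \sum_(i < N) (f pq.1 (Z i w) * f pq.2 (Z i w)) - Ex m (fun x => f pq.1 x * f pq.2 x)| < dd].
  apply: mostly_sub (mostly_forall (e := u') (G := fun pq : 'I_K * 'I_K => [set w | 
    `|N%:R^-1 * \sum_(i < N) (f pq.1 (Z i w) * f pq.2 (Z i w)) - Ex m (fun x => f pq.1 x * f pq.2 x)| < dd]) _); [|by []|].
    rewrite card_prod card_ord /u' mulrA ler_pdivrMr// mulrC; apply: ler_wpM2l; first exact: ltW.
    by rewrite ler_nat.
  by move=> pq; apply: HN1; apply: leq_trans NN1; exact: (leq_bigmax pq).
apply: mostly_sub (mostlyI (mostlyI M1 M2) (mostlyI M3 (HN2 N NN2))); first by rewrite le_eqVlt; apply/orP; left; apply/eqP; ring.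
move=> w [[/= h1 h2] [/= h3 h4]]; split.
- by split; [move=> p; exact: ltW|exact: ltW].
- move=> p q; have := h3 (p, q); rewrite /= of_ => /ltW; congr (_ <= _); congr (`| _ - _ |).
  by rewrite mulr_sumr; apply: eq_bigr => i _; rewrite /scaled -x2; ring.
- by apply/ltW; apply: le_lt_trans h4; apply: ler_sum => i _; rewrite rowE.
Qed.

End one_sample.

Lemma five_errors (R : realFieldType) (e p m b k k' f : R) : 0 < e -> 8 * e <= p ->
  `|m - p| <= e -> `|b - m| <= e -> `|k - b| < e -> `|k' - k| < e -> `|f - k'| < e -> e < f.
Proof.
move=> e0 ep; rewrite !ler_norml !ltr_norml.
by move=> /andP[? _] /andP[? _] /andP[? _] /andP[? _] /andP[? _]; lra.
Qed.

Lemma thirteen_sixteenths (R : realFieldType) (e : R) : 0 < e ->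
  4 * (e / 16) + 4 * (e / 16) + (e / 16 + e / 16 + (e / 16 + (e / 16 + e / 16))) <= e.
Proof. lra. Qed.

Section lower_tail.
Context dO (Om : measurableType dO) (R : realType) (Pr : probability Om R).
Context d (T : measurableType d) (P Q : probability T R) (X Y : nat -> Om -> T).
Hypothesis mX : forall i, measurable_fun setT (X i).
Hypothesis mY : forall i, measurable_fun setT (Y i).
Hypothesis samples : independent_iid_samples Pr P Q X Y.

Lemma X_pair i j (f : T -> R) : i != j -> sqi P f ->
  Ex Pr (fun w => f (X i w) * f (X j w)) = Ex P f ^+ 2.
Proof.
move=> ij sf; have If := sqi_intg sf.
have m k : measurable_fun (setT : set (sigmaT (draw X Y) [:: inl k])) (fun w => f (X k w)).
  by apply: (measurableT_comp (sqi_meas sf) (@measurable_Z_sigmaT _ _ _ _ _ (draw X Y) [:: inl k] (inl k) _)); rewrite inE.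
have [_ ->] := indep_mul (measurable_draw mX mY) (draw_indep samples) (J1 := [:: inl i]) (J2 := [:: inl j])
  ltac:(by rewrite /= inE andbT; apply: contra_neq ij => -[]) (m i) (m j)
  (X_Ex mX samples i If).1 (X_Ex mX samples j If).1.
by rewrite !(X_Ex mX samples _ If).2 expr2.
Qed.

Lemma Y_pair i j (f : T -> R) : i != j -> sqi Q f ->
  Ex Pr (fun w => f (Y i w) * f (Y j w)) = Ex Q f ^+ 2.
Proof.
move=> ij sf; have If := sqi_intg sf.
have m k : measurable_fun (setT : set (sigmaT (draw X Y) [:: inr k])) (fun w => f (Y k w)).
  by apply: (measurableT_comp (sqi_meas sf) (@measurable_Z_sigmaT _ _ _ _ _ (draw X Y) [:: inr k] (inr k) _)); rewrite inE.
have [_ ->] := indep_mul (measurable_draw mX mY) (draw_indep samples) (J1 := [:: inr i]) (J2 := [:: inr j])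
  ltac:(by rewrite /= inE andbT; apply: contra_neq ij => -[]) (m i) (m j)
  (Y_Ex mY samples i If).1 (Y_Ex mY samples j If).1.
by rewrite !(Y_Ex mY samples _ If).2 expr2.
Qed.

Variables (a b : nat -> T -> R) (z s : nat -> R) (tau TT : R).
Hypotheses (sa : forall k, sqi P (a k)) (sb : forall k, sqi Q (b k)).
Hypothesis oa : forall p q, Ex P (fun x => a p x * a q x) = (p == q)%:R * z p.
Hypothesis ob : forall p q, Ex Q (fun x => b p x * b q x) = (p == q)%:R * z p.
Hypotheses (ma : forall k, Ex P (a k) = 0) (mb : forall k, Ex Q (b k) = 0).
Hypotheses (z01 : forall k, z k = 0 \/ z k = 1) (zs : forall k, z k = 0 -> s k = 0).
Hypotheses (tau01 : 0 <= tau < 1) (s_ge0 : forall k, 0 <= s k) (s_le : forall k, s k ^+ 2 <= tau).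
Hypothesis s_sum : forall K, \sum_(k < K) s k ^+ 2 <= TT.

Definition lift_letter K (f : nat -> T -> R) (l : option 'I_K) (x : T) : R := ev (fun k : 'I_K => f k x) l.

Definition xi_lev K (zz : T * T) : R := 1 + \sum_(k < K) s k * a k zz.1 * b k zz.2.

Lemma lift_gram K (m : probability T R) (f : nat -> T -> R) : (forall k, sqi m (f k)) ->
  (forall p q, Ex m (fun x => f p x * f q x) = (p == q)%:R * z p) -> (forall k, Ex m (f k) = 0) ->
  [/\ forall l : option 'I_K, sqi m (lift_letter f l),
   forall l l' : option 'I_K, l != l' -> Ex m (fun x => lift_letter f l x * lift_letter f l' x) = 0
   & forall l : option 'I_K, Ex m (fun x => lift_letter f l x ^+ 2) = 1 \/
       Ex m (fun x => lift_letter f l x ^+ 2) = 0].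
Proof.
move=> sf of_ mf; split.
- by case=> [k|]; [exact: sf|exact: sqi_cst].
- case=> [k|] [l|] //= kl.
  + by rewrite of_ (_ : (k == l :> nat) = false) ?mul0r//; apply/negbTE.
  + by rewrite -(mf k); congr Rintegral; apply/funext => x; exact: mulr1.
  + by rewrite -(mf l); congr Rintegral; apply/funext => x; exact: mul1r.
- case=> [k|] /=; last by left; rewrite -[RHS](Ex_cst m 1); congr Rintegral; apply/funext => x; exact: expr1n.
  have -> : Ex m (fun x => lift_letter f (Some k) x ^+ 2) = z k by have := of_ k k; rewrite eqxx mul1r.
  by case: (z01 k); [right|left].
Qed.

Let gA K := lift_gram K sa oa ma.
Let gB K := lift_gram K sb ob mb.

Definition box_part K N (box : 'I_K -> nat -> bool) (w : Om) : R :=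
  \sum_(c : {ffun 'I_N -> option 'I_K}) \sum_(e : {ffun 'I_N -> option 'I_K})
    ([forall k, box k (occ c (Some k))])%:R * (mon (fun=> ev (fun k : 'I_K => s k)) c * wt c e) *
    sample_mon X Y (lift_letter a) (lift_letter b) (c, e) w.

(** Seen from level [K'], only monomials avoiding the letters from [K] on survive at level [K]; so
    truncation in letters and truncation in degree are both instances of [box_part]. *)
Lemma Dn_box K K' N w : (K <= K')%N ->
  Dn X Y (xi_lev K) N w = box_part N (fun (k : 'I_K') j => (k < K)%N || (j == 0%N)) w.
Proof.
move=> KK'; pose s' (l : option 'I_K') : R := ev (fun k : 'I_K' => if (k < K)%N then s k else 0) l.
have xE x y : xi_lev K (x, y) = \sum_l s' l * lift_letter a l x * lift_letter b l y.
  rewrite sum_option /= !mulr1; congr (_ + _).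
  rewrite (big_ord_widen _ (fun k => s k * a k x * b k y) KK') big_mkcond /=.
  by apply: eq_bigr => k _; case: ifP => // _; rewrite !mul0r.
rewrite /Dn; under eq_bigr do under eq_bigr do rewrite xE.
rewrite (expand_D s' (fun i l => lift_letter a l (X i w)) (fun i l => lift_letter b l (Y i w))).
apply: eq_bigr => c _; apply: eq_bigr => e _; congr (_ * _); rewrite mulrA; congr (_ * _).
rewrite !mon_occ//=; case: forallP => [H|/forallP].
  rewrite mul1r; apply: eq_bigr => k _; case: ifP => // kK.
  by have := H k; rewrite kK /= => /eqP ->; rewrite !expr0.
rewrite negb_forall => /existsP[k]; rewrite negb_or => /andP[/negbTE kK nk].
by rewrite mul0r (bigD1 k)//= kK expr0n (negbTE nk) mul0r.
Qed.

Lemma Dn_full K N w : Dn X Y (xi_lev K) N w = box_part N (fun (k : 'I_K) j => true) w.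
Proof.
rewrite (Dn_box N w (leqnn K)); apply: eq_bigr => c _; apply: eq_bigr => e _.
by rewrite (@eq_forallb _ _ predT)// => k; rewrite ltn_ord.
Qed.

Lemma box_part_close K N (box : 'I_K -> nat -> bool) :
  sqi Pr (fun w => Dn X Y (xi_lev K) N w - box_part N box w) /\
  Ex Pr (fun w => (Dn X Y (xi_lev K) N w - box_part N box w) ^+ 2) <=
  \prod_(k < K) \sum_(j < N.+1) (s k ^+ 2) ^+ j -
  \prod_(k < K) \sum_(j < N.+1) (box k j)%:R * (s k ^+ 2) ^+ j.
Proof.
have [sA oA nA] := gA K; have [sB oB nB] := gB K.
pose Pm (m : {ffun 'I_K -> 'I_N.+1}) := ~~ [forall k, box k (m k)].
pose f (c e : {ffun 'I_N -> option 'I_K}) : R :=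
  (Pm (occv c))%:R * (mon (fun=> ev (fun k : 'I_K => s k)) c * wt c e).
have dE : (fun w => Dn X Y (xi_lev K) N w - box_part N box w) =
    (fun w => \sum_c \sum_e f c e * sample_mon X Y (lift_letter a) (lift_letter b) (c, e) w).
  apply/funext => w; rewrite Dn_full -sumrB; apply: eq_bigr => c _; rewrite -sumrB; apply: eq_bigr => e _.
  rewrite -mulrBl; congr (_ * _); rewrite -mulrBl; congr (_ * _).
  rewrite (_ : [forall k, true] = true) ?mulr1n; last by apply/forallP.
  rewrite (_ : Pm (occv c) = ~~ [forall k, box k (occ c (Some k))]); last first.
    by congr (~~ _); apply: eq_forallb => k; rewrite occvE.
  by case: [forall k, box k (occ c (Some k))]; rewrite /= ?subrr ?subr0.
have [S1 S2] := sample_mon_sum mX mY samples sA sB oA oB nA nB f.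
rewrite dE; split => //.
rewrite (_ : Ex Pr _ = Ex Pr (fun w => (\sum_c \sum_e f c e * sample_mon X Y (lift_letter a) (lift_letter b) (c, e) w) ^+ 2)); last first.
  by congr Rintegral; apply/funext => w; congr (_ ^+ 2); exact: (congr1 (fun g => g w) dE).
apply: le_trans S2 _; apply: le_trans (@coeff_D_bound _ _ _ (ev (fun k : 'I_K => s k)) _ Pm) _ => //.
by rewrite (box_complement_sum N box (fun k : 'I_K => s k ^+ 2)).
Qed.

Let t01 k : 0 <= s k ^+ 2 < 1.
Proof. by rewrite sqr_ge0; case/andP: tau01 => _; exact: le_lt_trans. Qed.

Let geo_ge1 k N : 1 <= \sum_(j < N.+1) (s k ^+ 2) ^+ j.
Proof.
by rewrite big_ord_recl expr0 lerDl; apply: sumr_ge0 => j _; rewrite exprn_ge0// sqr_ge0.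
Qed.

Lemma level_close K K' N : (K <= K')%N ->
  sqi Pr (fun w => Dn X Y (xi_lev K') N w - Dn X Y (xi_lev K) N w) /\
  Ex Pr (fun w => (Dn X Y (xi_lev K') N w - Dn X Y (xi_lev K) N w) ^+ 2) <=
  \prod_(k < K') (1 - s k ^+ 2)^-1 - \prod_(k < K) (1 - s k ^+ 2)^-1.
Proof.
move=> KK'; have := @box_part_close K' N (fun k j => (k < K)%N || (j == 0%N)).
have -> : box_part N (fun (k : 'I_K') j => (k < K)%N || (j == 0%N)) = Dn X Y (xi_lev K) N.
  by apply/funext => w; rewrite (Dn_box N w KK').
case=> H1 H2; split => //; apply: le_trans H2 _.
have -> : \prod_(k < K') \sum_(j < N.+1) ((k < K)%N || (j == 0%N :> nat))%:R * (s k ^+ 2) ^+ j =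
    \prod_(k < K) \sum_(j < N.+1) (s k ^+ 2) ^+ j.
  rewrite [RHS](big_ord_widen _ (fun k => \sum_(j < N.+1) (s k ^+ 2) ^+ j) KK') [RHS]big_mkcond /=.
  apply: eq_bigr => k _; case: ifP => kK; first by apply: eq_bigr => j _; rewrite mul1r.
  by rewrite big_ord_recl /= expr0 mulr1 big1 ?addr0// => j _; rewrite mul0r.
apply: (@prod_diff_le R (fun k => \sum_(j < N.+1) (s k ^+ 2) ^+ j) (fun k => (1 - s k ^+ 2)^-1)) => // k.
by rewrite geo_ge1 geo_sum_le.
Qed.

Lemma box_close K M N : (M <= N)%N ->
  let U (w : Om) (i : 'I_N) (k : 'I_K) := (Num.sqrt N%:R)^-1 * a k (X i w) in
  let V (w : Om) (i : 'I_N) (k : 'I_K) := (Num.sqrt N%:R)^-1 * b k (Y i w) in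
  (0 < N)%N ->
  sqi Pr (fun w => Dn X Y (xi_lev K) N w - box_term (fun k : 'I_K => s k) M (U w) (V w)) /\
  Ex Pr (fun w => (Dn X Y (xi_lev K) N w - box_term (fun k : 'I_K => s k) M (U w) (V w)) ^+ 2) <=
  \prod_(k < K) (1 - s k ^+ 2)^-1 - \prod_(k < K) \sum_(j < M.+1) (s k ^+ 2) ^+ j.
Proof.
move=> MN U V N0; have := @box_part_close K N (fun k j => (j <= M)%N).
have -> : box_part N (fun (k : 'I_K) j => (j <= M)%N) = (fun w => box_term (fun k : 'I_K => s k) M (U w) (V w)).
  by apply/funext => w; rewrite /U /V box_term_sum.
case=> H1 H2; split => //; apply: le_trans H2 _; apply: lerB.
  apply: ler_prod => k _; rewrite geo_sum_le// andbT; exact: le_trans ler01 (geo_ge1 k N).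
rewrite le_eqVlt; apply/orP; left; apply/eqP; apply: eq_bigr => k _.
rewrite (big_ord_widen N.+1 (fun j => (s k ^+ 2) ^+ j)) ?ltnS// big_mkcond /=.
by apply: eq_bigr => j _; rewrite ltnS; case: ifP; rewrite ?mul1r ?mul0r.
Qed.

Local Notation U N K := (@scaled _ Om R _ T X a N K).
Local Notation V N K := (@scaled _ Om R _ T Y b N K).

(** Only the sum of the [s k ^+ 2] is bounded uniformly in [K], so the mixed terms of Mehler's
    exponent cannot be summed in absolute value. As monomials in the two samples they are
    orthogonal, and their second moment involves squares only. *)
Lemma cross_moment K (sg : nat -> R) N : (0 < N)%N ->
  sqi Pr (fun w => \sum_(k < K) sg k * (colsum (U N K w) k * colsum (V N K w) k)) /\
  Ex Pr (fun w => (\sum_(k < K) sg k * (colsum (U N K w) k * colsum (V N K w) k)) ^+ 2) <=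
  \sum_(k < K) sg k ^+ 2.
Proof.
move=> N0; have NR : 0 < N%:R :> R by rewrite ltr0n.
have x2 : (Num.sqrt N%:R)^-1 * (Num.sqrt N%:R)^-1 = N%:R^-1 :> R by rewrite -expr2 exprVn sqr_sqrtr// ltW.
have [sA oA nA] := gA K; have [sB oB nB] := gB K.
pose single (i : 'I_N) (p : 'I_K) : {ffun 'I_N -> option 'I_K} := [ffun j => if j == i then Some p else None].
have single_mon (g : nat -> T -> R) (S : nat -> Om -> T) w i p :
    mon (fun i l => lift_letter g l (S i w)) (single i p) = g p (S i w).
  rewrite /mon (bigD1 i)//= ffunE eqxx big1 ?mulr1// => j /negbTE ji.
  by rewrite ffunE ji.
pose J := ('I_K * ('I_N * 'I_N))%type.
pose phi (t : J) := sample_mon X Y (lift_letter a) (lift_letter b) (single t.2.1 t.1, single t.2.2 t.1).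
have phiE t w : phi t w = a t.1 (X t.2.1 w) * b t.1 (Y t.2.2 w).
  by rewrite /phi /sample_mon /= !single_mon.
have sphi t : sqi Pr (phi t) by exact: (sample_mon_sqi mX mY samples sA sB).
have single_inj i j p q : single i p = single j q -> i = j /\ p = q.
  move/ffunP => /(_ i); rewrite !ffunE eqxx; case: eqP => // -> [->]; split => //.
have ophi t t' : t != t' -> Ex Pr (fun w => phi t w * phi t' w) = 0.
  move=> tt'; apply: (sample_mon_orth mX mY samples sA sB oA oB); apply: contra_neq tt'.
  move: t t' => [p [i j]] [p' [i' j']] /= [] /single_inj[-> ->] /single_inj[-> _] //.
have phin t : Ex Pr (fun w => phi t w ^+ 2) <= 1.
  by have [->|->] := sample_mon_norm mX mY samples sA sB nA nB (single t.2.1 t.1, single t.2.2 t.1).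
have E : (fun w => \sum_(k < K) sg k * (colsum (U N K w) k * colsum (V N K w) k)) =
    (fun w => \sum_(t : J) (sg t.1 / N%:R) * phi t w).
  apply/funext => w; have -> : \sum_(t : J) (sg t.1 / N%:R) * phi t w =
     \sum_(k < K) \sum_(i < N) \sum_(j < N) (sg k / N%:R) * phi (k, (i, j)) w.
    under [RHS]eq_bigr do rewrite pair_bigA /=.
    by rewrite pair_bigA /=; apply: eq_bigr => -[k [i j]] _.
  apply: eq_bigr => k _; rewrite /colsum mulr_suml mulr_sumr.
  apply: eq_bigr => i _; rewrite !mulr_sumr; apply: eq_bigr => j _.
  by rewrite phiE /scaled /= -x2; ring.
rewrite (_ : Ex Pr _ = Ex Pr (fun w => (\sum_(t : J) (sg t.1 / N%:R) * phi t w) ^+ 2)); last first.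
  by congr Rintegral; apply/funext => w; congr (_ ^+ 2); exact: (congr1 (fun g => g w) E).
rewrite E; split; first by apply: sqi_sum => t _; exact: sqiZ.
rewrite (Ex_sqr_sum_orth sphi ophi (fun t => sg t.1 / N%:R)).
apply: (@le_trans _ _ (\sum_(t : J) (sg t.1 / N%:R) ^+ 2)).
  by apply: ler_sum => t _; rewrite ler_piMr ?sqr_ge0.
rewrite -(pair_bigA _ (fun (k : 'I_K) (_ : 'I_N * 'I_N) => (sg k / N%:R) ^+ 2)) /=.
apply: ler_sum => k _; rewrite sumr_const card_prod card_ord -[leLHS]mulr_natl natrM.
by rewrite le_eqVlt; apply/orP; left; apply/eqP; field; rewrite gt_eqF.
Qed.

Lemma mehler_prod_lower K (u v : 'I_K -> R) :
  expR (\sum_(k < K) s k / (1 - s k ^+ 2) * (u k * v k) -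
    \sum_(k < K) s k ^+ 2 / (2 * (1 - s k ^+ 2)) * (u k ^+ 2 + v k ^+ 2)) <=
  \prod_(k < K) mehler (s k) (u k) (v k).
Proof.
rewrite -sumrB expR_sum; apply: ler_prod => k _; rewrite expR_ge0 ler_expR /=.
apply: le_trans (mehler_lower _ _ _).
  by rewrite le_eqVlt; apply/orP; left; apply/eqP; field; have /andP[_ ?] := t01 k; rewrite gt_eqF//; lra.
rewrite ger0_norm//; have /andP[_ h] := t01 k.
by rewrite -(ltr_pXn2r (n := 2))// ?nnegrE// expr1n.
Qed.

(** The order of the choices matters: thresholds for the exponent from [TT] and [tau] alone, hence
    the lower bound [8 * eta] of the Mehler product; then the level [K], the degree [M], the
    deviations allowed for the samples, and for each [N] a last level [K'] at which the passage to
    [f] is accurate. *)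
Lemma Dn_lower f : L2lim P Q f xi_lev -> forall e : R, 0 < e ->
  exists2 dl : R, 0 < dl & exists N0, forall N, (N0 <= N)%N ->
  mostly Pr e [set w | dl < Dn X Y f N w].
Proof.
move=> Lf e e0; pose u := e / 16; have u0 : 0 < u by rewrite divr_gt0.
have /andP[tau0 tau1] := tau01.
have d0 : 0 < 1 - tau by lra.
have TT0 : 0 <= TT by apply: le_trans (s_sum 0); rewrite big_ord0.
pose L1 := TT / (1 - tau); have L10 : 0 <= L1 by rewrite divr_ge0// ltW.
pose L2 := TT / (1 - tau) ^+ 2; have L20 : 0 <= L2 by rewrite divr_ge0// sqr_ge0.
(* [L1] bounds the mean of [W1] and [L2] the second moment of [W2] below, so each threshold is
   exceeded with probability at most [u]; neither depends on [K]. *)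
pose h1 := L1 / u + 1; have h10 : 0 < h1 by rewrite ltr_wpDl// divr_ge0// ltW.
pose h2 := L2 / u + 1; have h20 : 0 < h2 by rewrite ltr_wpDl// divr_ge0// ltW.
(* Five errors of at most [eta] separate [Dn X Y f N] from the Mehler product, so [8 * eta] leaves
   more than [eta]. *)
pose eta := expR (- (h1 + h2)) / 8; have eta0 : 0 < eta by rewrite divr_gt0// expR_gt0.
have etaE : expR (- (h1 + h2)) = 8 * eta by rewrite /eta; field.
have ue0 : 0 < u * eta ^+ 2 by rewrite mulr_gt0// exprn_gt0.
have [K HK] := geo_prod_cvg (TT := TT) tau01 (fun k => introT andP (conj (sqr_ge0 (s k)) (s_le k))) s_sum ue0.
have [BX HX] := one_sample_regular mX (X_law samples) X_pair sa oa ma z01 K u0.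
have [BY HY] := one_sample_regular mY (Y_law samples) Y_pair sb ob mb z01 K u0.
pose B := Num.max BX BY.
have BXB : BX <= B by rewrite le_max lexx.
have BYB : BY <= B by rewrite le_max lexx orbT.
have [M1 HM1] := mehler_prod_cvg B K tau01 s_ge0 s_le z01 zs eta0.
have [M2 HM2] := geo_box_cvg K t01 ue0.
pose M := maxn M1 M2.
have [dd [N3 [dd0 HN3]]] := @box_approx R K (fun k => s k) (fun k => z k) M B eta
  (fun k => ltac:(by case: (z01 k) => ->; rewrite ?normr0 ?normr1)) eta0.
have [N1 HN1] := HX B BXB dd dd0.
have [N2 HN2] := HY B BYB dd dd0.
exists eta => //; exists (maxn 1 (maxn M (maxn N1 (maxn N2 N3)))) => N.
rewrite !(geq_max, gtn_max) => /and5P[N0 MN NN1 NN2 NN3].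
have [K0 HK0] := Dn_trunc mX mY samples N Lf (mulr_gt0 u0 eta0).
pose K' := maxn K0 K; have KK' : (K <= K')%N := leq_maxr _ _.
have sxi K'' : sqi (P \x Q)%E (xi_lev K'') by case: Lf.
have sf : sqi (P \x Q)%E f by case: Lf.
have A5 : mostly Pr u [set w | `|Dn X Y f N w - Dn X Y (xi_lev K') N w| < eta].
  have I5 : intg Pr (fun w => `|Dn X Y f N w - Dn X Y (xi_lev K') N w|).
    by apply: intg_norm; apply: intgB; apply: (Dn_intg mX mY samples); exact: sqi_intg.
  apply: mostly_sub (mostly_markov I5 (fun=> normr_ge0 _) eta0); last by [].
  by rewrite ler_pdivrMr//; exact: HK0 (leq_maxl _ _).
have [S3 S3'] := level_close N KK'.
have A3 : mostly Pr u [set w | `|Dn X Y (xi_lev K') N w - Dn X Y (xi_lev K) N w| < eta].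
  apply: mostly_sub (mostly_chebyshev S3 eta0); last by [].
  by rewrite ler_pdivrMr ?exprn_gt0//; apply: le_trans S3' _; exact: HK.
have {}MN : (M <= N)%N by rewrite geq_max.
have [S4 S4'] := @box_close K M N MN N0.
have A4 : mostly Pr u [set w | `|Dn X Y (xi_lev K) N w - box_term (fun k : 'I_K => s k) M (U N K w) (V N K w)| < eta].
  apply: mostly_sub (mostly_chebyshev S4 eta0); last by [].
  by rewrite ler_pdivrMr ?exprn_gt0//; apply: le_trans S4' _; apply: HM2; exact: leq_maxr.
have dk k : 0 < 1 - s k ^+ 2 by rewrite subr_gt0; case/andP: (t01 k).
have dk1 k : (1 - s k ^+ 2)^-1 <= (1 - tau)^-1 by rewrite lef_pV2 ?posrE// lerD2l lerN2.
pose W1 w := \sum_(k < K) s k ^+ 2 / (2 * (1 - s k ^+ 2)) * (colsum (U N K w) k ^+ 2 + colsum (V N K w) k ^+ 2).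
pose W2 w := \sum_(k < K) s k / (1 - s k ^+ 2) * (colsum (U N K w) k * colsum (V N K w) k).
have A1 : mostly Pr u [set w | W1 w < h1].
  have sU k := colsum_sqi mX (X_law samples) sa N (K := K) k.
  have sV k := colsum_sqi mY (Y_law samples) sb N (K := K) k.
  have c0 k : 0 <= s k ^+ 2 / (2 * (1 - s k ^+ 2)).
    by rewrite divr_ge0 ?sqr_ge0// mulr_ge0// ltW.
  have I1 (k : 'I_K) : intg Pr (fun w => s k ^+ 2 / (2 * (1 - s k ^+ 2)) * (colsum (U N K w) k ^+ 2 + colsum (V N K w) k ^+ 2)).
    by apply: intgZ; apply: intgD; apply: sqi_sq; [exact: sU|exact: sV].
  have IW : intg Pr W1 by apply: intg_sum.
  have W0 w : 0 <= W1 w.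
    by apply: sumr_ge0 => k _; rewrite mulr_ge0// addr_ge0// sqr_ge0.
  apply: mostly_sub (mostly_markov IW W0 h10); last by [].
  rewrite ler_pdivrMr// /h1 mulrDr mulrCA divff ?gt_eqF// !mulr1.
  apply: (@le_trans _ _ L1); last by rewrite lerDl ltW.
  rewrite Ex_sum// /L1; apply: (@le_trans _ _ (\sum_(k < K) s k ^+ 2 / (1 - tau))); last first.
    by rewrite -mulr_suml ler_wpM2r// invr_ge0 ltW.
  apply: ler_sum => k _; rewrite ExZ; last by apply: intgD; apply: sqi_sq; [exact: sU|exact: sV].
  rewrite ExD; [|exact: sqi_sq (sU k)|exact: sqi_sq (sV k)].
  have e1 := colsum_norm mX (X_law samples) X_pair sa oa ma z01 k N0.
  have e2 := colsum_norm mY (Y_law samples) Y_pair sb ob mb z01 k N0.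
  apply: le_trans (ler_wpM2l (c0 k) (lerD e1 e2)) _.
  rewrite [leLHS](_ : _ = s k ^+ 2 * (1 - s k ^+ 2)^-1); last by field; rewrite gt_eqF.
  by rewrite ler_wpM2l ?sqr_ge0.
have A2 : mostly Pr u [set w | `|W2 w| < h2].
  have [S2 S2'] := cross_moment K (fun k => s k / (1 - s k ^+ 2)) N0.
  apply: mostly_sub (mostly_chebyshev S2 h20); last by [].
  rewrite ler_pdivrMr ?exprn_gt0//; apply: le_trans S2' _.
  apply: (@le_trans _ _ L2).
    rewrite /L2; apply: (@le_trans _ _ (\sum_(k < K) s k ^+ 2 / (1 - tau) ^+ 2)); last first.
      by rewrite -mulr_suml ler_wpM2r// invr_ge0 sqr_ge0.
    apply: ler_sum => k _; rewrite expr_div_n ler_wpM2l ?sqr_ge0// -!exprVn.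
    by rewrite lerXn2r ?nnegrE ?invr_ge0// ltW.
  apply: (@le_trans _ _ (u * h2)); first by rewrite /h2 mulrDr mulrCA divff ?gt_eqF// !mulr1 lerDl ltW.
  have h21 : 1 <= h2 by rewrite /h2 lerDr divr_ge0// ltW.
  by apply: ler_wpM2l; [exact: ltW|rewrite expr2; apply: ler_peMr => //; exact: ltW].
apply: mostly_sub (mostlyI (mostlyI (HN1 N NN1) (HN2 N NN2)) (mostlyI (mostlyI A1 A2) (mostlyI A3 (mostlyI A4 A5)))).
  exact: (thirteen_sixteenths e0).
move=> w [[[/= tU cU rU] [/= tV cV rV]] [[/= w1 w2] [/= a3 [/= a4 a5]]]].
have bx := HN3 N (U N K w) (V N K w) NN3 tU tV cU cV rU rV.
have mh := HM1 M (leq_maxl _ _) (colsum (U N K w)) (colsum (V N K w)) tU.1 tV.1.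
have lo := mehler_prod_lower (colsum (U N K w)) (colsum (V N K w)).
have : expR (- (h1 + h2)) <= \prod_(k < K) mehler (s k) (colsum (U N K w) k) (colsum (V N K w) k).
  apply: le_trans lo; rewrite ler_expR -/(W1 w) -/(W2 w).
  move: w2; rewrite ltr_norml => /andP[w2 _].
  by rewrite opprD [leLHS]addrC; apply: lerB; exact: ltW.
rewrite etaE => lb; exact: (five_errors eta0 lb mh bx a4 a3 a5).
Qed.

End lower_tail.

(** * Linearization and conclusion *)

Section spectral_reduction.
Context dO (Om : measurableType dO) (R : realType) (Pr : probability Om R).
Context d (T : measurableType d) (P Q : probability T R) (X Y : nat -> Om -> T).
Hypothesis mX : forall i, measurable_fun setT (X i).
Hypothesis mY : forall i, measurable_fun setT (Y i).
Hypothesis samples : independent_iid_samples Pr P Q X Y.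
Variables (xi : T * T -> R) (s : nat -> R) (alpha beta : nat -> T -> R).
Hypothesis sxi : sqi (P \x Q)%E xi.
Hypothesis dec : eigen_decomposition P Q xi s alpha beta.
Hypotheses (s1 : s 1%N < 1) (s_le : forall k, (1 <= k)%N -> s k <= s 1%N).

(** The constant eigenfunction equals [1] only almost everywhere; replacing it by [cst 1] makes the
    truncated kernels contain the term [1] at every point. *)
Definition one_first (e : nat -> T -> R) (k : nat) : T -> R := if k is _.+1 then e k else cst 1.

Lemma one_first_basis (m : probability T R) e : orthonormal_basis m e ->
  ae_eq m setT (e 0%N) (cst 1) -> orthonormal_basis m (one_first e).
Proof.
move=> oe e0; apply: (orthonormal_ext _ _ oe); first by case=> [|k] //; exact: sqi_meas (orthonormal_sqi k.+1 oe).
by case=> [|k] //; exact: ae_eq_refl.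
Qed.

Lemma one_first_ae (m : probability T R) (e : nat -> T -> R) k : ae_eq m setT (e 0%N) (cst 1) ->
  ae_eq m setT (one_first e k) (e k).
Proof. by case: k => [|k] e0; [exact: ae_eq_sym|exact: ae_eq_refl]. Qed.

Let oalpha : orthonormal_basis P alpha. Proof. by case: dec => -[]. Qed.
Let obeta : orthonormal_basis Q beta. Proof. by case: dec => -[]. Qed.
Let alpha0 : ae_eq P setT (alpha 0%N) (cst 1). Proof. by case: dec => _ []. Qed.
Let beta0 : ae_eq Q setT (beta 0%N) (cst 1). Proof. by case: dec => _ []. Qed.
Let s0 : s 0%N = 1. Proof. by case: dec => _ []. Qed.
Let s_ge0 k : 0 <= s k. Proof. by case: dec => _ _ /(_ k)/andP[]. Qed.
Let a := one_first alpha.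
Let b := one_first beta.
Let oa : orthonormal_basis P a := one_first_basis oalpha alpha0.
Let ob : orthonormal_basis Q b := one_first_basis obeta beta0.
Let sa k := orthonormal_sqi k oa.
Let sb k := orthonormal_sqi k ob.
Let sal k := orthonormal_sqi k oalpha.
Let sbe k := orthonormal_sqi k obeta.

Let mxi1 x : measurable_fun setT (fun y => xi (x, y)).
Proof. exact: measurableT_comp (sqi_meas sxi) (pair1_measurable x). Qed.
Let mxi2 y : measurable_fun setT (fun x => xi (x, y)).
Proof. exact: measurableT_comp (sqi_meas sxi) (pair2_measurable y). Qed.

Lemma opA_ae f g y : sqi P f -> sqi P g -> ae_eq P setT f g ->
  Ex P (fun x => f x * xi (x, y)) = Ex P (fun x => g x * xi (x, y)).
Proof.
move=> sf sg fg; apply: Ex_ae.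
- exact: measurable_funM (sqi_meas sf) (mxi2 y).
- exact: measurable_funM (sqi_meas sg) (mxi2 y).
- by apply: filterS fg => x h xT; rewrite h.
Qed.

Lemma opAadj_ae f g x : sqi Q f -> sqi Q g -> ae_eq Q setT f g ->
  Ex Q (fun y => f y * xi (x, y)) = Ex Q (fun y => g y * xi (x, y)).
Proof.
move=> sf sg fg; apply: Ex_ae.
- exact: measurable_funM (sqi_meas sf) (mxi1 x).
- exact: measurable_funM (sqi_meas sg) (mxi1 x).
- by apply: filterS fg => y h yT; rewrite h.
Qed.

(** The unit margins of [xi] are read off the eigenfunction relations at index [0]. *)
Lemma xi_margin2 : ae_eq Q setT (fun y => Ex P (fun x => xi (x, y))) (cst 1).
Proof.
have [_ _ _ _ /(_ 0%N)[Aa _]] := dec.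
apply: filterS2 Aa beta0 => y h h' yT; have := h yT; rewrite /= s0 (h' yT) mul1r => E.
transitivity (opA P xi (alpha 0%N) y); last exact: E.
rewrite /opA -/(Ex P _) (opA_ae y (sal 0%N) (sqi_cst P 1) alpha0).
by congr Rintegral; apply/funext => x; rewrite mul1r.
Qed.

Lemma xi_margin1 : ae_eq P setT (fun x => Ex Q (fun y => xi (x, y))) (cst 1).
Proof.
have [_ _ _ _ /(_ 0%N)[_ Ab]] := dec.
apply: filterS2 Ab alpha0 => x h h' xT; have := h xT; rewrite /= s0 (h' xT) mul1r => E.
transitivity (opAadj Q xi (beta 0%N) x); last exact: E.
rewrite /opAadj -/(Ex Q _) (opAadj_ae x (sbe 0%N) (sqi_cst Q 1) beta0).
by congr Rintegral; apply/funext => y; rewrite mul1r.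
Qed.

Lemma xi_Ex1 f : sqi P f -> intg (P \x Q)%E (fun z => f z.1 * xi z) /\
  Ex (P \x Q)%E (fun z => f z.1 * xi z) = Ex P f.
Proof.
move=> sf; have s1' := sqi_cst Q 1.
have E : (fun z : T * T => f z.1 * xi z) = (fun z => xi z * (f z.1 * cst 1 z.2)).
  by apply/funext => z; rewrite /= mulr1 mulrC.
rewrite E; split; first by apply: sqi_intgM => //; exact: sqi_tensor.
rewrite -(opAadj_Ex sxi sf s1'); apply: Ex_ae.
- exact: intg_meas (sqi_intgM (opAadj_sqi sxi s1') sf).
- exact: (sqi_meas sf).
- apply: filterS xi_margin1 => x h xT; rewrite /opAadj -[RHS]mul1r; congr (_ * _).
  by rewrite -[RHS](h xT); congr Rintegral; apply/funext => y; rewrite mul1r.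
Qed.

Lemma xi_Ex2 g : sqi Q g -> intg (P \x Q)%E (fun z => g z.2 * xi z) /\
  Ex (P \x Q)%E (fun z => g z.2 * xi z) = Ex Q g.
Proof.
move=> sg; have s1' := sqi_cst P 1.
have E : (fun z : T * T => g z.2 * xi z) = (fun z => xi z * (cst 1 z.1 * g z.2)).
  by apply/funext => z; rewrite /= mul1r mulrC.
rewrite E; split; first by apply: sqi_intgM => //; exact: sqi_tensor.
rewrite -(opA_Ex sxi s1' sg); apply: Ex_ae.
- exact: intg_meas (sqi_intgM (opA_sqi sxi s1') sg).
- exact: (sqi_meas sg).
- apply: filterS xi_margin2 => y h yT; rewrite /opA -[RHS]mul1r; congr (_ * _).
  by rewrite -[RHS](h yT); congr Rintegral; apply/funext => x; rewrite mul1r.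
Qed.

Lemma one_first_tcoef p q : tcoef P Q a b xi p q = s p * Ex Q (fun y => b p y * b q y).
Proof.
rewrite /tcoef -(kernel_Ex sxi (sa p) (sb q)).
have -> : Ex Q (fun y => Ex P (fun x => a p x * xi (x, y)) * b q y) =
    Ex Q (fun y => Ex P (fun x => alpha p x * xi (x, y)) * beta q y).
  apply: Ex_ae.
  - exact: intg_meas (sqi_intgM (opA_sqi sxi (sa p)) (sb q)).
  - exact: intg_meas (sqi_intgM (opA_sqi sxi (sal p)) (sbe q)).
  - apply: filterS (one_first_ae q beta0) => y h yT; rewrite /b h//; congr (_ * _).
    exact: (opA_ae y (sa p) (sal p) (one_first_ae p alpha0)).
rewrite (kernel_Ex sxi (sal p) (sbe q)) (xi_tcoef sxi dec); congr (_ * _); apply: Ex_ae.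
- exact: intg_meas (sqi_intgM (sbe p) (sbe q)).
- exact: intg_meas (sqi_intgM (sb p) (sb q)).
- by apply: filterS2 (one_first_ae p beta0) (one_first_ae q beta0) => y h h' yT; rewrite /b h// h'.
Qed.

Lemma Dn_xi_lower : forall e : R, 0 < e ->
  exists2 dl : R, 0 < dl & exists N0, forall N, (N0 <= N)%N ->
  mostly Pr e [set w | dl < Dn X Y xi N w].
Proof.
pose sv k := sval_of P Q xi a b k.
(* A pair of basis vectors counts only if neither of them is padding; multiplying both by [z k]
   gives the two families equal norms, as [Dn_lower] requires. *)
pose z k := Ex P (fun x => alpha k.+1 x ^+ 2) * Ex Q (fun y => beta k.+1 y ^+ 2).
have na k := basis_norm01 k oalpha.
have nb k := basis_norm01 k obeta.
have z01 k : z k = 0 \/ z k = 1.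
  by rewrite /z; case: (na k.+1) => ->; case: (nb k.+1) => ->; rewrite ?mul0r ?mulr0 ?mul1r; auto.
pose a' k x := z k * alpha k.+1 x; pose b' k y := z k * beta k.+1 y.
have sa' k : sqi P (a' k) by exact: sqiZ.
have sb' k : sqi Q (b' k) by exact: sqiZ.
have z2 k : z k * (z k * Ex P (fun x => alpha k.+1 x * alpha k.+1 x)) = z k.
  have -> : Ex P (fun x => alpha k.+1 x * alpha k.+1 x) = Ex P (fun x => alpha k.+1 x ^+ 2) by [].
  by rewrite /z; case: (na k.+1) => ->; case: (nb k.+1) => ->; rewrite ?(mul0r, mulr0, mul1r).
have z2' k : z k * (z k * Ex Q (fun x => beta k.+1 x * beta k.+1 x)) = z k.
  have -> : Ex Q (fun x => beta k.+1 x * beta k.+1 x) = Ex Q (fun x => beta k.+1 x ^+ 2) by [].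
  by rewrite /z; case: (na k.+1) => ->; case: (nb k.+1) => ->; rewrite ?(mul0r, mulr0, mul1r).
have oa' p q : Ex P (fun x => a' p x * a' q x) = (p == q)%:R * z p.
  have -> : Ex P (fun x => a' p x * a' q x) = z p * (z q * Ex P (fun x => alpha p.+1 x * alpha q.+1 x)).
    have I := sqi_intgM (sal p.+1) (sal q.+1).
    rewrite -(ExZ (z q) I) -(ExZ (z p) (intgZ (z q) I)).
    by congr Rintegral; apply/funext => x; rewrite /a'; ring.
  have [->|pq] := eqVneq p q; first by rewrite z2 mul1r.
  by rewrite (orthonormal_orth oalpha) ?eqSS// !mulr0 mul0r.
have ob' p q : Ex Q (fun x => b' p x * b' q x) = (p == q)%:R * z p.
  have -> : Ex Q (fun x => b' p x * b' q x) = z p * (z q * Ex Q (fun x => beta p.+1 x * beta q.+1 x)).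
    have I := sqi_intgM (sbe p.+1) (sbe q.+1).
    rewrite -(ExZ (z q) I) -(ExZ (z p) (intgZ (z q) I)).
    by congr Rintegral; apply/funext => x; rewrite /b'; ring.
  have [->|pq] := eqVneq p q; first by rewrite z2' mul1r.
  by rewrite (orthonormal_orth obeta) ?eqSS// !mulr0 mul0r.
have ma' k : Ex P (a' k) = 0.
  rewrite /a' ExZ; last exact: sqi_intg.
  rewrite -(Ex_e0 oa (ae_eq_refl _ _ _) (sal k.+1)).
  have -> : Ex P (fun x => alpha k.+1 x * a 0%N x) = Ex P (fun x => a k.+1 x * a 0%N x) by [].
  by rewrite (orthonormal_orth oa) ?mulr0.
have mb' k : Ex Q (b' k) = 0.
  rewrite /b' ExZ; last exact: sqi_intg.
  rewrite -(Ex_e0 ob (ae_eq_refl _ _ _) (sbe k.+1)).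
  have -> : Ex Q (fun x => beta k.+1 x * b 0%N x) = Ex Q (fun x => b k.+1 x * b 0%N x) by [].
  by rewrite (orthonormal_orth ob) ?mulr0.
have bounds k := sval_of_bounds ob one_first_tcoef s_ge0 s_le k.
(* A discarded pair carries no part of [xi]: its coefficient is [s] times the squared norm of the
   [beta] vector, and it also vanishes when the [alpha] vector is null. *)
have zs k : z k = 0 -> sv k.+1 = 0.
  move=> /eqP; rewrite mulf_eq0 => /orP[/eqP h|/eqP h]; last first.
    by rewrite /sv /sval_of one_first_tcoef (_ : Ex Q _ = Ex Q (fun y => beta k.+1 y ^+ 2)) ?h ?mulr0.
  rewrite /sv /sval_of /tcoef -(kernel_Ex sxi (sa _) (sb _)).
  rewrite -[RHS](Ex_cst Q 0); congr Rintegral; apply/funext => y.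
  have ae0 : ae_eq P setT (alpha k.+1) (cst 0) := Ex_sqr_eq0 (sal k.+1) h.
  have -> : Ex P (fun x => a k.+1 x * xi (x, y)) = Ex P (fun x => cst 0 x * xi (x, y)).
    exact: (opA_ae y (sal k.+1) (sqi_cst P 0) ae0).
  have -> : Ex P (fun x => cst 0 x * xi (x, y)) = 0.
    by rewrite -[RHS](Ex_cst P 0); congr Rintegral; apply/funext => x; rewrite mul0r.
  by rewrite mul0r.
have s1ge := s_ge0 1.
have tau01 : 0 <= s 1%N ^+ 2 < 1 by rewrite sqr_ge0 expr_lt1.
have sv_le k : sv k.+1 ^+ 2 <= s 1%N ^+ 2.
  by have /andP[? ?] := bounds k; rewrite ler_pXn2r// nnegrE.
have sv0 k : 0 <= sv k.+1 by case/andP: (bounds k).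
have L := L2lim_trunc oa ob sxi.
have tE : trunc P Q a b xi = xi_lev a' b' (fun k => sv k.+1).
  apply/funext => K; apply/funext => zz; rewrite (trunc_xi ob one_first_tcoef) sum_option /xi_lev /=.
  rewrite (sval_of0 (erefl _) one_first_tcoef s0) !mul1r; congr (_ + _); apply: eq_bigr => k _.
  rewrite /a' /b' -/(sv k.+1); have [h|->] := z01 k; last by rewrite !mul1r.
  by rewrite (zs k h) !mul0r.
rewrite tE in L.
exact: (Dn_lower mX mY samples sa' sb' oa' ob' ma' mb' z01 zs tau01 sv0 sv_le
  (sval_of_sum sxi oa ob) L).
Qed.

Lemma En_xi_small : exists2 C : R, 0 <= C & forall F N (c e : R), sqi (P \x Q)%E F -> (0 < N)%N ->
  Ex (P \x Q)%E F = 0 -> 0 < c -> 0 < e ->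
  mostly Pr (C / c ^+ 2 * (N%:R^-1 * Ex (P \x Q)%E (fun z => F z ^+ 2) +
     Ex P (fun x => Ex Q (fun y => F (x, y)) ^+ 2) + Ex Q (fun y => Ex P (fun x => F (x, y)) ^+ 2)) + e)
   [set w | `|En X Y F xi N w| < c].
Proof.
exact: (En_small mX mY samples sxi oa ob (erefl _) (erefl _) one_first_tcoef s0 s_ge0 s1 s_le).
Qed.

End spectral_reduction.

Section bounded_approximation.
Context d (T : measurableType d) (R : realType) (m : probability T R).

(** Truncation followed by recentring. As [u] has mean [0], the recentring subtracts from the error
    its own mean, which only decreases its second moment. *)
Lemma bounded_centered (u : T -> R) : sqi m u -> Ex m u = 0 -> forall e : R, 0 < e ->
  exists (M : R) (u' : T -> R), [/\ measurable_fun setT u', forall x, `|u' x| <= M, Ex m u' = 0 &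
    Ex m (fun x => (u x - u' x) ^+ 2) <= e].
Proof.
move=> su u0 e e0; have mu := sqi_meas su.
have [n Hn] := tail_small mu (sqi_sq su) e0.
pose u1 x := if n%:R < `|u x| then 0 else u x.
have mc : measurable_fun setT (fun x => n%:R < `|u x|).
  by apply: measurable_fun_ltr => //; exact: measurableT_comp.
have mu1 : measurable_fun setT u1 by apply: measurable_fun_ifT.
have u1n x : `|u1 x| <= n%:R by rewrite /u1; case: ifPn; rewrite ?normr0// -leNgt.
have su1 : sqi m u1 := sqi_bounded m mu1 u1n.
have I1 := sqi_intg su1.
pose c := Ex m u1.
have sd : sqi m (fun x => u x - u1 x) by exact: sqiB.
have Ed : Ex m (fun x => u x - u1 x) = - c.
  by rewrite ExB ?u0 ?sub0r//; exact: sqi_intg.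
exists (n%:R + `|c|), (fun x => u1 x - c); split.
- exact: measurable_funB.
- by move=> x; apply: le_trans (ler_normB _ _) _; rewrite lerD2r.
- by rewrite ExB ?Ex_cst ?subrr//; exact: intg_cst.
- have Id := sqi_intg sd.
  have -> : Ex m (fun x => (u x - (u1 x - c)) ^+ 2) =
      Ex m (fun x => (u x - u1 x) ^+ 2) - c ^+ 2.
    have E : (fun x => (u x - (u1 x - c)) ^+ 2) = (fun x => (u x - u1 x) ^+ 2 + (2 * c * (u x - u1 x) + c ^+ 2)).
      by apply/funext => x; ring.
    rewrite E ExD; [|exact: sqi_sq|by apply: intgD; [exact: intgZ|exact: intg_cst]].
    rewrite ExD; [|exact: intgZ|exact: intg_cst].
    by rewrite ExZ// Ed Ex_cst; ring.
  apply: (@le_trans _ _ (Ex m (fun x => (u x - u1 x) ^+ 2))); first by rewrite gerBl sqr_ge0.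
  apply: le_trans Hn; rewrite le_eqVlt; apply/orP; left; apply/eqP; congr Rintegral.
  apply/funext => x; rewrite /u1; case: ifP => _; last by rewrite subrr expr0n.
  by rewrite subr0 ger0_norm// sqr_ge0.
Qed.

(** Off the exceptional set the Lipschitz bound applies; on it, two values in []0, 1[] differ by
    less than [1]. *)
Lemma slutsky (Z W : T -> R) (F : R -> R) (L c e : R) : 0 <= c -> 0 <= L ->
  (forall x, 0 < F x < 1) -> (forall x y, `|F x - F y| <= L * `|x - y|) ->
  measurable_fun setT (fun x => F (Z x)) -> measurable_fun setT (fun x => F (W x)) ->
  mostly m e [set x | `|Z x - W x| < c] ->
  `|Ex m (fun x => F (Z x)) - Ex m (fun x => F (W x))| <= L * c + e.
Proof.
move=> c0 L0 F01 FL mZ mW [A [mA Ae HA]].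
have IF (V : T -> R) : measurable_fun setT (fun x => F (V x)) -> intg m (fun x => F (V x)).
  move=> mV; apply: (@intg_bounded _ _ _ m 1) => // x.
  by have /andP[f0 f1] := F01 (V x); rewrite gtr0_norm// ltW.
have IA : intg m (\1_A : T -> R).
  apply: (@intg_bounded _ _ _ m 1) => // x; rewrite indicE; case: (_ \in _); rewrite ?normr1 ?normr0//.
rewrite -ExB; [|exact: IF|exact: IF].
apply: le_trans (Ex_norm _) _; first by apply: intgB; exact: IF.
apply: (@le_trans _ _ (Ex m (fun x => L * c + (\1_A x : R)))).
  apply: Ex_le; [by apply: intg_norm; apply: intgB; exact: IF|by apply: intgD; [exact: intg_cst|]|].
  move=> x; rewrite indicE; case: (boolP (x \in A)) => xA /=.
    have /andP[? ?] := F01 (Z x); have /andP[? ?] := F01 (W x).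
    apply: (@le_trans _ _ 1); first by rewrite ler_norml; apply/andP; split; lra.
    by rewrite lerDr mulr_ge0.
  rewrite addr0; apply: le_trans (FL _ _) _; apply: ler_wpM2l => //; apply/ltW/HA.
  by move=> Ax; move: xA; rewrite mem_set.
rewrite ExD//; last exact: intg_cst.
by rewrite Ex_cst lerD2l -pr_Ex.
Qed.

End bounded_approximation.

Section linearization.
Context dO (Om : measurableType dO) (R : realType) (Pr : probability Om R).
Context d (T : measurableType d) (P Q : probability T R) (X Y : nat -> Om -> T).
Hypothesis mX : forall i, measurable_fun setT (X i).
Hypothesis mY : forall i, measurable_fun setT (Y i).
Hypothesis samples : independent_iid_samples Pr P Q X Y.
Variables (xi : T * T -> R) (s : nat -> R) (alpha beta : nat -> T -> R).
Hypothesis sxi : sqi (P \x Q)%E xi.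
Hypothesis dec : eigen_decomposition P Q xi s alpha beta.
Hypotheses (s1 : s 1%N < 1) (s_le : forall k, (1 <= k)%N -> s k <= s 1%N).

Lemma En_mul (h : T * T -> R) N w : En X Y (fun z => h z * xi z) xi N w =
  (Num.sqrt N%:R)^-1 * ((N`!%:R)^-1 * \sum_(t : 'S_N)
    (\sum_(i < N) h (X i w, Y (t i) w)) * \prod_(j < N) xi (X j w, Y (t j) w)).
Proof.
congr (_ * _); rewrite -mulr_sumr; congr (_ * _); rewrite exchange_big /=; apply: eq_bigr => t _.
rewrite mulr_suml; apply: eq_bigr => i _.
by rewrite -mulrA; congr (_ * _); rewrite [RHS](bigD1 i).
Qed.

Lemma EnB (F G : T * T -> R) N w :
  En X Y (fun z => F z - G z) xi N w = En X Y F xi N w - En X Y G xi N w.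
Proof.
rewrite -mulrBr -sumrB; congr (_ * _); apply: eq_bigr => i _.
rewrite -mulrBr -sumrB; congr (_ * _); apply: eq_bigr => t _.
by rewrite mulrBl.
Qed.

Definition linear_stat (u v : T -> R) N (w : Om) : R :=
  \sum_(i < N) (u (X i w) + v (Y i w)) / Num.sqrt N%:R.

(** The sum over [i] of [u (X i) + v (Y (t i))] does not depend on the permutation [t], so it leaves
    the average. *)
Lemma En_linear u v N w : En X Y (fun z => (u z.1 + v z.2) * xi z) xi N w =
  Dn X Y xi N w * linear_stat u v N w.
Proof.
rewrite En_mul /linear_stat -mulr_suml [RHS]mulrA [RHS]mulrC; congr (_ * _).
rewrite /Dn -mulrA; congr (_ * _); rewrite mulr_suml; apply: eq_bigr => t _.
rewrite mulrC; congr (_ * _); rewrite !big_split /=; congr (_ + _).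
by rewrite [RHS](reindex_inj (@perm_inj _ t)).
Qed.

Lemma linear_statB u v u' v' N w :
  linear_stat u v N w - linear_stat u' v' N w = linear_stat (fun x => u x - u' x) (fun y => v y - v' y) N w.
Proof. by rewrite -sumrB; apply: eq_bigr => i _; ring. Qed.

Lemma linear_stat_sqr u v N : (0 < N)%N -> sqi P u -> sqi Q v -> Ex P u = 0 -> Ex Q v = 0 ->
  sqi Pr (linear_stat u v N) /\
  Ex Pr (fun w => linear_stat u v N w ^+ 2) <= 2 * Ex P (fun x => u x ^+ 2) + 2 * Ex Q (fun y => v y ^+ 2).
Proof.
move=> N0 su sv u0 v0; have NR : 0 < N%:R :> R by rewrite ltr0n.
have x2 : (Num.sqrt N%:R)^-1 ^+ 2 = N%:R^-1 :> R by rewrite exprVn sqr_sqrtr// ltW.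
have E : linear_stat u v N = (fun w => (Num.sqrt N%:R)^-1 * (\sum_(i < N) u (X i w)) +
    (Num.sqrt N%:R)^-1 * (\sum_(i < N) v (Y i w))).
  by apply/funext => w; rewrite /linear_stat -mulr_suml big_split mulrC mulrDr.
have S1 := sum_sqi mX (X_law samples) N su; have S2 := sum_sqi mY (Y_law samples) N sv.
rewrite E; split; first by apply: sqiD; exact: sqiZ.
apply: le_trans (Ex_sqrD_le (sqiZ _ S1) (sqiZ _ S2)) _.
have V1 : Ex Pr (fun w => ((Num.sqrt N%:R)^-1 * (\sum_(i < N) u (X i w))) ^+ 2) = Ex P (fun x => u x ^+ 2).
  under [X in Ex _ X]eq_fun do rewrite exprMn x2; rewrite ExZ; last exact: sqi_sq.
  by rewrite (sum_sqr_Ex mX (X_law samples) (X_pair mX mY samples) N su u0) mulKf// gt_eqF.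
have V2 : Ex Pr (fun w => ((Num.sqrt N%:R)^-1 * (\sum_(i < N) v (Y i w))) ^+ 2) = Ex Q (fun x => v x ^+ 2).
  under [X in Ex _ X]eq_fun do rewrite exprMn x2; rewrite ExZ; last exact: sqi_sq.
  by rewrite (sum_sqr_Ex mY (Y_law samples) (Y_pair mX mY samples) N sv v0) mulKf// gt_eqF.
by rewrite V1 V2.
Qed.

Lemma opAadj_bound g : sqi Q g ->
  Ex P (fun x => opAadj Q xi g x ^+ 2) <= Ex Q (fun y => g y ^+ 2) * Ex (P \x Q)%E (fun z => xi z ^+ 2).
Proof.
move=> sg; have [_] := kernel_sqi (sqi_swap sxi) sg.
by rewrite (intg_swap (sqi_sq sxi)).2.
Qed.

Lemma opA_bound f : sqi P f ->
  Ex Q (fun y => opA P xi f y ^+ 2) <= Ex P (fun x => f x ^+ 2) * Ex (P \x Q)%E (fun z => xi z ^+ 2).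
Proof. by move=> sf; have [_] := kernel_sqi sxi sf. Qed.

Variables (F0 : T * T -> R) (u v : T -> R).
Hypotheses (sF0 : sqi (P \x Q)%E F0) (EF0 : Ex (P \x Q)%E F0 = 0).
Hypotheses (su : sqi P u) (sv : sqi Q v) (u0 : Ex P u = 0) (v0 : Ex Q v = 0).
Hypothesis hu : ae_eq P setT (fun x => u x + opAadj Q xi v x) (fun x => Ex Q (fun y => F0 (x, y))).
Hypothesis hv : ae_eq Q setT (fun y => v y + opA P xi u y) (fun y => Ex P (fun x => F0 (x, y))).

Section residual.
Variables (M M' : R) (u' v' : T -> R).
Hypotheses (mu' : measurable_fun setT u') (mv' : measurable_fun setT v').
Hypotheses (uM : forall x, `|u' x| <= M) (vM : forall y, `|v' y| <= M').
Hypotheses (u'0 : Ex P u' = 0) (v'0 : Ex Q v' = 0).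

Let su' : sqi P u' := sqi_bounded P mu' uM.
Let sv' : sqi Q v' := sqi_bounded Q mv' vM.

(* The bounded functions [u'], [v'] approximate [u], [v], so that the row and
   column means of the residual are small, while the subtracted kernel contributes
   exactly [Dn * linear_stat u' v'] to [En F0] (lemma [En_linear]). *)
Definition residual (z : T * T) : R := F0 z - (u' z.1 + v' z.2) * xi z.

Lemma residual_sqi : sqi (P \x Q)%E residual.
Proof.
apply: sqiB => //.
apply: (@sqiM_bounded _ _ _ _ (M + M') xi (fun z : T * T => u' z.1 + v' z.2) sxi).
  by apply: measurable_funD; apply: measurableT_comp.
by move=> z; apply: le_trans (ler_normD _ _) _; exact: lerD.
Qed.

Lemma residual_Ex : Ex (P \x Q)%E residual = 0.
Proof.
have [I1 E1] := xi_Ex1 sxi dec su'; have [I2 E2] := xi_Ex2 sxi dec sv'.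
have E : residual = (fun z => F0 z - (u' z.1 * xi z + v' z.2 * xi z)).
  by apply/funext => z; rewrite /residual mulrDl.
rewrite E ExB; [|exact: sqi_intg|exact: intgD].
by rewrite ExD// E1 E2 u'0 v'0 EF0 addr0 subr0.
Qed.

(** By the coupled equations and the unit margins of [xi], the row mean is [u - u'] plus the adjoint
    operator applied to [v - v'], almost everywhere; the L^2 norm of [xi] bounds the second part. *)
Lemma residual_row : Ex P (fun x => Ex Q (fun y => residual (x, y)) ^+ 2) <=
  2 * Ex P (fun x => (u x - u' x) ^+ 2) +
  2 * (Ex Q (fun y => (v y - v' y) ^+ 2) * Ex (P \x Q)%E (fun z => xi z ^+ 2)).
Proof.
have sdv : sqi Q (fun y => v y - v' y) by exact: sqiB.
have sdu : sqi P (fun x => u x - u' x) by exact: sqiB.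
have sop := opAadj_sqi sxi sdv.
have [I1 _] := xi_Ex1 sxi dec su'; have [I2 _] := xi_Ex2 sxi dec sv'; have [I3 _] := xi_Ex2 sxi dec sv.
have E : ae_eq P setT (fun x => Ex Q (fun y => residual (x, y)) ^+ 2)
    (fun x => (u x - u' x + opAadj Q xi (fun y => v y - v' y) x) ^+ 2).
  have J0 := intg_section1 (sqi_intg sF0); have J1 := intg_section1 I1.
  have J2 := intg_section1 I2; have J3 := intg_section1 I3; have J4 := intg_section1 (sqi_intg sxi).
  have J01 : {ae P, forall x, intg Q (fun y => F0 (x, y)) /\ intg Q (fun y => u' x * xi (x, y))}.
    by apply: filterS2 J0 J1 => x; split.
  have J23 : {ae P, forall x, intg Q (fun y => v' y * xi (x, y)) /\ intg Q (fun y => v y * xi (x, y))}.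
    by apply: filterS2 J2 J3 => x; split.
  have J04 : {ae P, forall x, [/\ intg Q (fun y => F0 (x, y)) /\ intg Q (fun y => u' x * xi (x, y)),
      intg Q (fun y => v' y * xi (x, y)) /\ intg Q (fun y => v y * xi (x, y)) & intg Q (fun y => xi (x, y))]}.
    by apply: filterS3 J01 J23 J4 => x; split.
  apply: filterS3 J04 hu (xi_margin1 sxi dec) => x [[K0 K1] [K2 K3] K4] h h' xT.
  congr (_ ^+ 2).
  have -> : Ex Q (fun y => residual (x, y)) =
      Ex Q (fun y => F0 (x, y) - (u' x * xi (x, y) + v' y * xi (x, y))).
    by congr Rintegral; apply/funext => y; rewrite /residual mulrDl.
  rewrite ExB//; last exact: intgD.
  rewrite ExD// ExZ// (h' xT) /= mulr1 -(h xT).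
  have -> : opAadj Q xi (fun y => v y - v' y) x = opAadj Q xi v x - opAadj Q xi v' x.
    by rewrite /opAadj -!/(Ex Q _) -ExB//; congr Rintegral; apply/funext => y; rewrite mulrBl.
  by rewrite /opAadj -!/(Ex Q _); ring.
have mR : measurable_fun setT (fun x => Ex Q (fun y => residual (x, y)) ^+ 2).
  by apply: measurable_funX; exact: intg_meas (fubini1 (sqi_intg residual_sqi)).1.
rewrite (Ex_ae mR _ E); last exact: intg_meas (sqi_sq (sqiD sdu sop)).
apply: le_trans (Ex_sqrD_le sdu sop) _; rewrite lerD2l ler_pM2l//.
exact: opAadj_bound.
Qed.

Lemma residual_col : Ex Q (fun y => Ex P (fun x => residual (x, y)) ^+ 2) <=
  2 * Ex Q (fun y => (v y - v' y) ^+ 2) +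
  2 * (Ex P (fun x => (u x - u' x) ^+ 2) * Ex (P \x Q)%E (fun z => xi z ^+ 2)).
Proof.
have sdv : sqi Q (fun y => v y - v' y) by exact: sqiB.
have sdu : sqi P (fun x => u x - u' x) by exact: sqiB.
have sop := opA_sqi sxi sdu.
have [I1 _] := xi_Ex1 sxi dec su'; have [I2 _] := xi_Ex2 sxi dec sv'; have [I3 _] := xi_Ex1 sxi dec su.
have E : ae_eq Q setT (fun y => Ex P (fun x => residual (x, y)) ^+ 2)
    (fun y => (v y - v' y + opA P xi (fun x => u x - u' x) y) ^+ 2).
  have J0 := intg_section2 (sqi_intg sF0); have J1 := intg_section2 I1.
  have J2 := intg_section2 I2; have J3 := intg_section2 I3; have J4 := intg_section2 (sqi_intg sxi).
  have J01 : {ae Q, forall y, intg P (fun x => F0 (x, y)) /\ intg P (fun x => u' x * xi (x, y))}.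
    by apply: filterS2 J0 J1 => y; split.
  have J23 : {ae Q, forall y, intg P (fun x => v' y * xi (x, y)) /\ intg P (fun x => u x * xi (x, y))}.
    by apply: filterS2 J2 J3 => y; split.
  have J04 : {ae Q, forall y, [/\ intg P (fun x => F0 (x, y)) /\ intg P (fun x => u' x * xi (x, y)),
      intg P (fun x => v' y * xi (x, y)) /\ intg P (fun x => u x * xi (x, y)) & intg P (fun x => xi (x, y))]}.
    by apply: filterS3 J01 J23 J4 => y; split.
  apply: filterS3 J04 hv (xi_margin2 sxi dec) => y [[K0 K1] [K2 K3] K4] h h' yT.
  congr (_ ^+ 2).
  have -> : Ex P (fun x => residual (x, y)) =
      Ex P (fun x => F0 (x, y) - (u' x * xi (x, y) + v' y * xi (x, y))).
    by congr Rintegral; apply/funext => x; rewrite /residual mulrDl.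
  rewrite ExB//; last exact: intgD.
  rewrite ExD// [X in _ - (_ + X)]ExZ// (h' yT) /= mulr1 -(h yT).
  have -> : opA P xi (fun x => u x - u' x) y = opA P xi u y - opA P xi u' y.
    by rewrite /opA -!/(Ex P _) -ExB//; congr Rintegral; apply/funext => x; rewrite mulrBl.
  by rewrite /opA -!/(Ex P _); ring.
have mR : measurable_fun setT (fun y => Ex P (fun x => residual (x, y)) ^+ 2).
  by apply: measurable_funX; exact: intg_meas (fubini2 (sqi_intg residual_sqi)).1.
rewrite (Ex_ae mR _ E); last exact: intg_meas (sqi_sq (sqiD sdv sop)).
apply: le_trans (Ex_sqrD_le sdv sop) _; rewrite lerD2l ler_pM2l//.
exact: opA_bound.
Qed.

End residual.

Lemma linearization (c e : R) : 0 < c -> 0 < e -> exists N0, forall N, (N0 <= N)%N ->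
  mostly Pr e [set w | 0 < Dn X Y xi N w /\
    `|En X Y F0 xi N w / Dn X Y xi N w - linear_stat u v N w| < c].
Proof.
move=> c0 e0; have e4 : 0 < e / 4 by lra.
have [dl dl0 [N1 HN1]] := Dn_xi_lower mX mY samples sxi dec s1 s_le e4.
have [C C0 HC] := En_xi_small mX mY samples sxi dec s1 s_le.
pose S := Ex (P \x Q)%E (fun z => xi z ^+ 2); have S0 : 0 <= S by apply: Ex_ge0 => z; exact: sqr_ge0.
(* A numerator below [c * dl / 2] over a denominator above [dl] uses half of the tolerance [c]; the
   other half is left to the linear statistic of [u - u'] and [v - v']. *)
pose c' := c * dl / 2; have c'0 : 0 < c' by rewrite divr_gt0// mulr_gt0.
pose D := C / c' ^+ 2; have D0 : 0 <= D by rewrite divr_ge0// sqr_ge0.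
(* The first bound makes the row and column means cost at most [e / 8] in [En_xi_small], the second
   makes Chebyshev for the linear statistic of [u - u'], [v - v'] cost at most [e / 4]; the term in
   [1/N] is left to the choice of [N]. *)
pose ep := Num.min (e / 8 / (4 * (D + 1) * (1 + S))) (e * c ^+ 2 / 64).
have ep0 : 0 < ep.
  rewrite lt_min !divr_gt0// ?mulr_gt0 ?exprn_gt0//; lra.
have ep1 : D * (4 * ep * (1 + S)) <= e / 8.
  have : ep <= e / 8 / (4 * (D + 1) * (1 + S)) by rewrite ge_min lexx.
  rewrite ler_pdivlMr; last by rewrite !mulr_gt0//; lra.
  have : 0 <= ep * (4 * (1 + S)) by rewrite !mulr_ge0// ?ltW//; lra.
  move=> h1 h2; apply: le_trans h2; nra.
have ep2 : ep <= e * c ^+ 2 / 64 by rewrite ge_min lexx orbT.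
have [M [u' [mu' uM u'0 uu']]] := bounded_centered su u0 ep0.
have [M' [v' [mv' vM v'0 vv']]] := bounded_centered sv v0 ep0.
pose F := residual u' v'.
have sF : sqi (P \x Q)%E F := residual_sqi mu' mv' uM vM.
have EF : Ex (P \x Q)%E F = 0 := residual_Ex mu' mv' uM vM u'0 v'0.
have rF := residual_row mu' mv' uM vM; have cF := residual_col mu' mv' uM vM.
pose E2 := Ex (P \x Q)%E (fun z => F z ^+ 2); have E20 : 0 <= E2 by apply: Ex_ge0 => z; exact: sqr_ge0.
exists (maxn 1 (maxn N1 (Num.truncn (D * E2 / (e / 8))).+1)) => N.
rewrite !geq_max => /and3P[N0 NN1 NN2].
have NR : 0 < N%:R :> R by rewrite ltr0n.
have DN : D * (N%:R^-1 * E2) <= e / 8.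
  have : D * E2 / (e / 8) <= N%:R.
    apply/ltW/(lt_le_trans (truncnS_gt _)); by rewrite ler_nat.
  rewrite ler_pdivrMr; last by lra.
  by move=> h; rewrite mulrCA ler_pdivrMl// mulrC.
have A1 := HN1 N NN1.
have A2 := HC F N c' (e / 4) sF N0 EF c'0 e4.
have sdu : sqi P (fun x => u x - u' x) by apply: sqiB => //; exact: sqi_bounded mu' uM.
have sdv : sqi Q (fun y => v y - v' y) by apply: sqiB => //; exact: sqi_bounded mv' vM.
have du0 : Ex P (fun x => u x - u' x) = 0.
  by rewrite ExB ?u0 ?u'0 ?subrr//; apply: sqi_intg => //; exact: sqi_bounded mu' uM.
have dv0 : Ex Q (fun y => v y - v' y) = 0.
  by rewrite ExB ?v0 ?v'0 ?subrr//; apply: sqi_intg => //; exact: sqi_bounded mv' vM.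
have [S3 S3'] := linear_stat_sqr N0 sdu sdv du0 dv0.
have c2 : 0 < c / 2 by rewrite divr_gt0.
have A3 := mostly_chebyshev S3 c2.
apply: mostly_sub (mostlyI A1 (mostlyI A2 A3)).
  rewrite [leRHS](_ : e = e / 4 + ((e / 4 + e / 4) + e / 4)); last by field.
  rewrite lerD2l; apply: lerD.
    rewrite lerD2r -/D -addrA mulrDr.
    rewrite [leRHS](_ : e / 4 = e / 8 + e / 8); last by field.
    apply: lerD => //; apply: le_trans ep1; apply: ler_wpM2l => //.
    apply: le_trans (lerD rF cF) _; rewrite -/S.
    have := ler_wpM2r S0 uu'; have := ler_wpM2r S0 vv'.
    move: uu' vv'; move: (Ex P _) (Ex Q _) => r k; rewrite mulrDr mulr1; lra.
  rewrite ler_pdivrMr ?exprn_gt0//; apply: le_trans S3' _.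
  have -> : e / 4 * (c / 2) ^+ 2 = 4 * (e * c ^+ 2 / 64) by field.
  lra.
move=> w [/= d1 [/= d2 d3]].
have Dw : 0 < Dn X Y xi N w := lt_trans dl0 d1.
split => //.
have -> : En X Y F0 xi N w / Dn X Y xi N w - linear_stat u v N w =
    En X Y F xi N w / Dn X Y xi N w - linear_stat (fun x => u x - u' x) (fun y => v y - v' y) N w.
  have -> : En X Y F xi N w = En X Y F0 xi N w - Dn X Y xi N w * linear_stat u' v' N w.
    by rewrite -En_linear -EnB.
  by rewrite -linear_statB; field; rewrite gt_eqF.
apply: le_lt_trans (ler_normB _ _) _; rewrite [ltRHS]splitr.
apply: ltrD => //; rewrite normrM [`|_^-1|]gtr0_norm ?invr_gt0// ltr_pdivrMr//.
apply: lt_le_trans d2 _; rewrite /c' (_ : c * dl / 2 = c / 2 * dl); last by ring.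
by apply: ler_wpM2l; exact: ltW.
Qed.

End linearization.

Section linear_limit.
Context dO (Om : measurableType dO) (R : realType) (Pr : probability Om R).
Context d (T : measurableType d) (P Q : probability T R) (X Y : nat -> Om -> T).
Hypothesis mX : forall i, measurable_fun setT (X i).
Hypothesis mY : forall i, measurable_fun setT (Y i).
Hypothesis samples : independent_iid_samples Pr P Q X Y.

Lemma Ex_normal_law0 (F : measurableTypeR R -> R) : measurable_fun setT F ->
  Ex (normal_law 0 0) F = F 0.
Proof.
move=> mF; rewrite /normal_law eqxx /Ex /Rintegral integral_dirac//; last exact/measurable_EFinP.
by rewrite diracT mul1e.
Qed.

(** The summands [u (X i) + v (Y i)] come from independent pairs of law [P \x Q] and have variance
    [V], so [clt_smooth] applies on the product space. A vanishing variance is treated apart: the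
    statistic is then almost surely [0] and the limit a point mass. *)
Lemma linear_stat_cvg (u v : T -> R) (c e : R) : sqi P u -> sqi Q v -> Ex P u = 0 -> Ex Q v = 0 ->
  0 < e -> forall eps : R, 0 < eps -> exists N0, forall N, (N0 <= N)%N ->
  `|Ex Pr (fun w => sigmoid c e (linear_stat X Y u v N w)) -
    Ex (normal_law 0 (Ex P (fun x => u x ^+ 2) + Ex Q (fun y => v y ^+ 2))) (sigmoid c e)| <= eps.
Proof.
move=> su sv u0 v0 e0 eps eps0.
set V := _ + _.
have [ms Ms] := sigmoid_bmeas c e0.
have P0 : 0 <= Ex P (fun x => u x ^+ 2) by apply: Ex_ge0 => x; exact: sqr_ge0.
have Q0 : 0 <= Ex Q (fun y => v y ^+ 2) by apply: Ex_ge0 => x; exact: sqr_ge0.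
have lip (x y : R) : `|sigmoid c e x - sigmoid c e y| <= e^-1 * `|x - y|.
  by rewrite mulrC; exact: sigmoid_lipschitz.
have mL N : (0 < N)%N -> measurable_fun setT (fun w => sigmoid c e (linear_stat X Y u v N w)).
  move=> N0; have [S _] := linear_stat_sqr mX mY samples N0 su sv u0 v0.
  exact: measurableT_comp ms (sqi_meas S).
have [V0|V0] := eqVneq V 0.
  exists 1%N => N N0; have [S S'] := linear_stat_sqr mX mY samples N0 su sv u0 v0.
  rewrite V0 Ex_normal_law0//.
  have -> : sigmoid c e 0 = Ex Pr (fun w => sigmoid c e (cst (0 : R) w)) by rewrite -[LHS](Ex_cst Pr).
  have d0 : 0 < e * eps by rewrite mulr_gt0.
  have M := mostly_chebyshev S d0.
  have M0 : mostly Pr 0 [set w | `|linear_stat X Y u v N w - cst 0 w| < e * eps].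
    apply: mostly_sub M; last by move=> w /=; rewrite subr0.
    rewrite ler_pdivrMr ?exprn_gt0// mul0r; apply: le_trans S' _.
    move: V0; rewrite /V; lra.
  apply: le_trans (slutsky (ltW d0) _ (fun x => sigmoid_bounds c e x) lip (mL N N0) _ M0) _.
  - by rewrite invr_ge0 ltW.
  - exact: (measurable_cst (sigmoid c e 0)).
  - by rewrite addr0 mulKf// gt_eqF.
have Vpos : 0 < V by rewrite lt_def V0 addr_ge0.
pose w (z : T * T) := u z.1 + v z.2.
have c1 := sqi_cst P 1; have c2 := sqi_cst Q 1.
have wE : w = (fun z => u z.1 * cst 1 z.2 + cst 1 z.1 * v z.2).
  by apply/funext => z; rewrite /w /= mulr1 mul1r.
have sw : sqi (P \x Q)%E w by rewrite wE; apply: sqiD; exact: sqi_tensor.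
have w0 : Ex (P \x Q)%E w = 0.
  have [I1 E1] := intg_tensor (sqi_intg su) (sqi_intg c2).
  have [I2 E2] := intg_tensor (sqi_intg c1) (sqi_intg sv).
  by rewrite wE ExD// E1 E2 u0 v0 mul0r mulr0 addr0.
have w2 : Ex (P \x Q)%E (fun z => w z ^+ 2) = V.
  have [I1 E1] := intg_tensor (sqi_sq su) (sqi_intg c2).
  have [I2 E2] := intg_tensor (sqi_intg c1) (sqi_sq sv).
  have [I3 E3] := intg_tensor (sqi_intg su) (sqi_intg sv).
  have E : (fun z : T * T => w z ^+ 2) = (fun z => (u z.1 ^+ 2 * cst 1 z.2 + cst 1 z.1 * v z.2 ^+ 2) + 2 * (u z.1 * v z.2)).
    by apply/funext => z; rewrite /w /=; ring.
  rewrite E ExD; [|exact: intgD|exact: intgZ].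
  by rewrite ExD// ExZ// E1 E2 E3 u0 v0 !Ex_cst mulr1 mul1r !mulr0 addr0.
have [C [F1 [F2 [C0 sF]]]] := sigmoid_smooth c e0.
have sig0 : 0 < Num.sqrt (Ex (P \x Q)%E (fun z => w z ^+ 2)) by rewrite w2 sqrtr_gt0.
have [N0 HN] := clt_smooth C0 sF sw w0 sig0 eps0.
exists N0 => N NN; have := HN N NN.
have mh : measurable_fun setT (fun z => w z / Num.sqrt N%:R) by apply: measurable_funM => //; exact: sqi_meas sw.
rewrite -(sum_iter_cop mX mY samples N 0 mh (conj ms Ms)) w2.
rewrite /normal_law (negbTE V0).
rewrite (_ : Ex Pr (fun w0 : Om => sigmoid c e (0 + _)) = Ex Pr (fun w1 => sigmoid c e (linear_stat X Y u v N w1)))//.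
by congr Rintegral; apply/funext => w1; rewrite add0r.
Qed.

Lemma T_num_En (xi eta : T * T -> R) (th : R) N w : (0 < N)%N ->
  Num.sqrt N%:R * (T_num xi eta N (X ^~ w) (Y ^~ w) - th * T_den xi N (X ^~ w) (Y ^~ w)) =
  En X Y (fun z => (eta z - th) * xi z) xi N w.
Proof.
move=> N0; have NR : 0 < N%:R :> R by rewrite ltr0n.
have sN : Num.sqrt (N%:R : R) * Num.sqrt N%:R = N%:R by rewrite -expr2 sqr_sqrtr// ltW.
have sN0 : 0 < Num.sqrt (N%:R : R) by rewrite sqrtr_gt0.
rewrite En_mul /T_num /T_den [th * _]mulrCA -mulrBr [LHS]mulrCA [RHS]mulrCA; congr (_ * _).
rewrite mulr_sumr -sumrB !mulr_sumr; apply: eq_bigr => t _; rewrite -/(xi_tensor _ _ _ _).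
rewrite /xi_tensor; move: (\prod_(i < N) _) => p.
rewrite sumrB sumr_const card_ord -[th *+ N]mulr_natl.
set q := Num.sqrt N%:R in sN sN0 *; rewrite -sN.
by field; rewrite gt_eqF.
Qed.

End linear_limit.

Lemma probability_density_integral d (T : measurableType d) (R : realType) (nu m : probability T R) (g f : T -> R) :
  measurable_fun setT g -> nu `<< m ->
  (forall A, measurable A -> nu A = (\int[m]_(x in A) (g x)%:E)%E) -> intg nu f ->
  (\int[nu]_x (f x)%:E = \int[m]_x (f x * g x)%:E)%E.
Proof. by move=> mg numu nug If; exact: (@density_integral d T R nu m g mg numu nug f If). Qed.

Lemma ler_dist_split (R : realFieldType) (p q r e : R) :
  `|p - q| <= e / 4 + e / 4 -> `|q - r| <= e / 2 -> `|p - r| <= e.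
Proof. by have := ler_distD q p r; lra. Qed.

Theorem corollary5 (R : realType) (d : nat)
  (P Q : probability (Rvec R d) R)
  (mu : probability (Rvec R d * Rvec R d)%type R)
  (mu_marginals : has_marginals P Q mu)
  (mu_ac : mu `<< (P \x Q)%E)
  (xi : Rvec R d * Rvec R d -> R)
  (xi_density : is_density P Q mu xi)
  (xi_L2 : L2 (P \x Q)%E xi)
  (s : nat -> R) (alpha beta : nat -> Rvec R d -> R)
  (decomp : eigen_decomposition P Q xi s alpha beta)
  (gap : s 1%N < 1 /\ forall k : nat, (1 <= k)%N -> s k <= s 1%N)
  (eta : Rvec R d * Rvec R d -> R)
  (eta_int : mu.-integrable setT (EFin \o eta))
  (eta2xi_L1 : (P \x Q)%E.-integrable setT (fun z => (eta z ^+ 2 * xi z)%:E))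
  (etaxi_L2 : L2 (P \x Q)%E (fun z => eta z * xi z))
  (dO : measure_display) (Omega : measurableType dO)
  (Pr : probability Omega R)
  (X Y : nat -> {RV Pr >-> Rvec R d})
  (samples : independent_iid_samples Pr P Q X Y)
  (T : nat -> {RV Pr >-> measurableTypeR R})
  (T_def : forall (N : nat) (w : Omega), (0 < N)%N ->
     T_den xi N (X ^~ w) (Y ^~ w) != 0 ->
     T N w = T_num xi eta N (X ^~ w) (Y ^~ w) / T_den xi N (X ^~ w) (Y ^~ w)) :
  cvg_in_law Pr
    (fun N w => Num.sqrt N%:R * (T N w - theta mu eta))
    (normal_law 0 (asymptotic_variance P Q mu xi eta)).
Proof.
have mX i : measurable_fun setT (X i) by [].
have mY i : measurable_fun setT (Y i) by [].
have sxi : sqi (P \x Q)%E xi by apply/L2P.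
have sex : sqi (P \x Q)%E (fun z => eta z * xi z) by apply/L2P.
have [s1 s_le] := gap; have [mxi xiE] := xi_density.
pose th := theta mu eta.
pose F0 (z : Rvec R d * Rvec R d) := (eta z - th) * xi z.
have F0E : F0 = (fun z => eta z * xi z - th * xi z) by apply/funext => z; rewrite /F0 mulrBl.
have sF0 : sqi (P \x Q)%E F0 by rewrite F0E; apply: sqiB => //; exact: sqiZ.
have Exi : Ex (P \x Q)%E xi = 1.
  have [_ E] := xi_Ex1 sxi decomp (sqi_cst P 1); rewrite -[RHS](Ex_cst P 1) -E.
  by congr Rintegral; apply/funext => z; rewrite mul1r.
have Eeta : Ex (P \x Q)%E (fun z => eta z * xi z) = th.
  by rewrite /th /theta /Ex /Rintegral (@probability_density_integral _ _ R mu (P \x Q)%E xi _ mxi mu_ac xiE eta_int).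
have EF0 : Ex (P \x Q)%E F0 = 0.
  rewrite F0E ExB; [|exact: sqi_intg|by apply: intgZ; exact: sqi_intg].
  by rewrite ExZ; [rewrite Eeta Exi mulr1 subrr|exact: sqi_intg].
have s10 : sqi P (eta10 Q mu xi eta).
  have [S _] := kernel_sqi (sqi_swap sF0) (sqi_cst Q 1).
  by move: S; congr sqi; apply/funext => x; congr Rintegral; apply/funext => y; rewrite mul1r.
have s01 : sqi Q (eta01 P mu xi eta).
  have [S _] := kernel_sqi sF0 (sqi_cst P 1).
  by move: S; congr sqi; apply/funext => x; congr Rintegral; apply/funext => y; rewrite mul1r.
have E10 : Ex P (eta10 Q mu xi eta) = 0 by rewrite -[RHS]EF0 -(fubini1 (sqi_intg sF0)).2.
have E01 : Ex Q (eta01 P mu xi eta) = 0 by rewrite -[RHS]EF0 -(fubini2 (sqi_intg sF0)).2.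
(* These are the two functions whose squared norms make up the asymptotic variance; the coupled
   equations hold for the very representatives picked by choice. *)
have [su sv u0 v0 [hu hv]] := coupled_resolvent sxi decomp s1 s_le s10 s01 E10 E01.
rewrite /asymptotic_variance.
set u := resolvent_L2_0 P _ _ in su u0 hu hv *; set v := resolvent_L2_0 Q _ _ in sv v0 hu hv *.
have mT N : measurable_fun setT (T N) by [].
have mlin N : measurable_fun setT (fun x : measurableTypeR R => Num.sqrt N%:R * (x - th) : R).
  by apply: measurable_funM => //; apply: measurable_funB.
have mZ N := measurableT_comp (mlin N) (mT N).
apply: sigmoid_cvg_in_law => // c e e0; apply/cvgrPdist_le => eps eps0.
have eps2 : 0 < eps / 2 by rewrite divr_gt0.
have [N1 HN1] := linear_stat_cvg mX mY samples c su sv u0 v0 e0 eps2.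
have eps4 : 0 < eps / 4 by rewrite divr_gt0.
(* A sigmoid of width [e] has Lipschitz constant at most [1 / e], so this tolerance costs
   [eps / 4]. *)
have d0 : 0 < e * (eps / 4) by rewrite mulr_gt0.
have [N2 HN2] := linearization mX mY samples sxi decomp s1 s_le sF0 EF0 su sv u0 v0 hu hv d0 eps4.
exists (maxn 1 (maxn N1 N2)) => // N /=; rewrite !geq_max => /and3P[N0 NN1 NN2].
have [ms Ms] := sigmoid_bmeas c e0.
have [SL _] := linear_stat_sqr mX mY samples N0 su sv u0 v0.
have M : mostly Pr (eps / 4) [set w | `|Num.sqrt N%:R * (T N w - th) - linear_stat X Y u v N w| < e * (eps / 4)].
  (* The event of [linearization] contains the positivity of the denominator, so [T N] is there the
     ratio; its arbitrary values are confined to the exceptional set. *)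
  apply: mostly_sub (HN2 N NN2) => // w [/= D0 H].
  have D0' : T_den xi N (X ^~ w) (Y ^~ w) != 0 by rewrite gt_eqF.
  apply: le_lt_trans H; rewrite (T_def N w N0 D0') -(T_num_En X Y xi eta th w N0).
  rewrite le_eqVlt; apply/orP; left; apply/eqP; congr (`| _ - _ |).
  rewrite (_ : Dn X Y xi N w = T_den xi N (X ^~ w) (Y ^~ w))//.
  rewrite -/th; move: D0'; move: (T_den _ _ _ _) (T_num _ _ _ _ _) => D n Dn0.
  by field.
have lip (x y : R) : `|sigmoid c e x - sigmoid c e y| <= e^-1 * `|x - y|.
  by rewrite mulrC; exact: sigmoid_lipschitz.
have ei0 : 0 <= e^-1 by rewrite invr_ge0 ltW.
have := slutsky (ltW d0) ei0 (fun x => sigmoid_bounds c e x) lip (measurableT_comp ms (mZ N))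
  (measurableT_comp ms (sqi_meas SL)) M.
rewrite mulKf ?gt_eqF// => H1.
have H2 := HN1 N NN1.
by rewrite distrC; exact: ler_dist_split H1 H2.
Qed.
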